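(* Let $A$ be a finite set of complex variables, $\alpha^*,\beta^*\in A$, $A'=A\setminus\{\alpha^*,\beta^*\}$, and regard $J^*_{DL}(A,\emptyset)$ as a meromorphic function of the elements of $A$. Then $$\operatorname{Res}_{\alpha^*=-\beta^*}J^*_{DL}(A,\emptyset)=J^*_{DL}(A'\cup\{\beta^*\},\emptyset)+J^*_{DL}(A'\cup\{-\beta^*\},\emptyset)-J^*_{DL}(A',\{\beta^*\}),$$ i.e. the last term is $\sum_{0<d\le X}\frac{\psi_{DL}'}{\psi_{DL}}(\frac12+\beta^*,\chi_d)$ times the summand of $J^*_{DL}(A',\emptyset)$; and $\operatorname{Res}_{\alpha^*=0}J^*_{DL}(A,\emptyset)=0$.
   Context: Sums over $0<d\le X$ run over positive fundamental discriminants; $\chi_d=(d/\cdot)$; $\psi_{DL}(s,\chi_d)=(\pi/d)^{s-1/2}\frac{\Gamma(s/2)}{\Gamma((1-s)/2)}$. $Z_\zeta(A,B)=\prod_{a\in A,b\in B}\zeta(1+a+b)$, $Y_\zeta(A)=\prod_{a\in A}\zeta(1+2a)$, $Z^\dagger_\zeta$ omits factors $\zeta(1)$, $D^-=\{-\delta:\delta\in D\}$, $V_\pm(A)=\prod_{\alpha\in A}(1\pm p^{-1/2-\alpha})$. With $S=(A\setminus D)\cup D^-$: $Y_{DL}(A,B,D)=\sqrt{\frac{Z_\zeta(S,S)Y_\zeta(S)Z_\zeta(B,B)}{Z_\zeta(S,B)^2Y_\zeta(B)}}$, $A_{DL}(A,B,D)=Y_{DL}(A,B,D)^{-1}\prod_p\frac1{1+1/p}\left(\frac12\frac{V_-(B)}{V_-(S)}+\frac12\frac{V_+(B)}{V_+(S)}+\frac1p\right)$.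 For nonempty $W\subseteq A\setminus D$: $A_D(W)=\prod_{\alpha\in W}\frac{\partial}{\partial\alpha}A_{DL}(A,B,D)\big|_{B=A}$; $H_D(\{\gamma\})=\sum_{\beta\in D}\left(\frac{\zeta'}{\zeta}(1+\gamma-\beta)-\frac{\zeta'}{\zeta}(1+\gamma+\beta)\right)+\frac{\zeta'}{\zeta}(1+2\gamma)$, $H_D(\{\gamma_1,\gamma_2\})=\left(\frac{\zeta'}{\zeta}\right)'(1+\gamma_1+\gamma_2)$; $\widehat H_D=H_D+A_D$. Then $J^*_{DL}(A,B)=\sum_{0<d\le X}\prod_{\beta\in B}\frac{\psi_{DL}'}{\psi_{DL}}(\tfrac12+\beta,\chi_d)\sum_{D\subseteq A}(d/\pi)^{-\sum_{\delta\in D}\delta}\prod_{\delta\in D}\frac{\Gamma(\frac14-\frac\delta2)}{\Gamma(\frac14+\frac\delta2)}\sqrt{\frac{Z_\zeta(D^-,D^-)Z_\zeta(D,D)Y_\zeta(D^-)}{Z^\dagger_\zeta(D^-,D)Y_\zeta(D)}}(-1)^{|D|}A_{DL}(D,D,D)\sum_{A\setminus D=W_1\cup\cdots\cup W_R}\prod_r\widehat H_D(W_r)$ (set partitions into nonempty blocks of size at most 2; equal to 1 if empty).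
   Formalization: Corrected formulas: Z† under the root is squared; ψ_DL has Γ((1-s)/2)/Γ(s/2); A_D(W) is the mixed derivative of log A_DL; blocks of any size occur (H_D=0 beyond 2). Y_DL^{-1} is spread over the primes in A_DL. Stated at generic points with |Re|<1/4. *)

(* Defs.v *)
From HB Require Import structures.
From mathcomp Require Import all_boot all_order all_algebra.
From mathcomp Require Import all_classical all_reals all_analysis.
From mathcomp Require Import complex.
Set Implicit Arguments.
Unset Strict Implicit.
Unset Printing Implicit Defensive.
Import Order.TTheory GRing.Theory Num.Theory.
Import numFieldNormedType.Exports.
Local Open Scope classical_set_scope.
Local Open Scope ring_scope.

(* R[i] packed as a numClosedFieldType: it inherits from numFieldNormedType
   the topology of its norm, and [derive1], [derivable _ _ 1] are then the
   complex derivative and complex differentiability. *)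
Definition cplx (R : realType) : numClosedFieldType := R[i]%C.

Definition of_real (R : realType) (r : R) : cplx R := (r%:C)%C.

Definition cexp (R : realType) (z : cplx R) : cplx R :=
  of_real (expR (complex.Re z)) *
  (cos (complex.Im z) +i* sin (complex.Im z))%C.

(* r ^ s for real r > 0 *)
Definition rpow (R : realType) (r : R) (s : cplx R) : cplx R :=
  cexp (s * of_real (ln r)).

(* Euler's definition of the Gamma function. *)
Definition cGamma (R : realType) (z : cplx R) : cplx R :=
  lim ((fun n : nat => n`!%:R * rpow n%:R z /
                       \prod_(0 <= k < n.+1) (z + k%:R)) @ \oo).

(* The Riemann zeta function on Re s > 0, s <> 1.  For Re s > 1 the second
   term tends to 0 and this is the Dirichlet series; the limit exists and is
   analytic for Re s > 0, s <> 1 (Euler-Maclaurin), hence is the continuation.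
   Only arguments with Re s > 1/2 occur below. *)
Definition zeta (R : realType) (s : cplx R) : cplx R :=
  lim ((fun N : nat => \sum_(1 <= n < N.+1) rpow n%:R (- s)
                       - rpow N%:R (1 - s) / (1 - s)) @ \oo).

Definition zeta_loc (R : realType) (p : nat) (s : cplx R) : cplx R :=
  (1 - rpow p%:R (- s))^-1.

Definition logder (R : realType) (f : cplx R -> cplx R) (z : cplx R) : cplx R :=
  derive1 f z / f z.

(* f is meromorphic at z0, with residue r: f = g + principal part near z0,
   where g is holomorphic at z0 and c k is the coefficient of
   (z - z0) ^ - (k + 1). *)
Definition is_residue (R : realType) (f : cplx R -> cplx R) (z0 r : cplx R) :=
  exists (N : nat) (c : nat -> cplx R) (g : cplx R -> cplx R),
    [/\ \forall z \near z0, derivable g z 1,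
        \forall z \near z0^', f z = g z + \sum_(k < N.+1) c k / (z - z0) ^+ k.+1
      & c 0%N = r].

Definition squarefree (n : nat) : bool :=
  all (fun p => ~~ (p ^ 2 %| n)%N) (primes n).

(* for d > 0; d = 1 is included *)
Definition fundamental_discriminant (d : nat) : bool :=
  ((d %% 4 == 1)%N && squarefree d) ||
  [&& (4 %| d)%N, squarefree (d %/ 4)
    & ((d %/ 4) %% 4 == 2)%N || ((d %/ 4) %% 4 == 3)%N].

(* L(s, chi_d) = psi_DL d s * L(1 - s, chi_d) *)
Definition psi_DL (R : realType) (d : nat) (s : cplx R) : cplx R :=
  rpow (pi / d%:R) (s - 2^-1) * (cGamma ((1 - s) / 2) / cGamma (s / 2)).

(* A finite family of complex variables is a finite set I of indices together
   with a valuation u giving their values. The products below take zeta or an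
   Euler factor zeta_loc p as parameter z. *)
Definition Zprod (R : realType) (T : finType) (z : cplx R -> cplx R)
    (I : {set T}) (u : T -> cplx R) (J : {set T}) (v : T -> cplx R) : cplx R :=
  \prod_(i in I) \prod_(j in J) z (1 + u i + v j).

Definition Zdagger (R : realType) (T : finType) (z : cplx R -> cplx R)
    (I : {set T}) (u : T -> cplx R) (J : {set T}) (v : T -> cplx R) : cplx R :=
  \prod_(i in I) \prod_(j in J | u i + v j != 0) z (1 + u i + v j).

Definition Yprod (R : realType) (T : finType) (z : cplx R -> cplx R)
    (I : {set T}) (u : T -> cplx R) : cplx R :=
  \prod_(i in I) z (1 + u i *+ 2).

(* product over unordered pairs of distinct indices *)
Definition Zpairs (R : realType) (T : finType) (z : cplx R -> cplx R)
    (I : {set T}) (u : T -> cplx R) : cplx R :=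
  \prod_(i in I) \prod_(j in I | (enum_rank i < enum_rank j)%N)
    z (1 + u i + u j).

(* The square root of Z(I,I) Y(I) Z(J,J) / Y(J) that is meromorphic in the
   variables and has coefficient +1 as a product of values of z;
   see sqrtZY_sqr. *)
Definition sqrtZY (R : realType) (T : finType) (z : cplx R -> cplx R)
    (I : {set T}) (u : T -> cplx R) (J : {set T}) (v : T -> cplx R) : cplx R :=
  Yprod z I u * Zpairs z I u * Zpairs z J v.

Lemma Zprod_diag (R : realType) (T : finType) (z : cplx R -> cplx R)
    (I : {set T}) (u : T -> cplx R) :
  Zprod z I u I u = Yprod z I u * Zpairs z I u ^+ 2.
Proof.
have -> : Zpairs z I u ^+ 2 = Zpairs z I u *
    \prod_(i in I) \prod_(j in I | (enum_rank j < enum_rank i)%N)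
      z (1 + u i + u j).
  rewrite expr2; congr (_ * _); rewrite /Zpairs.
  rewrite (exchange_big_dep (fun i => i \in I)) /=; last by move=> i j _ /andP[].
  apply: eq_bigr => i iI; apply: eq_big => [j|j _]; first by rewrite iI.
  by rewrite addrAC.
rewrite /Zprod /Yprod /Zpairs -!big_split /=; apply: eq_bigr => i iI.
rewrite (bigD1 i) //= mulr2n addrA; congr (_ * _).
rewrite (bigID (fun j => (enum_rank i < enum_rank j)%N)) /=.
congr (_ * _); apply: eq_bigl => j; rewrite -andbA; congr (_ && _).
  by apply: andb_idl; apply: contraTneq => ->; rewrite ltnn.
have [->|ji] := eqVneq j i; first by rewrite ltnn.
rewrite -leqNgt leq_eqVlt /=; case: eqP => //= /val_inj/enum_rank_inj e.
by rewrite e eqxx in ji.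
Qed.

Lemma sqrtZY_sqr (R : realType) (T : finType) (z : cplx R -> cplx R)
    (I : {set T}) (u : T -> cplx R) (J : {set T}) (v : T -> cplx R) :
  Yprod z J v != 0 ->
  sqrtZY z I u J v ^+ 2 =
  Zprod z I u I u * Yprod z I u * Zprod z J v J v / Yprod z J v.
Proof.
move=> Y0; rewrite !Zprod_diag [X in _ / X]lock /sqrtZY !exprMn -lock.
rewrite (mulrC (Yprod z J v)) !mulrA mulfK // expr2.
do 2 congr (_ * _); by rewrite [RHS]mulrAC; congr (_ * _); rewrite [RHS]mulrAC.
Qed.

(* values of the variables of S = (A \ D) :|: D^-, indexed by A *)
Definition swap (R : realType) (T : finType) (D : {set T}) (x : T -> cplx R) :
    T -> cplx R :=
  fun i => if i \in D then - x i else x i.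

(* V_+ for e = 1, V_- for e = -1 *)
Definition V (R : realType) (T : finType) (p : nat) (e : cplx R)
    (I : {set T}) (u : T -> cplx R) : cplx R :=
  \prod_(i in I) (1 + e * rpow p%:R (- (2^-1 + u i))).

Definition Y_DL (R : realType) (T : finType) (z : cplx R -> cplx R)
    (A : {set T}) (x : T -> cplx R) (B : {set T}) (y : T -> cplx R)
    (D : {set T}) : cplx R :=
  sqrtZY z A (swap D x) B y / Zprod z A (swap D x) B y.

(* A_DL(A,B,D), A taking the values x and B the values y.  The factor 1 / Y_DL
   is distributed over the primes as its Euler product: where it is used, i.e.
   at B = A, the factor 1 / Y_DL has a pole (when D is nonempty) and the product
   over p of the remaining factors does not converge, whereas the combined
   product converges absolutely for real parts in ]-1/4, 1/4[. *)
Definition A_DL (R : realType) (T : finType)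
    (A : {set T}) (x : T -> cplx R) (B : {set T}) (y : T -> cplx R)
    (D : {set T}) : cplx R :=
  lim ((fun N : nat => \prod_(0 <= p < N | prime p)
    ((Y_DL (zeta_loc p) A x B y D)^-1 * (1 + p%:R^-1)^-1 *
     (2^-1 * (V p (-1) B y / V p (-1) A (swap D x)) +
      2^-1 * (V p 1 B y / V p 1 A (swap D x)) + p%:R^-1))) @ \oo).

Definition upd (R : realType) (T : finType) (x : T -> cplx R) (i : T)
    (w : cplx R) : T -> cplx R :=
  fun j => if j == i then w else x j.

Definition pderiv (R : realType) (T : finType) (i : T)
    (F : (T -> cplx R) -> cplx R) : (T -> cplx R) -> cplx R :=
  fun x => derive1 (fun w => F (upd x i w)) (x i).

(* mixed partial derivative of log F with respect to the variables of W; the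
   first derivative is the logarithmic derivative, so that no branch of log is
   involved *)
Definition pderivs_log (R : realType) (T : finType) (W : {set T})
    (F : (T -> cplx R) -> cplx R) : (T -> cplx R) -> cplx R :=
  if enum W is i :: s then foldr (@pderiv R T) (fun x => pderiv i F x / F x) s
  else fun=> 0.

(* the arithmetic part A_D(W): derivatives act on the variables A of
   A_DL(A,B,D) only, and then B = A *)
Definition A_part (R : realType) (T : finType) (A : {set T}) (x : T -> cplx R)
    (D W : {set T}) : cplx R :=
  pderivs_log W (fun x' => A_DL A x' A x D) x.

Definition H_part (R : realType) (T : finType) (x : T -> cplx R)
    (D W : {set T}) : cplx R :=
  match enum W with
  | [:: g] =>
      \sum_(b in D) (logder (@zeta R) (1 + x g - x b)
                     - logder (@zeta R) (1 + x g + x b))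
      + logder (@zeta R) (1 + x g *+ 2)
  | [:: g1; g2] => derive1 (logder (@zeta R)) (1 + x g1 + x g2)
  | _ => 0
  end.

(* for #|W| >= 3 the zeta part vanishes and only the arithmetic part is left *)
Definition H_hat (R : realType) (T : finType) (A : {set T}) (x : T -> cplx R)
    (D W : {set T}) : cplx R :=
  H_part x D W + A_part A x D W.

(* The sum over D in J*_DL(A, _), for one discriminant d.  The quotient by
   Zdagger is the root of
   Z(D^-,D^-) Z(D,D) Y(D^-) / (Zdagger(D^-,D)^2 Y(D)),
   i.e. Y_DL at A = B = D without its factors zeta(1). *)
Definition J_summand (R : realType) (T : finType) (d : nat) (A : {set T})
    (x : T -> cplx R) : cplx R :=
  \sum_(D : {set T} | D \subset A)
    (rpow (d%:R / pi) (- \sum_(i in D) x i) *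
     (\prod_(i in D) (cGamma (4^-1 - x i / 2) / cGamma (4^-1 + x i / 2))) *
     (sqrtZY (@zeta R) D (fun i => - x i) D x /
      Zdagger (@zeta R) D (fun i => - x i) D x) *
     (-1) ^+ #|D| * A_DL D x D x D *
     \sum_(P : {set {set T}} | finset.partition P (A :\: D)%SET)
       \prod_(W in P) H_hat A x D W).

(* J*_DL(A,B), the variables of A and B taking their values from x *)
Definition Jstar (R : realType) (T : finType) (X : R) (A B : {set T})
    (x : T -> cplx R) : cplx R :=
  \sum_(1 <= d < (Num.truncn X).+1 | fundamental_discriminant d)
    ((\prod_(b in B) logder (@psi_DL R d) (2^-1 + x b)) * J_summand d A x).

(* 1 + w and 1 - w are neither zeros nor the pole of zeta *)
Definition zeta_regular (R : realType) (w : cplx R) : Prop :=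
  [/\ w != 0, zeta (1 + w) != 0 & zeta (1 - w) != 0].

(* x is off the polar set of the formula for Jstar X A set0, and within the
   region |Re| < 1/4 of convergence of its Euler products *)
Definition regular_at (R : realType) (T : finType) (A : {set T})
    (x : T -> cplx R) : Prop :=
  [/\ forall i, i \in A -> `|complex.Re (x i)| < 4^-1,
      forall i, i \in A -> zeta_regular (x i *+ 2),
      forall i j, i \in A -> j \in A -> i != j ->
        zeta_regular (x i + x j) /\ zeta_regular (x i - x j)
    & forall D : {set T}, D \subset A -> A_DL D x D x D != 0].

(* Main.v *)
Require Import Defs.
From HB Require Import structures.
From mathcomp Require Import all_boot all_order all_algebra.
From mathcomp Require Import all_classical all_reals all_analysis.
From mathcomp Require Import complex ring lra.
(* J* is a finite sum of terms t_D, D a subset of A, so the residue is computed term by term,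
   for a = alpha* and b = beta*.
   At x_a = - x_b, terms with a, b \notin D only have the double pole of (zeta'/zeta)'(1 + x_a + x_b),
   without residue. If exactly one of a, b lies in D, the block {b} or {a} has a simple pole with
   residue 1, and the rest of the term is a term of J*(A \ a) at x or at x with x_b negated: the
   Euler product A_DL only sees the values of its variables, and a common value of S and B cancels.
   If a, b \in D, the prefactor has a double pole whose coefficient function must be differentiated.
   Its logarithmic derivative is psi'/psi (1/2 + x_b) minus the H-parts of the block {b} at x and
   at x with x_b negated, and the chain rule turns the derivative of the remaining factors into
   minus the sums of the blocks enlarged by b, which recombine into sums over the partitions of a
   set containing b.
   At x_a = 0 the residues -1/2 of zeta'/zeta (1 + 2 x_a) and 1/2 of the terms with a \in D cancel
   between D and D \cup {a}.
   Holomorphy is smoothness in the sense of iterated complex derivatives; infinite products are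
   handled by Weierstrass' theorem, proved from a Cauchy estimate by averaging over roots of unity. *)

Set Implicit Arguments.
Unset Strict Implicit.
Unset Printing Implicit Defensive.
Import Order.TTheory GRing.Theory Num.Theory.
Import numFieldNormedType.Exports.
Local Open Scope classical_set_scope.
Local Open Scope ring_scope.

(** * Complex differentiation *)

Section ModulusTheory.
Context {R : realType}.
Local Notation C := (cplx R).
Implicit Types (z w h : C).

(** If a lies in D, moving alpha* to w moves two arguments of the Euler product at once, the S-value
    - w and the B-value w, whereas A_D(W) differentiates S-values only. Hence [PhiS] takes S- and
    B-values as independent variables indexed by [T + T]. The loci where two of them coincide are
    not open, so derivatives of log [PhiS] are compared there by transport along variables that do
    not leave the locus. The regularity hypotheses concern A \ a alone; that the Euler product of A
    does not vanish at the collision is deduced from the same cancellations. The width 1/4 of the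
    strip and the expansions to fourth order belong together: p^(-1/2-alpha) is at most p^(-1/4-d)
    in modulus on a smaller strip, so a factor must be 1 plus a term of order four. The average over
    the sign removes odd orders, and the zeta factors of Y_DL remove order two. The factor psi'/psi
    arises because the power of d/pi and the Gamma quotient of one delta in D form psi_DL at 1/2 +
    delta, a function inverted by delta -> - delta. Two opposite elements of D therefore cancel in
    value but not in derivative. *)

Definition nrm z : R := complex.Re `|z|.

(** The norm of [cplx R] has values in [cplx R], where the order is partial; estimates are moved to
    the real number [nrm z], where real inequalities and [lra] apply. *)
Lemma nrmE z : `|z| = of_real (nrm z).
Proof. by case: z => a b. Qed.

Lemma of_realD (a b : R) : of_real (a + b) = of_real a + of_real b.
Proof. exact: (rmorphD (real_complex R)). Qed.
Lemma of_realM (a b : R) : of_real (a * b) = of_real a * of_real b.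
Proof. exact: (rmorphM (real_complex R)). Qed.
Lemma of_realN (a : R) : of_real (- a) = - of_real a.
Proof. exact: (rmorphN (real_complex R)). Qed.
Lemma of_realB (a b : R) : of_real (a - b) = of_real a - of_real b.
Proof. exact: (rmorphB (real_complex R)). Qed.
Lemma of_realV (a : R) : of_real a^-1 = (of_real a)^-1.
Proof. exact: (fmorphV (real_complex R)). Qed.
Lemma of_realX (a : R) n : of_real (a ^+ n) = of_real a ^+ n.
Proof. exact: (rmorphXn (real_complex R)). Qed.
Lemma of_real0 : of_real (0 : R) = 0. Proof. by []. Qed.
Lemma of_real1 : of_real (1 : R) = 1. Proof. by []. Qed.
Lemma of_real_nat n : of_real (n%:R : R) = n%:R.
Proof. exact: (rmorph_nat (real_complex R)). Qed.
Lemma of_real_le (a b : R) : (of_real a <= of_real b) = (a <= b).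
Proof. exact: lecR. Qed.
Lemma of_real_lt (a b : R) : (of_real a < of_real b) = (a < b).
Proof. exact: ltcR. Qed.
Lemma of_realI : injective (@of_real R).
Proof. exact: complexI. Qed.

Lemma nrmM z w : nrm (z * w) = nrm z * nrm w.
Proof. by apply: of_realI; rewrite of_realM -!nrmE normrM. Qed.
Lemma nrm_ge0 z : 0 <= nrm z.
Proof. by rewrite -of_real_le -nrmE normr_ge0. Qed.
Lemma nrm0 : nrm 0 = 0.
Proof. by apply: of_realI; rewrite -nrmE normr0. Qed.
Lemma nrm1 : nrm 1 = 1.
Proof. by apply: of_realI; rewrite -nrmE normr1. Qed.
Lemma nrmN z : nrm (- z) = nrm z.
Proof. by apply: of_realI; rewrite -!nrmE normrN. Qed.
Lemma nrmBC z w : nrm (z - w) = nrm (w - z).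
Proof. by rewrite -nrmN opprB. Qed.
Lemma nrmV z : nrm z^-1 = (nrm z)^-1.
Proof. by apply: of_realI; rewrite of_realV -!nrmE normfV. Qed.
Lemma nrmD z w : nrm (z + w) <= nrm z + nrm w.
Proof. by rewrite -of_real_le of_realD -!nrmE ler_normD. Qed.
Lemma nrmB z w : nrm (z - w) <= nrm z + nrm w.
Proof. by rewrite (le_trans (nrmD _ _)) // nrmN. Qed.
Lemma nrm_sub3 u z w : nrm (z - w) <= nrm (z - u) + nrm (u - w).
Proof. by rewrite (le_trans _ (nrmD _ _)) // addrA subrK. Qed.
Lemma nrm_eq0 z : (nrm z == 0) = (z == 0).
Proof. by rewrite -(inj_eq of_realI) -nrmE normr_eq0. Qed.
Lemma nrm_gt0 z : (0 < nrm z) = (z != 0).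
Proof. by rewrite lt_neqAle nrm_ge0 andbT eq_sym nrm_eq0. Qed.
Lemma nrmX z n : nrm (z ^+ n) = nrm z ^+ n.
Proof. by apply: of_realI; rewrite of_realX -!nrmE normrX. Qed.
Lemma nrm_real (a : R) : nrm (of_real a) = `|a|.
Proof. by rewrite /nrm /of_real /= expr0n addr0 sqrtr_sqr. Qed.
Lemma nrm_nat n : nrm n%:R = n%:R.
Proof. by rewrite -of_real_nat nrm_real ger0_norm // ler0n. Qed.
Lemma nrm_sum (I : Type) (r : seq I) (P : pred I) (F : I -> C) :
  nrm (\sum_(i <- r | P i) F i) <= \sum_(i <- r | P i) nrm (F i).
Proof.
elim/big_rec2: _ => [|i y x Pi H]; first by rewrite nrm0.
by rewrite (le_trans (nrmD _ _)) // lerD2l.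
Qed.
Lemma nrm_prod (I : Type) (r : seq I) (P : pred I) (F : I -> C) :
  nrm (\prod_(i <- r | P i) F i) = \prod_(i <- r | P i) nrm (F i).
Proof. by rewrite (big_morph nrm nrmM nrm1). Qed.
Lemma nrm_lb z w : nrm z - nrm w <= nrm (z - w).
Proof. by rewrite lerBlDr (le_trans _ (nrmD _ _)) // subrK. Qed.

Lemma Re_le_nrm z : `|complex.Re z| <= nrm z.
Proof.
case: z => a b; rewrite /nrm /= -sqrtr_sqr ler_wsqrtr // lerDl sqr_ge0 //.
Qed.
Lemma Im_le_nrm z : `|complex.Im z| <= nrm z.
Proof.
case: z => a b; rewrite /nrm /= -sqrtr_sqr ler_wsqrtr // lerDr sqr_ge0 //.
Qed.
Lemma nrm_le_ReIm z : nrm z <= `|complex.Re z| + `|complex.Im z|.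
Proof.
have -> : z = of_real (complex.Re z) + 'i%C * of_real (complex.Im z) by exact: complexE.
apply: le_trans (nrmD _ _) _; rewrite nrmM !nrm_real.
case: z => a b /=; rewrite !(mul0r, mul1r, subr0, addr0, add0r, mulr0).
suff -> : nrm 'i%C = 1 by rewrite mul1r.
by rewrite /nrm /= expr0n add0r expr1n sqrtr1.
Qed.
Lemma ReB z w : complex.Re (z - w : C) = complex.Re z - complex.Re w.
Proof. by case: z => a b; case: w. Qed.
Lemma ImB z w : complex.Im (z - w : C) = complex.Im z - complex.Im w.
Proof. by case: z => a b; case: w. Qed.
Lemma ReD z w : complex.Re (z + w : C) = complex.Re z + complex.Re w.
Proof. by case: z => a b; case: w. Qed.
Lemma ImD z w : complex.Im (z + w : C) = complex.Im z + complex.Im w.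
Proof. by case: z => a b; case: w. Qed.
Lemma ReN z : complex.Re (- z : C) = - complex.Re z.
Proof. by case: z. Qed.
Lemma cReMr (a : R) z : complex.Re (of_real a * z : C) = a * complex.Re z.
Proof. by case: z => c d; rewrite /= mul0r subr0. Qed.

Lemma cvgnP (T : Type) (F : set_system T) {FF : Filter F} (f : T -> C) (l : C) : 
  (f @ F --> l) <-> (forall e : R, 0 < e -> \forall x \near F, nrm (f x - l) < e).
Proof.
split=> [/cvgrPdist_lt h e e0|h].
  have := h (of_real e); rewrite -[0]of_real0 of_real_lt => /(_ e0).
  by apply: filterS => x; rewrite nrmE of_real_lt nrmBC.
apply/cvgrPdist_lt => e e0.
(* Only numbers with equal imaginary parts are comparable, so a positive [e] is real. *)
have er : e = of_real (complex.Re e).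
  by case: e e0 => a b; rewrite ltcE /= => /andP[/eqP-> _].
have := h (complex.Re e); rewrite -of_real_lt of_real0 -er => /(_ e0).
by apply: filterS => x; rewrite nrmE nrmBC -of_real_lt -er.
Qed.

Lemma nbhs_nrmP z (P : set C) :
  nbhs z P <-> exists2 e : R, 0 < e & forall w, nrm (w - z) < e -> P w.
Proof.
split=> [/nbhs_normP [e /= e0 H]|[e e0 H]].
  have er : e = of_real (complex.Re e).
    by case: e e0 H => a b; rewrite ltcE /= => /andP[/eqP-> _].
  exists (complex.Re e); first by rewrite -of_real_lt -er.
  by move=> w wz; apply: H; rewrite /= er nrmE of_real_lt nrmBC.
apply/nbhs_normP; exists (of_real e) => /=; first by rewrite -[0]of_real0 of_real_lt.
by move=> w; rewrite /= nrmE of_real_lt nrmBC; exact: H.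
Qed.

Definition nbC z : set_system C := nbhs z.

Global Instance nbC_filter z : ProperFilter (nbC z).
Proof. exact: nbhs_pfilter. Qed.

Lemma nbC_P z (P : set C) :
  nbC z P <-> exists2 e : R, 0 < e & forall w, nrm (w - z) < e -> P w.
Proof. exact: nbhs_nrmP. Qed.

Lemma nrm_cvg (T : Type) (F : set_system T) {FF : Filter F} (f : T -> C) (l : C) : 
  f @ F --> l -> (fun x => nrm (f x)) @ F --> nrm l.
Proof.
move=> /cvgnP h; apply/cvgrPdist_lt => e e0.
apply: filterS (h _ e0) => x; apply: le_lt_trans.
by rewrite distrC ler_norml lerNl opprB !(le_trans (nrm_lb _ _)) // nrmBC.
Qed.

Lemma Re_cvg (T : Type) (F : set_system T) {FF : Filter F} (f : T -> C) (l : C) : 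
  f @ F --> l -> (fun x => complex.Re (f x)) @ F --> complex.Re l.
Proof.
move=> /cvgnP h; apply/cvgrPdist_lt => e e0.
apply: filterS (h _ e0) => x; apply: le_lt_trans.
by rewrite distrC -ReB Re_le_nrm.
Qed.

Lemma cvg_le_nrm (T : Type) (F : set_system T) {FF : ProperFilter F} (f : T -> C) (l : C) (M : R) :
  f @ F --> l -> (\forall x \near F, nrm (f x) <= M) ->
  nrm l <= M.
Proof.
move=> h hM; have h' : (fun x => nrm (f x)) @ F --> nrm l by exact: nrm_cvg.
move/cvgrPdist_lt: h' => h'.
apply/ler_addgt0Pr => e e0.
have [x [h1 h2]] : exists x, `|nrm l - nrm (f x)| < e /\ nrm (f x) <= M.
  by apply: (@filter_ex T F); exact: filterI (h' _ e0) hM.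
apply: le_trans (_ : nrm (f x) + e <= _); last by rewrite lerD2r.
by rewrite -lerBlDl ltW // (le_lt_trans (ler_norm _)).
Qed.

Lemma ccvg_cst (T : Type) (F : set_system T) {FF : Filter F} (c : C) : 
  (fun _ : T => c) @ F --> c.
Proof. by exact: (cvg_cst c). Qed.

Lemma ccvgD (T : Type) (F : set_system T) {FF : Filter F} (f g : T -> C) (a b : C) : 
  f @ F --> a -> g @ F --> b -> (fun x => f x + g x) @ F --> a + b.
Proof. by move=> fa gb; exact: (cvgD fa gb). Qed.

Lemma ccvgN (T : Type) (F : set_system T) {FF : Filter F} (f : T -> C) (a : C) : 
  f @ F --> a -> (fun x => - f x) @ F --> - a.
Proof. by move=> fa; exact: (cvgN fa). Qed.

Lemma ccvgM (T : Type) (F : set_system T) {FF : Filter F} (f g : T -> C) (a b : C) : 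
  f @ F --> a -> g @ F --> b -> (fun x => f x * g x) @ F --> a * b.
Proof. by move=> fa gb; exact: (cvgM fa gb). Qed.

Lemma ccvgV (T : Type) (F : set_system T) {FF : Filter F} (f : T -> C) (a : C) : 
  a != 0 -> f @ F --> a -> (fun x => (f x)^-1) @ F --> a^-1.
Proof. by move=> a0 fa; exact: (cvgV a0 fa). Qed.

(** Completeness is inherited from the reals, applied to real and imaginary parts, both of which are
    1-Lipschitz for [nrm]. *)
Lemma cauchy_cvgn (u : nat -> C) :
  (forall e : R, 0 < e -> exists N, forall k l, (N <= k)%N -> (N <= l)%N ->
     nrm (u k - u l) <= e) ->
  exists l : C, u @ \oo --> l.
Proof.
move=> H.
have aux (p : C -> R) : (forall z w, `|p z - p w| <= nrm (z - w)) ->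
    exists l : R, (fun n => p (u n)) @ \oo --> l.
  move=> hp; suff : cvg ((fun n => p (u n)) @ \oo) by move=> h; exists (lim ((fun n => p (u n)) @ \oo)).
  apply/cauchy_cvgP/cauchy_ballP => e e0.
  have [N HN] := H (e / 2) (divr_gt0 e0 (ltr0Sn _ _)).
  have e2 : e / 2 < e by rewrite ltr_pdivrMr // ltr_pMr // ltr1n.
  exists ((fun n => p (u n)) @` [set n | (N <= n)%N], (fun n => p (u n)) @` [set n | (N <= n)%N]).
    by split; exists N => // n /= Nn; exists n.
  move=> [_ _] [/= [m Nm <-] [n Nn <-]]; rewrite /ball /=.
  by apply: le_lt_trans (hp _ _) _; apply: le_lt_trans (HN _ _ Nm Nn) e2.
have [a ha] := aux (fun z => complex.Re z) (fun z w => ltac:(rewrite -ReB; exact: Re_le_nrm)).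
have [b hb] := aux (fun z => complex.Im z) (fun z w => ltac:(rewrite -ImB; exact: Im_le_nrm)).
exists (a +i* b)%C; apply/cvgnP => e e0.
have e20 : 0 < e / 2 by rewrite divr_gt0.
move/cvgrPdist_lt/(_ _ e20): ha => ha; move/cvgrPdist_lt/(_ _ e20): hb => hb.
near=> n; apply: le_lt_trans (nrm_le_ReIm _) _.
rewrite ReB ImB /= (splitr e) ltrD // distrC; near: n; [exact: ha|exact: hb].
Unshelve. all: end_near. Qed.

End ModulusTheory.

(** * Rules of complex differentiation and the mean value inequality *)

Section ComplexDerivative.
Context {R : realType}.
Local Notation C := (cplx R).
Implicit Types (f g : C -> C) (z w l m : C).

(* Caratheodory's form of complex differentiability: f w - f z = phi w (w - z)
   with phi continuous at z. *)
Definition cder f z l := exists phi : C -> C,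
  [/\ phi @ nbC z --> phi z, phi z = l & forall w, f w = f z + phi w * (w - z)].

Lemma cder_cvg f z l : cder f z l -> f @ nbC z --> f z.
Proof.
move=> [phi [cphi _ Hf]].
have -> : f = (fun w => f z + phi w * (w - z)) by apply/funext.
have H0 : (fun w : C => w - z) @ nbC z --> 0.
  by rewrite -(subrr z); apply: ccvgD; [exact: (@cvg_id _ (nbC z))|exact: ccvg_cst].
by rewrite subrr; apply: ccvgD; [exact: ccvg_cst|exact: ccvgM].
Qed.

Lemma cderP f z l : cder f z l <->
  (forall e : R, 0 < e -> exists2 d : R, 0 < d & forall w, nrm (w - z) < d ->
     nrm (f w - f z - l * (w - z)) <= e * nrm (w - z)).
Proof.
split=> [[phi [/cvgnP cphi <- Hf]] e e0|H].
  have /nbC_P[d d0 Hd] := cphi _ e0; exists d => // w /Hd/ltW h.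
  by rewrite Hf [f z + _]addrC addrK -mulrBl nrmM ler_wpM2r ?nrm_ge0.
exists (fun w => if w == z then l else (f w - f z) / (w - z)); split.
- apply/cvgnP => e e0; have [d d0 Hd] := H (e / 2) (divr_gt0 e0 (ltr0Sn _ _)).
  apply/nbC_P; exists d => // w /Hd; rewrite eqxx.
  case: eqP => [_ _|/eqP wz]; first by rewrite subrr nrm0.
  have wz0 : 0 < nrm (w - z) by rewrite nrm_gt0 subr_eq0.
  have -> : f w - f z - l * (w - z) = ((f w - f z) / (w - z) - l) * (w - z).
    by rewrite mulrBl divfK // subr_eq0.
  rewrite nrmM ler_pM2r // => h; apply: le_lt_trans h _.
  by rewrite ltr_pdivrMr // ltr_pMr // ltr1n.
- by rewrite eqxx.
- move=> w; case: eqP => [->|/eqP wz]; first by rewrite subrr mulr0 addr0.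
  by rewrite divfK ?subr_eq0 // addrC subrK.
Qed.

Lemma cder_ext f g z l : (\forall w \near nbC z, f w = g w) -> cder f z l -> cder g z l.
Proof.
move=> /nbC_P[d0 d00 fg] /cderP H; apply/cderP => e e0.
have [d dp Hd] := H e e0; exists (Num.min d d0); first by rewrite lt_min dp.
move=> w; rewrite lt_min => /andP[w1 w2]; rewrite -!fg ?Hd //.
by rewrite subrr nrm0.
Qed.

Lemma cder_cst c z : cder (fun=> c) z 0.
Proof.
exists (fun=> 0); split; [exact: ccvg_cst|by []|].
by move=> w; rewrite mul0r addr0.
Qed.

Lemma cder_id z : cder id z 1.
Proof.
exists (fun=> 1); split; [exact: ccvg_cst|by []|].
by move=> w; rewrite mul1r addrC subrK.
Qed.

Lemma cderD f g z l m : cder f z l -> cder g z m -> cder (fun w => f w + g w) z (l + m).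
Proof.
move=> [p [cp <- Hp]] [q [cq <- Hq]]; exists (fun w => p w + q w).
split; [exact: ccvgD|by []|].
by move=> w; rewrite Hp Hq; ring.
Qed.

Lemma cderM f g z l m : cder f z l -> cder g z m ->
  cder (fun w => f w * g w) z (l * g z + f z * m).
Proof.
move=> fl [q [cq <- Hq]]; have cf := cder_cvg fl.
move: fl => [p [cp <- Hp]]; exists (fun w => p w * g z + f w * q w).
split; [|by []|].
  apply: ccvgD; apply: ccvgM; [exact: cp|exact: ccvg_cst|exact: cf|exact: cq].
move=> w; transitivity (f w * g z + f w * (q w * (w - z))).
  by rewrite -mulrDr -Hq.
by rewrite {1}Hp; ring.
Qed.

Lemma cderZ c f z l : cder f z l -> cder (fun w => c * f w) z (c * l).
Proof. by move=> H; have := cderM (cder_cst c z) H; rewrite mul0r add0r. Qed.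

Lemma cderN f z l : cder f z l -> cder (fun w => - f w) z (- l).
Proof.
move=> H; rewrite -mulN1r; have -> : (fun w => - f w) = (fun w => -1 * f w).
  by apply/funext => w; rewrite mulN1r.
exact: cderZ.
Qed.

Lemma cderB f g z l m : cder f z l -> cder g z m -> cder (fun w => f w - g w) z (l - m).
Proof. by move=> H K; apply: cderD => //; exact: cderN. Qed.

Lemma cderV f z l : f z != 0 -> cder f z l ->
  cder (fun w => (f w)^-1) z (- l / f z ^+ 2).
Proof.
move=> fz0 fl; have cf := cder_cvg fl.
have nz : \forall w \near nbC z, f w != 0.
  move/cvgnP: (cf) => /(_ (nrm (f z))); rewrite nrm_gt0 => /(_ fz0).
  apply: filterS => w; apply: contraTneq => ->; rewrite sub0r nrmN ltxx //.
move: fl => [p [cp <- Hp]].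
pose q w := - p w / (f z * f w).
(* Caratheodory's identity must hold for every [w], and it fails for the default value of the
   inverse where [f w = 0]. The function is therefore redefined on the zeros of [f], which stay away
   from [z]. *)
suff : cder (fun w => if f w == 0 then (f z)^-1 + q w * (w - z) else (f w)^-1) z (- p z / f z ^+ 2).
  by apply: cder_ext; apply: filterS nz => w /negbTE ->.
exists q; split.
- rewrite /q; apply: ccvgM; first exact: ccvgN.
  apply: ccvgV; first by rewrite mulf_neq0.
  by apply: ccvgM; [exact: ccvg_cst|exact: cf].
- by rewrite /q expr2.
- move=> w; rewrite (negbTE fz0); case: eqP => // /eqP fw0.
  apply: (mulfI (mulf_neq0 fz0 fw0)); rewrite mulrDr /q.
  rewrite mulfK // [RHS]addrC mulrA mulrCA mulfV ?mulf_neq0 // mulr1.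
  by rewrite mulrAC mulfV // mul1r (Hp w); ring.
Qed.

Lemma cder_comp f g z l m : cder g z m -> cder f (g z) l ->
  cder (fun w => f (g w)) z (l * m).
Proof.
move=> gm [p [cp <- Hp]]; have cg := cder_cvg gm.
move: gm => [q [cq <- Hq]]; exists (fun w => p (g w) * q w).
split; [|by []|].
  by apply: ccvgM; [exact: cvg_comp cg cp|].
by move=> w; rewrite Hp -mulrA; congr (_ + p _ * _); rewrite Hq [g z + _]addrC addrK.
Qed.

Lemma cder_uniq f z l m : cder f z l -> cder f z m -> l = m.
Proof.
move=> fl fm; have := cderB fl fm => /cderP H.
apply/eqP; rewrite -subr_eq0 -nrm_eq0 eq_le nrm_ge0 andbT.
apply/ler_addgt0Pl => e e0; rewrite addr0.
have [d d0 Hd] := H e e0.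
have := Hd (z + of_real (d / 2)).
rewrite [z + _]addrC addrK !subrr !sub0r nrmN nrmM nrm_real gtr0_norm ?divr_gt0 //.
rewrite ler_pM2r ?divr_gt0 //; apply.
by rewrite ltr_pdivrMr // ltr_pMr // ltr1n.
Qed.

Lemma cder_sum (I : Type) (r : seq I) (P : pred I) (F : I -> C -> C) z (L : I -> C) :
  (forall i, P i -> cder (F i) z (L i)) ->
  cder (fun w => \sum_(i <- r | P i) F i w) z (\sum_(i <- r | P i) L i).
Proof.
move=> H; elim: r => [|i r IH].
  rewrite big_nil; have -> : (fun w => \sum_(i <- [::] | P i) F i w) = (fun=> 0).
    by apply/funext => w; rewrite big_nil.
  exact: cder_cst.
rewrite big_cons.
have -> : (fun w => \sum_(j <- i :: r | P j) F j w) =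
   (fun w => if P i then F i w + \sum_(j <- r | P j) F j w else \sum_(j <- r | P j) F j w).
  by apply/funext => w; rewrite big_cons.
by case: ifP => // Pi; apply: cderD => //; exact: H.
Qed.

Lemma cder_is_derive f z l : cder f z l -> is_derive z (1 : C) f l.
Proof.
move=> [p [cp pz Hp]].
suff H : (fun h : C => h^-1 *: ((f \o shift z) (h *: (1 : C)) - f z)) @ 0^' --> l.
  by apply: DeriveDef; [apply/cvg_ex; exists l|exact: cvg_lim].
have H1 : (fun h : C => p (h + z)) @ 0^' --> l.
  rewrite -pz; have := @cvg_comp _ _ _ (fun h : C => h + z) p (0^') (nbC z) (nbhs (p z)).
  apply; [|exact: cp]; apply/cvgnP => e e0; apply/nbhs_nrmP; exists e => // w.
  by rewrite subr0 => we _; rewrite addrK.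
apply: cvg_trans H1; apply: near_eq_cvg; apply/nbhs_nrmP; exists 1 => // h _ h0.
rewrite /= [h *: 1](mulr1) [h^-1 *: _]/(h^-1 * _) (Hp (h + z)) addrK [f z + _]addrC addrK.
by rewrite -[RHS]/(h^-1 * _) mulrC mulfK.
Qed.

Lemma cder_derive1 f z l : cder f z l -> derive1 f z = l.
Proof. by move=> /cder_is_derive H; rewrite derive1E derive_val. Qed.

Lemma cder_derivable f z l : cder f z l -> derivable f z 1.
Proof. by move=> /cder_is_derive H; exact: ex_derive. Qed.

(** Pairing [f] along the segment with the conjugate [u] of the total increment gives a real
    function whose increment is the squared modulus. The real mean value theorem bounds it by the
    modulus times [M * nrm h], and one factor is divided out. *)
Lemma mean_value (f df : C -> C) z h (M : R) :
  (forall t : R, 0 <= t <= 1 -> cder f (z + of_real t * h) (df (z + of_real t * h)) /\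
     nrm (df (z + of_real t * h)) <= M) ->
  nrm (f (z + h) - f z) <= M * nrm h.
Proof.
move=> H; pose u : C := (complex.conjc (f (z + h) - f z)).
have M0 : 0 <= M.
  by have [|_] := H 0; [rewrite lexx ler01|exact: le_trans (nrm_ge0 _)].
have nu : nrm u = nrm (f (z + h) - f z).
  by rewrite /u; case: (f (z + h) - f z) => a b; rewrite /nrm /= sqrrN.
pose g (t : R) := complex.Re (u * f (z + of_real t * h)).
pose dg (t : R) := complex.Re (u * (df (z + of_real t * h) * h)).
have dgP (t : R) : t \in `[0, 1]%R -> is_derive t 1 g (dg t).
  rewrite in_itv /= => /H[[p [cp pz Hp]] _].
  suff K : (fun k : R => k^-1 *: ((g \o shift t) (k *: (1 : R)) - g t)) @ 0^' --> dg t.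
    by apply: DeriveDef; [apply/cvg_ex; exists (dg t)|exact: cvg_lim].
  have K1 : (fun k : R => complex.Re (u * (p (z + of_real (k + t) * h) * h))) @ 0^' --> dg t.
    apply: Re_cvg; apply: ccvgM; first exact: ccvg_cst.
    apply: ccvgM; last exact: ccvg_cst.
    rewrite -pz; apply: (@cvg_comp _ _ _ (fun k : R => z + of_real (k + t) * h) p) cp.
    apply/cvgnP => e e0.
    have e1 : 0 < e / (nrm h + 1) by rewrite divr_gt0 // ltr_wpDl ?nrm_ge0.
    apply/nbhs_normP; exists (e / (nrm h + 1)) ; first exact: e1.
    move=> k /=; rewrite sub0r normrN => ke _.
    rewrite of_realD mulrDl addrCA addrK nrmM nrm_real.
    rewrite (le_lt_trans (y := `|k| * (nrm h + 1))) //; first by rewrite ler_wpM2l // lerDl.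
    by rewrite -ltr_pdivlMr // ltr_wpDl ?nrm_ge0.
  apply: cvg_trans K1; apply: near_eq_cvg; apply/nbhs_normP; exists 1 => //= k _ k0.
  rewrite [k *: 1](mulr1) [_^-1 *: _]/(k^-1 * _) /g -ReB -mulrBr.
  rewrite (Hp (z + of_real (k + t) * h)) [X in X - _]addrC addrK.
  have -> : z + of_real (k + t) * h - (z + of_real t * h) = of_real k * h.
    by rewrite of_realD; ring.
  have -> : u * (p (z + of_real (k + t) * h) * (of_real k * h)) =
     of_real k * (u * (p (z + of_real (k + t) * h) * h)) by ring.
  by rewrite cReMr -[RHS]/(k^-1 * _) mulKf.
have cg : {within `[0, 1], continuous g}.
  by apply: derivable_within_continuous => t t01; have ? := dgP t t01; exact: ex_derive.
have dgP' (t : R) : t \in `]0, 1[%R -> is_derive t 1 g (dg t).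
  by move=> t01; apply: dgP; exact: subset_itv_oo_cc.
have [c c01] := MVT_segment ler01 dgP' cg; rewrite subr0 mulr1.
have /H[_ dM] : 0 <= c <= 1 by move: c01; rewrite in_itv.
rewrite /g of_real0 of_real1 mul0r mul1r addr0 -ReB -mulrBr => E.
have {E} : nrm (f (z + h) - f z) ^+ 2 <= nrm (f (z + h) - f z) * (M * nrm h).
  have -> : nrm (f (z + h) - f z) ^+ 2 = complex.Re (u * (f (z + h) - f z)).
    rewrite /u; case: (f (z + h) - f z) => a b; rewrite /nrm /= sqr_sqrtr ?addr_ge0 ?sqr_ge0 //.
    by ring.
  rewrite E (le_trans (ler_norm _)) // (le_trans (Re_le_nrm _)) // 2!nrmM nu.
  by rewrite ler_wpM2l ?nrm_ge0 // ler_wpM2r ?nrm_ge0.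
have [->|n0] := eqVneq (nrm (f (z + h) - f z)) 0; first by rewrite mulr_ge0 ?nrm_ge0.
by rewrite expr2 ler_pM2l // lt_neqAle eq_sym n0 nrm_ge0.
Qed.

End ComplexDerivative.

(** * The complex exponential and its derivative *)

Section Exponential.
Context {R : realType}.
Local Notation C := (cplx R).
Implicit Types (z w h : C).

Definition cis (t : R) : C := (cos t +i* sin t)%C.

Lemma cisD a b : cis (a + b) = cis a * cis b.
Proof. by rewrite /cis cosD sinD; congr (_ +i* _)%C; rewrite addrC. Qed.

Lemma cis0 : cis 0 = 1. Proof. by rewrite /cis cos0 sin0. Qed.

Lemma cisMn a n : cis (a *+ n) = cis a ^+ n.
Proof. by elim: n => [|n IH]; rewrite ?mulr0n ?cis0 // mulrS cisD IH exprS. Qed.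

Lemma nrm_cis a : nrm (cis a) = 1.
Proof. by rewrite /nrm /= cos2Dsin2 sqrtr1. Qed.

Lemma nrm_cis_sub1 (a : R) : nrm (cis a - 1) <= `|a| + `|a|.
Proof.
apply: le_trans (nrm_le_ReIm _) _; rewrite /cis /= subr0.
have aux (f df : R -> R) : (forall x : R, is_derive x 1 f (df x)) ->
    (forall x, `|df x| <= 1) -> `|f a - f 0| <= `|a|.
  move=> fdf df1; have cf : continuous f.
    by move=> x; apply: differentiable_continuous; apply/derivable1_diffP; have := fdf x.
  have [a0|a0] := leP 0 a.
    have [c _ ->] := MVT_segment a0 (fun x _ => fdf x) (continuous_subspaceT cf).
    by rewrite subr0 normrM ler_piMl.
  have [c _ E] := MVT_segment (ltW a0) (fun x _ => fdf x) (continuous_subspaceT cf).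
  by rewrite distrC E sub0r normrM normrN ler_piMl.
apply: lerD.
  rewrite -[X in _ - X]cos0; apply: (aux cos (fun x => - sin x)) => x.
  by rewrite normrN ler_norml sin_geN1 sin_le1.
rewrite -[sin a]subr0 -[X in _ - X]sin0; apply: (aux sin cos) => x.
by rewrite ler_norml cos_geN1 cos_le1.
Qed.

Lemma cexpE z : cexp z = of_real (expR (complex.Re z)) * cis (complex.Im z).
Proof. by []. Qed.

Lemma cexpD z w : cexp (z + w) = cexp z * cexp w.
Proof. by rewrite !cexpE ReD ImD expRD cisD of_realM; ring. Qed.

Lemma cexp0 : cexp (0 : C) = 1.
Proof. by rewrite cexpE expR0 cis0 mulr1. Qed.

Lemma nrm_cexp z : nrm (cexp z) = expR (complex.Re z).
Proof. by rewrite cexpE nrmM nrm_cis mulr1 nrm_real gtr0_norm // expR_gt0. Qed.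

Lemma cexp_neq0 z : cexp z != 0.
Proof. by rewrite -nrm_gt0 nrm_cexp expR_gt0. Qed.

Lemma cexpN z : cexp (- z) = (cexp z)^-1.
Proof.
by apply: (mulfI (cexp_neq0 z)); rewrite -cexpD subrr cexp0 mulfV ?cexp_neq0.
Qed.

Lemma cexp_real (a : R) : cexp (of_real a) = of_real (expR a).
Proof. by rewrite cexpE cis0 mulr1. Qed.

Lemma real_derive_eps (f : R -> R) (df x : R) : is_derive x 1 f df ->
  forall e : R, 0 < e -> exists2 d : R, 0 < d & forall h : R, `|h| < d ->
    `|f (x + h) - f x - df * h| <= e * `|h|.
Proof.
move=> [fd fdE] e e0.
have : (fun h : R => h^-1 *: ((f \o shift x) (h *: (1 : R)) - f x)) @ 0^' --> df.
  by rewrite -fdE; exact: fd.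
move=> /cvgrPdist_lt /(_ e e0); rewrite near_withinE => /nbhs_normP[d /= d0 H].
exists d => // h hd; have [->|h0] := eqVneq h 0.
  by rewrite addr0 subrr mulr0 subr0 normr0 mulr0.
have := H h; rewrite /= sub0r normrN => /(_ hd h0).
rewrite [h *: 1](mulr1) -[_ *: _]/(h^-1 * _) distrC => /ltW hh.
have -> : f (x + h) - f x - df * h = (h^-1 * (f (h + x) - f x) - df) * h.
  by rewrite mulrBl mulrAC mulVf // mul1r addrC [h + x]addrC addrC.
by rewrite normrM ler_wpM2r.
Qed.

Lemma cder_cexp0 : cder (@cexp R) 0 1.
Proof.
apply/cderP => e e0; 
(* The factor 5 counts the error terms below: one for the real exponential, two for [cis b - 1], and
   one each for the cosine and the sine. *)
have [f [f0 f1 fe]] : exists f : R, [/\ 0 < f, f <= 1 & 5%:R * f <= e].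
  exists (Num.min 1 (e / 5%:R)); split; first by rewrite lt_min ltr01 divr_gt0.
    by rewrite ge_min lexx.
  by rewrite -ler_pdivlMl // mulrC ge_min lexx orbT.
have [d1 d10 H1] := real_derive_eps (is_derive_expR 0) f0.
have [d2 d20 H2] := real_derive_eps (is_derive_cos 0) f0.
have [d3 d30 H3] := real_derive_eps (is_derive_sin 0) f0.
exists (Num.min f (Num.min d1 (Num.min d2 d3))); first by rewrite !lt_min f0 d10 d20 d30.
move=> h; rewrite subr0 !lt_min => /and4P[hf h1 h2 h3].
set a := complex.Re h; set b := complex.Im h.
have ah : `|a| <= nrm h by exact: Re_le_nrm.
have bh : `|b| <= nrm h by exact: Im_le_nrm.
have := H1 a (le_lt_trans ah h1); rewrite add0r expR0 mul1r => {}H1.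
have := H2 b (le_lt_trans bh h2); rewrite add0r cos0 sin0 oppr0 mul0r subr0 => {}H2.
have := H3 b (le_lt_trans bh h3); rewrite add0r sin0 cos0 mul1r subr0 => {}H3.
have -> : cexp h - cexp 0 - 1 * h =
   of_real (expR a - 1 - a) * cis b + of_real a * (cis b - 1) +
     ((cos b - 1) +i* (sin b - b))%C.
  rewrite cexp0 cexpE -/a -/b !of_realB of_real1.
  have -> : ((cos b - 1) +i* (sin b - b))%C = cis b - 1 - (0 +i* b)%C :> C.
    by rewrite /cis; congr (_ +i* _)%C; rewrite ?subr0.
  have -> : h = of_real a + (0 +i* b)%C.
    by rewrite /a /b; case: (h) => u v; congr (_ +i* _)%C; rewrite /= ?addr0 ?add0r.
  by ring.
apply: le_trans (nrmD _ _) _.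
apply: le_trans (lerD (nrmD _ _) (nrm_le_ReIm _)) _.
rewrite !nrmM nrm_cis mulr1 !nrm_real /=.
have K1 : `|a| * nrm (cis b - 1) <= nrm h * (f + f).
  apply: ler_pM; rewrite ?nrm_ge0 //.
  by apply: le_trans (nrm_cis_sub1 b) _; rewrite lerD // ltW // (le_lt_trans bh).
have K2 : f * `|a| <= f * nrm h by rewrite ler_pM2l.
have K3 : f * `|b| <= f * nrm h by rewrite ler_pM2l.
have K4 : 5%:R * f * nrm h <= e * nrm h by rewrite ler_wpM2r ?nrm_ge0.
lra.
Qed.

Lemma cder_cexp z : cder (@cexp R) z (cexp z).
Proof.
have -> : @cexp R = (fun w => cexp z * cexp (w - z)).
  by apply/funext => w; rewrite -cexpD addrC subrK.
rewrite subrr cexp0; apply: cderZ; rewrite -[X in cder _ _ X](mulr1 1).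
apply: (cder_comp (f := @cexp R)); last by rewrite subrr; exact: cder_cexp0.
by rewrite -[X in cder _ _ X](subr0 1); apply: cderB; [exact: cder_id|exact: cder_cst].
Qed.

End Exponential.

(** * Holomorphic functions of several variables *)

Section SeveralVariables.
Context {R : realType} {I : finType}.
Local Notation C := (cplx R).
Implicit Types (x y : I -> C) (U : set (I -> C)) (F G : (I -> C) -> C) (i j : I).

Definition box x (r : R) y := forall i, nrm (y i - x i) < r.

(** The neighbourhood filter of the sup distance, written so that every neighbourhood comes with a
    radius. *)
Definition nbx x : set_system (I -> C) :=
  [set P | exists2 r : R, 0 < r & forall y, box x r y -> P y].

Lemma box_refl x (r : R) : 0 < r -> box x r x.
Proof. by move=> r0 i; rewrite subrr nrm0. Qed.

Lemma box_le x (r s : R) y : r <= s -> box x r y -> box x s y.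
Proof. by move=> rs b i; exact: lt_le_trans (b i) rs. Qed.

Global Instance nbx_filter x : ProperFilter (nbx x).
Proof.
split; first by move=> [r r0 /(_ x (box_refl x r0))].
split.
- by exists 1.
- move=> P Q [r r0 Hr] [s s0 Hs]; exists (Num.min r s); first by rewrite lt_min r0.
  move=> y b; split; [apply: Hr|apply: Hs]; apply: box_le b.
    by rewrite ge_min lexx.
  by rewrite ge_min lexx orbT.
- by move=> P Q PQ [r r0 Hr]; exists r => // y /Hr/PQ.
Qed.

Definition opn U := forall x, U x -> nbx x U.

Lemma opn_box x (r : R) : opn (box x r).
Proof.
move=> y b.
pose m := \big[Num.min/1]_(i : I) (r - nrm (y i - x i)).
have m0 : 0 < m.
  rewrite /m; elim/big_ind: _ => // [u v u0 v0|i _]; first by rewrite lt_min u0.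
  by rewrite subr_gt0.
exists m => // z bz i; apply: le_lt_trans (nrm_sub3 (y i) _ _) _.
rewrite -ltrBrDr; apply: lt_le_trans (bz i) _.
by rewrite /m (bigD1 i) //= ge_min lexx.
Qed.

Lemma upd_id x i : upd x i (x i) = x.
Proof. by apply/funext => j; rewrite /upd; case: eqP => // ->. Qed.

Lemma upd_same x i w : upd x i w i = w.
Proof. by rewrite /upd eqxx. Qed.

Lemma upd_upd x i u w : upd (upd x i u) i w = upd x i w.
Proof. by apply/funext => j; rewrite /upd; case: eqP. Qed.

Lemma updC x i j u w : i != j -> upd (upd x i u) j w = upd (upd x j w) i u.
Proof.
move=> ij; apply/funext => k; rewrite /upd; case: eqP => [->|] //.
by rewrite eq_sym (negbTE ij).
Qed.

Lemma box_upd x (r : R) y i w : box x r y -> nrm (w - x i) < r -> box x r (upd y i w).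
Proof. by move=> b wr j; rewrite /upd; case: eqP => [->|]. Qed.

Lemma upd_cvg x i : (fun w => upd x i w) @ nbC (x i) --> nbx x.
Proof.
move=> P [r r0 Hr]; apply/nbC_P; exists r => // w wr; apply: Hr.
by apply: box_upd => //; exact: box_refl.
Qed.

Lemma proj_cvg x i : (fun y => y i) @ nbx x --> x i.
Proof. by apply/cvgnP => e e0; exists e => // y; exact. Qed.

(** Joint continuity is required at every order. With it, total differentiability ([frechet]) and
    the symmetry of second derivatives ([pderivC]) follow from partial derivatives by mean value
    arguments. *)
Fixpoint Cn (n : nat) U F : Prop :=
  (forall x, U x -> F @ nbx x --> F x) /\
  if n is m.+1 then
    forall i, exists G, (forall x, U x -> cder (fun w => F (upd x i w)) (x i) (G x)) /\ Cn m U G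
  else True.

Definition hol U F := forall n, Cn n U F.

Lemma Cn_cvg n U F x : Cn n U F -> U x -> F @ nbx x --> F x.
Proof. by case: n => [|n] [H _] Ux; apply: H. Qed.

Lemma CnW n U F : Cn n.+1 U F -> Cn n U F.
Proof.
elim: n F => [|n IH] F [cF dF]; split => //.
by move=> i; have [G [HG CG]] := dF i; exists G; split => //; exact: IH.
Qed.

Lemma Cn_sub n U V F : (forall x, V x -> U x) -> Cn n U F -> Cn n V F.
Proof.
move=> VU; elim: n F => [|n IH] F [cF dF]; split; try by move=> x /VU; exact: cF.
- by [].
- by move=> i; have [G [HG CG]] := dF i; exists G; split; [move=> x /VU; exact: HG|exact: IH].
Qed.

Lemma near_upd U x i : nbx x U -> \forall w \near nbC (x i), U (upd x i w).
Proof. by move=> nU; exact: (@upd_cvg x i U nU). Qed.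

Lemma Cn_ext n U F G : opn U -> (forall x, U x -> F x = G x) -> Cn n U F -> Cn n U G.
Proof.
move=> oU; elim: n F G => [|n IH] F G FG [cF dF].
  split; last exact: Logic.I.
  move=> x Ux; rewrite -(FG _ Ux); apply: cvg_trans (cF x Ux); apply: near_eq_cvg.
  by apply: filterS (oU x Ux) => y Uy; rewrite FG.
split.
  move=> x Ux; rewrite -(FG _ Ux); apply: cvg_trans (cF x Ux); apply: near_eq_cvg.
  by apply: filterS (oU x Ux) => y Uy; rewrite FG.
move=> i; have [D [HD CD]] := dF i; exists D; split=> // x Ux.
apply: cder_ext (HD x Ux); apply: filterS (near_upd i (oU x Ux)) => w; exact: FG.
Qed.

Lemma Cn_cst n U c : Cn n U (fun=> c).
Proof.
elim: n c => [|n IH] c; split; try by move=> x _; exact: ccvg_cst.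
- by [].
- by move=> i; exists (fun=> 0); split=> // x _; exact: cder_cst.
Qed.

Lemma Cn_proj n U i : Cn n U (fun x => x i).
Proof.
case: n => [|n]; split; try by move=> x _; exact: proj_cvg.
- by [].
- move=> j; exists (fun=> if i == j then 1 else 0); split; last exact: Cn_cst.
  move=> x _; rewrite /upd; case: eqP => _; [exact: cder_id|exact: cder_cst].
Qed.

Lemma CnD n U F G : Cn n U F -> Cn n U G -> Cn n U (fun x => F x + G x).
Proof.
elim: n F G => [|n IH] F G [cF dF] [cG dG].
  by split; last exact: Logic.I; move=> x Ux; apply: ccvgD; [exact: cF|exact: cG].
split; first by move=> x Ux; apply: ccvgD; [exact: cF|exact: cG].
move=> i; have [F' [HF CF]] := dF i; have [G' [HG CG]] := dG i.
exists (fun x => F' x + G' x); split; last exact: IH.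
by move=> x Ux; apply: cderD; [exact: HF|exact: HG].
Qed.

Lemma CnM n U F G : Cn n U F -> Cn n U G -> Cn n U (fun x => F x * G x).
Proof.
elim: n F G => [|n IH] F G CF CG.
  by split; last exact: Logic.I; move=> x Ux; apply: ccvgM; [exact: (Cn_cvg CF)|exact: (Cn_cvg CG)].
split; first by move=> x Ux; apply: ccvgM; [exact: (Cn_cvg CF)|exact: (Cn_cvg CG)].
move=> i; have [F' [HF CF']] := CF.2 i; have [G' [HG CG']] := CG.2 i.
exists (fun x => F' x * G x + F x * G' x); split; last first.
  by apply: CnD; apply: IH => //; exact: CnW.
move=> x Ux; have := cderM (HF x Ux) (HG x Ux); by rewrite upd_id.
Qed.

Lemma CnN n U F : Cn n U F -> Cn n U (fun x => - F x).
Proof.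
move=> CF; have := CnM (Cn_cst n U (-1)) CF.
by have -> : (fun x => -1 * F x) = (fun x => - F x) by apply/funext => x; rewrite mulN1r.
Qed.

Lemma CnV n U F : (forall x, U x -> F x != 0) -> Cn n U F -> Cn n U (fun x => (F x)^-1).
Proof.
move=> F0; elim: n => [|n IH] CF.
  by split; last exact: Logic.I; move=> x Ux; apply: ccvgV; [exact: F0|exact: (Cn_cvg CF)].
split; first by move=> x Ux; apply: ccvgV; [exact: F0|exact: (Cn_cvg CF)].
move=> i; have [F' [HF CF']] := CF.2 i.
exists (fun x => - F' x * ((F x)^-1 * (F x)^-1)); split; last first.
  by apply: CnM; [exact: CnN|apply: CnM; apply: IH; exact: CnW].
move=> x Ux; have := @cderV _ (fun w => F (upd x i w)) (x i) (F' x).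
rewrite upd_id => /(_ (F0 x Ux) (HF x Ux)).
by rewrite expr2 invfM.
Qed.

Lemma hol_sub U V F : (forall x, V x -> U x) -> hol U F -> hol V F.
Proof. by move=> VU H n; exact: Cn_sub VU (H n). Qed.
Lemma hol_ext U F G : opn U -> (forall x, U x -> F x = G x) -> hol U F -> hol U G.
Proof. by move=> oU FG H n; exact: Cn_ext oU FG (H n). Qed.
Lemma hol_cst U c : hol U (fun=> c). Proof. by move=> n; exact: Cn_cst. Qed.
Lemma hol_proj U i : hol U (fun x => x i). Proof. by move=> n; exact: Cn_proj. Qed.
Lemma holD U F G : hol U F -> hol U G -> hol U (fun x => F x + G x).
Proof. by move=> HF HG n; exact: CnD. Qed.
Lemma holM U F G : hol U F -> hol U G -> hol U (fun x => F x * G x).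
Proof. by move=> HF HG n; exact: CnM. Qed.
Lemma holN U F : hol U F -> hol U (fun x => - F x).
Proof. by move=> HF n; exact: CnN. Qed.
Lemma holB U F G : hol U F -> hol U G -> hol U (fun x => F x - G x).
Proof. by move=> HF HG; apply: holD => //; exact: holN. Qed.
Lemma holV U F : (forall x, U x -> F x != 0) -> hol U F -> hol U (fun x => (F x)^-1).
Proof. by move=> F0 HF n; exact: CnV. Qed.
Lemma hol_sum (J : Type) (r : seq J) (P : pred J) U (F : J -> (I -> C) -> C) :
  (forall j : J, P j -> hol U (F j)) -> hol U (fun x => \sum_(j <- r | P j) F j x).
Proof.
move=> H; elim: r => [|j r IH].
  have -> : (fun x => \sum_(j <- [::] | P j) F j x) = (fun=> 0).
    by apply/funext => x; rewrite big_nil.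
  exact: hol_cst.
have -> : (fun x => \sum_(k <- j :: r | P k) F k x) =
   (fun x => (if P j then F j x else 0) + \sum_(k <- r | P k) F k x).
  by apply/funext => x; rewrite big_cons; case: ifP => // _; rewrite add0r.
by apply: holD => //; case Pj: (P j); [exact: H|exact: hol_cst].
Qed.
Lemma hol_prod (J : Type) (r : seq J) (P : pred J) U (F : J -> (I -> C) -> C) :
  (forall j : J, P j -> hol U (F j)) -> hol U (fun x => \prod_(j <- r | P j) F j x).
Proof.
move=> H; elim: r => [|j r IH].
  have -> : (fun x => \prod_(j <- [::] | P j) F j x) = (fun=> 1).
    by apply/funext => x; rewrite big_nil.
  exact: hol_cst.
have -> : (fun x => \prod_(k <- j :: r | P k) F k x) =
   (fun x => (if P j then F j x else 1) * \prod_(k <- r | P k) F k x).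
  by apply/funext => x; rewrite big_cons; case: ifP => // _; rewrite mul1r.
by apply: holM => //; case Pj: (P j); [exact: H|exact: hol_cst].
Qed.

Lemma hol_cexp U F : hol U F -> hol U (fun x => cexp (F x)).
Proof.
move=> HF n; elim: n => [|n IH]; have cc x : U x -> (fun x => cexp (F x)) @ nbx x --> cexp (F x).
- move=> Ux; apply: (@cvg_comp _ _ _ F (@cexp R)); first exact: (Cn_cvg (HF 0%N)).
  exact: (cder_cvg (cder_cexp (F x))).
- by split; [exact: cc|exact: Logic.I].
- move=> Ux; apply: (@cvg_comp _ _ _ F (@cexp R)); first exact: (Cn_cvg (HF 0%N)).
  exact: (cder_cvg (cder_cexp (F x))).
split; first exact: cc.
move=> i; have [F' [HF' CF']] := (HF n.+1).2 i.
exists (fun x => cexp (F x) * F' x); split; last exact: CnM.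
move=> x Ux; apply: (cder_comp (f := @cexp R)) (HF' x Ux) _.
by rewrite upd_id; exact: cder_cexp.
Qed.

Lemma cder_pderiv U F i x : hol U F -> U x ->
  cder (fun w => F (upd x i w)) (x i) (pderiv i F x).
Proof.
move=> HF Ux; have [G [HG _]] := (HF 1%N).2 i.
by have := HG x Ux => H; rewrite /pderiv (cder_derive1 H).
Qed.

Lemma hol_pderiv U F i : opn U -> hol U F -> hol U (pderiv i F).
Proof.
move=> oU HF n; have [G [HG CG]] := (HF n.+1).2 i.
apply: (Cn_ext oU _ CG) => x Ux.
by rewrite /pderiv (cder_derive1 (HG x Ux)).
Qed.

Lemma seg_ball (z a b : C) (r t : R) : 0 <= t <= 1 ->
  nrm (a - z) < r -> nrm (b - z) < r -> nrm (b + of_real t * (a - b) - z) < r.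
Proof.
move=> /andP[t0 t1] ar br.
have -> : b + of_real t * (a - b) - z = of_real t * (a - z) + of_real (1 - t) * (b - z).
  by rewrite of_realB of_real1; ring.
apply: le_lt_trans (nrmD _ _) _; rewrite !nrmM !nrm_real !ger0_norm ?subr_ge0 //.
have [t_eq|tn] := eqVneq t 0; first by rewrite t_eq mul0r add0r subr0 mul1r.
have tp : 0 < t by rewrite lt_neqAle eq_sym tn.
have : t * nrm (a - z) < t * r by rewrite ltr_pM2l.
have : (1 - t) * nrm (b - z) <= (1 - t) * r by rewrite ler_wpM2l ?subr_ge0 // ltW.
lra.
Qed.

(** The mean value inequality for [F] minus its linear part in coordinate [i], whose derivative is
    small near [x] by continuity of [pderiv i F]. The bound is uniform in the other coordinates of
    [m], as [pderivC] and [frechet] both require. *)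
Lemma mean_value_coord U F i x : opn U -> hol U F -> U x ->
  forall e : R, 0 < e -> exists2 r : R, 0 < r & forall m a b, box x r m ->
    nrm (a - x i) < r -> nrm (b - x i) < r ->
    nrm (F (upd m i a) - F (upd m i b) - pderiv i F x * (a - b)) <= e * nrm (a - b).
Proof.
move=> oU HF Ux e e0; set D := pderiv i F x.
have [r r0 Hr] := oU x Ux.
have /cvgnP/(_ e e0)[s s0 Hs] := Cn_cvg (hol_pderiv i oU HF 0%N) Ux.
exists (Num.min r s); first by rewrite lt_min r0.
move=> m a b bm ar br.
pose f w := F (upd m i w) - D * w.
have := @mean_value _ f (fun w => pderiv i F (upd m i w) - D) b (a - b) e.
have -> : b + (a - b) = a by ring.
have -> : f a - f b = F (upd m i a) - F (upd m i b) - D * (a - b) by rewrite /f; ring.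
apply=> t t01; set w := b + _.
have wr : nrm (w - x i) < Num.min r s by exact: seg_ball.
have bu := box_upd bm wr.
have := box_le _ bu; rewrite -/D => bu'; split.
  apply: cderB; last by rewrite -{2}[D]mulr1; apply: cderZ; exact: cder_id.
  have Uu : U (upd m i w) by apply: Hr; apply: bu'; rewrite ge_min lexx.
  have := cder_pderiv i HF Uu; rewrite upd_same; congr (cder _ _ _).
  by apply/funext => v; rewrite upd_upd.
by apply/ltW/Hs/bu'; rewrite ge_min lexx orbT.
Qed.

(** The second difference of [F] over a square of side [h] is symmetric in the two coordinates, and
    up to a small multiple of [nrm h ^+ 2] it is each of the two mixed derivatives times
    [h ^+ 2]. *)
Lemma pderivC U F i j x : opn U -> hol U F -> U x ->
  pderiv i (pderiv j F) x = pderiv j (pderiv i F) x.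
Proof.
move=> oU HF Ux; have [->//|ij] := eqVneq i j.
suff H (k l : I) : k != l -> forall e : R, 0 < e -> exists2 r : R, 0 < r &
    forall h : C, nrm h < r ->
    nrm (F (upd (upd x l (x l + h)) k (x k + h)) - F (upd x k (x k + h)) -
         F (upd x l (x l + h)) + F x - pderiv l (pderiv k F) x * h ^+ 2) <= e * nrm h ^+ 2.
  apply/eqP; rewrite -subr_eq0 -nrm_eq0 eq_le nrm_ge0 andbT.
  apply/ler_addgt0Pl => e e0; rewrite addr0.
  have e20 : 0 < e / 2 by rewrite divr_gt0.
  have [r r0 Hr] := H i j ij _ e20; have [s s0 Hs] := H j i (ltac:(rewrite eq_sym; exact ij)) _ e20.
  pose m := Num.min r s; have m0 : 0 < m by rewrite lt_min r0.
  pose h : C := of_real (m / 2).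
  have hn : nrm h = m / 2 by rewrite nrm_real gtr0_norm // divr_gt0.
  have hm : nrm h < m by rewrite hn ltr_pdivrMr // ltr_pMr // ltr1n.
  have h0 : 0 < nrm h by rewrite hn divr_gt0.
  have mr : m <= r by rewrite ge_min lexx.
  have ms : m <= s by rewrite ge_min lexx orbT.
  have h1 := Hr h (lt_le_trans hm mr).
  have h2 := Hs h (lt_le_trans hm ms).
  rewrite (updC x (x i + h) (x j + h) ij) in h2.
  rewrite -(ler_pM2r (exprn_gt0 2 h0)) -nrmX -nrmM nrmX.
  have E (a b c d p q k : C) : (p - q) * k = (a - b - c + d - q * k) - (a - c - b + d - p * k).
    by ring.
  rewrite (E (F (upd (upd x j (x j + h)) i (x i + h))) (F (upd x i (x i + h)))
    (F (upd x j (x j + h))) (F x)).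
  apply: le_trans (nrmB _ _) _; apply: le_trans (lerD h1 h2) _.
  by rewrite -mulrDl -splitr.
move=> kl e e0; set D := pderiv l (pderiv k F) x.
have [r r0 Hr] := mean_value_coord l oU (hol_pderiv k oU HF) Ux e0.
have [s s0 Hs] := oU x Ux.
exists (Num.min r s); first by rewrite lt_min r0.
move=> h; rewrite lt_min => /andP[hr hs].
pose f w := F (upd (upd x l (x l + h)) k w) - F (upd x k w) - D * h * w.
have E1 : upd (upd x l (x l + h)) k (x k) = upd x l (x l + h).
  by rewrite -(updC x (x k) (x l + h) kl) upd_id.
have -> : F (upd (upd x l (x l + h)) k (x k + h)) - F (upd x k (x k + h)) -
         F (upd x l (x l + h)) + F x - D * h ^+ 2 = f (x k + h) - f (x k).
  rewrite /f E1 upd_id; have E (a b c d p q k' : C) :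
    a - b - c + d - p * k' ^+ 2 = a - b - p * k' * (q + k') - (c - d - p * k' * q) by ring.
  exact: E.
rewrite [_ * nrm h ^+ 2](_ : _ = e * nrm h * nrm h); last by ring.
apply: (mean_value (df := fun w => pderiv k F (upd (upd x l (x l + h)) k w) -
   pderiv k F (upd x k w) - D * h)).
move=> t /andP[t0 t1]; set w := x k + _.
have wk : nrm (w - x k) <= nrm h.
  by rewrite /w [x k + _]addrC addrK nrmM nrm_real ger0_norm // ler_piMl ?nrm_ge0.
have bx : box x r (upd x k w).
  by apply: box_upd; [exact: box_refl|exact: le_lt_trans wk hr].
have hl (q : R) : nrm h < q -> nrm (x l + h - x l) < q by rewrite [x l + _]addrC addrK.
split.
  apply: cderB; last by rewrite -{2}[D * h]mulr1; apply: cderZ; exact: cder_id.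
  apply: cderB.
    have Uu : U (upd (upd x l (x l + h)) k w).
      apply: Hs; apply: box_upd; last exact: le_lt_trans wk hs.
      by apply: box_upd; [exact: box_refl|exact: hl].
    have := cder_pderiv k HF Uu; rewrite upd_same; congr (cder _ _ _).
    by apply/funext => v; rewrite upd_upd.
  have Uu : U (upd x k w).
    by apply: Hs; apply: box_upd; [exact: box_refl|exact: le_lt_trans wk hs].
  have := cder_pderiv k HF Uu; rewrite upd_same; congr (cder _ _ _).
  by apply/funext => v; rewrite upd_upd.
have := Hr _ (x l + h) (x l) bx (hl _ hr).
rewrite subrr nrm0 => /(_ r0); rewrite -/D [x l + h]addrC addrK [h + x l]addrC.
rewrite (updC _ _ _ kl) (updC _ w (x l) kl) upd_id //.
Qed.

(* Caratheodory's form of the differentiability of F at x *)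
Lemma frechet U F x : opn U -> hol U F -> U x ->
  exists Phi : I -> (I -> C) -> C,
    (forall i, Phi i @ nbx x --> pderiv i F x) /\
    forall y, F y = F x + \sum_i Phi i y * (y i - x i).
Proof.
move=> oU HF Ux.
(* The coordinates in [s] have been moved from [x] to [y]; adding one more coordinate to [s]
   contributes its difference quotient. *)
pose mix (s : seq I) y : I -> C := fun i => if i \in s then y i else x i.
suff H (s : seq I) : uniq s -> exists Phi : I -> (I -> C) -> C,
    (forall i, Phi i @ nbx x --> pderiv i F x) /\
    forall y, F (mix s y) = F x + \sum_(i <- s) Phi i y * (y i - x i).
  have [Phi [H1 H2]] := H _ (index_enum_uniq I); exists Phi; split=> // y.
  rewrite -H2; congr F; apply/funext => i; by rewrite /mix mem_index_enum.
elim: s => [|j s IH] /=.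
  move=> _; exists (fun i _ => pderiv i F x); split; first by move=> i; exact: ccvg_cst.
  by move=> y; rewrite big_nil addr0.
move=> /andP[js us]; have [Phi [H1 H2]] := IH us.
have mixj y : mix (j :: s) y = upd (mix s y) j (y j).
  apply/funext => i; rewrite /mix /upd inE; case: eqP => [->|] //.
have mixs y : mix s y = upd (mix s y) j (x j).
  by apply/funext => i; rewrite /mix /upd; case: eqP => [->|//]; rewrite (negbTE js).
exists (fun i y => if i == j then (if y j == x j then pderiv j F x else
   (F (mix (j :: s) y) - F (mix s y)) / (y j - x j)) else Phi i y); split; last first.
  move=> y; rewrite big_cons eqxx (eq_big_seq (fun i => Phi i y * (y i - x i))); last first.
    by move=> i ii; case: eqP => // ij; rewrite -ij ii in js.
  case: (eqVneq (y j) (x j)) => [yx|yx].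
    by rewrite yx subrr mulr0 add0r mixj yx -mixs H2.
  by rewrite divfK ?subr_eq0 // addrCA -H2 subrK.
move=> i; case: (eqVneq i j) => [->|//].
apply/cvgnP => e e0; have e20 : 0 < e / 2 by rewrite divr_gt0.
have [r r0 Hr] := mean_value_coord j oU HF Ux e20.
exists r => // y bxy; case: (eqVneq (y j) (x j)) => [_|yx]; first by rewrite subrr nrm0.
have bm : box x r (mix s y).
  by move=> k; rewrite /mix; case: ifP => // _; rewrite subrr nrm0.
have := Hr _ (y j) (x j) bm (bxy j); rewrite subrr nrm0 => /(_ r0).
rewrite -mixj -mixs => h.
have yx0 : 0 < nrm (y j - x j) by rewrite nrm_gt0 subr_eq0.
apply: (@le_lt_trans _ _ (e / 2)); last by rewrite ltr_pdivrMr // ltr_pMr // ltr1n.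
by rewrite -(ler_pM2r yx0) -nrmM mulrBl divfK // subr_eq0.
Qed.

Lemma cder_chain U F (g : C -> I -> C) z (l : I -> C) : opn U -> hol U F -> U (g z) ->
  (forall i, cder (fun w => g w i) z (l i)) ->
  cder (fun w => F (g w)) z (\sum_i pderiv i F (g z) * l i).
Proof.
move=> oU HF Ugz Hg.
have [Phi [H1 H2]] := frechet oU HF Ugz.
have cg : g @ nbC z --> nbx (g z).
  move=> P [r r0 Hr].
  have : \forall w \near nbC z, forall i, nrm (g w i - g z i) < r.
    apply: filter_forall => i; have /cvgnP := cder_cvg (Hg i); exact.
  by apply: filterS => w; exact: Hr.
have /choice [q Hq] : forall i, exists q : C -> C,
    [/\ q @ nbC z --> q z, q z = l i & forall w, g w i = g z i + q w * (w - z)].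
  by move=> i; exact: Hg.
have P0 i : Phi i (g z) = pderiv i F (g z).
  have := H1 i => /cvgnP h; apply/eqP; rewrite -subr_eq0 -nrm_eq0 eq_le nrm_ge0 andbT.
  apply/ler_addgt0Pl => e e0; rewrite addr0.
  by have [r r0 Hr] := h e e0; apply/ltW/Hr; exact: box_refl.
exists (fun w => \sum_i Phi i (g w) * q i w); split.
- elim: (index_enum I) => [|i s IH].
    rewrite big_nil; have -> : (fun w => \sum_(i <- [::]) Phi i (g w) * q i w) = (fun=> 0).
      by apply/funext => w; rewrite big_nil.
    exact: ccvg_cst.
  rewrite big_cons; have -> : (fun w => \sum_(j <- i :: s) Phi j (g w) * q j w) =
     (fun w => Phi i (g w) * q i w + \sum_(j <- s) Phi j (g w) * q j w).
    by apply/funext => w; rewrite big_cons.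
  apply: ccvgD; last exact: IH.
  apply: ccvgM; last by have [] := Hq i.
  by rewrite P0; apply: (@cvg_comp _ _ _ g (Phi i) _ (nbx (g z))); [exact: cg|exact: H1].
- by apply: eq_bigr => i _; rewrite P0; have [_ ->] := Hq i.
- move=> w; rewrite (H2 (g w)); congr (_ + _); rewrite mulr_suml; apply: eq_bigr => i _.
  by have [_ _ ->] := Hq i; rewrite [g z i + _]addrC addrK mulrA.
Qed.

End SeveralVariables.

Lemma hol_comp (R : realType) (I J : finType) (U : set (J -> cplx R)) (V : set (I -> cplx R))
    (F : (J -> cplx R) -> cplx R) (L : (I -> cplx R) -> J -> cplx R) :
  opn U -> hol U F -> (forall j, hol V (fun x => L x j)) -> (forall x, V x -> U (L x)) ->
  hol V (fun x => F (L x)).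
Proof.
move=> oU HF HL VU n; elim: n F HF => [|n IH] F HF; have cc x : V x ->
    (fun x => F (L x)) @ nbx x --> F (L x).
- move=> Vx; apply: (@cvg_comp _ _ _ L F _ (nbx (L x))); last exact: (Cn_cvg (HF 0%N) (VU x Vx)).
  move=> P [r r0 Hr].
  have : \forall y \near nbx x, forall j, nrm (L y j - L x j) < r.
    by apply: filter_forall => j; have /cvgnP := Cn_cvg (HL j 0%N) Vx; exact.
  by apply: filterS => w; exact: Hr.
- by split; [exact: cc|exact: Logic.I].
- move=> Vx; apply: (@cvg_comp _ _ _ L F _ (nbx (L x))); last exact: (Cn_cvg (HF 0%N) (VU x Vx)).
  move=> P [r r0 Hr].
  have : \forall y \near nbx x, forall j, nrm (L y j - L x j) < r.
    by apply: filter_forall => j; have /cvgnP := Cn_cvg (HL j 0%N) Vx; exact.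
  by apply: filterS => w; exact: Hr.
split=> // i.
have /choice [L' HL'] : forall j, exists G, (forall x, V x ->
    cder (fun w => L (upd x i w) j) (x i) (G x)) /\ Cn n V G.
  by move=> j; exact: (HL j n.+1).2.
exists (fun x => \sum_j pderiv j F (L x) * L' j x); split.
  move=> x Vx; have := @cder_chain _ _ U F (fun w => L (upd x i w)) (x i) (fun j => L' j x) oU HF.
  rewrite upd_id; apply; first exact: VU.
  by move=> j; have [H _] := HL' j; exact: H.
elim: (index_enum J) => [|j s IHs].
  have -> : (fun x => \sum_(j <- [::]) pderiv j F (L x) * L' j x) = (fun=> 0).
    by apply/funext => x; rewrite big_nil.
  exact: Cn_cst.
have -> : (fun x => \sum_(k <- j :: s) pderiv k F (L x) * L' k x) =
   (fun x => pderiv j F (L x) * L' j x + \sum_(k <- s) pderiv k F (L x) * L' k x).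
  by apply/funext => x; rewrite big_cons.
apply: CnD => //; apply: CnM; last by have [] := HL' j.
by apply: IH; exact: hol_pderiv.
Qed.

(** * Locally uniform limits and infinite products *)

Section CauchyEstimate.
Context {R : realType}.
Local Notation C := (cplx R).
Implicit Types (f : C -> C) (z w t : C).

(** Compactness is used for the square circumscribed about the disc of radius [r]. Its corners are
    at distance at most [r + r] from the centre, whence the larger disc in the hypothesis. *)
Lemma heine f z0 (r : R) :
  (forall w, nrm (w - z0) <= r + r -> f @ nbC w --> f w) ->
  forall e : R, 0 < e -> exists2 d : R, 0 < d & forall u v : C,
    nrm (u - z0) <= r -> nrm (v - u) < d -> nrm (f v - f u) <= e.
Proof.
move=> cf e e0.
pose c (p : R * R) : C := (p.1 +i* p.2)%C.
pose K : set (R * R) := (`[complex.Re z0 - r, complex.Re z0 + r] `*`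
  `[complex.Im z0 - r, complex.Im z0 + r])%classic.
have cK : compact K by apply: compact_setX; exact: segment_compact.
pose P (d : R) (p : R * R) := forall v, nrm (v - c p) < d -> nrm (f v - f (c p)) <= e.
have nc : \forall d \near (0 : R)^'+, K `<=` P d.
  move/compact_near_coveringP: cK; apply=> -[a b] [/= Ka Kb].
  have ab : nrm (c (a, b) - z0) <= r + r.
    apply: le_trans (nrm_le_ReIm _) _; rewrite ReB ImB /=; apply: lerD.
      by move: Ka; rewrite in_itv /= ler_distl.
    by move: Kb; rewrite in_itv /= ler_distl.
  have e20 : 0 < e / 2 by rewrite divr_gt0.
  have /cvgnP/(_ _ e20)/nbC_P[d d0 Hd] := cf _ ab.
  have d4 : 0 < d / 4 by rewrite divr_gt0.
  have d2 : 0 < d / 2 by rewrite divr_gt0.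
  exists ([set p : R * R | `|p.1 - a| < d / 4 /\ `|p.2 - b| < d / 4], [set x : R | x < d / 2]) => /=.
    split; last exact: nbhs_right_lt.
    exists ([set x : R | `|x - a| < d / 4], [set x : R | `|x - b| < d / 4]) => /=.
      split; apply/nbhs_normP; exists (d / 4) => //= x /=; rewrite distrC //.
    by move=> [x y] [/= ? ?].
  move=> [[x y] s] [/= [xa yb] sd] v vs.
  have h1 : nrm (c (x, y) - c (a, b)) <= d / 2.
    apply: le_trans (nrm_le_ReIm _) _; rewrite ReB ImB /=.
    by rewrite (_ : d / 2 = d / 4 + d / 4) ?lerD // ?ltW //; lra.
  have h2 : nrm (f (c (x, y)) - f (c (a, b))) < e / 2.
    by apply: Hd; apply: le_lt_trans h1 _; lra.
  have h3 : nrm (f v - f (c (a, b))) < e / 2.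
    apply: Hd; apply: le_lt_trans (nrm_sub3 (c (x, y)) _ _) _.
    have := lt_trans vs sd; lra.
  apply: le_trans (nrm_sub3 (f (c (a, b))) _ _) _.
  by rewrite (splitr e) lerD // ltW // nrmBC.
have [d [d0 dK]] : exists d : R, 0 < d /\ K `<=` P d.
  apply: (@filter_ex R (0 : R)^'+); exact: filterI (nbhs_right_gt (0 : R)) nc.
exists d => // u v uz vu.
have := dK (complex.Re u, complex.Im u); rewrite /P /c /=.
have -> : (complex.Re u +i* complex.Im u)%C = u :> C by case: (u).
apply=> //; split => /=; rewrite in_itv /= -ler_distl.
  by rewrite -ReB; apply: le_trans uz; exact: Re_le_nrm.
by rewrite -ImB; apply: le_trans uz; exact: Im_le_nrm.
Qed.

Lemma small_root_of_unity (r d : R) : 0 < d -> exists N (w : C),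
  [/\ (0 < N)%N, w ^+ N = 1, nrm w = 1, w != 1 & r * nrm (w - 1) < d].
Proof.
move=> d0; pose B := (r * (pi + pi) + r * (pi + pi)) / d.
(* At least three, so that the angle lies strictly between 0 and [pi]; its sine is then positive and
   [cis a] differs from 1. [B] comes from the bound [a + a] on the distance between [cis a] and
   1. *)
pose N := (Num.bound B).+3; pose a : R := (pi + pi) / N%:R.
have N0 : 0 < N%:R :> R by rewrite ltr0n.
have p0 : 0 < pi :> R := pi_gt0 R.
have a0 : 0 < a by rewrite divr_gt0 // addr_gt0.
have ap : a < pi.
  rewrite ltr_pdivrMr //; have : 3%:R <= N%:R :> R by rewrite ler_nat.
  move=> h; have h' : (pi : R) * 3%:R <= pi * N%:R by rewrite ler_pM2l. 
  by lra.
exists N, (cis a); split => //.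
- rewrite -cisMn -mulr_natr /a divfK ?gt_eqF //.
  by rewrite -mulr2n /cis; congr (_ +i* _)%C; rewrite ?cos2pi ?sin2pi.
- exact: nrm_cis.
- by apply/eqP => -[_ sa]; have := @sin_gt0_pi R a; rewrite a0 ap sa ltxx => /(_ isT).
- have [r0|r0] := leP 0 r; last first.
    by apply: le_lt_trans d0; rewrite mulr_le0_ge0 ?nrm_ge0 // ltW.
  apply: (@le_lt_trans _ _ (r * (a + a))).
    by rewrite ler_wpM2l // (le_trans (nrm_cis_sub1 a)) // gtr0_norm.
  have -> : r * (a + a) = B * d / N%:R by rewrite /B /a divfK ?gt_eqF //; lra.
  rewrite ltr_pdivrMr // mulrC ltr_pM2l //.
  have B0 : 0 <= B by rewrite /B divr_ge0 ?(ltW d0) // addr_ge0 // mulr_ge0 // ltW // addr_gt0.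
  by apply: lt_le_trans (archi_boundP B0) _; rewrite ler_nat /N -addn3 leq_addr.
Qed.

(* The averages of f over the N-th roots of unity replace Cauchy's integral:
   by periodicity the sum of f2 (z0 + t w^j) w^j is a vanishing Riemann sum. *)
Lemma cauchy_estimate f (f1 f2 : C -> C) z0 (r M : R) : 0 < r ->
  (forall w, nrm (w - z0) <= r + r ->
     [/\ cder f w (f1 w), cder f1 w (f2 w) & f2 @ nbC w --> f2 w]) ->
  (forall w, nrm (w - z0) <= r -> nrm (f w) <= M) ->
  nrm (f1 z0) * r <= M + M.
Proof.
move=> r0 Hf HM; apply/ler_addgt0Pr => e' e'0.
(* The bound [N%:R * e] on [c] is integrated twice over a length at most [r], which turns it into
   [N%:R * e']. *)
pose e := e' / (r * r); have e0 : 0 < e by rewrite divr_gt0 // mulr_gt0.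
have [d d0 Hd] : exists2 d : R, 0 < d & forall u v : C,
    nrm (u - z0) <= r -> nrm (v - u) < d -> nrm (f2 v - f2 u) <= e.
  by apply: heine e0 => w wr; have [] := Hf w wr.
have [N [w [N0 wN w1 wn1 rd]]] := small_root_of_unity r d0.
have Hf' u : nrm (u - z0) <= r -> [/\ cder f u (f1 u), cder f1 u (f2 u) & f2 @ nbC u --> f2 u].
  by move=> h; apply: Hf; apply: le_trans h _; rewrite lerDl ltW.
have w0 : w != 0 by rewrite -nrm_gt0 w1.
have wjn j : nrm (w ^+ j) = 1 by rewrite nrmX w1 expr1n.
pose u t j := z0 + t * w ^+ j.
have uz t j : nrm (u t j - z0) = nrm t by rewrite /u [z0 + _]addrC addrK nrmM wjn mulr1.
have cu t j : cder (fun t => u t j) t (w ^+ j).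
  rewrite -[w ^+ j]add0r; apply: cderD; first exact: cder_cst.
  have -> : (fun t : C => t * w ^+ j) = (fun t => w ^+ j * t) by apply/funext => v; rewrite mulrC.
  rewrite -{2}[w ^+ j]mulr1; apply: cderZ; exact: cder_id.
(* On the disc [B] has derivative [b] and [b] has derivative [c]. If [c] is small, [b] stays near
   [b 0 = 0] and [B] near [B 0]; thus [N%:R * f1 z0 * r] is close to a difference of two weighted
   sums of values of [f], each of modulus at most [N%:R * M]. *)
pose B t := \sum_(0 <= j < N) (w ^+ j)^-1 * f (u t j) - N%:R * f1 z0 * t.
pose b t := \sum_(0 <= j < N) f1 (u t j) - N%:R * f1 z0.
pose c t := \sum_(0 <= j < N) f2 (u t j) * w ^+ j.
have sumw : \sum_(0 <= j < N) w ^+ j = 0.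
  have : (w - 1) * \sum_(0 <= j < N) w ^+ j = 0.
    rewrite mulr_sumr (eq_bigr (fun j => w ^+ j.+1 - w ^+ j)); last first.
      by move=> j _; rewrite exprS; ring.
    by rewrite telescope_sumr // wN expr0 subrr.
  by move/eqP; rewrite mulf_eq0 subr_eq0 (negbTE wn1) => /eqP.
have dB t : nrm t <= r -> cder B t (b t).
  move=> tr; apply: cderB; last first.
    by rewrite -{2}[_ * f1 z0]mulr1; apply: cderZ; exact: cder_id.
  apply: cder_sum => j _.
  have -> : f1 (u t j) = (w ^+ j)^-1 * (f1 (u t j) * w ^+ j).
    by rewrite mulrCA mulVf ?mulr1 // expf_neq0.
  apply: cderZ; apply: (cder_comp (f := f)) (cu t j) _.
  by have [] := Hf' (u t j) (ltac:(rewrite uz; exact: tr)).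
have db t : nrm t <= r -> cder b t (c t).
  move=> tr; rewrite -[c t]subr0; apply: cderB; last exact: cder_cst.
  apply: cder_sum => j _; apply: (cder_comp (f := f1)) (cu t j) _.
  by have [] := Hf' (u t j) (ltac:(rewrite uz; exact: tr)).
have cbound t : nrm t <= r -> nrm (c t) <= N%:R * e.
  move=> tr; have [->|t0] := eqVneq t 0.
    rewrite /c (eq_bigr (fun j => f2 z0 * w ^+ j)); last by move=> j _; rewrite /u mul0r addr0.
    by rewrite -mulr_sumr sumw mulr0 nrm0 mulr_ge0 ?ler0n // ltW.
  pose s := t * (w - 1).
  have s0 : 0 < nrm s by rewrite nrm_gt0 mulf_neq0 // subr_eq0.
  have us j : u t j.+1 = u t j + s * w ^+ j by rewrite /u /s exprS; ring.
  rewrite -(ler_pM2r s0) -nrmM.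
  have -> : c t * s = - \sum_(0 <= j < N)
       (f1 (u t j.+1) - f1 (u t j) - f2 (u t j) * (s * w ^+ j)).
    rewrite sumrB telescope_sumr // /u wN expr0 subrr sub0r opprK /c mulr_suml.
    by apply: eq_bigr => j _; ring.
  rewrite nrmN; apply: le_trans (nrm_sum _ _ _) _.
  have -> : N%:R * e * nrm s = \sum_(0 <= j < N) (e * nrm s).
    by rewrite sumr_const_nat subn0 -[RHS]mulr_natl mulrA.
  apply: ler_sum => j _; rewrite us.
  have -> : e * nrm s = e * nrm (s * w ^+ j) by rewrite nrmM wjn mulr1.
  pose g v := f1 v - f2 (u t j) * v.
  have -> : f1 (u t j + s * w ^+ j) - f1 (u t j) - f2 (u t j) * (s * w ^+ j) =
     g (u t j + s * w ^+ j) - g (u t j) by rewrite /g; ring.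
  apply: (mean_value (df := fun v => f2 v - f2 (u t j))) => x /andP[x0 x1].
  set v := u t j + _.
  have vz : nrm (v - z0) <= r.
    apply: le_trans tr; have -> : v - z0 = t * w ^+ j * (of_real (1 - x) + of_real x * w).
      by rewrite /v /u /s of_realB of_real1; ring.
    rewrite nrmM nrmM wjn mulr1 ler_piMr ?nrm_ge0 // (le_trans (nrmD _ _)) //.
    by rewrite nrmM w1 mulr1 !nrm_real !ger0_norm ?subr_ge0 // subrK.
  have [_ d1 _] := Hf' v vz; split.
    by apply: cderB => //; rewrite -{2}[f2 (u t j)]mulr1; apply: cderZ; exact: cder_id.
  apply: Hd; first by rewrite uz.
  rewrite /v [u t j + _]addrC addrK nrmM nrmM wjn mulr1 nrm_real ger0_norm //.
  apply: le_lt_trans rd; rewrite /s nrmM.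
  apply: (@le_trans _ _ (nrm t * nrm (w - 1))); first by rewrite ler_piMl // mulr_ge0 ?nrm_ge0.
  by rewrite ler_wpM2r ?nrm_ge0.
have segt t x : nrm t <= r -> 0 <= x <= 1 -> nrm (0 + of_real x * t) <= r.
  move=> tr /andP[x0 x1]; rewrite add0r nrmM nrm_real ger0_norm //.
  by apply: le_trans tr; rewrite ler_piMl ?nrm_ge0.
have b0 : b 0 = 0.
  rewrite /b (eq_bigr (fun=> f1 z0)); last by move=> j _; rewrite /u mul0r addr0.
  by rewrite sumr_const_nat subn0 mulr_natl subrr.
have bbound t : nrm t <= r -> nrm (b t) <= N%:R * e * r.
  move=> tr; have := @mean_value _ b c 0 t (N%:R * e); rewrite add0r b0 subr0 => H.
  apply: le_trans (H _) _.
    by move=> x x01; have tx := segt t x tr x01; split; [exact: db|exact: cbound].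
  by rewrite ler_wpM2l // mulr_ge0 ?ler0n // ltW.
have rr : nrm (of_real r) = r by rewrite nrm_real gtr0_norm.
have rle : nrm (of_real r) <= r by rewrite rr.
have := @mean_value _ B b 0 (of_real r) (N%:R * e * r); rewrite add0r rr => H.
have {H} HB : nrm (B (of_real r) - B 0) <= N%:R * e * r * r.
  apply: H => x x01; have tx := segt _ x rle x01; split; [exact: dB|exact: bbound].
have Np : 0 < N%:R :> R by rewrite ltr0n.
rewrite -(ler_pM2l Np).
have -> : N%:R * (nrm (f1 z0) * r) = nrm (N%:R * f1 z0 * of_real r).
  by rewrite 2!nrmM rr nrm_nat mulrA.
have -> : N%:R * f1 z0 * of_real r = \sum_(0 <= j < N) (w ^+ j)^-1 * f (u (of_real r) j) -
   \sum_(0 <= j < N) (w ^+ j)^-1 * f (u 0 j) - (B (of_real r) - B 0).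
  by rewrite /B; ring.
have sb t : nrm t <= r -> nrm (\sum_(0 <= j < N) (w ^+ j)^-1 * f (u t j)) <= N%:R * M.
  move=> tr; apply: le_trans (nrm_sum _ _ _) _.
  have -> : N%:R * M = \sum_(0 <= j < N) M by rewrite sumr_const_nat subn0 -[RHS]mulr_natl.
  apply: ler_sum => j _; rewrite nrmM nrmV wjn invr1 mul1r; apply: HM.
  by rewrite uz.
apply: le_trans (nrmB _ _) _.
apply: le_trans (lerD (nrmB _ _) HB) _.
have -> : N%:R * (M + M + e') = N%:R * M + N%:R * M + N%:R * e * r * r.
  by rewrite /e; field; rewrite gt_eqF.
by rewrite lerD2r lerD // sb // nrm0 ltW.
Qed.

End CauchyEstimate.

(** * Weierstrass' theorem, series and infinite products of holomorphic functions *)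

Section Weierstrass.
Context {R : realType} {I : finType}.
Local Notation C := (cplx R).
Implicit Types (x y : I -> C) (U : set (I -> C)) (F G : (I -> C) -> C) (i j : I)
  (Fs : nat -> (I -> C) -> C).

Definition lucvg U Fs F := forall x, U x -> exists2 r : R, 0 < r &
  (forall y, box x r y -> U y) /\
  forall e : R, 0 < e -> exists N, forall k, (N <= k)%N -> forall y, box x r y ->
    nrm (Fs k y - F y) <= e.

Lemma lucvg_cvg U Fs F x : lucvg U Fs F -> U x -> (fun k => Fs k x) @ \oo --> F x.
Proof.
move=> H Ux; have [r r0 [_ Hr]] := H x Ux.
apply/cvgnP => e e0; have [N HN] := Hr (e / 2) (divr_gt0 e0 (ltr0Sn _ _)).
exists N => // k Nk; apply: le_lt_trans (HN k Nk x (box_refl x r0)) _.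
by rewrite ltr_pdivrMr // ltr_pMr // ltr1n.
Qed.

(** Cauchy's estimate is applied to the difference of two members of the sequence, restricted to
    coordinate [i]. *)
Lemma lucvg_pderiv_cauchy U Fs F i x : (forall k, hol U (Fs k)) -> opn U ->
  lucvg U Fs F -> U x -> exists2 r : R, 0 < r & (forall y, box x r y -> U y) /\
    forall e : R, 0 < e -> exists N, forall k l, (N <= k)%N -> (N <= l)%N ->
      forall y, box x r y -> nrm (pderiv i (Fs k) y - pderiv i (Fs l) y) <= e.
Proof.
move=> HF oU HL Ux; have [r r0 [rU Hr]] := HL x Ux.
exists (r / 2); first by rewrite divr_gt0.
split; first by move=> y yb; apply: rU; apply: box_le yb; lra.
(* The estimate at radius [s] involves the disc of radius [s + s] about [y i], which stays in the
   large box when [y] is in the half box. Its bound consists of four terms [e1], in total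
   [e * s]. *)
move=> e e0; pose s := r / 8%:R; have s0 : 0 < s by rewrite divr_gt0.
pose e1 := e * s / 4%:R; have e10 : 0 < e1 by rewrite divr_gt0 // mulr_gt0.
have [N HN] := Hr e1 e10; exists N => k l Nk Nl y yb.
have Hw w : nrm (w - y i) <= s + s -> box x r (upd y i w).
  move=> ws j; rewrite /upd; case: eqP => [->|_]; last by apply: lt_trans (yb j) _; lra.
  apply: le_lt_trans (nrm_sub3 (y i) _ _) _; have := yb i; rewrite /s in ws; lra.
pose D k w := pderiv i (Fs k) (upd y i w); pose D2 k w := pderiv i (pderiv i (Fs k)) (upd y i w).
have cD (G : (I -> C) -> C) w : hol U G -> U (upd y i w) ->
    cder (fun w => G (upd y i w)) w (pderiv i G (upd y i w)).
  move=> HG Uw; have := cder_pderiv i HG Uw; rewrite upd_same.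
  by congr (cder _ _ _); apply/funext => v; rewrite upd_upd.
have := @cauchy_estimate _ (fun w => Fs k (upd y i w) - Fs l (upd y i w))
  (fun w => D k w - D l w) (fun w => D2 k w - D2 l w) (y i) s (e1 + e1) s0.
rewrite /D /D2 upd_id => H.
have {}H : nrm (pderiv i (Fs k) y - pderiv i (Fs l) y) * s <= e1 + e1 + (e1 + e1).
  apply: H => w ws; last first.
    have bw : box x r (upd y i w) by apply: Hw; lra.
    have h1 := HN k Nk _ bw; have h2 := HN l Nl _ bw.
    by apply: le_trans (nrm_sub3 (F (upd y i w)) _ _) _; rewrite lerD // nrmBC.
  have Uw := rU _ (Hw w ws); split.
  - by apply: cderB; apply: cD.
  - by apply: cderB; apply: cD => //; exact: hol_pderiv.
  - apply: ccvgD; last apply: ccvgN; apply: (@cder_cvg _ _ _ _ (cD _ _ _ Uw));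
      do 2 (apply: hol_pderiv; first exact: oU); exact: HF.
by rewrite -(ler_pM2r s0); apply: le_trans H _; rewrite /e1; lra.
Qed.

Lemma lucvg_pderiv U Fs F i : (forall k, hol U (Fs k)) -> opn U -> lucvg U Fs F ->
  exists G, lucvg U (fun k => pderiv i (Fs k)) G /\
    forall x, U x -> cder (fun w => F (upd x i w)) (x i) (G x).
Proof.
move=> HF oU HL; pose G x := lim ((fun k => pderiv i (Fs k) x) @ \oo).
have cG x : U x -> (fun k => pderiv i (Fs k) x) @ \oo --> G x.
  move=> Ux; have [r r0 [rU Hr]] := lucvg_pderiv_cauchy i HF oU HL Ux.
  suff [l Hl] : exists l : C, (fun k => pderiv i (Fs k) x) @ \oo --> l.
    by rewrite /G (cvg_lim _ Hl).
  apply: cauchy_cvgn => e e0; have [N HN] := Hr e e0; exists N => k l Nk Nl.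
  by apply: HN => //; exact: box_refl.
have key x : U x -> exists2 r : R, 0 < r & (forall y, box x r y -> U y) /\
    forall e : R, 0 < e -> exists N,
      (forall k l, (N <= k)%N -> (N <= l)%N ->
         forall y, box x r y -> nrm (pderiv i (Fs k) y - pderiv i (Fs l) y) <= e) /\
      forall k, (N <= k)%N -> forall y, box x r y -> nrm (pderiv i (Fs k) y - G y) <= e.
  move=> Ux; have [r r0 [rU Hr]] := lucvg_pderiv_cauchy i HF oU HL Ux.
  exists r => //; split=> // e e0; have [N HN] := Hr e e0; exists N; split=> // k Nk y yb.
  have cc : (fun l => pderiv i (Fs k) y - pderiv i (Fs l) y) @ \oo --> pderiv i (Fs k) y - G y.
    by apply: ccvgD; [exact: ccvg_cst|apply: ccvgN; apply: cG; exact: rU].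
  apply: (cvg_le_nrm cc); exists N => // l /= Nl; exact: HN.
exists G; split.
  move=> x Ux; have [r r0 [rU Hr]] := key x Ux; exists r => //; split=> // e e0.
  by have [N [_ HN]] := Hr e e0; exists N.
move=> x Ux; have [r r0 [rU Hr]] := key x Ux.
apply/cderP => e e0; have e30 : 0 < e / 3%:R by rewrite divr_gt0.
have [N [HN1 HN2]] := Hr _ e30.
have /cderP/(_ _ e30)[d d0 Hd] := cder_pderiv i (HF N) Ux.
exists (Num.min r d); first by rewrite lt_min r0.
move=> w; rewrite lt_min => /andP[wr wd]; rewrite upd_id.
have := Hd w wd; rewrite upd_id => h2.
have h3 : nrm ((pderiv i (Fs N) x - G x) * (w - x i)) <= e / 3%:R * nrm (w - x i).
  by rewrite nrmM ler_wpM2r ?nrm_ge0 // HN2 //; exact: box_refl.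
have seg t : 0 <= t <= 1 -> box x r (upd x i (x i + of_real t * (w - x i))).
  move=> /andP[t0 t1]; apply: box_upd; first exact: box_refl.
  rewrite [x i + _]addrC addrK nrmM nrm_real ger0_norm //.
  by apply: le_lt_trans wr; rewrite ler_piMl ?nrm_ge0.
have Uw : U (upd x i w).
  by apply: rU; apply: box_upd => //; exact: box_refl.
have h1 : nrm ((F (upd x i w) - Fs N (upd x i w)) - (F x - Fs N x)) <= e / 3%:R * nrm (w - x i).
  have cc : (fun l => (Fs l (upd x i w) - Fs N (upd x i w)) - (Fs l x - Fs N x)) @ \oo -->
      (F (upd x i w) - Fs N (upd x i w)) - (F x - Fs N x).
    by apply: ccvgD; last apply: ccvgN; apply: ccvgD; try exact: ccvg_cst; apply: lucvg_cvg HL _.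
  apply: (cvg_le_nrm cc); exists N => // l /= Nl.
  have := @mean_value _ (fun v => Fs l (upd x i v) - Fs N (upd x i v))
    (fun v => pderiv i (Fs l) (upd x i v) - pderiv i (Fs N) (upd x i v)) (x i) (w - x i) (e / 3%:R).
  rewrite [x i + (w - x i)]addrC subrK upd_id; apply=> t /seg bt; split; last exact: HN1.
  have Ut := rU _ bt.
  apply: cderB; [have := cder_pderiv i (HF l) Ut|have := cder_pderiv i (HF N) Ut];
    rewrite upd_same; congr (cder _ _ _); by apply/funext => v; rewrite upd_upd.
have E (a b c d' g p q : C) : a - b - g * q = (a - c - (b - d')) + (c - d' - p * q) + (p - g) * q.
  by ring.
rewrite (E _ _ (Fs N (upd x i w)) (Fs N x) _ (pderiv i (Fs N) x)).
apply: le_trans (nrmD _ _) _; apply: le_trans (lerD (nrmD _ _) h3) _.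
by have := lerD h1 h2; move=> h; apply: le_trans (lerD h (lexx _)) _; lra.
Qed.

(** The derivatives converge locally uniformly as well, and to the derivative of the limit, so the
    induction on the order of smoothness passes to the derived sequence. *)
Theorem lucvg_hol U Fs F : (forall k, hol U (Fs k)) -> opn U -> lucvg U Fs F -> hol U F.
Proof.
move=> HF oU HL n; elim: n Fs F HF HL => [|n IH] Fs F HF HL.
all: have cF x (Ux : U x) : F @ nbx x --> F x.
1,3: have [r r0 [rU Hr]] := HL x Ux.
1,2: apply/cvgnP => e e0; have e30 : 0 < e / 4%:R by rewrite divr_gt0.
1,2: have [N HN] := Hr _ e30; have /cvgnP/(_ _ e30) := Cn_cvg (HF N 0%N) Ux.
1,2: move=> [s s0 Hs]; exists (Num.min r s); first by rewrite lt_min r0.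
1,2: move=> y yb; have yr : box x r y by apply: box_le yb; rewrite ge_min lexx.
1,2: have ys : box x s y by apply: box_le yb; rewrite ge_min lexx orbT.
1,2: have h1 := HN N (leqnn N) y yr; have h2 := HN N (leqnn N) x (box_refl x r0).
1,2: have h3 := Hs y ys; rewrite nrmBC in h1.
1,2: apply: le_lt_trans (nrm_sub3 (Fs N y) _ _) _.
1,2: have h4 := nrm_sub3 (Fs N x) (Fs N y) (F x); lra.
- by split; [exact: cF|exact: Logic.I].
- split; first exact: cF.
  move=> i; have [G [HG1 HG2]] := lucvg_pderiv i HF oU HL; exists G; split=> //.
  by apply: IH HG1 => k; exact: hol_pderiv.
Qed.

Definition summable_seq (c : nat -> R) := exists B : R, forall N, \sum_(0 <= n < N) c n <= B.

Lemma summable_seq_tail (c : nat -> R) : (forall n, 0 <= c n) -> summable_seq c ->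
  forall e : R, 0 < e -> exists N, forall k l, (N <= k <= l)%N -> \sum_(k <= n < l) c n <= e.
Proof.
move=> c0 [B HB] e e0.
have nd : nondecreasing_seq (fun N => \sum_(0 <= n < N) c n).
  move=> k l kl; rewrite (big_cat_nat (n := k) (p := l)) //= lerDl.
  by apply: sumr_ge0 => *.
have cv : cvgn (fun N => \sum_(0 <= n < N) c n).
  by apply: nondecreasing_is_cvgn nd _; exists B => _ [n _ <-]; exact: HB.
have /cvg_ex[/= l0 /cvgrPdist_le/(_ (e / 2) (divr_gt0 e0 (ltr0Sn _ _)))] := cv.
move=> [N _ HN]; exists N => k l /andP[Nk kl].
have h1 := HN k Nk; have h2 := HN l (leq_trans Nk kl); rewrite /= in h1 h2.
have -> : \sum_(k <= n < l) c n = (l0 - \sum_(0 <= n < k) c n) - (l0 - \sum_(0 <= n < l) c n).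
  by rewrite (big_cat_nat (m := 0%N) (n := k) (p := l)) //=; ring.
by apply: le_trans (ler_norm _) _; apply: le_trans (ler_normB _ _) _; rewrite (splitr e) lerD.
Qed.

Lemma hol_series U (u : nat -> (I -> C) -> C) : opn U -> (forall n, hol U (u n)) ->
  (forall x, U x -> exists2 r : R, 0 < r & exists2 c : nat -> R, summable_seq c &
     forall y, box x r y -> forall n, nrm (u n y) <= c n) ->
  hol U (fun x => lim ((fun N => \sum_(0 <= n < N) u n x) @ \oo)) /\
  forall x, U x -> (fun N => \sum_(0 <= n < N) u n x) @ \oo -->
     lim ((fun N => \sum_(0 <= n < N) u n x) @ \oo).
Proof.
move=> oU Hu HM; pose S N x := \sum_(0 <= n < N) u n x.
have HS N : hol U (S N) by apply: hol_sum => n _; exact: Hu.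
have key x : U x -> exists2 r : R, 0 < r & (forall y, box x r y -> U y) /\
    forall e : R, 0 < e -> exists N, forall k l, (N <= k)%N -> (N <= l)%N ->
      forall y, box x r y -> nrm (S k y - S l y) <= e.
  move=> Ux; have [r r0 [c sc Hc]] := HM x Ux; have [s s0 Hs] := oU x Ux.
  exists (Num.min r s); first by rewrite lt_min r0.
  split; first by move=> y yb; apply: Hs; apply: box_le yb; rewrite ge_min lexx orbT.
  move=> e e0.
  have c0 n : 0 <= c n by apply: le_trans (Hc x (box_refl x r0) n); exact: nrm_ge0.
  have [N HN] := summable_seq_tail c0 sc e0; exists N.
  suff H k l : (N <= k <= l)%N -> forall y, box x (Num.min r s) y -> nrm (S k y - S l y) <= e.
    move=> k l Nk Nl y yb; have [kl|lk] := leqP k l; first by apply: H => //; rewrite Nk.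
    by rewrite nrmBC; apply: H => //; rewrite Nl ltnW.
  move=> /[dup] Nkl /andP[_ kl] y yb.
  rewrite nrmBC /S (big_cat_nat (m := 0%N) (n := k) (p := l)) //= [X in nrm X](_ : _ = \sum_(k <= n < l) u n y); last by ring.
  apply: le_trans (nrm_sum _ _ _) _; apply: le_trans (HN _ _ Nkl).
  by apply: ler_sum => n _; apply: Hc; apply: box_le yb; rewrite ge_min lexx.
have cS x : U x -> (fun N => S N x) @ \oo --> lim ((fun N => S N x) @ \oo).
  move=> Ux; have [r r0 [rU Hr]] := key x Ux.
  suff [l Hl] : exists l : C, (fun N => S N x) @ \oo --> l by rewrite (cvg_lim _ Hl).
  apply: cauchy_cvgn => e e0; have [N HN] := Hr e e0; exists N => k l Nk Nl.
  by apply: HN => //; exact: box_refl.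
split=> //; apply: (lucvg_hol HS oU) => x Ux; have [r r0 [rU Hr]] := key x Ux.
exists r => //; split=> // e e0; have [N HN] := Hr e e0; exists N => k Nk y yb.
have cc : (fun l => S k y - S l y) @ \oo --> S k y - lim ((fun N => S N y) @ \oo).
  by apply: ccvgD; [exact: ccvg_cst|apply: ccvgN; apply: cS; exact: rU].
apply: (cvg_le_nrm cc); exists N => // l /= Nl; exact: HN.
Qed.

Lemma prod_bound (E : nat -> C) (c : nat -> R) (B : R) N :
  (forall n, nrm (E n - 1) <= c n) -> \sum_(0 <= n < N) c n <= B ->
  nrm (\prod_(0 <= n < N) E n) <= expR B.
Proof.
move=> Hc HB; apply: (@le_trans _ _ (expR (\sum_(0 <= n < N) c n))); last by rewrite ler_expR.
rewrite nrm_prod expR_sum; apply: ler_prod => n _; rewrite nrm_ge0 /=.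
apply: le_trans (expR_ge1Dx _); rewrite -lerBlDl.
by apply: le_trans (Hc n); rewrite -nrm1; exact: nrm_lb.
Qed.

(** The partial products are the partial sums of a telescoping series with terms P_m (E_m - 1),
    where the P_m are bounded by [expR B]; this series is dominated by a multiple of [c].
    Non-vanishing of the limit is a separate matter. *)
Lemma hol_infprod U (E : nat -> (I -> C) -> C) : opn U -> (forall n, hol U (E n)) ->
  (forall x, U x -> exists2 r : R, 0 < r & exists2 c : nat -> R, summable_seq c &
     forall y, box x r y -> forall n, nrm (E n y - 1) <= c n) ->
  hol U (fun x => lim ((fun N => \prod_(0 <= n < N) E n x) @ \oo)) /\
  forall x, U x -> (fun N => \prod_(0 <= n < N) E n x) @ \oo -->
     lim ((fun N => \prod_(0 <= n < N) E n x) @ \oo).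
Proof.
move=> oU HE HM.
pose u n x := if n is m.+1 then (\prod_(0 <= k < m) E k x) * (E m x - 1) else 1.
have Eu N x : \sum_(0 <= n < N.+1) u n x = \prod_(0 <= n < N) E n x.
  elim: N => [|N IH]; first by rewrite big_nat1 big_geq.
  by rewrite big_nat_recr //= IH /u [RHS]big_nat_recr //=; ring.
have Hu n : hol U (u n).
  case: n => [|n]; first exact: hol_cst.
  apply: holM; first by apply: hol_prod => k _; exact: HE.
  by apply: holB; [exact: HE|exact: hol_cst].
have [|h1 h2] := @hol_series U u oU Hu.
  move=> x Ux; have [r r0 [c [B HB] Hc]] := HM x Ux; exists r => //.
  have c0 n : 0 <= c n by apply: le_trans (Hc x (box_refl x r0) n); exact: nrm_ge0.
  exists (fun n => if n is m.+1 then expR B * c m else 1); last first.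
    move=> y yb [|n] /=; first by rewrite nrm1.
    rewrite nrmM ler_pM ?nrm_ge0 //; last exact: Hc.
    by apply: prod_bound (HB n) => k; exact: Hc.
  exists (1 + expR B * B) => -[|N]; first by rewrite big_geq // addr_ge0 // mulr_ge0 ?expR_ge0 //; apply: le_trans (HB 0%N); rewrite big_geq.
  by rewrite big_nat_recl //= lerD2l -mulr_sumr ler_pM2l ?expR_gt0.
have E1 x : U x -> (fun N => \prod_(0 <= n < N) E n x) @ \oo -->
    lim ((fun N => \sum_(0 <= n < N) u n x) @ \oo).
  move=> Ux; have := h2 x Ux; rewrite -(cvg_shiftS (fun N => \sum_(0 <= n < N) u n x)).
  by rewrite (_ : [sequence _]_n = (fun N => \prod_(0 <= n < N) E n x)) //; apply/funext => N; exact: Eu.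
have El x : U x -> lim ((fun N => \prod_(0 <= n < N) E n x) @ \oo) =
    lim ((fun N => \sum_(0 <= n < N) u n x) @ \oo).
  by move=> Ux; exact: cvg_lim (E1 x Ux).
split; last by move=> x Ux; rewrite El //; exact: E1.
by apply: hol_ext h1 => // x Ux; rewrite El.
Qed.

End Weierstrass.

(** * Germs and double poles *)

Section Germs.
Context {R : realType}.
Local Notation C := (cplx R).
Implicit Types (f g phi psi : C -> C) (z w : C).

Definition disc z (r : R) : set (unit -> C) := [set x | nrm (x tt - z) < r].

Lemma opn_disc z r : opn (disc z r).
Proof.
move=> x xr; have bx : box (fun _ : unit => z) r x by case.
have [s s0 H] := opn_box bx.
by exists s => // y /H /(_ tt).
Qed.

(** Analyticity at a point in one variable, encoded with the index type [unit] so that the theory in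
    several variables applies to it unchanged. *)
Definition an phi z := exists2 r : R, 0 < r & hol (disc z r) (fun x => phi (x tt)).

Lemma disc_le z (r s : R) x : r <= s -> disc z r x -> disc z s x.
Proof. by move=> rs h; exact: lt_le_trans h rs. Qed.

Lemma an_sub phi z : an phi z -> forall d : R, 0 < d ->
  exists2 r : R, 0 < r <= d & hol (disc z r) (fun x => phi (x tt)).
Proof.
move=> [r r0 H] d d0; exists (Num.min r d); first by rewrite lt_min r0 d0 ge_min lexx orbT.
by apply: hol_sub H => x; apply: disc_le; rewrite ge_min lexx.
Qed.

Lemma an2 phi psi z : an phi z -> an psi z -> exists2 r : R, 0 < r &
  hol (disc z r) (fun x => phi (x tt)) /\ hol (disc z r) (fun x => psi (x tt)).
Proof.
move=> [r r0 H] /an_sub/(_ r r0)[s /andP[s0 sr] K]; exists s => //; split=> //.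
by apply: hol_sub H => x; exact: disc_le.
Qed.

Lemma an_cst c z : an (fun=> c) z.
Proof. by exists 1 => //; exact: hol_cst. Qed.
Lemma an_id z : an (fun w => w) z.
Proof. by exists 1 => //; exact: hol_proj. Qed.
Lemma anD phi psi z : an phi z -> an psi z -> an (fun w => phi w + psi w) z.
Proof. by move=> H K; have [r r0 [H1 H2]] := an2 H K; exists r => //; exact: holD. Qed.
Lemma anM phi psi z : an phi z -> an psi z -> an (fun w => phi w * psi w) z.
Proof. by move=> H K; have [r r0 [H1 H2]] := an2 H K; exists r => //; exact: holM. Qed.
Lemma anN phi z : an phi z -> an (fun w => - phi w) z.
Proof. by move=> [r r0 H]; exists r => //; exact: holN. Qed.
Lemma anB phi psi z : an phi z -> an psi z -> an (fun w => phi w - psi w) z.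
Proof. by move=> H K; apply: anD => //; exact: anN. Qed.
Lemma an_cexp phi z : an phi z -> an (fun w => cexp (phi w)) z.
Proof. by move=> [r r0 H]; exists r => //; exact: hol_cexp. Qed.
Lemma an_sum (J : Type) (r : seq J) (P : pred J) (F : J -> C -> C) z :
  (forall j, P j -> an (F j) z) -> an (fun x => \sum_(j <- r | P j) F j x) z.
Proof.
move=> H; elim: r => [|j r IH].
  have -> : (fun x => \sum_(j <- [::] | P j) F j x) = (fun=> 0).
    by apply/funext => x; rewrite big_nil.
  exact: an_cst.
have -> : (fun x => \sum_(k <- j :: r | P k) F k x) =
   (fun x => (if P j then F j x else 0) + \sum_(k <- r | P k) F k x).
  by apply/funext => x; rewrite big_cons; case: ifP => // _; rewrite add0r.
by apply: anD => //; case Pj: (P j); [exact: H|exact: an_cst].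
Qed.
Lemma an_prod (J : Type) (r : seq J) (P : pred J) (F : J -> C -> C) z :
  (forall j, P j -> an (F j) z) -> an (fun x => \prod_(j <- r | P j) F j x) z.
Proof.
move=> H; elim: r => [|j r IH].
  have -> : (fun x => \prod_(j <- [::] | P j) F j x) = (fun=> 1).
    by apply/funext => x; rewrite big_nil.
  exact: an_cst.
have -> : (fun x => \prod_(k <- j :: r | P k) F k x) =
   (fun x => (if P j then F j x else 1) * \prod_(k <- r | P k) F k x).
  by apply/funext => x; rewrite big_cons; case: ifP => // _; rewrite mul1r.
by apply: anM => //; case Pj: (P j); [exact: H|exact: an_cst].
Qed.

Lemma hol_disc_cder phi z (r : R) w : hol (disc z r) (fun x => phi (x tt)) ->
  nrm (w - z) < r -> cder phi w (derive1 phi w).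
Proof.
move=> H wr; have := @cder_pderiv _ _ _ _ tt (fun=> w) H wr => /= h.
have E : (fun v => phi (upd (fun=> w) tt v tt)) = phi by apply/funext => v; rewrite upd_same.
rewrite E in h; by rewrite (cder_derive1 h).
Qed.

Lemma an_cder phi z : an phi z -> cder phi z (derive1 phi z).
Proof. by move=> [r r0 H]; apply: (hol_disc_cder H); rewrite subrr nrm0. Qed.

Lemma an_cvg phi z : an phi z -> phi @ nbC z --> phi z.
Proof. by move=> /an_cder/cder_cvg. Qed.

Lemma an_near phi z : an phi z -> \forall w \near nbC z, an phi w.
Proof.
move=> [r r0 H]; apply/nbC_P; exists r => // w wr; exists (r - nrm (w - z)); first by rewrite subr_gt0.
apply: hol_sub H => x; rewrite /disc /= => xw.
by apply: le_lt_trans (nrm_sub3 w _ _) _; rewrite -ltrBrDr.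
Qed.

Lemma an_ext phi psi z : (\forall w \near nbC z, phi w = psi w) -> an phi z -> an psi z.
Proof.
move=> /nbC_P[d d0 Hd] /an_sub/(_ d d0)[r /andP[r0 rd] H]; exists r => //.
apply: hol_ext H; first exact: opn_disc.
by move=> x xr; apply: Hd; exact: lt_le_trans xr rd.
Qed.

Lemma an_derive phi z : an phi z -> an (derive1 phi) z.
Proof.
move=> [r r0 H]; exists r => //; apply: hol_ext (hol_pderiv tt (@opn_disc z r) H).
  exact: opn_disc.
move=> x xr; by rewrite /pderiv; congr (derive1 _ _).
Qed.

Lemma an_compN (J : finType) (U : set (J -> C)) (F : (J -> C) -> C) (L : C -> J -> C) z :
  opn U -> hol U F -> U (L z) -> (forall j, an (fun w => L w j) z) -> an (fun w => F (L w)) z.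
Proof.
move=> oU HF Uz HL; have [s s0 Hs] := oU _ Uz.
have : \forall w \near nbC z, forall j, nrm (L w j - L z j) < s.
  by apply: filter_forall => j; have /cvgnP := an_cvg (HL j); exact.
move=> /nbC_P[d d0 Hd].
have /choice[rr Hrr] : forall j, exists r : R, 0 < r <= d /\ hol (disc z r) (fun x => L (x tt) j).
  by move=> j; have [r ? ?] := an_sub (HL j) d0; exists r.
pose m := \big[Num.min/d]_(j : J) rr j.
have m0 : 0 < m.
  rewrite /m; elim/big_ind: _ => // [u v u0 v0|i _]; first by rewrite lt_min u0.
  by have [/andP[]] := Hrr i.
have md : m <= d.
  rewrite /m; elim/big_ind: _ => // [u v u0 v0|i _]; first by rewrite ge_min u0.
  by have [/andP[]] := Hrr i.
exists m => //; apply: (hol_comp (L := fun x => L (x tt)) oU HF).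
  move=> j; have [_ H] := Hrr j; apply: hol_sub H => x; apply: disc_le.
  by rewrite /m (bigD1 j) //= ge_min lexx.
by move=> x xm; apply: Hs => j; apply: Hd; exact: lt_le_trans xm md.
Qed.

Lemma an_comp phi psi z : an psi z -> an phi (psi z) -> an (fun w => phi (psi w)) z.
Proof.
move=> Hpsi [r r0 H]; apply: (an_compN (F := fun x => phi (x tt)) (L := fun w _ => psi w) (opn_disc (z := psi z) (r := r)) H).
  by rewrite /disc /= subrr nrm0.
by [].
Qed.

Lemma an_neq0 phi z : an phi z -> phi z != 0 -> \forall w \near nbC z, phi w != 0.
Proof.
move=> H z0; have /cvgnP/(_ (nrm (phi z))) := an_cvg H.
rewrite nrm_gt0 => /(_ z0); apply: filterS => w.
by apply: contraTneq => ->; rewrite sub0r nrmN ltxx.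
Qed.

Lemma anV phi z : phi z != 0 -> an phi z -> an (fun w => (phi w)^-1) z.
Proof.
move=> z0 H; have /nbC_P[d d0 Hd] := an_neq0 H z0.
have [r /andP[r0 rd] Hr] := an_sub H d0; exists r => //; apply: holV => //.
by move=> x xr; apply: Hd; exact: lt_le_trans xr rd.
Qed.

(* The difference quotient is the limit of the Riemann sums of
   int_0^1 phi'(z + t (w - z)) dt. *)
Lemma an_quotient phi z : an phi z ->
  an (fun w => if w == z then derive1 phi z else (phi w - phi z) / (w - z)) z.
Proof.
move=> H; have [r r0 Hr] := H.
have H1 := an_derive H; have H2 := an_derive H1.
have /nbC_P[d d0 Hd] : \forall w \near nbC z,
   [/\ an (derive1 phi) w, an phi w & nrm (derive1 (derive1 phi) w) <= nrm (derive1 (derive1 phi) z) + 1].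
  have h1 := an_near H; have h2 := an_near H1; have /cvgnP/(_ 1 ltr01) h3 := an_cvg H2.
  apply: filterS3 h1 h2 h3 => w a1 a2 a3; split=> //.
  rewrite -lerBlDl; apply: le_trans (ltW a3); exact: nrm_lb.
set B := nrm (derive1 (derive1 phi) z) + 1 in Hd.
have B0 : 0 <= B by rewrite addr_ge0 ?nrm_ge0.
have [s /andP[s0 sd] Hs] := an_sub H1 d0.
pose p k j w := z + of_real (j%:R / k.+1%:R) * (w - z).
pose S k w := of_real (k.+1%:R^-1) * \sum_(0 <= j < k.+1) derive1 phi (p k j w).
have pz k j w : nrm (p k j w - z) = j%:R / k.+1%:R * nrm (w - z).
  by rewrite /p [z + _]addrC addrK nrmM nrm_real ger0_norm // divr_ge0.
have jk k j : (j <= k.+1)%N -> (0 <= (j%:R / k.+1%:R : R) <= 1).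
  by move=> jk; rewrite divr_ge0 //= ler_pdivrMr ?ltr0n // mul1r ler_nat.
have pd k j w : (j <= k.+1)%N -> nrm (p k j w - z) <= nrm (w - z).
  by move=> /jk/andP[j0 j1]; rewrite pz ler_piMl ?nrm_ge0.
have HS k : hol (disc z s) (fun x => S k (x tt)).
  apply: holM; first exact: hol_cst.
  rewrite [X in hol _ X](_ : _ = (fun x : unit -> C => \sum_(0 <= j < k.+1 | (j < k.+1)%N) derive1 phi (p k j (x tt)))).
    2: by apply/funext => x; rewrite [RHS]big_nat_cond [LHS]big_nat_cond; apply: eq_bigl => j; case: (_ <= _)%N; case: (j < _)%N.
  apply: hol_sum => j jk1.
  apply: (hol_comp (F := fun x => derive1 phi (x tt)) (L := fun x _ => p k j (x tt)) (opn_disc (z := z) (r := s)) Hs).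
    move=> _; apply: holD; first exact: hol_cst.
    apply: holM; first exact: hol_cst.
    by apply: holB; [exact: hol_proj|exact: hol_cst].
  by move=> x xs; apply: le_lt_trans xs; apply: pd; exact: ltnW.
exists s => //.
apply: (lucvg_hol HS (opn_disc (z := z) (r := s))) => x xs.
have [t t0 Ht] := opn_disc xs; exists t => //; split=> // e e0.
(* Each of the [k.+1] steps of the Riemann sum errs by at most [B * nrm h * nrm h]; summed and
   divided by [nrm (w - z)] this is at most [B * d / k.+1%:R]. *)
have [N HN] : exists N : nat, B * d < e * N.+1%:R.
  exists (Num.bound (B * d / e)); rewrite [e * _]mulrC -ltr_pdivrMr //.
  apply: lt_trans (archi_boundP _) _; first by rewrite divr_ge0 ?mulr_ge0 // ltW.
  by rewrite ltr_nat.
exists N => k Nk y yt; have ys := Ht y yt; move: ys; rewrite /disc /=; set w := y tt => ws.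
have wd : nrm (w - z) < d := lt_le_trans ws sd.
case: eqP => [wz|/eqP wz].
  rewrite /S (eq_bigr (fun=> derive1 phi z)); last first.
    by move=> j _; rewrite /p wz subrr mulr0 addr0.
  rewrite sumr_const_nat subn0 -[derive1 phi z *+ _]mulr_natl of_realV of_real_nat mulrA mulVf ?pnatr_eq0 //.
  by rewrite mul1r subrr nrm0 ltW.
have wz0 : 0 < nrm (w - z) by rewrite nrm_gt0 subr_eq0.
rewrite -(ler_pM2r wz0) -nrmM mulrBl divfK ?subr_eq0 //.
have k0 : 0 < k.+1%:R :> R by rewrite ltr0n.
pose h := of_real (k.+1%:R^-1) * (w - z).
have nh : nrm h = nrm (w - z) / k.+1%:R.
  by rewrite /h nrmM nrm_real gtr0_norm ?invr_gt0 // mulrC.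
have pS j : p k j.+1 w = p k j w + h.
  by rewrite /p /h -addn1 natrD mulrDl div1r of_realD; ring.
have -> : S k w * (w - z) - (phi w - phi z) =
   - \sum_(0 <= j < k.+1) (phi (p k j.+1 w) - phi (p k j w) - derive1 phi (p k j w) * h).
  rewrite sumrB telescope_sumr // -mulr_suml {1 2}/p mul0r mulfV ?gt_eqF //.
  by rewrite of_real0 of_real1 mul0r mul1r addr0 [z + _]addrC subrK /S /h; ring.
rewrite nrmN; apply: le_trans (nrm_sum _ _ _) _.
apply: (@le_trans _ _ (\sum_(0 <= j < k.+1) (B * nrm h * nrm h))); last first.
  rewrite sumr_const_nat subn0 -[(B * _ * _) *+ _]mulr_natl nh.
  have -> : k.+1%:R * (B * (nrm (w - z) / k.+1%:R) * (nrm (w - z) / k.+1%:R)) =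
     B * nrm (w - z) / k.+1%:R * nrm (w - z) by field; rewrite gt_eqF.
  rewrite ler_wpM2r ?nrm_ge0 // ler_pdivrMr //.
  apply: (@le_trans _ _ (B * d)); first by rewrite ler_wpM2l // ltW.
  by apply: le_trans (ltW HN) _; rewrite ler_pM2l // ler_nat.
rewrite big_nat [X in _ <= X]big_nat; apply: ler_sum => j /andP[_ jk1].
have seg v t' : nrm (v - z) < d -> 0 <= t' <= 1 -> nrm (v + h - z) < d ->
    nrm (v + of_real t' * h - z) < d.
  move=> vd t01 vhd; have := @seg_ball R z (v + h) v d t' t01 vhd vd.
  by rewrite [v + h]addrC addrK.
have pjd : nrm (p k j w - z) < d by apply: le_lt_trans wd; apply: pd; exact: ltnW.
have pjd1 : nrm (p k j w + h - z) < d by rewrite -pS; apply: le_lt_trans wd; exact: pd.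
pose g v := phi v - derive1 phi (p k j w) * v.
rewrite pS; have -> : phi (p k j w + h) - phi (p k j w) - derive1 phi (p k j w) * h =
   g (p k j w + h) - g (p k j w) by rewrite /g; ring.
apply: (mean_value (df := fun v => derive1 phi v - derive1 phi (p k j w))) => t' t01.
have qd := seg _ _ pjd t01 pjd1; set q := p k j w + _ in qd *.
split.
  apply: cderB; last by rewrite -{2}[derive1 phi (p k j w)]mulr1; apply: cderZ; exact: cder_id.
  by apply: an_cder; have [] := Hd q qd.
have hq : nrm (of_real t' * h) <= nrm h.
  by rewrite nrmM nrm_real; case/andP: t01 => t0' t1'; rewrite ger0_norm // ler_piMl ?nrm_ge0.
apply: (@le_trans _ _ (B * nrm (of_real t' * h))); last by rewrite ler_wpM2l.
rewrite /q; apply: (mean_value (df := derive1 (derive1 phi))) => t'' t02.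
have qd' : nrm (p k j w + of_real t'' * (of_real t' * h) - z) < d.
  rewrite mulrA -of_realM; apply: seg => //.
  case/andP: t01 => ? ?; case/andP: t02 => ? ?; apply/andP; split; first exact: mulr_ge0.
  by apply: mulr_ile1.
have [a1 a2 a3] := Hd _ qd'; split=> //; exact: an_cder.
Qed.

(* The residue of phi w / (w - z)^2 at z is phi' z. *)
Definition pole2 f z r := exists phi, [/\ an phi z, derive1 phi z = r &
  exists2 d : R, 0 < d & forall w, nrm (w - z) < d -> w != z -> f w = phi w / (w - z) ^+ 2].

(** Two divided differences split off the Taylor coefficients [phi z] and [phi'(z)], which become
    the coefficients of orders two and one; the second divided difference is the holomorphic
    part. *)
Lemma pole2_residue f z r : pole2 f z r -> is_residue f z r.
Proof.
move=> [phi [Hphi Hr [d d0 Hd]]].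
pose q w := if w == z then derive1 phi z else (phi w - phi z) / (w - z).
have Hq : an q z by exact: an_quotient.
pose g w := if w == z then derive1 q z else (q w - q z) / (w - z).
have Hg : an g z by exact: an_quotient.
exists 1%N, (fun k => if k == 0%N then r else phi z), g; split=> //.
  by have := an_near Hg; apply: filterS => w; move/an_cder/cder_derivable.
rewrite /dnbhs; apply/nbhs_nrmP; exists d => // w wd /= wz; rewrite Hd //.
rewrite big_ord_recl big_ord1 /= expr1 /g (negbTE wz) /q (negbTE wz) eqxx Hr.
by field; rewrite subr_eq0.
Qed.

Lemma cder_sub z w : cder (fun v => v - z) w 1.
Proof. by rewrite -[X in cder _ _ X](subr0 1); apply: cderB; [exact: cder_id|exact: cder_cst]. Qed.

Lemma an_subc z w : an (fun v => v - z) w.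
Proof. by apply: anB; [exact: an_id|exact: an_cst]. Qed.

Lemma pole2_simple f phi z : an phi z ->
  (exists2 d : R, 0 < d & forall w, nrm (w - z) < d -> w != z -> f w = phi w / (w - z)) ->
  pole2 f z (phi z).
Proof.
move=> Hphi [d d0 Hd]; exists (fun w => phi w * (w - z)); split.
- by apply: anM => //; exact: an_subc.
- have := cderM (an_cder Hphi) (cder_sub z z); rewrite subrr mulr0 add0r mulr1.
  by move/cder_derive1.
- exists d => // w wd wz; rewrite Hd //; field; by rewrite subr_eq0.
Qed.

Lemma pole2_an f z : an f z -> pole2 f z 0.
Proof.
move=> Hf; have -> : 0 = (fun w => f w * (w - z)) z by rewrite subrr mulr0.
apply: (pole2_simple (phi := fun w => f w * (w - z))).
  by apply: anM => //; exact: an_subc.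
by exists 1 => // w _ wz; field; rewrite subr_eq0.
Qed.

Lemma pole2_double f phi z : an phi z ->
  (exists2 d : R, 0 < d & forall w, nrm (w - z) < d -> w != z -> f w = phi w / (w - z) ^+ 2) ->
  pole2 f z (derive1 phi z).
Proof. by move=> Hphi H; exists phi. Qed.

Lemma pole2_ext f g z r :
  (exists2 d : R, 0 < d & forall w, nrm (w - z) < d -> w != z -> f w = g w) ->
  pole2 f z r -> pole2 g z r.
Proof.
move=> [d d0 Hd] [phi [H1 H2 [s s0 Hs]]]; exists phi; split=> //.
exists (Num.min d s); first by rewrite lt_min d0.
by move=> w; rewrite lt_min => /andP[wd ws] wz; rewrite -Hd // Hs.
Qed.

Lemma pole2D f g z r s : pole2 f z r -> pole2 g z s -> pole2 (fun w => f w + g w) z (r + s).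
Proof.
move=> [phi [H1 H2 [d d0 Hd]]] [psi [K1 K2 [e e0 He]]].
exists (fun w => phi w + psi w); split.
- exact: anD.
- by apply: cder_derive1; apply: cderD; [rewrite -H2; exact: an_cder|rewrite -K2; exact: an_cder].
- exists (Num.min d e); first by rewrite lt_min d0.
  by move=> w; rewrite lt_min => /andP[wd we] wz; rewrite Hd // He // mulrDl.
Qed.

Lemma pole2Z c f z r : pole2 f z r -> pole2 (fun w => c * f w) z (c * r).
Proof.
move=> [phi [H1 H2 [d d0 Hd]]]; exists (fun w => c * phi w); split.
- by apply: anM => //; exact: an_cst.
- by apply: cder_derive1; apply: cderZ; rewrite -H2; exact: an_cder.
- by exists d => // w wd wz; rewrite Hd // mulrA.
Qed.

Lemma pole2_sum (J : Type) (s : seq J) (P : pred J) (F : J -> C -> C) (r : J -> C) z :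
  (forall j, P j -> pole2 (F j) z (r j)) ->
  pole2 (fun w => \sum_(j <- s | P j) F j w) z (\sum_(j <- s | P j) r j).
Proof.
move=> H; elim: s => [|j s IH].
  rewrite big_nil; apply: pole2_ext (pole2_an (an_cst 0 z)).
  by exists 1 => // w _ _; rewrite big_nil.
rewrite big_cons; case Pj: (P j).
  apply: pole2_ext (pole2D (H j Pj) IH); exists 1 => // w _ _.
  by rewrite big_cons Pj.
by apply: pole2_ext IH; exists 1 => // w _ _; rewrite big_cons Pj.
Qed.

End Germs.

(** * The zeta and Gamma functions *)

Section ComplexPowers.
Context {R : realType}.
Local Notation C := (cplx R).
Implicit Types (s t z w : C).

Lemma rpowD (r : R) s t : rpow r (s + t) = rpow r s * rpow r t.
Proof. by rewrite /rpow mulrDl cexpD. Qed.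

Lemma rpow0 (r : R) : rpow r (0 : C) = 1.
Proof. by rewrite /rpow mul0r cexp0. Qed.

Lemma rpow_neq0 (r : R) s : rpow r s != 0.
Proof. exact: cexp_neq0. Qed.

Lemma rpowN (r : R) s : rpow r (- s) = (rpow r s)^-1.
Proof. by rewrite /rpow mulNr cexpN. Qed.

Lemma rpow_nat1 (s : C) : rpow (1 : R) s = 1.
Proof. by rewrite /rpow ln1 mulr0 cexp0. Qed.

Lemma cReMl z (a : R) : complex.Re (z * of_real a : C) = complex.Re z * a.
Proof. by case: z => b c; rewrite /= mulr0 subr0. Qed.

Lemma nrm_rpow (r : R) s : nrm (rpow r s) = expR (complex.Re s * ln r).
Proof. by rewrite /rpow nrm_cexp cReMl. Qed.

Lemma hol_rpow (I : finType) (U : set (I -> C)) (r : R) F :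
  hol U F -> hol U (fun x => rpow r (F x)).
Proof. by move=> HF; apply: hol_cexp; apply: holM => //; exact: hol_cst. Qed.

Lemma an_rpow (r : R) f z : an f z -> an (fun w => rpow r (f w)) z.
Proof. by move=> Hf; apply: an_cexp; apply: anM => //; exact: an_cst. Qed.

Lemma ln_le_sub1 (x : R) : 0 < x -> ln x <= x - 1.
Proof.
by move=> x0; have := expR_ge1Dx (ln x); rewrite lnK //; lra.
Qed.

Lemma ln_natS_sub (n : nat) : (0 < n)%N ->
  n.+1%:R^-1 <= ln (n.+1%:R : R) - ln n%:R <= n%:R^-1.
Proof.
move=> n0; have np : 0 < n%:R :> R by rewrite ltr0n.
have n1p : 0 < n.+1%:R :> R by rewrite ltr0n.
rewrite -ln_div ?posrE //; apply/andP; split; last first.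
  apply: le_trans (ln_le_sub1 _) _; first by rewrite divr_gt0.
  by rewrite -natr1 mulrDl mulfV ?gt_eqF // addrAC subrr add0r mul1r.
rewrite -lerN2 -lnV ?posrE ?divr_gt0 // invf_div.
apply: le_trans (ln_le_sub1 _) _; first by rewrite divr_gt0.
by rewrite -lerN2 opprK opprB -[X in X - _](mulfV (lt0r_neq0 n1p)) -mulrBl -natrB // subSnn mul1r.
Qed.

(* n^(-1-d) is dominated by the telescoping sequence ((n-1)^(-d) - n^(-d)) / d *)
Lemma summable_pow (d : R) : 0 < d ->
  summable_seq (fun n => expR (- (1 + d) * ln (n%:R : R))).
Proof.
move=> d0; pose p n : R := expR (- d * ln n%:R).
have step n : (0 < n)%N -> d * expR (- (1 + d) * ln (n.+1%:R : R)) <= p n - p n.+1.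
  move=> n0; have /andP[h _] := ln_natS_sub n0.
  have n1p : 0 < n.+1%:R :> R by rewrite ltr0n.
  have -> : p n = p n.+1 * expR (d * (ln n.+1%:R - ln n%:R)).
    by rewrite /p -expRD; congr expR; ring.
  have -> : expR (- (1 + d) * ln (n.+1%:R : R)) = p n.+1 * n.+1%:R^-1.
    have -> : n.+1%:R^-1 = expR (- ln (n.+1%:R : R)) by rewrite expRN lnK ?posrE.
    by rewrite /p -expRD; congr expR; ring.
  rewrite -[X in _ - X]mulr1 -mulrBr mulrCA ler_pM2l ?expR_gt0 //.
  have h1 := expR_ge1Dx (d * (ln n.+1%:R - ln n%:R)).
  have h2 : d * n.+1%:R^-1 <= d * (ln n.+1%:R - ln n%:R) by rewrite ler_pM2l.
  by rewrite lerBrDl; apply: le_trans h1; rewrite lerD2l.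
(* The terms for [n = 0], where [ln 0 = 0] by convention, and for [n = 1] both equal 1; the others
   telescope to at most [d^-1]. *)
exists (2 + d^-1) => N.
suff H M : \sum_(0 <= n < M.+2) expR (- (1 + d) * ln (n%:R : R)) <= 2 + d^-1.
  case: N => [|[|N]]; last exact: H.
    by rewrite big_geq // addr_ge0 // invr_ge0 ltW.
  apply: le_trans (H 0%N); rewrite [X in _ <= X]big_nat_recr //= lerDl; exact: expR_ge0.
rewrite big_nat_recl // big_nat_recl // ln0 // ln1 mulr0 expR0 addrA lerD2l.
have -> : d^-1 = d^-1 * p 1%N by rewrite /p ln1 mulr0 expR0 mulr1.
rewrite -(ler_pM2l d0) mulrA mulfV ?gt_eqF // mul1r mulr_sumr.
apply: (@le_trans _ _ (\sum_(0 <= n < M) (p n.+1 - p n.+2))).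
  by apply: ler_sum => n _; exact: step.
have -> : \sum_(0 <= n < M) (p n.+1 - p n.+2) = p 1%N - p M.+1.
  rewrite -[RHS]opprB -(telescope_sumr (fun n => p n.+1)) // -sumrN.
  by apply: eq_bigr => n _; rewrite opprB.
by rewrite lerBlDr lerDl expR_ge0.
Qed.

Lemma summableZ (c : nat -> R) (k : R) : 0 <= k -> summable_seq c -> summable_seq (fun n => k * c n).
Proof.
by move=> k0 [B HB]; exists (k * B) => N; rewrite -mulr_sumr ler_wpM2l.
Qed.

End ComplexPowers.

Lemma hol_local (R : realType) (I : finType) (U : set (I -> cplx R)) F :
  opn U -> (forall x, U x -> exists2 r : R, 0 < r & hol (box x r) F) -> hol U F.
Proof.
move=> oU H n; elim: n F H => [|n IH] F H.
  split; last exact: Logic.I.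
  by move=> x Ux; have [r r0 Hr] := H x Ux; apply: (Cn_cvg (Hr 0%N)); exact: box_refl.
split; first by move=> x Ux; have [r r0 Hr] := H x Ux; apply: (Cn_cvg (Hr 0%N)); exact: box_refl.
move=> i; exists (pderiv i F); split.
  by move=> x Ux; have [r r0 Hr] := H x Ux; apply: (cder_pderiv i Hr); exact: box_refl.
apply: IH => x Ux; have [r r0 Hr] := H x Ux; exists r => //; apply: hol_pderiv => //; exact: opn_box.
Qed.

(** * The continuation of zeta to Re s > 0 *)

Section Zeta.
Context {R : realType}.
Local Notation C := (cplx R).
Implicit Types (s t z w c y : C).

(* (e^z - 1) / z *)
Definition eps z : C := if z == 0 then 1 else (cexp z - 1) / z.

Lemma an_eps z : an eps z.
Proof.
have ae w : an (@cexp R) w by apply: (an_cexp (an_id w)).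
have [->|z0] := eqVneq z 0.
  apply: an_ext (an_quotient (ae 0)); apply: filterE => w; rewrite /eps cexp0 subr0.
  by case: eqP => // _; rewrite (cder_derive1 (cder_cexp 0)) cexp0.
have : an (fun w => (cexp w - 1) / w) z.
  by apply: anM; [apply: anB; [exact: ae|exact: an_cst]|apply: anV => //; exact: an_id].
apply: an_ext; have := an_neq0 (an_id z) z0; apply: filterS => w w0.
by rewrite /eps (negbTE w0).
Qed.

(* int_0^y e^(c t) dt *)
Definition expint c y : C := y * eps (c * y).

Lemma cder_expint c y : cder (expint c) y (cexp (c * y)).
Proof.
have [->|c0] := eqVneq c 0.
  rewrite mul0r cexp0; apply: cder_ext (cder_id y); apply: filterE => w.
  by rewrite /expint mul0r /eps eqxx mulr1.
have : cder (fun w => c^-1 * (cexp (c * w) - 1)) y (cexp (c * y)).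
  have -> : cexp (c * y) = c^-1 * (cexp (c * y) * (c * 1) - 0).
    by rewrite subr0 mulr1 mulrCA mulVf // mulr1.
  apply: cderZ; apply: cderB; last exact: cder_cst.
  apply: (cder_comp (f := @cexp R)); last exact: cder_cexp.
  by apply: cderZ; exact: cder_id.
apply: cder_ext; apply: filterE => w; rewrite /expint /eps mulf_eq0 (negbTE c0) /=.
case: eqP => [->|/eqP w0]; first by rewrite mulr0 cexp0 subrr mulr0 mul0r.
by field; rewrite w0.
Qed.

Lemma hol_expint (I : finType) (U : set (I -> C)) F y : opn U -> hol U F ->
  hol U (fun x => expint (F x) y).
Proof.
move=> oU HF; apply: holM; first exact: hol_cst.
apply: hol_local => // x Ux.
have [r r0 H] := an_eps (F x * y).
have /cvgnP/(_ r r0)[s s0 Hs] := Cn_cvg ((holM HF (hol_cst U y)) 0%N) Ux.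
have [t t0 Ht] := oU x Ux.
pose m := Num.min s t; exists m; first by rewrite lt_min s0.
apply: (hol_comp (F := fun x : unit -> C => eps (x tt)) (L := fun x _ => F x * y) (opn_disc (z := F x * y) (r := r)) H).
  move=> _; apply: holM; last exact: hol_cst.
  by apply: hol_sub HF => u um; apply: Ht; apply: box_le um; rewrite ge_min lexx orbT.
by move=> u um; apply: Hs; apply: box_le um; rewrite ge_min lexx.
Qed.

(* n^-s - int_(n-1)^n t^-s dt, with n + 1 for n *)
Definition zeta_term (n : nat) s : C :=
  rpow n.+1%:R (- s) - (expint (1 - s) (of_real (ln n.+1%:R)) - expint (1 - s) (of_real (ln n%:R))).

(** The convention [ln 0 = 0] makes the integral over [0, 1] disappear, which is what the start of
    the series at 1 requires. *)
Lemma zeta_term0 s : zeta_term 0 s = 1.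
Proof. by rewrite /zeta_term rpow_nat1 ln1 ln0 // subrr subr0. Qed.

(** In the variable y = ln t the term is minus the increment of [f] between ln n and ln (n + 1). The
    derivative of [f] is e^y (e^(-s y) - (n+1)^(-s)), of modulus at most (n+1) |s| n^(-Re s) / n;
    the interval has length at most 1/n, and (n+1) / n^2 is at most 2/n. *)
Lemma nrm_zeta_term n s : (0 < n)%N -> 0 <= complex.Re s ->
  nrm (zeta_term n s) <= 2 * nrm s * expR (- (1 + complex.Re s) * ln n%:R).
Proof.
move=> n0 s0; set g := complex.Re s in s0 *.
set a : R := ln n.+1%:R; set b : R := ln n%:R.
have np : 0 < n%:R :> R by rewrite ltr0n.
have n1p : 0 < n.+1%:R :> R by rewrite ltr0n.
have /andP[ab1 ab2] := @ln_natS_sub R n n0; rewrite -/a -/b in ab1 ab2.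
have ab0 : 0 <= a - b by apply: le_trans ab1; rewrite invr_ge0 ltW.
have nab : nrm (of_real a - of_real b) = a - b by rewrite -of_realB nrm_real ger0_norm.
have b0 : 0 <= b by rewrite /b ln_ge0 // ler1n.
have seg (t : R) : of_real b + of_real t * (of_real a - of_real b) = of_real (b + t * (a - b)).
  by rewrite of_realD of_realM of_realB.
pose f y := expint (1 - s) y - cexp (- s * of_real a) * cexp y.
pose df y := cexp ((1 - s) * y) - cexp (- s * of_real a) * cexp y.
have -> : zeta_term n s = - (f (of_real b + (of_real a - of_real b)) - f (of_real b)).
  have -> : of_real b + (of_real a - of_real b) = of_real a by ring.
  rewrite /zeta_term -/a -/b /f !cexp_real /a /b !lnK ?posrE // -/a -/b /rpow -/a.
  have -> : of_real (n.+1%:R : R) = of_real n%:R + 1 :> C by rewrite -natr1 of_realD.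
  by ring.
rewrite nrmN.
have K (y : R) : 0 <= y <= 1 -> nrm (cexp (- s * of_real (b + y * (a - b))) - cexp (- s * of_real a)) <=
     nrm s * expR (- g * b) * (a - b).
  move=> /andP[y0 y1]; set q := b + y * (a - b).
  have qb : b <= q by rewrite /q lerDl mulr_ge0.
  have qa : q <= a by rewrite /q -lerBrDl ler_piMl.
  have := @mean_value _ (fun y => cexp (- s * y)) (fun y => - s * cexp (- s * y)) (of_real a)
     (of_real q - of_real a) (nrm s * expR (- g * b)).
  rewrite [of_real a + _]addrC subrK => H; apply: le_trans (H _) _; last first.
    rewrite ler_wpM2l ?mulr_ge0 ?nrm_ge0 ?expR_ge0 // -of_realB nrm_real distrC ger0_norm ?subr_ge0 //.
    by rewrite lerD2l lerN2.
  move=> t /andP[t0 t1]; set v := of_real a + _.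
  have vE : v = of_real (a + t * (q - a)) by rewrite /v of_realD of_realM of_realB.
  have vb : b <= a + t * (q - a).
    have : t * (a - q) <= 1 * (a - q) by rewrite ler_wpM2r ?subr_ge0.
    lra.
  split.
    rewrite [- s * cexp _](_ : _ = cexp (- s * v) * (- s * 1)); last by ring.
    apply: (cder_comp (f := @cexp R)); last exact: cder_cexp.
    by apply: cderZ; exact: cder_id.
  rewrite nrmM nrmN ler_wpM2l ?nrm_ge0 // nrm_cexp vE cReMl ReN -/g ler_expR.
  by rewrite ler_wnM2l // oppr_le0.
apply: (@le_trans _ _ (n.+1%:R * (nrm s * expR (- g * b) * (a - b)) * (a - b))).
  rewrite -[X in _ <= _ * X]nab; apply: (mean_value (df := df)) => t t01.
  have := K t t01; rewrite seg; set q := b + t * (a - b) => Kq; split.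
    apply: cderB; first exact: cder_expint.
    by apply: cderZ; exact: cder_cexp.
  have -> : df (of_real q) = cexp (of_real q) * (cexp (- s * of_real q) - cexp (- s * of_real a)).
    rewrite /df; have -> : (1 - s) * of_real q = of_real q + - s * of_real q by ring.
    by rewrite cexpD; ring.
  rewrite nrmM ler_pM ?nrm_ge0 // nrm_cexp /= -[X in _ <= X]lnK ?posrE // ler_expR -/a.
  case/andP: t01 => t0 t1; rewrite /q -lerBrDl ler_piMl //.
have -> : expR (- (1 + g) * b) = n%:R^-1 * expR (- g * b).
  have -> : n%:R^-1 = expR (- b) by rewrite expRN /b lnK ?posrE.
  by rewrite -expRD; congr expR; ring.
have -> : n.+1%:R * (nrm s * expR (- g * b) * (a - b)) * (a - b) =
   nrm s * expR (- g * b) * (n.+1%:R * ((a - b) * (a - b))) by ring.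
have -> : 2 * nrm s * (n%:R^-1 * expR (- g * b)) = nrm s * expR (- g * b) * (2 * n%:R^-1) by ring.
rewrite ler_wpM2l ?mulr_ge0 ?nrm_ge0 ?expR_ge0 //.
apply: (@le_trans _ _ (n.+1%:R * (n%:R^-1 * n%:R^-1))).
  by rewrite ler_pM2l // ler_pM.
rewrite mulrA ler_pM2r ?invr_gt0 // ler_pdivrMr // -natrM ler_nat mulSn mul1n -addn1 leq_add2l //.
Qed.

(** This is zeta(s) - 1/(s - 1), regular at s = 1 too; see [zetaE]. *)
Definition zeta_holo s : C := lim ((fun N => \sum_(0 <= n < N) zeta_term n s) @ \oo).

Lemma zeta_holo_hol : hol [set x : unit -> C | 0 < complex.Re (x tt)] (fun x => zeta_holo (x tt)) /\
  forall s, 0 < complex.Re s -> (fun N => \sum_(0 <= n < N) zeta_term n s) @ \oo --> zeta_holo s.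
Proof.
have oU : opn [set x : unit -> C | 0 < complex.Re (x tt)].
  move=> x /= x0; exists (complex.Re (x tt)) => // y /(_ tt) h /=.
  have := Re_le_nrm (y tt - x tt); rewrite ReB ler_norml => /andP[h1 _]; lra.
have := @hol_series R unit _ (fun n x => zeta_term n (x tt)) oU => -[||h1 h2].
- move=> n; apply: holB.
    by apply: hol_rpow; apply: holN; exact: hol_proj.
  by apply: holB; apply: hol_expint => //; apply: holB; [exact: hol_cst|exact: hol_proj|exact: hol_cst|exact: hol_proj].
- move=> x /= x0; set g := complex.Re (x tt) / 2.
  have g0 : 0 < g by rewrite divr_gt0.
  (* The maximum with 1 takes care of the term of index 0. *)
  pose K := Num.max 1 (2 * (nrm (x tt) + g)).
  have K0 : 0 <= K by rewrite le_max ler01.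
  exists g => //; exists (fun n => K * expR (- (1 + g) * ln n%:R)).
    by apply: summableZ => //; exact: summable_pow.
  move=> y /(_ tt) yb [|n].
    by rewrite zeta_term0 nrm1 ln0 // mulr0 expR0 mulr1 le_max lexx.
  have := Re_le_nrm (y tt - x tt); rewrite ReB ler_norml => /andP[h1 _].
  have yg : g <= complex.Re (y tt) by rewrite /g in yb *; lra.
  apply: le_trans (nrm_zeta_term _ _) _ => //; first exact: le_trans (ltW g0) yg.
  apply: ler_pM; rewrite ?mulr_ge0 ?nrm_ge0 ?expR_ge0 //.
    rewrite le_max; apply/orP; right; rewrite ler_pM2l //.
    have := nrm_lb (y tt) (x tt); lra.
  rewrite ler_expR ler_wpM2r // ?ln_ge0 ?ler1n //; lra.
by split=> // s s0; exact: (h2 (fun=> s) s0).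
Qed.

Lemma an_zeta_holo s : 0 < complex.Re s -> an zeta_holo s.
Proof.
move=> s0; exists (complex.Re s) => //; apply: hol_sub (zeta_holo_hol.1) => x; rewrite /disc /=.
have := Re_le_nrm (x tt - s); rewrite ReB ler_norml => /andP[h1 _] h; lra.
Qed.

Lemma zetaE s : 0 < complex.Re s -> s != 1 -> zeta s = (s - 1)^-1 + zeta_holo s.
Proof.
move=> s0 s1; apply: cvg_lim => //.
have s10 : 1 - s != 0 by rewrite subr_eq0 eq_sym.
have E N : \sum_(1 <= n < N.+1) rpow n%:R (- s) - rpow (N%:R : R) (1 - s) / (1 - s) =
    (s - 1)^-1 + \sum_(0 <= n < N) zeta_term n s.
  rewrite big_add1 /= sumrB telescope_sumr // [ln 0%:R]ln0 // [expint _ (of_real 0)]/expint mul0r subr0.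
  have -> : expint (1 - s) (of_real (ln (N%:R : R))) = (rpow (N%:R : R) (1 - s) - 1) / (1 - s).
    rewrite /expint /eps mulf_eq0 (negbTE s10) /= /rpow.
    by case: eqP => [->|/eqP l0]; [rewrite mulr0 cexp0 subrr !mul0r|field; rewrite s10].
  by field; rewrite s10 subr_eq0.
have -> : (fun N => \sum_(1 <= n < N.+1) rpow (n%:R : R) (- s) - rpow (N%:R : R) (1 - s) / (1 - s)) =
   (fun N => (s - 1)^-1 + \sum_(0 <= n < N) zeta_term n s) by apply/funext => N; rewrite E.
by apply: ccvgD; [exact: ccvg_cst|exact: (zeta_holo_hol.2 s s0)].
Qed.

(* w * zeta (1 + w), continued to w = 0 *)
Definition zeta_res w : C := 1 + w * zeta_holo (1 + w).

Lemma zeta_res0 : zeta_res 0 = 1.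
Proof. by rewrite /zeta_res mul0r addr0. Qed.

Lemma an_zeta_res w : -1 < complex.Re w -> an zeta_res w.
Proof.
move=> w1; apply: anD; first exact: an_cst.
apply: anM; first exact: an_id.
apply: (an_comp (phi := zeta_holo)); first by apply: anD; [exact: an_cst|exact: an_id].
by apply: an_zeta_holo; rewrite ReD /=; lra.
Qed.

Lemma zeta1E w : -1 < complex.Re w -> w != 0 -> zeta (1 + w) = zeta_res w / w.
Proof.
move=> w1 w0; rewrite zetaE; last by rewrite -subr_eq0 [1 + w]addrC addrK.
  by rewrite [1 + w]addrC addrK /zeta_res [w + 1]addrC; field.
by rewrite ReD /=; lra.
Qed.

Lemma an_zeta w : -1 < complex.Re w -> w != 0 -> an (fun v => zeta (1 + v)) w.
Proof.
move=> w1 w0; have : an (fun v => zeta_res v / v) w.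
  by apply: anM; [exact: an_zeta_res|apply: anV => //; exact: an_id].
apply: an_ext; have /cvgnP/(_ (complex.Re w + 1)) := an_cvg (an_id w).
move=> h; apply: filterS2 (h _) (an_neq0 (an_id w) w0) => [v vw v0|]; last by lra.
rewrite zeta1E //; have := Re_le_nrm (v - w); rewrite ReB ler_norml => /andP[h1 _]; lra.
Qed.

End Zeta.

(** * Gamma on Re z > 0 as a non-vanishing infinite product *)

Section Gamma.
Context {R : realType}.
Local Notation C := (cplx R).
Implicit Types (s t z w u : C).

Lemma nrm_cexp_sub1 u : nrm (cexp u - 1) <= expR (nrm u) * nrm u.
Proof.
have := @mean_value _ (@cexp R) (@cexp R) 0 u (expR (nrm u)); rewrite add0r cexp0; apply=> t t01.
split; first exact: cder_cexp.
rewrite nrm_cexp ler_expR add0r cReMr; case/andP: t01 => t0 t1.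
apply: le_trans (ler_norm _) _; rewrite normrM ger0_norm //.
by apply: le_trans (Re_le_nrm u); rewrite ler_piMl.
Qed.

Lemma nrm_cexp_sub2 u : nrm (cexp u - 1 - u) <= expR (nrm u) * nrm u * nrm u.
Proof.
have := @mean_value _ (fun w => cexp w - w) (fun w => cexp w - 1) 0 u (expR (nrm u) * nrm u).
rewrite add0r cexp0 subr0 => H; rewrite addrAC; apply: H => t /andP[t0 t1]; rewrite add0r.
split; first by apply: cderB; [exact: cder_cexp|exact: cder_id].
apply: le_trans (nrm_cexp_sub1 _) _.
have h : nrm (of_real t * u) <= nrm u by rewrite nrmM nrm_real ger0_norm // ler_piMl ?nrm_ge0.
by apply: ler_pM; rewrite ?expR_ge0 ?nrm_ge0 // ler_expR.
Qed.

Lemma summable_seqS (c : nat -> R) : 0 <= c 0%N -> summable_seq c -> summable_seq (fun n => c n.+1).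
Proof.
move=> c0 [B HB]; exists B => N; apply: le_trans (HB N.+1).
by rewrite [X in _ <= X]big_nat_recl //= lerDr.
Qed.

(* (1 + 1/k)^z / (1 + z/k) with k = n + 1 *)
Definition gamma_fac (n : nat) z : C :=
  cexp (z * of_real (ln n.+2%:R - ln n.+1%:R)) * (1 + z / n.+1%:R)^-1.

Lemma gamma_den_ge1 n z : 0 <= complex.Re z -> 1 <= nrm (1 + z / n.+1%:R).
Proof.
move=> z0; apply: le_trans (Re_le_nrm _); rewrite ReD.
have -> : z / n.+1%:R = of_real n.+1%:R^-1 * z by rewrite mulrC of_realV of_real_nat.
rewrite cReMr /= ger0_norm ?lerDl ?addr_ge0 ?mulr_ge0 ?invr_ge0 ?ler0n //.
Qed.

(** With k = n + 1 and l = ln (k + 1) - ln k, the difference is the second-order remainder of the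
    exponential at z l, plus z (l - 1/k). Both are of order k^(-2), because l lies between 1/(k + 1)
    and 1/k. *)
Lemma gamma_num_bound n z (M : R) : nrm z <= M ->
  nrm (cexp (z * of_real (ln n.+2%:R - ln n.+1%:R)) - (1 + z / n.+1%:R)) <=
  (expR M * M * M + M) * expR (- (1 + 1) * ln n.+1%:R).
Proof.
move=> zM; have M0 : 0 <= M := le_trans (nrm_ge0 z) zM.
have /andP[l1 l2] := @ln_natS_sub R n.+1 (ltn0Sn n).
set l := ln _ - ln _ in l1 l2 *; set k : R := n.+1%:R in l2 *.
have k0 : 0 < k by rewrite ltr0n.
have l0 : 0 <= l by apply: le_trans l1; rewrite invr_ge0 ler0n.
have k1 : k^-1 <= 1 by rewrite invf_le1 // /k ler1n.
have -> : expR (- (1 + 1) * ln k) = k^-1 * k^-1.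
  have -> : k^-1 = expR (- ln k) by rewrite expRN lnK ?posrE.
  by rewrite -expRD; congr expR; ring.
have nzl : nrm (z * of_real l) <= M * k^-1.
  by rewrite nrmM nrm_real ger0_norm // ler_pM ?nrm_ge0.
have nzl1 : nrm (z * of_real l) <= M by apply: le_trans nzl _; rewrite ler_piMr.
have -> : cexp (z * of_real l) - (1 + z / n.+1%:R) =
   (cexp (z * of_real l) - 1 - z * of_real l) + z * of_real (l - k^-1).
  by rewrite (of_realB l) of_realV of_real_nat; ring.
apply: le_trans (nrmD _ _) _; rewrite mulrDl; apply: lerD.
  apply: le_trans (nrm_cexp_sub2 _) _.
  have -> : expR M * M * M * (k^-1 * k^-1) = expR M * (M * k^-1) * (M * k^-1) by ring.
  do 2 (apply: ler_pM; rewrite ?mulr_ge0 ?expR_ge0 ?nrm_ge0 ?ler_expR //).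
rewrite nrmM nrm_real ler_pM ?nrm_ge0 // distrC ger0_norm ?subr_ge0 //.
have k2 : 0 < k + 1 by rewrite addr_gt0.
apply: (@le_trans _ _ (k^-1 - (k + 1)^-1)).
  by rewrite lerD2l lerN2 /k natr1.
have -> : k^-1 - (k + 1)^-1 = k^-1 * (k + 1)^-1 by field; rewrite !gt_eqF.
by rewrite ler_pM2l ?invr_gt0 // lef_pV2 ?posrE // lerDl.
Qed.

(** For Re z >= 0 the exponential and the denominator both have modulus at least 1, so dividing by
    either one preserves the bound on their difference. The inverse factors are included for the
    sake of [gamma_prod_neq0]. *)
Lemma gamma_fac_bound n z (M : R) : 0 <= complex.Re z -> nrm z <= M ->
  nrm (gamma_fac n z - 1) <= (expR M * M * M + M) * expR (- (1 + 1) * ln n.+1%:R) /\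
  nrm ((gamma_fac n z)^-1 - 1) <= (expR M * M * M + M) * expR (- (1 + 1) * ln n.+1%:R).
Proof.
move=> z0 zM; have h1 := gamma_num_bound n zM; have h2 := gamma_den_ge1 n z0.
have d0 : 1 + z / n.+1%:R != 0 by rewrite -nrm_gt0; apply: lt_le_trans h2.
rewrite /gamma_fac; set E := cexp _ in h1 *; set D := 1 + _ in h1 h2 d0 *.
have E0 : E != 0 by exact: cexp_neq0.
split.
  have -> : E * D^-1 - 1 = (E - D) * D^-1 by field.
  rewrite nrmM nrmV; apply: le_trans h1; rewrite ler_piMr ?nrm_ge0 // invf_le1 //.
  exact: lt_le_trans h2.
have -> : (E * D^-1)^-1 - 1 = - (E - D) * E^-1 by field; rewrite E0 d0.
rewrite nrmM nrmN nrmV; apply: le_trans h1; rewrite ler_piMr ?nrm_ge0 // -nrmV -cexpN nrm_cexp.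
rewrite -[X in _ <= X]expR0 ler_expR ReN cReMl oppr_le0 mulr_ge0 //.
have /andP[l1 _] := @ln_natS_sub R n.+1 (ltn0Sn n).
by apply: le_trans l1; rewrite invr_ge0 ler0n.
Qed.

Definition gamma_prod z : C := lim ((fun N => \prod_(0 <= n < N) gamma_fac n z) @ \oo).

Local Notation halfplane := [set x : unit -> C | 0 < complex.Re (x tt)].

Lemma opn_halfplane : opn halfplane.
Proof.
move=> x /= x0; exists (complex.Re (x tt)) => // y /(_ tt) h /=.
have := Re_le_nrm (y tt - x tt); rewrite ReB ler_norml => /andP[h1 _]; lra.
Qed.

Lemma hol_gamma_fac n : hol halfplane (fun x => gamma_fac n (x tt)).
Proof.
apply: holM.
  by apply: hol_cexp; apply: holM; [exact: hol_proj|exact: hol_cst].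
apply: holV.
  by move=> x /= /ltW x0; rewrite -nrm_gt0; apply: lt_le_trans (gamma_den_ge1 n x0).
by apply: holD; [exact: hol_cst|apply: holM; [exact: hol_proj|exact: hol_cst]].
Qed.

Lemma gamma_fac_neq0 n z : 0 < complex.Re z -> gamma_fac n z != 0.
Proof.
move=> /ltW z0; rewrite mulf_neq0 ?cexp_neq0 // invr_eq0 -nrm_gt0.
exact: lt_le_trans (gamma_den_ge1 n z0).
Qed.

Lemma gamma_locbound (x : unit -> C) : halfplane x -> exists2 r : R, 0 < r & exists2 c : nat -> R,
   summable_seq c & forall y, box x r y -> forall n,
   nrm (gamma_fac n (y tt) - 1) <= c n /\ nrm ((gamma_fac n (y tt))^-1 - 1) <= c n.
Proof.
move=> /= x0; set r := complex.Re (x tt) in x0 *.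
pose M := nrm (x tt) + r.
exists r => //; exists (fun n => (expR M * M * M + M) * expR (- (1 + 1) * ln n.+1%:R)).
  have M0 : 0 <= M by rewrite addr_ge0 ?nrm_ge0 // ltW.
  apply: summableZ; first by rewrite addr_ge0 // !mulr_ge0 // expR_ge0.
  apply: (summable_seqS (c := fun n => expR (- (1 + 1) * ln n%:R))); first exact: expR_ge0.
  exact: summable_pow.
move=> y /(_ tt) yb n; apply: gamma_fac_bound.
  have := Re_le_nrm (y tt - x tt); rewrite ReB ler_norml => /andP[h1 _]; rewrite /r in yb; lra.
by rewrite /M -lerBlDl; apply: le_trans (nrm_lb _ _) (ltW yb).
Qed.

Lemma gamma_prod_hol : hol halfplane (fun x => gamma_prod (x tt)) /\
  forall z, 0 < complex.Re z -> (fun N => \prod_(0 <= n < N) gamma_fac n z) @ \oo --> gamma_prod z.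
Proof.
have := @hol_infprod R unit halfplane (fun n x => gamma_fac n (x tt)) opn_halfplane hol_gamma_fac.
case.
  move=> x Ux; have [r r0 [c sc H]] := gamma_locbound Ux; exists r => //; exists c => // y yb n.
  by have [] := H y yb n.
by move=> h1 h2; split=> // z z0; exact: (h2 (fun=> z) z0).
Qed.

(** The product of the inverse factors converges too, and the two limits multiply to 1. *)
Lemma gamma_prod_neq0 z : 0 < complex.Re z -> gamma_prod z != 0.
Proof.
move=> z0.
have := @hol_infprod R unit halfplane (fun n x => (gamma_fac n (x tt))^-1) opn_halfplane.
case.
- move=> n; apply: holV; last exact: hol_gamma_fac.
  by move=> x; exact: gamma_fac_neq0.
- move=> x Ux; have [r r0 [c sc H]] := gamma_locbound Ux; exists r => //; exists c => // y yb n.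
  by have [] := H y yb n.
move=> _ /(_ (fun=> z) z0) h2; have h1 := gamma_prod_hol.2 z z0.
set Q := lim _ in h2; pose l := gamma_prod z * Q.
have : (fun N => \prod_(0 <= n < N) gamma_fac n z * \prod_(0 <= n < N) (gamma_fac n z)^-1) @ \oo --> l.
  by apply: ccvgM; [exact: h1|exact: h2].
have -> : (fun N => \prod_(0 <= n < N) gamma_fac n z * \prod_(0 <= n < N) (gamma_fac n z)^-1) = (fun=> 1).
  apply/funext => N; rewrite -big_split /= big1 // => n _; rewrite mulfV // gamma_fac_neq0 //.
move=> h; apply/eqP => P0.
have E1 : lim ((fun _ : nat => 1 : C) @ \oo) = l by exact: cvg_lim h.
have E2 : lim ((fun _ : nat => 1 : C) @ \oo) = 1.
  exact: (cvg_lim (@norm_hausdorff _ _) (@ccvg_cst R nat \oo _ 1)).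
by move/eqP: E1; rewrite E2 /l P0 mul0r oner_eq0.
Qed.

Lemma cGammaE z : 0 < complex.Re z -> cGamma z = z^-1 * gamma_prod z.
Proof.
move=> z0; apply: cvg_lim => //.
have zk k : z + k%:R != 0.
  rewrite -nrm_gt0; apply: lt_le_trans (Re_le_nrm _); rewrite ReD -of_real_nat /=.
  by rewrite gtr0_norm ltr_wpDr ?ler0n.
have zn0 : z != 0 by have := zk 0%N; rewrite addr0.
(* The factors up to index N - 1 telescope to (N + 1)^z rather than N^z; the correcting exponential
   tends to 1 by [lim1]. *)
have E N : (0 < N)%N -> N`!%:R * rpow (N%:R : R) z / \prod_(0 <= k < N.+1) (z + k%:R) =
   z^-1 * (\prod_(0 <= n < N) gamma_fac n z * cexp (z * of_real (ln N%:R - ln N.+1%:R))).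
  move=> N0; have -> : rpow (N%:R : R) z = rpow (N.+1%:R : R) z * cexp (z * of_real (ln N%:R - ln N.+1%:R)).
    by rewrite /rpow -cexpD -mulrDr -of_realD addrC subrK.
  have -> : N`!%:R * (rpow N.+1%:R z * cexp (z * of_real (ln N%:R - ln N.+1%:R))) / \prod_(0 <= k < N.+1) (z + k%:R) =
    N`!%:R * rpow N.+1%:R z / \prod_(0 <= k < N.+1) (z + k%:R) * cexp (z * of_real (ln N%:R - ln N.+1%:R)) by ring.
  suff -> : N`!%:R * rpow (N.+1%:R : R) z / \prod_(0 <= k < N.+1) (z + k%:R) =
      z^-1 * \prod_(0 <= n < N) gamma_fac n z by rewrite -[LHS]mulrA.
  elim: N {N0} => [|N IH].
    by rewrite big_nat1 fact0 rpow_nat1 mulr1 div1r big_geq // mulr1 addr0.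
  rewrite [in LHS]big_nat_recr //= invfM factS natrM [X in _ = _ * X]big_nat_recr //= [RHS]mulrA -IH.
  have -> : rpow (N.+2%:R : R) z = rpow (N.+1%:R : R) z * cexp (z * of_real (ln N.+2%:R - ln N.+1%:R)).
    by rewrite /rpow -cexpD -mulrDr -of_realD addrC subrK.
  have P0 : \prod_(0 <= i < N.+1) (z + i%:R) != 0 by rewrite prodf_seq_neq0; apply/allP => i _; rewrite zk.
  rewrite /gamma_fac; field.
  by rewrite nat1r pnatr_eq0 [_ + z]addrC zk P0.
have lim1 : (fun N => cexp (z * of_real (ln (N%:R : R) - ln N.+1%:R))) @ \oo --> (1 : C).
  rewrite -cexp0; apply: (@cvg_comp _ _ _ (fun N : nat => z * of_real (ln (N%:R : R) - ln N.+1%:R)) (@cexp R) _ (nbC 0)); last first.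
    exact: (cder_cvg (cder_cexp 0)).
  apply/cvgnP => e e0; exists (Num.bound (nrm z / e)).+1 => // N /= NN; rewrite subr0 nrmM nrm_real.
  have N0 : (0 < N)%N by apply: leq_trans NN.
  have /andP[l1 l2] := @ln_natS_sub R N N0.
  have Np : 0 < N%:R :> R by rewrite ltr0n.
  rewrite distrC ger0_norm; last by apply: le_trans l1; rewrite invr_ge0 ler0n.
  apply: (@le_lt_trans _ _ (nrm z * N%:R^-1)); first by rewrite ler_wpM2l ?nrm_ge0.
  rewrite ltr_pdivrMr // mulrC -ltr_pdivrMr //.
  apply: lt_le_trans (archi_boundP _) _; first by rewrite divr_ge0 ?nrm_ge0 // ltW.
  by rewrite ler_nat ltnW.
have h : (fun N => z^-1 * (\prod_(0 <= n < N) gamma_fac n z * cexp (z * of_real (ln N%:R - ln N.+1%:R)))) @ \oo -->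
    z^-1 * (gamma_prod z * 1).
  by apply: ccvgM; [exact: ccvg_cst|apply: ccvgM; [exact: gamma_prod_hol.2|exact: lim1]].
rewrite mulr1 in h; apply: cvg_trans h; apply: near_eq_cvg; exists 1%N => // N /= N0; by rewrite E.
Qed.

Lemma cGamma_neq0 z : 0 < complex.Re z -> cGamma z != 0.
Proof.
move=> z0; rewrite cGammaE // mulf_neq0 ?gamma_prod_neq0 // invr_eq0.
by apply: contraTneq z0 => ->; rewrite ltxx.
Qed.

Lemma an_cGamma z : 0 < complex.Re z -> an (@cGamma R) z.
Proof.
move=> z0; have zn0 : z != 0 by apply: contraTneq z0 => ->; rewrite ltxx.
have H : an (fun w => w^-1 * gamma_prod w) z.
  apply: anM; first by apply: anV => //; exact: an_id.
  exists (complex.Re z) => //; apply: hol_sub (gamma_prod_hol.1) => x; rewrite /disc /=.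
  have := Re_le_nrm (x tt - z); rewrite ReB ler_norml => /andP[h1 _] h; lra.
apply: an_ext H; apply/nbC_P; exists (complex.Re z) => // w wz; rewrite cGammaE //.
have := Re_le_nrm (w - z); rewrite ReB ler_norml => /andP[h1 _]; lra.
Qed.

End Gamma.

(** A new index [c] adds each pair of [c] with an old index once, on one side or the other of the
    ordering; symmetry of [K] makes the side irrelevant. The monoid is arbitrary because both sums
    and products over pairs occur. *)
Lemma big_pairs_setU1 (V : Type) (idx : V) (op : Monoid.com_law idx) (T : finType)
    (c : T) (I : {set T}) (K : T -> T -> V) : c \notin I -> (forall i j, K i j = K j i) ->
  \big[op/idx]_(i in (c |: I)%SET) \big[op/idx]_(j in (c |: I)%SET | (enum_rank i < enum_rank j)%N) K i j =
  op (\big[op/idx]_(i in I) \big[op/idx]_(j in I | (enum_rank i < enum_rank j)%N) K i j)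
     (\big[op/idx]_(j in I) K c j).
Proof.
move=> cI Ksym; rewrite big_setU1 //=.
have H i : \big[op/idx]_(j in (c |: I)%SET | (enum_rank i < enum_rank j)%N) K i j =
    op (if (enum_rank i < enum_rank c)%N then K i c else idx)
       (\big[op/idx]_(j in I | (enum_rank i < enum_rank j)%N) K i j).
  by rewrite [LHS]big_mkcondr big_setU1 //= -big_mkcondr.
rewrite H ltnn Monoid.mul1m (eq_bigr _ (fun i _ => H i)) big_split /= Monoid.mulmA Monoid.mulmC.
congr (op _ _).
rewrite [RHS](bigID (fun j => (enum_rank c < enum_rank j)%N)) /=; congr (op _ _).
rewrite -big_mkcondr; apply: eq_big => [j|j _]; last exact: Ksym.
case jI: (j \in I) => //=; have cj : c != j by apply: contraNneq cI => ->.
by case: ltngtP => // /val_inj/enum_rank_inj e; rewrite e eqxx in cj.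
Qed.

(** * The Euler product A_DL *)

Section BigO.
Context {R : realType} {Om : Type} (y : Om -> R) (y0 : R).
Hypotheses (y_ge0 : forall o, 0 <= y o) (y_le : forall o, y o <= y0) (y0_lt1 : y0 < 1).
Local Notation C := (cplx R).
Implicit Types (f g h F G : Om -> C).

(** A parameter in [Om] will be a prime together with a point of a box: a single constant for all of
    them is what the majorant of an infinite product needs. *)
Definition bigO k f := exists c : R, forall o, nrm (f o) <= c * y o ^+ k.

Lemma y_le1 o : y o <= 1.
Proof. exact: le_trans (y_le o) (ltW y0_lt1). Qed.

Lemma bigO_pos k f : bigO k f -> exists2 c : R, 0 <= c & forall o, nrm (f o) <= c * y o ^+ k.
Proof.
move=> [c H]; exists (Num.max c 0); first by rewrite le_max lexx orbT.
move=> o; apply: le_trans (H o) _; rewrite ler_wpM2r ?exprn_ge0 // le_max lexx //.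
Qed.

Lemma bigO_ext k f g : f =1 g -> bigO k f -> bigO k g.
Proof. by move=> fg [c H]; exists c => o; rewrite -fg. Qed.

Lemma bigOD k f g : bigO k f -> bigO k g -> bigO k (fun o => f o + g o).
Proof.
move=> [c H] [d K]; exists (c + d) => o; rewrite mulrDl.
by apply: le_trans (nrmD _ _) _; rewrite lerD.
Qed.

Lemma bigON k f : bigO k f -> bigO k (fun o => - f o).
Proof. by move=> [c H]; exists c => o; rewrite nrmN. Qed.

Lemma bigOB k f g : bigO k f -> bigO k g -> bigO k (fun o => f o - g o).
Proof. by move=> H K; apply: bigOD => //; exact: bigON. Qed.

Lemma bigOM k l f g : bigO k f -> bigO l g -> bigO (k + l) (fun o => f o * g o).
Proof.
move=> [c H] [d K]; exists (c * d) => o; rewrite nrmM exprD mulrACA.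
by apply: ler_pM; rewrite ?nrm_ge0.
Qed.

Lemma bigO_cst c : bigO 0 (fun _ : Om => c).
Proof. by exists (nrm c) => o; rewrite expr0 mulr1. Qed.

Lemma bigOZ k c f : bigO k f -> bigO k (fun o => c * f o).
Proof. exact: (bigOM (bigO_cst c)). Qed.

Lemma bigOW k l f : (l <= k)%N -> bigO k f -> bigO l f.
Proof.
move=> lk /bigO_pos[c c0 H]; exists c => o; apply: le_trans (H o) _.
by rewrite ler_wpM2l // ler_wiXn2l // y_le1.
Qed.

Lemma bigO0 k : bigO k (fun _ : Om => 0).
Proof. by exists 0 => o; rewrite nrm0 mul0r. Qed.

Lemma bigO_inv1B f : (forall o, nrm (f o) <= y o) -> bigO 0 (fun o => (1 - f o)^-1).
Proof.
move=> fy; exists (1 - y0)^-1 => o; rewrite expr0 mulr1 nrmV.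
have h : 1 - y0 <= nrm (1 - f o).
  apply: le_trans (nrm_lb _ _); rewrite nrm1 lerD2l lerN2.
  exact: le_trans (fy o) (y_le o).
by rewrite lef_pV2 // posrE ?subr_gt0 //; apply: lt_le_trans h; rewrite subr_gt0.
Qed.

(* F = 1 + e + O(y^4) *)
Definition quad F e := bigO 2 e /\ bigO 4 (fun o => F o - (1 + e o)).

Lemma quad_bounded F e : quad F e -> bigO 0 F.
Proof.
move=> [h1 h2]; apply: bigO_ext (bigOD (bigOW (l := 0) _ h2) (bigOD (bigO_cst 1) (bigOW (l := 0) _ h1))) => // o.
by ring.
Qed.

(** The corrections have order 2, so their product is already of order 4, and the expansions add. *)
Lemma quadM F G e h : quad F e -> quad G h -> quad (fun o => F o * G o) (fun o => e o + h o).
Proof.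
move=> HF HG; have FO := quad_bounded HF; move: HF HG => [e2 F4] [h2 G4]; split; first exact: bigOD.
have k1 := bigOM FO G4; have k2 := bigOM F4 (bigOD (bigO_cst 1) (bigOW (l := 0) isT h2)).
have k3 := bigOM e2 h2.
by apply: bigO_ext (bigOD (bigOD k1 k2) k3) => o; ring.
Qed.

Lemma quad1 : quad (fun=> 1) (fun=> 0).
Proof. by split; [exact: bigO0|apply: bigO_ext (bigO0 4) => o; ring]. Qed.

Lemma quad_ext F G e h : F =1 G -> e =1 h -> quad F e -> quad G h.
Proof.
move=> FG eh [h1 h2]; split; first exact: bigO_ext h1.
by apply: bigO_ext h2 => o; rewrite FG eh.
Qed.

Lemma quad_prod (J : Type) (s : seq J) (P : pred J) (F e : J -> Om -> C) :
  (forall j, P j -> quad (F j) (e j)) ->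
  quad (fun o => \prod_(j <- s | P j) F j o) (fun o => \sum_(j <- s | P j) e j o).
Proof.
move=> H; elim: s => [|j s IH].
  by apply: quad_ext quad1 => o; rewrite big_nil.
case Pj: (P j); last by apply: quad_ext IH => o; rewrite big_cons Pj.
by apply: quad_ext (quadM (H j Pj) IH) => o; rewrite big_cons Pj.
Qed.

Lemma quad_1B f g : bigO 1 f -> bigO 1 g -> quad (fun o => 1 - f o * g o) (fun o => - (f o * g o)).
Proof.
move=> f1 g1; split; first by apply: bigON; exact: (bigOM f1 g1).
by apply: bigO_ext (bigO0 4) => o; ring.
Qed.

Lemma quad_inv f g : (forall o, nrm (f o) <= y o) -> (forall o, nrm (g o) <= y o) ->
  quad (fun o => (1 - f o * g o)^-1) (fun o => f o * g o).
Proof.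
move=> fy gy.
have f1 : bigO 1 f by exists 1 => o; rewrite mul1r expr1.
have g1 : bigO 1 g by exists 1 => o; rewrite mul1r expr1.
have fgy o : nrm (f o * g o) <= y o.
  rewrite nrmM -[X in _ <= X]mulr1; apply: ler_pM; rewrite ?nrm_ge0 //.
  exact: le_trans (gy o) (y_le1 o).
have fg2 := bigOM f1 g1.
have inv0 := bigO_inv1B fgy.
split=> //; apply: bigO_ext (bigOM (bigOM fg2 fg2) inv0) => o.
have d0 : 1 - f o * g o != 0.
  rewrite subr_eq0; apply: contraTneq (fgy o) => <-.
  by rewrite nrm1 -ltNge; exact: le_lt_trans (y_le o) y0_lt1.
by field.
Qed.

(* Fp and Fm are the values at 1 and -1 of a function of a sign with the
   expansion 1 + c1 + c2 + c3 + O(y^4), 2 c2 = c1^2 + p2: in this form c1 and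
   p2 are additive. *)
Definition jet Fp Fm c1 p2 := [/\ bigO 1 c1, bigO 2 p2 & exists c3, [/\ bigO 3 c3,
  bigO 4 (fun o => Fp o - (1 + c1 o + (c1 o ^+ 2 + p2 o) / 2 + c3 o)) &
  bigO 4 (fun o => Fm o - (1 - c1 o + (c1 o ^+ 2 + p2 o) / 2 - c3 o))]].

Lemma jet_ext Fp Fm c p Gp Gm d q : Fp =1 Gp -> Fm =1 Gm -> c =1 d -> p =1 q ->
  jet Fp Fm c p -> jet Gp Gm d q.
Proof.
by move=> /funext-> /funext-> /funext-> /funext->.
Qed.

Lemma bigO_c2 c p : bigO 1 c -> bigO 2 p -> bigO 2 (fun o => (c o ^+ 2 + p o) / 2).
Proof.
move=> h1 h2; have := bigOZ 2^-1 (bigOD (bigOM h1 h1) h2).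
by apply: bigO_ext => o; ring.
Qed.

Lemma jetM Fp Fm c p Gp Gm d q : jet Fp Fm c p -> jet Gp Gm d q ->
  jet (fun o => Fp o * Gp o) (fun o => Fm o * Gm o) (fun o => c o + d o) (fun o => p o + q o).
Proof.
move=> [c1 p2 [c3 [hc3 hp hm]]] [d1 q2 [d3 [hd3 kp km]]].
have c2 := bigO_c2 c1 p2; have d2 := bigO_c2 d1 q2.
pose C2 o := (c o ^+ 2 + p o) / 2; pose D2 o := (d o ^+ 2 + q o) / 2.
split; [exact: bigOD|exact: bigOD|].
exists (fun o => c3 o + d3 o + c o * D2 o + C2 o * d o); split.
- by apply: bigOD; [apply: bigOD; [exact: bigOD|exact: (bigOM c1 d2)]|exact: (bigOM c2 d1)].
- have Fb : bigO 0 Fp.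
    apply: bigO_ext (bigOD (bigOW (l := 0) isT hp) (bigOD (bigOD (bigOD (bigO_cst 1)
      (bigOW (l := 0) isT c1)) (bigOW (l := 0) isT c2)) (bigOW (l := 0) isT hc3))) => o; ring.
  have Gb := bigOD (bigOD (bigOD (bigO_cst 1) (bigOW (l := 0) isT d1)) (bigOW (l := 0) isT d2))
    (bigOW (l := 0) isT hd3).
  have k1 := bigOM Fb kp; have k2 := bigOM hp Gb.
  have k3 := bigOD (bigOD (bigOM c1 hd3) (bigOM c2 d2)) (bigOM hc3 d1).
  have k4 := bigOW (l := 4) (k := 5) isT (bigOD (bigOM c2 hd3) (bigOM hc3 d2)).
  have k5 := bigOW (l := 4) (k := 6) isT (bigOM hc3 hd3).
  apply: bigO_ext (bigOD (bigOD k1 k2) (bigOD (bigOD k3 k4) k5)) => o; by rewrite /C2 /D2; field.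
- have Fb : bigO 0 Fm.
    apply: bigO_ext (bigOD (bigOW (l := 0) isT hm) (bigOB (bigOD (bigOB (bigO_cst 1)
      (bigOW (l := 0) isT c1)) (bigOW (l := 0) isT c2)) (bigOW (l := 0) isT hc3))) => o; ring.
  have Gb := bigOB (bigOD (bigOB (bigO_cst 1) (bigOW (l := 0) isT d1)) (bigOW (l := 0) isT d2))
    (bigOW (l := 0) isT hd3).
  have k1 := bigOM Fb km; have k2 := bigOM hm Gb.
  have k3 := bigOD (bigOD (bigOM c1 hd3) (bigOM c2 d2)) (bigOM hc3 d1).
  have k4 := bigOW (l := 4) (k := 5) isT (bigOD (bigOM c2 hd3) (bigOM hc3 d2)).
  have k5 := bigOW (l := 4) (k := 6) isT (bigOM hc3 hd3).
  apply: bigO_ext (bigOD (bigOD k1 k2) (bigOD (bigOB k3 k4) k5)) => o; by rewrite /C2 /D2; field.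
Qed.

Lemma jet1 : jet (fun=> 1) (fun=> 1) (fun=> 0) (fun=> 0).
Proof.
split; [exact: bigO0|exact: bigO0|exists (fun=> 0); split; first exact: bigO0].
  by apply: bigO_ext (bigO0 4) => o; field.
by apply: bigO_ext (bigO0 4) => o; field.
Qed.

Lemma jet_prod (J : Type) (s : seq J) (P : pred J) (Fp Fm c p : J -> Om -> C) :
  (forall j, P j -> jet (Fp j) (Fm j) (c j) (p j)) ->
  jet (fun o => \prod_(j <- s | P j) Fp j o) (fun o => \prod_(j <- s | P j) Fm j o)
      (fun o => \sum_(j <- s | P j) c j o) (fun o => \sum_(j <- s | P j) p j o).
Proof.
move=> H; elim: s => [|j s IH].
  by apply: jet_ext jet1 => o; rewrite big_nil.
case Pj: (P j); last by apply: jet_ext IH => o; rewrite big_cons Pj.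
by apply: jet_ext (jetM (H j Pj) IH) => o; rewrite big_cons Pj.
Qed.

Lemma jet_1B g : (forall o, nrm (g o) <= y o) ->
  jet (fun o => 1 + -1 * g o) (fun o => 1 + 1 * g o) (fun o => - g o) (fun o => - g o ^+ 2).
Proof.
move=> gy; have g1 : bigO 1 g by exists 1 => o; rewrite mul1r expr1.
split; [exact: bigON|by apply: bigON; exact: (bigOM g1 g1)|].
exists (fun=> 0); split; first exact: bigO0.
  by apply: bigO_ext (bigO0 4) => o; field.
by apply: bigO_ext (bigO0 4) => o; field.
Qed.

Lemma jet_inv g : (forall o, nrm (g o) <= y o) ->
  jet (fun o => (1 + -1 * g o)^-1) (fun o => (1 + 1 * g o)^-1) g (fun o => g o ^+ 2).
Proof.
move=> gy; have g1 : bigO 1 g by exists 1 => o; rewrite mul1r expr1.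
have g2 := bigOM g1 g1.
have nz h : (forall o, nrm (h o) <= y o) -> forall o, 1 - h o != 0.
  move=> hy o; rewrite subr_eq0; apply: contraTneq (hy o) => <-.
  by rewrite nrm1 -ltNge; exact: le_lt_trans (y_le o) y0_lt1.
have gy' o : nrm (- g o) <= y o by rewrite nrmN.
have i1 := bigO_inv1B gy; have i2 := bigO_inv1B gy'.
split=> //; exists (fun o => g o ^+ 3); split; first exact: (bigOM g1 g2).
  apply: bigO_ext (bigOM (bigOM g2 g2) i1) => o; have := nz _ gy o.
  by rewrite mulN1r => n0; field.
apply: bigO_ext (bigOM (bigOM g2 g2) i2) => o; have := nz _ gy' o.
by rewrite mul1r opprK => n0; field.
Qed.

(** The mean over the two signs removes the terms of orders one and three, so the cubic term never
    has to be identified. *)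
Lemma jet_half Fp Fm c p : jet Fp Fm c p ->
  quad (fun o => 2^-1 * Fp o + 2^-1 * Fm o) (fun o => (c o ^+ 2 + p o) / 2).
Proof.
move=> [c1 p2 [c3 [_ h1 h2]]]; split; first exact: bigO_c2.
by apply: bigO_ext (bigOD (bigOZ 2^-1 h1) (bigOZ 2^-1 h2)) => o; field.
Qed.

(** For F = 1 + e the expression equals 1 + e / (1 + r), and replacing the denominator by 1 costs a
    term e r of order 4. The assumption on the real part keeps [1 + r] at modulus at least 1. *)
Lemma quad_average F e r : quad F e -> bigO 2 r -> (forall o, 0 <= complex.Re (r o)) ->
  quad (fun o => (1 + r o)^-1 * (F o + r o)) e.
Proof.
move=> [e2 F4] r2 r0; split=> //.
have n1 o : 1 <= nrm (1 + r o).
  apply: le_trans (Re_le_nrm _); rewrite ReD /= ger0_norm ?lerDl // addr_ge0 //.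
have inv0 : bigO 0 (fun o => (1 + r o)^-1).
  exists 1 => o; rewrite mul1r expr0 nrmV invf_le1 //; exact: lt_le_trans (n1 o).
have k := bigOB F4 (bigOM e2 r2).
apply: bigO_ext (bigOM inv0 k) => o.
have d0 : 1 + r o != 0 by rewrite -nrm_gt0; exact: lt_le_trans (n1 o).
by field.
Qed.

End BigO.

(** * The factor of [A_DL] at one prime *)

Section LocalFactor.
Context {R : realType} {T : finType}.
Local Notation C := (cplx R).
Implicit Types (I J A B : {set T}) (u v : T -> C) (p : nat).

(** All local quantities are rational in these numbers: V has factors 1 + e [qp p a], and the zeta
    factor at 1 + a + b is the inverse of 1 - [qp p a * qp p b]. *)
Definition qp p (a : C) : C := rpow (p%:R : R) (- (2^-1 + a)).

Lemma qpM p a b : rpow (p%:R : R) (- (1 + a + b)) = qp p a * qp p b.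
Proof. by rewrite /qp -rpowD; congr rpow; field. Qed.

Lemma zeta_loc_qp p a b : zeta_loc p (1 + a + b) = (1 - qp p a * qp p b)^-1.
Proof. by rewrite /zeta_loc qpM. Qed.

Lemma zeta_loc_qp2 p a : zeta_loc p (1 + a *+ 2) = (1 - qp p a * qp p a)^-1.
Proof. by rewrite mulr2n addrA zeta_loc_qp. Qed.

(** The S-values [u] are a free argument here instead of [swap D x]; cancellation and relabelling
    are statements about such free values. *)
Definition euler_fac p A u B v : C :=
  (sqrtZY (zeta_loc p) A u B v / Zprod (zeta_loc p) A u B v)^-1 * (1 + (p%:R : C)^-1)^-1 *
  (2^-1 * (V p (-1) B v / V p (-1) A u) + 2^-1 * (V p 1 B v / V p 1 A u) + (p%:R)^-1).

Lemma A_DLE A x B y D : A_DL A x B y D =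
  lim ((fun N : nat => \prod_(0 <= p < N) (if prime p then euler_fac p A (swap D x) B y else 1)) @ \oo).
Proof. by congr (lim (_ @ \oo)); apply/funext => N; rewrite big_mkcond. Qed.

Lemma nrm_qp p a : nrm (qp p a) = expR (- (2^-1 + complex.Re a) * ln p%:R).
Proof.
have h : (2^-1 : C) = of_real 2^-1 by rewrite of_realV of_real_nat.
by rewrite nrm_rpow ReN ReD h.
Qed.

Lemma sum_pairs I (f : T -> C) : (\sum_(i in I) f i) ^+ 2 = \sum_(i in I) f i ^+ 2 +
  2 * \sum_(i in I) \sum_(j in I | (enum_rank i < enum_rank j)%N) f i * f j.
Proof.
elim: {I}_.+1 {-2}I (ltnSn #|I|) => // n IH I In.
have [->|[c cI]] := set_0Vmem I; first by rewrite !big_set0; ring.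
rewrite -(finset.setD1K cI); set J := (I :\ c)%SET.
have cJ : c \notin J by rewrite !inE eqxx.
have /= E := @big_pairs_setU1 C 0 +%R T c J (fun i j => f i * f j) cJ (fun i j => mulrC _ _).
rewrite E !big_setU1 //= sqrrD IH; last by move: In; rewrite (finset.cardsD1 c) cI add1n.
by rewrite -mulr_sumr /=; ring.
Qed.

(** Here the shape of Y_DL matters: its inverse has precisely the second-order terms that compensate
    those of the mean over the two signs. Everything is expanded in [qp], bounded by [y], so what
    remains has order [y o ^+ 4]. *)
Lemma euler_fac_bound (Om : Type) (y : Om -> R) (y0 : R) (p : Om -> nat) (u v : Om -> T -> C) A B :
  (forall o, 0 <= y o) -> (forall o, y o <= y0) -> y0 < 1 ->
  (forall o, (p o)%:R^-1 <= y o ^+ 2) ->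
  (forall o i, i \in A -> nrm (qp (p o) (u o i)) <= y o) ->
  (forall o i, i \in B -> nrm (qp (p o) (v o i)) <= y o) ->
  exists c : R, forall o, nrm (euler_fac (p o) A (u o) B (v o) - 1) <= c * y o ^+ 4.
Proof.
move=> y_ge0 y_le y0_lt1 py uy vy.
pose f i o := if i \in A then qp (p o) (u o i) else 0.
pose g i o := if i \in B then qp (p o) (v o i) else 0.
have fy i o : nrm (f i o) <= y o by rewrite /f; case: ifP => [/(uy o)//|_]; rewrite nrm0.
have gy i o : nrm (g i o) <= y o by rewrite /g; case: ifP => [/(vy o)//|_]; rewrite nrm0.
have f1 i : bigO y 1 (f i) by exists 1 => o; rewrite mul1r expr1.
have g1 i : bigO y 1 (g i) by exists 1 => o; rewrite mul1r expr1.
have r2 : bigO y 2 (fun o => ((p o)%:R : C)^-1).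
  by exists 1 => o; rewrite mul1r nrmV nrm_nat.
have r0 o : 0 <= complex.Re ((p o)%:R : C)^-1.
  by rewrite -of_real_nat -of_realV /= invr_ge0 ler0n.
have jB := jet_prod (P := xpredT) y_ge0 y_le y0_lt1 (enum B) (fun i _ => jet_1B (gy i)).
have jA := jet_prod (P := xpredT) y_ge0 y_le y0_lt1 (enum A) (fun i _ => jet_inv y_le y0_lt1 (fy i)).
have avg := quad_average (jet_half (jetM y_ge0 y_le y0_lt1 jB jA)) r2 r0.
have qAB := quad_prod (P := xpredT) y_ge0 y_le y0_lt1 (enum A) (fun i _ =>
  quad_prod (P := xpredT) y_ge0 y_le y0_lt1 (enum B) (fun j _ => quad_inv y_le y0_lt1 (fy i) (gy j))).
have qA := quad_prod (P := xpredT) y_ge0 y_le y0_lt1 (enum A) (fun i _ => quad_1B (f1 i) (f1 i)).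
have qAA := quad_prod (P := xpredT) y_ge0 y_le y0_lt1 (enum A) (fun i _ =>
  quad_prod (P := fun j => (enum_rank i < enum_rank j)%N) y_ge0 y_le y0_lt1 (enum A) (fun j _ => quad_1B (f1 i) (f1 j))).
have qBB := quad_prod (P := xpredT) y_ge0 y_le y0_lt1 (enum B) (fun i _ =>
  quad_prod (P := fun j => (enum_rank i < enum_rank j)%N) y_ge0 y_le y0_lt1 (enum B) (fun j _ => quad_1B (g1 i) (g1 j))).
have M := @quadM R Om y y0 y_ge0 y_le y0_lt1.
have [_ [c Hc]] := M _ _ _ _ (M _ _ _ _ (M _ _ _ _ (M _ _ _ _ qAB qA) qAA) qBB) avg.
have prodV (J : {set T}) (P : pred T) (h k : T -> C) : (forall i, i \in J -> P i -> h i = (k i)^-1) ->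
    \prod_(i in J | P i) h i = (\prod_(i in J | P i) k i)^-1.
  by move=> hk; rewrite -prodfV; apply: eq_bigr => i /andP[iJ Pi]; rewrite hk.
exists c => o; apply: le_trans (Hc o).
have fE i : i \in A -> f i o = qp (p o) (u o i) by move=> iA; rewrite /f iA.
have gE i : i \in B -> g i o = qp (p o) (v o i) by move=> iB; rewrite /g iB.
rewrite !big_enum /=.
have -> : \prod_(i in A) \prod_(j <- enum B) (1 - f i o * g j o)^-1 = Zprod (zeta_loc (p o)) A (u o) B (v o).
  apply: eq_bigr => i iA; rewrite big_enum /=; apply: eq_bigr => j jB'.
  by rewrite zeta_loc_qp fE // gE.
have -> : \prod_(i in A) (1 - f i o * f i o) = (Yprod (zeta_loc (p o)) A (u o))^-1.
  by rewrite -prodfV; apply: eq_bigr => i iA; rewrite zeta_loc_qp2 invrK fE.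
have -> : \prod_(i in A) \prod_(j <- enum A | (enum_rank i < enum_rank j)%N) (1 - f i o * f j o) =
    (Zpairs (zeta_loc (p o)) A (u o))^-1.
  rewrite -prodfV; apply: eq_bigr => i iA; rewrite big_enum_cond /=; apply: prodV => j jA' _.
  by rewrite zeta_loc_qp invrK !fE.
have -> : \prod_(i in B) \prod_(j <- enum B | (enum_rank i < enum_rank j)%N) (1 - g i o * g j o) =
    (Zpairs (zeta_loc (p o)) B (v o))^-1.
  rewrite -prodfV; apply: eq_bigr => i iB; rewrite big_enum_cond /=; apply: prodV => j jB' _.
  by rewrite zeta_loc_qp invrK !gE.
have HV (e : C) : \prod_(i in B) (1 + e * g i o) = V (p o) e B (v o).
  by apply: eq_bigr => i iB; rewrite gE.
have HU (e : C) : \prod_(i in A) (1 + e * f i o)^-1 = (V (p o) e A (u o))^-1.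
  by rewrite prodfV; congr (_^-1); apply: eq_bigr => i iA; rewrite fE.
rewrite !HV !HU /euler_fac /sqrtZY.
set e := (X in _ - (1 + X)).
(* With F1, G1 the sums of the values over A and B and F2, G2 the sums of their squares, the
   contributions are F1 G1, - F2, - (F1^2 - F2)/2, - (G1^2 - G2)/2 and ((F1 - G1)^2 + F2 - G2)/2,
   which add up to zero. *)
have -> : e = 0.
  rewrite /e; under [X in X + _ + _ + _ + _]eq_bigr => i _ do rewrite big_enum /= -mulr_sumr.
  rewrite -mulr_suml.
  under [X in _ + X + _ + _ + _]eq_bigr => i _ do rewrite -expr2.
  under [X in _ + _ + X + _ + _]eq_bigr => i _ do rewrite big_enum_cond /= sumrN.
  under [X in _ + _ + _ + X + _]eq_bigr => i _ do rewrite big_enum_cond /= sumrN.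
  rewrite !sumrN; have hA := sum_pairs A (fun i => f i o); have hB := sum_pairs B (fun i => g i o).
  move: hA hB; move: (\sum_(i in A) f i o) (\sum_(i in B) g i o) (\sum_(i in A) f i o ^+ 2) (\sum_(i in B) g i o ^+ 2).
  move: (\sum_(i in A) \sum_(j in A | _) f i o * f j o) (\sum_(i in B) \sum_(j in B | _) g i o * g j o).
  move=> PF PG F1 G1 F2 G2 hA hB.
  have -> : PF = (F1 ^+ 2 - F2) / 2 by rewrite hA; field.
  have -> : PG = (G1 ^+ 2 - G2) / 2 by rewrite hB; field.
  by field.
rewrite addr0 le_eqVlt; apply/orP; left; apply/eqP; congr (nrm (_ - _)).
by rewrite invf_div !invfM; ring.
Qed.


End LocalFactor.

(** * Cancellation and relabelling in the Euler product, and its holomorphy *)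

Section Products.
Context {R : realType} {T : finType}.
Local Notation C := (cplx R).
Implicit Types (I J A B : {set T}) (u v : T -> C) (c d : T).

Lemma YprodU z c I u : c \notin I -> Yprod z (c |: I)%SET u = z (1 + u c *+ 2) * Yprod z I u.
Proof. by move=> cI; rewrite /Yprod big_setU1. Qed.

Lemma ZpairsU z c I u : c \notin I ->
  Zpairs z (c |: I)%SET u = Zpairs z I u * \prod_(j in I) z (1 + u c + u j).
Proof.
move=> cI; have := @big_pairs_setU1 C 1 *%R T c I (fun i j => z (1 + u i + u j)) cI.
by apply=> i j; rewrite addrAC.
Qed.

Lemma ZprodUl z c I u J v : c \notin I ->
  Zprod z (c |: I)%SET u J v = (\prod_(j in J) z (1 + u c + v j)) * Zprod z I u J v.
Proof. by move=> cI; rewrite /Zprod big_setU1. Qed.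

Lemma ZprodUr z I u d J v : d \notin J ->
  Zprod z I u (d |: J)%SET v = (\prod_(i in I) z (1 + u i + v d)) * Zprod z I u J v.
Proof.
by move=> dJ; rewrite /Zprod -big_split /=; apply: eq_bigr => i _; rewrite big_setU1.
Qed.

Lemma VU p e c I u : c \notin I ->
  V p e (c |: I)%SET u = (1 + e * qp p (u c)) * V p e I u.
Proof. by move=> cI; rewrite /V big_setU1. Qed.

Lemma eq_Yprod z I u u' : {in I, u =1 u'} -> Yprod z I u = Yprod z I u'.
Proof. by move=> uu; apply: eq_bigr => i iI; rewrite uu. Qed.
Lemma eq_Zpairs z I u u' : {in I, u =1 u'} -> Zpairs z I u = Zpairs z I u'.
Proof. by move=> uu; apply: eq_bigr => i iI; apply: eq_bigr => j /andP[jI _]; rewrite !uu. Qed.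
Lemma eq_Zprod z I u u' J v v' : {in I, u =1 u'} -> {in J, v =1 v'} ->
  Zprod z I u J v = Zprod z I u' J v'.
Proof. by move=> uu vv; apply: eq_bigr => i iI; apply: eq_bigr => j jJ; rewrite uu ?vv. Qed.
Lemma eq_V p e I u u' : {in I, u =1 u'} -> V p e I u = V p e I u'.
Proof. by move=> uu; apply: eq_bigr => i iI; rewrite uu. Qed.

Lemma eq_euler_fac p A u u' B v v' : {in A, u =1 u'} -> {in B, v =1 v'} ->
  euler_fac p A u B v = euler_fac p A u' B v'.
Proof.
move=> uu vv; rewrite /euler_fac /sqrtZY (eq_Yprod _ uu) !(eq_Zpairs _ uu) (eq_Zpairs _ vv).
by rewrite (eq_Zprod _ uu vv) !(eq_V _ _ uu) !(eq_V _ _ vv).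
Qed.

Lemma nrm_qp_lt1 p (a : C) : (1 < p)%N -> - 2^-1 < complex.Re a -> nrm (qp p a) < 1.
Proof.
move=> p1 a0; rewrite nrm_qp -[X in _ < X]expR0 ltr_expR nmulr_rlt0 ?ln_gt0 ?ltr1n //.
by rewrite oppr_lt0; lra.
Qed.

Lemma one_sub_neq0 (a : C) : nrm a < 1 -> 1 - a != 0.
Proof. by move=> h; rewrite subr_eq0; apply: contraTneq h => <-; rewrite nrm1 ltxx. Qed.

Lemma zeta_loc_neq0 p (a b : C) : (1 < p)%N -> - 2^-1 < complex.Re a -> - 2^-1 < complex.Re b ->
  zeta_loc p (1 + a + b) != 0.
Proof.
move=> p1 a0 b0; rewrite zeta_loc_qp invr_eq0 one_sub_neq0 // nrmM.
by rewrite -[X in _ < X]mulr1 ltr_pM ?nrm_ge0 // nrm_qp_lt1.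
Qed.

Lemma V_neq0 p e I u : (1 < p)%N -> nrm e = 1 ->
  (forall i, i \in I -> - 2^-1 < complex.Re (u i)) -> V p e I u != 0.
Proof.
move=> p1 e1 Hu; apply/prodf_neq0 => i iI; rewrite -/(qp p (u i)) -[e * _]opprK.
by apply: one_sub_neq0; rewrite nrmN nrmM e1 mul1r nrm_qp_lt1 // Hu.
Qed.

(** When the values at [c] and [d] agree, the new factor of Z(S,B) at this pair is the new factor of
    Y(S), and its other new factors are those of the two products over pairs; the factors of V
    cancel in the same way. *)
Lemma euler_fac_cancel p c I u d J v : (1 < p)%N -> c \notin I -> d \notin J -> u c = v d ->
  (forall i, i \in (c |: I)%SET -> - 2^-1 < complex.Re (u i)) ->
  (forall i, i \in (d |: J)%SET -> - 2^-1 < complex.Re (v i)) ->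
  euler_fac p (c |: I)%SET u (d |: J)%SET v = euler_fac p I u J v.
Proof.
move=> p1 cI dJ uv Hu Hv; set z : C -> C := @zeta_loc R p.
have uc : - 2^-1 < complex.Re (u c) by apply: Hu; rewrite setU11.
have Hu' i : i \in I -> - 2^-1 < complex.Re (u i) by move=> iI; apply: Hu; rewrite setU1r.
have Hv' i : i \in J -> - 2^-1 < complex.Re (v i) by move=> iI; apply: Hv; rewrite setU1r.
have Vc (e : C) : nrm e = 1 -> V p e (d |: J)%SET v / V p e (c |: I)%SET u = V p e J v / V p e I u.
  move=> e1; rewrite !VU // -uv.
  have h1 : 1 + e * qp p (u c) != 0.
    by rewrite -[e * _]opprK one_sub_neq0 // nrmN nrmM e1 mul1r nrm_qp_lt1.
  have h2 := V_neq0 p1 e1 Hu'.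
  by field; rewrite h1 h2.
have nm1 : nrm (-1 : C) = 1 by rewrite nrmN nrm1.
rewrite /euler_fac (Vc _ nm1) (Vc _ nrm1); congr (_^-1 * _ * _).
rewrite /sqrtZY YprodU // !ZpairsU // ZprodUl // ZprodUr // big_setU1 //= -uv.
have h0 : z (1 + u c + u c) != 0 by exact: zeta_loc_neq0.
have h1 : \prod_(j in I) z (1 + u c + u j) != 0.
  by apply/prodf_neq0 => j jI; apply: zeta_loc_neq0 => //; exact: Hu'.
have h2 : \prod_(j in J) z (1 + u c + v j) != 0.
  by apply/prodf_neq0 => j jI; apply: zeta_loc_neq0 => //; exact: Hv'.
have h3 : Zprod z I u J v != 0.
  apply/prodf_neq0 => i iI; apply/prodf_neq0 => j jJ; apply: zeta_loc_neq0 => //; [exact: Hu'|exact: Hv'].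
rewrite mulr2n addrA -/z.
have -> : \prod_(i in I) z (1 + u i + u c) = \prod_(j in I) z (1 + u c + u j).
  by apply: eq_bigr => i _; rewrite addrAC.
by field; rewrite h0 h1 h2 h3.
Qed.

Lemma euler_fac_relabelS p c c' I u u' B v : c \notin I -> c' \notin I -> u c = u' c' ->
  {in I, u =1 u'} -> euler_fac p (c |: I)%SET u B v = euler_fac p (c' |: I)%SET u' B v.
Proof.
move=> cI c'I uc uu.
rewrite /euler_fac /sqrtZY !YprodU // !ZpairsU // !ZprodUl // !VU // uc.
rewrite (eq_Yprod _ uu) (eq_Zpairs _ uu) (eq_Zprod _ uu (fun j _ => erefl (v j))) !(eq_V _ _ uu).
by rewrite (eq_bigr _ (fun j jI => congr1 (fun t => zeta_loc p (1 + u' c' + t)) (uu j jI))).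
Qed.

Lemma euler_fac_relabelB p c c' I u B v v' : c \notin B -> c' \notin B -> v c = v' c' ->
  {in B, v =1 v'} -> euler_fac p I u (c |: B)%SET v = euler_fac p I u (c' |: B)%SET v'.
Proof.
move=> cB c'B vc vv.
rewrite /euler_fac /sqrtZY !ZpairsU // !ZprodUr // !VU // vc.
rewrite (eq_Zpairs _ vv) (eq_Zprod _ (fun j _ => erefl (u j)) vv) !(eq_V _ _ vv).
by rewrite (eq_bigr _ (fun j jI => congr1 (fun t => zeta_loc p (1 + v' c' + t)) (vv j jI))).
Qed.

Definition Phi A u B v : C :=
  lim ((fun N : nat => \prod_(0 <= p < N) (if prime p then euler_fac p A u B v else 1)) @ \oo).

Lemma A_DL_Phi A x B y D : A_DL A x B y D = Phi A (swap D x) B y.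
Proof. exact: A_DLE. Qed.

Lemma eq_Phi_fac A u B v A' u' B' v' :
  (forall p, prime p -> euler_fac p A u B v = euler_fac p A' u' B' v') ->
  Phi A u B v = Phi A' u' B' v'.
Proof.
move=> H; rewrite /Phi; congr (lim (_ @ \oo)); apply/funext => N; apply: eq_bigr => p _.
by case: ifP => // /H.
Qed.

Lemma eq_Phi A u u' B v v' : {in A, u =1 u'} -> {in B, v =1 v'} -> Phi A u B v = Phi A u' B v'.
Proof. by move=> uu vv; apply: eq_Phi_fac => p _; exact: eq_euler_fac. Qed.

Lemma Phi_cancel A u B v c d : c \in A -> d \in B -> u c = v d ->
  (forall i, i \in A -> - 2^-1 < complex.Re (u i)) ->
  (forall i, i \in B -> - 2^-1 < complex.Re (v i)) ->
  Phi A u B v = Phi (A :\ c)%SET u (B :\ d)%SET v.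
Proof.
move=> cA dB uv Hu Hv; apply: eq_Phi_fac => p /prime_gt1 p1.
rewrite -{1}(finset.setD1K cA) -{1}(finset.setD1K dB); apply: euler_fac_cancel => //.
- by rewrite !inE eqxx.
- by rewrite !inE eqxx.
- by rewrite finset.setD1K.
- by rewrite finset.setD1K.
Qed.

(** Indices are only names. After a cancellation the surviving value of [a] can be renamed [b],
    which makes it a variable of A \ a. *)
Lemma Phi_relabelS A c c' u u' B v : c \in A -> c' \notin A -> u c = u' c' ->
  {in (A :\ c)%SET, u =1 u'} -> Phi A u B v = Phi (c' |: A :\ c)%SET u' B v.
Proof.
move=> cA c'A uc uu; apply: eq_Phi_fac => p _; rewrite -{1}(finset.setD1K cA).
by apply: euler_fac_relabelS => //; rewrite !inE ?eqxx // (negbTE c'A) andbF.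
Qed.

Lemma Phi_relabelB A u B c c' v v' : c \in B -> c' \notin B -> v c = v' c' ->
  {in (B :\ c)%SET, v =1 v'} -> Phi A u B v = Phi A u (c' |: B :\ c)%SET v'.
Proof.
move=> cA c'A uc uu; apply: eq_Phi_fac => p _; rewrite -{1}(finset.setD1K cA).
by apply: euler_fac_relabelB => //; rewrite !inE ?eqxx // (negbTE c'A) andbF.
Qed.

Definition strip A B : set (T + T -> C) := [set z |
  (forall i, i \in A -> `|complex.Re (z (inl i))| < 4^-1) /\
  (forall i, i \in B -> `|complex.Re (z (inr i))| < 4^-1)].

(* A_DL as a function of independent values of the variables of S (left) and of B (right) *)
Definition PhiS A B (z : T + T -> C) : C := Phi A (z \o inl) B (z \o inr).

Lemma strip_margin A B z : strip A B z -> exists2 d : R, 0 < d <= 4^-1 &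
  forall w, box z d w ->
    (forall i, i \in A -> `|complex.Re (w (inl i))| <= 4^-1 - d) /\
    (forall i, i \in B -> `|complex.Re (w (inr i))| <= 4^-1 - d).
Proof.
move=> [HA HB].
pose K k := match k with inl i => i \in A | inr i => i \in B end.
pose m := \big[Num.min/4^-1]_(k : T + T | K k) ((4^-1 - `|complex.Re (z k)|) / 2).
have m0 : 0 < m.
  rewrite /m; elim/big_ind: _ => // [a b a0 b0|[i|i] Ki]; first by rewrite lt_min a0.
  - by rewrite divr_gt0 // subr_gt0 HA.
  - by rewrite divr_gt0 // subr_gt0 HB.
have m4 : m <= 4^-1.
  rewrite /m; elim/big_ind: _ => // [a b a0 b0|k _]; first by rewrite ge_min a0.
  by have := normr_ge0 (complex.Re (z k)); lra.
have mk k : K k -> m <= (4^-1 - `|complex.Re (z k)|) / 2.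
  by move=> Kk; rewrite /m (bigD1 k) //= ge_min lexx.
have key w k : K k -> box z m w -> `|complex.Re (w k)| <= 4^-1 - m.
  move=> Kk /(_ k) bw; have := Re_le_nrm (w k - z k); rewrite ReB => h.
  have := ler_normD (complex.Re (w k) - complex.Re (z k)) (complex.Re (z k)); rewrite subrK.
  have := mk k Kk; lra.
by exists m; [rewrite m0|move=> w bw; split=> i Hi; [apply: (key w (inl i))|apply: (key w (inr i))]].
Qed.

Lemma opn_strip A B : opn (strip A B).
Proof.
move=> z Hz; have [d /andP[d0 _] H] := strip_margin Hz; exists d => // w /H[h1 h2].
by split=> i Hi; [apply: le_lt_trans (h1 i Hi) _|apply: le_lt_trans (h2 i Hi) _]; lra.
Qed.

Lemma strip_half A B z : strip A B z ->
  (forall i, i \in A -> - 2^-1 < complex.Re (z (inl i))) /\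
  (forall i, i \in B -> - 2^-1 < complex.Re (z (inr i))).
Proof.
by move=> [h1 h2]; split=> i Hi; [have := h1 i Hi|have := h2 i Hi]; rewrite ltr_norml => /andP[]; lra.
Qed.

Lemma hol_euler_fac p A B : (1 < p)%N ->
  hol (strip A B) (fun z => euler_fac p A (z \o inl) B (z \o inr)).
Proof.
move=> p1; set U := strip A B.
have Hl i : hol U (fun z => (z \o inl) i) by exact: hol_proj.
have Hr i : hol U (fun z => (z \o inr) i) by exact: hol_proj.
have hz (f g : (T + T -> C) -> C) : hol U f -> hol U g ->
    (forall z, U z -> - 2^-1 < complex.Re (f z)) -> (forall z, U z -> - 2^-1 < complex.Re (g z)) ->
    hol U (fun z => zeta_loc p (1 + f z + g z)).
  move=> hf hg f0 g0; apply: holV.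
    by move=> z Uz; have := zeta_loc_neq0 p1 (f0 z Uz) (g0 z Uz); rewrite /zeta_loc invr_eq0.
  apply: holB; first exact: hol_cst.
  by apply: hol_rpow; apply: holN; apply: holD => //; apply: holD => //; exact: hol_cst.
have UA i z : i \in A -> U z -> - 2^-1 < complex.Re ((z \o inl) i) by move=> iA /strip_half[h _]; exact: h.
have UB i z : i \in B -> U z -> - 2^-1 < complex.Re ((z \o inr) i) by move=> iA /strip_half[_ h]; exact: h.
have hY : hol U (fun z => Yprod (zeta_loc p) A (z \o inl)).
  apply: hol_prod => i iA; have := hz _ _ (Hl i) (Hl i) (UA i ^~ iA) (UA i ^~ iA).
  by congr (hol _ _); apply/funext => z; rewrite mulr2n addrA.
have hA : hol U (fun z => Zpairs (zeta_loc p) A (z \o inl)).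
  apply: hol_prod => i iA; apply: hol_prod => j /andP[jA _].
  by apply: hz (Hl i) (Hl j) _ _ => z; apply: UA.
have hB : hol U (fun z => Zpairs (zeta_loc p) B (z \o inr)).
  apply: hol_prod => i iA; apply: hol_prod => j /andP[jA _].
  by apply: hz (Hr i) (Hr j) _ _ => z; apply: UB.
have hAB : hol U (fun z => Zprod (zeta_loc p) A (z \o inl) B (z \o inr)).
  apply: hol_prod => i iA; apply: hol_prod => j jB.
  by apply: hz (Hl i) (Hr j) _ _ => z; [apply: UA|apply: UB].
have hVA e : hol U (fun z => V p e A (z \o inl)).
  apply: hol_prod => i iA; apply: holD; first exact: hol_cst.
  apply: holM; first exact: hol_cst.
  by apply: hol_rpow; apply: holN; apply: holD => //; exact: hol_cst.
have hVB e : hol U (fun z => V p e B (z \o inr)).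
  apply: hol_prod => i iA; apply: holD; first exact: hol_cst.
  apply: holM; first exact: hol_cst.
  by apply: hol_rpow; apply: holN; apply: holD => //; exact: hol_cst.
have nAB z : U z -> Zprod (zeta_loc p) A (z \o inl) B (z \o inr) != 0.
  move=> Uz; apply/prodf_neq0 => i iA; apply/prodf_neq0 => j jB.
  by apply: zeta_loc_neq0 => //; [apply: UA|apply: UB].
have nY z : U z -> Yprod (zeta_loc p) A (z \o inl) != 0.
  move=> Uz; apply/prodf_neq0 => i iA; rewrite mulr2n addrA.
  by apply: zeta_loc_neq0 => //; apply: UA.
have nA z : U z -> Zpairs (zeta_loc p) A (z \o inl) != 0.
  move=> Uz; apply/prodf_neq0 => i iA; apply/prodf_neq0 => j /andP[jA _].
  by apply: zeta_loc_neq0 => //; apply: UA.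
have nB z : U z -> Zpairs (zeta_loc p) B (z \o inr) != 0.
  move=> Uz; apply/prodf_neq0 => i iA; apply/prodf_neq0 => j /andP[jA _].
  by apply: zeta_loc_neq0 => //; apply: UB.
have nm1 : nrm (-1 : C) = 1 by rewrite nrmN nrm1.
have nV e z : nrm e = 1 -> U z -> V p e A (z \o inl) != 0.
  by move=> e1 Uz; apply: V_neq0 => // i iA; exact: UA.
apply: holM.
  apply: holM; last exact: hol_cst.
  apply: holV.
    by move=> z Uz; rewrite mulf_neq0 ?invr_eq0 ?nAB // /sqrtZY !mulf_neq0 ?nY ?nA ?nB.
  apply: holM; last by apply: holV.
  by apply: holM => //; apply: holM.
apply: holD; last exact: hol_cst.
apply: holD; (apply: holM; first exact: hol_cst); apply: holM => //; apply: holV => // z Uz.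
- exact: nV.
- by apply: nV => //; exact: nrm1.
Qed.

Lemma hol_PhiS A B : hol (strip A B) (PhiS A B) /\ forall z, strip A B z ->
  (fun N : nat => \prod_(0 <= p < N) (if prime p then euler_fac p A (z \o inl) B (z \o inr) else 1))
    @ \oo --> PhiS A B z.
Proof.
apply: (@hol_infprod R (T + T)%type (strip A B)
  (fun p z => if prime p then euler_fac p A (z \o inl) B (z \o inr) else 1) (@opn_strip A B)).
  by move=> p; case pp: (prime p); [exact: hol_euler_fac (prime_gt1 pp)|exact: hol_cst].
move=> z Hz; have [d /andP[d0 d4] Hd] := strip_margin Hz; exists d => //.
(* Taking prime and point together as the parameter gives one constant for the whole box. *)
pose Om := {o : nat * (T + T -> C) | prime o.1 /\ box z d o.2}.
(* On the box real parts are at least - 1/4 + d, so [qp] is bounded by n^(-1/4-d). Its fourth power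
   n^(-1-4d) is summable, and its square dominates 1/n because d <= 1/4. *)
pose yn (n : nat) : R := expR (- (4^-1 + d) * ln n%:R).
pose y (o : Om) : R := yn (sval o).1.
have ln2 : 0 < ln 2 :> R by rewrite ln_gt0 // ltr1n.
have lnp n : prime n -> ln 2 <= ln n%:R :> R.
  by move=> /prime_gt1 p1; rewrite ler_ln ?posrE ?ltr0n ?ler_nat // (ltn_trans _ p1).
have [c Hc] : exists c : R, forall o : Om, nrm (euler_fac (sval o).1 A ((sval o).2 \o inl) B ((sval o).2 \o inr) - 1) <= c * y o ^+ 4.
  apply: (@euler_fac_bound R T Om y (yn 2%N) (fun o => (sval o).1) (fun o => (sval o).2 \o inl) (fun o => (sval o).2 \o inr)).
  - by move=> o; exact: expR_ge0.
  - move=> [[n w] [/= pn bw]]; rewrite ler_expR ler_wnM2l ?lnp //; lra.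
  - by rewrite -[X in _ < X]expR0 ltr_expR nmulr_rlt0 //; lra.
  - move=> [[n w] [/= pn bw]]; rewrite /y /yn /=.
    have n0 : 0 < n%:R :> R by rewrite ltr0n prime_gt0.
    have -> : n%:R^-1 = expR (- ln (n%:R : R)) by rewrite expRN lnK ?posrE.
    rewrite expr2 -expRD ler_expR; have := lnp n pn; move: (ln n%:R) => l l2.
    have l0 : 0 < l := lt_le_trans ln2 l2.
    have : d * l <= 4^-1 * l by rewrite ler_pM2r.
    lra.
  - move=> [[n w] [/= pn bw]] i iA; rewrite nrm_qp ler_expR ler_wpM2r //.
      by apply: ltW; apply: lt_le_trans ln2 (lnp n pn).
    have [h _] := Hd w bw; have := h i iA; rewrite ler_norml => /andP[h1 _].
    by rewrite lerN2 /=; lra.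
  - move=> [[n w] [/= pn bw]] i iA; rewrite nrm_qp ler_expR ler_wpM2r //.
      by apply: ltW; apply: lt_le_trans ln2 (lnp n pn).
    have [_ h] := Hd w bw; have := h i iA; rewrite ler_norml => /andP[h1 _].
    by rewrite lerN2 /=; lra.
exists (fun n => Num.max c 0 * expR (- (1 + 4 * d) * ln n%:R)).
  apply: summableZ; first by rewrite le_max lexx orbT.
  by apply: summable_pow; rewrite mulr_gt0.
move=> w bw n; have rhs0 : 0 <= Num.max c 0 * expR (- (1 + 4 * d) * ln (n%:R : R)).
  by rewrite mulr_ge0 ?expR_ge0 // le_max lexx orbT.
case pn: (prime n); last by rewrite subrr nrm0.
have := Hc (exist _ (n, w) (conj pn bw)); rewrite /y /yn /= => h; apply: le_trans h _.
have -> : expR (- (4^-1 + d) * ln (n%:R : R)) ^+ 4 = expR (- (1 + 4 * d) * ln n%:R).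
  by rewrite -expRM_natl; congr expR; rewrite -[4%:R]/(4 : R); field.
by rewrite ler_wpM2r ?expR_ge0 // le_max lexx.
Qed.

End Products.

Lemma derive1_near {R : realType} (f g : cplx R -> cplx R) z :
  (\forall w \near nbC z, f w = g w) -> derive1 f z = derive1 g z.
Proof.
move=> /nbC_P H; rewrite !derive1E; apply: near_eq_derive; by apply/nbhs_nrmP.
Qed.

(** * Logarithmic derivatives of A_DL *)

Section LogDerivatives.
Context {R : realType}.
Local Notation C := (cplx R).

Lemma pderivE {I : finType} (i : I) F (x : I -> C) :
  pderiv i F x = derive1 (fun w => F (upd x i w)) (x i).
Proof. by []. Qed.

(* Otherwise unification decides [pderiv i F x = pderiv j F x] by unfolding limits. *)
Local Opaque pderiv.

Definition dlog {I : finType} (i : I) (F : (I -> C) -> C) (x : I -> C) : C := pderiv i F x / F x.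

(** Lists replace sets since [pderivs_log] differentiates in the order of [enum W]; that the order
    is immaterial is a theorem, [plog_perm]. *)
Definition plog {I : finType} (l : seq I) (F : (I -> C) -> C) : (I -> C) -> C :=
  if l is i :: s then foldr (@pderiv R I) (dlog i F) s else fun=> 0.

(* For l empty, F itself rather than log F: A_DL enters J* undifferentiated. *)
Definition pdlog {I : finType} (l : seq I) (F : (I -> C) -> C) : (I -> C) -> C :=
  if l is [::] then F else plog l F.

(** The head of the list carries the logarithmic derivative and the next entry is the outermost
    derivative, so one more derivative enters in second place. *)
Definition ins2 {I : finType} (k : I) (l : seq I) :=
  if l is i :: s then [:: i, k & s] else [:: k].

Section OneSpace.
Context {I : finType}.
Implicit Types (U L : set (I -> C)) (F G : (I -> C) -> C) (x y : I -> C) (i j k : I) (l s : seq I).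

Lemma upd_ne x i j w : j != i -> upd x i w j = x j.
Proof. by rewrite /upd => /negbTE ->. Qed.

Lemma pderiv_pdlog k l F x : F x != 0 ->
  pderiv k (pdlog l F) x = (if l is [::] then F x else 1) * plog (ins2 k l) F x.
Proof.
by case: l => [|i s] F0 /=; [rewrite /dlog mulrC divfK|rewrite mul1r].
Qed.

Lemma pderiv_eq U i F G x : opn U -> (forall y, U y -> F y = G y) -> U x ->
  pderiv i F x = pderiv i G x.
Proof.
move=> oU FG Ux; rewrite !pderivE; apply: derive1_near; have := near_upd i (oU x Ux).
by apply: filterS => w; exact: FG.
Qed.

Lemma foldr_pderiv_eq U s F G x : opn U -> (forall y, U y -> F y = G y) -> U x ->
  foldr (@pderiv R I) F s x = foldr (@pderiv R I) G s x.
Proof.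
move=> oU FG; elim: s x => [|i s IH] x Ux /=; first exact: FG.
exact: (pderiv_eq _ oU IH).
Qed.

Lemma hol_foldr_pderiv U s F : opn U -> hol U F -> hol U (foldr (@pderiv R I) F s).
Proof. by move=> oU hF; elim: s => //= i s IH; exact: hol_pderiv. Qed.

Lemma foldr_pderiv_mid U s1 i s2 F x : opn U -> hol U F -> U x ->
  foldr (@pderiv R I) F (s1 ++ i :: s2) x = foldr (@pderiv R I) F (i :: s1 ++ s2) x.
Proof.
move=> oU hF; elim: s1 x => [|j s1 IH] x Ux; first by [].
rewrite cat_cons; apply: (etrans (pderiv_eq j oU IH Ux)).
by apply: (pderivC j i oU _ Ux); exact: hol_foldr_pderiv.
Qed.

Lemma foldr_pderiv_perm U s s' F x : opn U -> hol U F -> U x -> perm_eq s s' ->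
  foldr (@pderiv R I) F s x = foldr (@pderiv R I) F s' x.
Proof.
move=> oU hF; elim: s s' x => [|i s IH] s' x Ux; first by rewrite perm_sym => /perm_nilP ->.
move=> pss; have is' : i \in s' by rewrite -(perm_mem pss) mem_head.
case/splitPr: is' pss => s1 s2 pss; apply: etrans (esym (foldr_pderiv_mid s1 i s2 oU hF Ux)).
have ps : perm_eq s (s1 ++ s2).
  by rewrite -(perm_cons i); apply: (perm_trans pss); rewrite -cat1s perm_catCA.
by apply: (pderiv_eq i oU _ Ux) => y Uy; exact: IH.
Qed.

Lemma hol_dlog U F i : opn U -> hol U F -> (forall x, U x -> F x != 0) -> hol U (dlog i F).
Proof. by move=> oU hF F0; apply: holM; [exact: hol_pderiv|exact: holV]. Qed.

Lemma hol_plog U F l : opn U -> hol U F -> (forall x, U x -> F x != 0) -> hol U (plog l F).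
Proof.
move=> oU hF F0; case: l => [|i s]; first exact: hol_cst.
by apply: hol_foldr_pderiv => //; exact: hol_dlog.
Qed.

Lemma hol_pdlog U F l : opn U -> hol U F -> (forall x, U x -> F x != 0) -> hol U (pdlog l F).
Proof. by move=> oU hF F0; case: l => [//|i s]; exact: hol_plog. Qed.

Lemma pderiv_dlog U F i j x : opn U -> hol U F -> (forall x, U x -> F x != 0) -> U x ->
  pderiv j (dlog i F) x =
  (pderiv j (pderiv i F) x * F x - pderiv i F x * pderiv j F x) / F x ^+ 2.
Proof.
move=> oU hF F0 Ux; apply: cder_derive1.
have h1 := cder_pderiv j hF Ux; have h2 := cder_pderiv j (hol_pderiv i oU hF) Ux.
have h3 := cderV (f := fun w => F (upd x j w)) _ h1; rewrite /= upd_id in h3.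
have := cderM h2 (h3 (F0 x Ux)); rewrite /= !upd_id.
have nF := F0 x Ux; move: (pderiv j F x) (pderiv i F x) (pderiv j (pderiv i F) x) (F x) nF => p q r f nf.
by have -> : r / f + q * (- p / f ^+ 2) = (r * f - q * p) / f ^+ 2 by field.
Qed.

Lemma dlogC U F i j x : opn U -> hol U F -> (forall x, U x -> F x != 0) -> U x ->
  pderiv j (dlog i F) x = pderiv i (dlog j F) x.
Proof.
move=> oU hF F0 Ux; rewrite (pderiv_dlog _ _ oU hF F0 Ux) (pderiv_dlog _ _ oU hF F0 Ux).
have := pderivC j i oU hF Ux.
move: (pderiv j (pderiv i F) x) (pderiv i (pderiv j F) x) => p q ->.
have E (f u v : C) : (q * f - u * v) / f ^+ 2 = (q * f - v * u) / f ^+ 2 by rewrite (mulrC u).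
exact: E.
Qed.

Lemma plog_perm U F l l' x : opn U -> hol U F -> (forall x, U x -> F x != 0) -> U x ->
  perm_eq l l' -> plog l F x = plog l' F x.
Proof.
move=> oU hF F0 Ux; case: l => [|i s]; first by rewrite perm_sym => /perm_nilP ->.
case: l' => [/perm_nilP//|j t] pp.
have hd k := hol_dlog k oU hF F0.
have [ij|ij] := eqVneq i j.
  by move: pp; rewrite -ij perm_cons => pp; exact: (foldr_pderiv_perm oU (hd i) Ux pp).
have js : j \in s by move: (perm_mem pp j); rewrite !inE eqxx eq_sym (negbTE ij).
have p1 := perm_to_rem js; move: (rem j s) p1 => s' p1.
have p2 : perm_eq t (i :: s').
  rewrite perm_sym -(perm_cons j); apply: perm_trans pp.
  have -> : [:: j, i & s'] = [:: j] ++ [:: i] ++ s' by [].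
  by rewrite perm_catCA perm_cons perm_sym.
apply: (etrans (foldr_pderiv_perm oU (hd i) Ux p1)).
apply: (etrans _ (esym (foldr_pderiv_perm oU (hd j) Ux p2))).
(* The variable to be exchanged with the head is made the innermost derivative, acting directly on
   [dlog], where [dlogC] applies. *)
have m k (l : seq I) : perm_eq (k :: l) (rcons l k) by rewrite perm_sym perm_rcons.
apply: (etrans (foldr_pderiv_perm oU (hd i) Ux (m j s'))).
apply: (etrans _ (esym (foldr_pderiv_perm oU (hd j) Ux (m i s')))).
have E k n : foldr (@pderiv R I) (dlog k F) (rcons s' n) = foldr (@pderiv R I) (pderiv n (dlog k F)) s'.
  exact: foldr_rcons.
apply: (etrans (congr1 (@^~ x) (E i j))); apply: (etrans _ (esym (congr1 (@^~ x) (E j i)))).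
apply: (@foldr_pderiv_eq U s' (pderiv j (dlog i F)) (pderiv i (dlog j F)) x oU _ Ux) => y Uy.
exact: (dlogC i j oU hF F0 Uy).
Qed.

End OneSpace.

Section Transport.
Context {I J : finType}.
Implicit Types (L : set (I -> C)) (F : (I -> C) -> C) (G : (J -> C) -> C) (e : (I -> C) -> J -> C).

(* If F = G o e on L and the variables i of l are carried by e to the variables h i,
   then the derivatives of log F along l are those of log G along h l. *)
Definition carries L (l : seq I) (h : I -> J) e := forall x, L x -> forall i, i \in l ->
  [/\ \forall w \near nbC (x i), L (upd x i w),
      forall w, e (upd x i w) = upd (e x) (h i) w & e x (h i) = x i].

Lemma pderiv_transport L l h e F G i x : carries L l h e -> (forall x, L x -> F x = G (e x)) ->
  L x -> i \in l -> pderiv i F x = pderiv (h i) G (e x).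
Proof.
move=> H FG Lx il; have [h1 h2 h3] := H x Lx i il; rewrite !pderivE h3; apply: derive1_near.
by apply: filterS h1 => w Lw; rewrite FG // h2.
Qed.

Lemma foldr_transport L l h e F G s x : carries L l h e -> (forall x, L x -> F x = G (e x)) ->
  L x -> {subset s <= l} ->
  foldr (@pderiv R I) F s x = foldr (@pderiv R J) G (map h s) (e x).
Proof.
move=> H FG; elim: s x => [|i s IH] x Lx sl; first exact: FG.
apply: (pderiv_transport H _ Lx); last by apply: sl; exact: mem_head.
by move=> y Ly; apply: IH => // k ks; apply: sl; rewrite inE ks orbT.
Qed.

Lemma plog_transport L l h e F G s x : carries L l h e -> (forall x, L x -> F x = G (e x)) ->
  L x -> {subset s <= l} -> plog s F x = plog (map h s) G (e x).
Proof.
move=> H FG Lx; case: s => [//|i s] sl.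
apply: (foldr_transport H _ Lx); last by move=> k ks; apply: sl; rewrite inE ks orbT.
move=> y Ly; rewrite /dlog (FG y Ly) (pderiv_transport H FG Ly) //.
by apply: sl; exact: mem_head.
Qed.

Lemma pdlog_transport L l h e F G s x : carries L l h e -> (forall x, L x -> F x = G (e x)) ->
  L x -> {subset s <= l} -> pdlog s F x = pdlog (map h s) G (e x).
Proof.
move=> H FG Lx; case: s => [|i s] sl; first exact: FG.
exact: (plog_transport H FG Lx sl).
Qed.

End Transport.

End LogDerivatives.

(** * [A_DL] and the derivatives of its logarithm at coinciding values *)

Section ArithmeticPart.
Context {R : realType} {T : finType}.
Local Notation C := (cplx R).
Implicit Types (A D W : {set T}) (l : seq T) (a b c i : T) (x u v : T -> C) (z y : T + T -> C).

Local Opaque pderiv.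

Definition pt u v : T + T -> C := fun k => match k with inl i => u i | inr i => v i end.

(** Only S-values, on the left of [T + T], are differentiated; the B-values are parameters, as in
    [A_part]. *)
Definition aq A l z : C := pdlog (map inl l) (PhiS A A) z.

Definition okS A : set (T + T -> C) := [set z | strip A A z /\ PhiS A A z != 0].

Lemma opn_okS A : opn (okS A).
Proof.
move=> z [sz nz]; have [h _] := hol_PhiS (R := R) A A.
have cz : PhiS A A @ nbx z --> PhiS A A z := Cn_cvg (h 0%N) sz.
have [r r0 H] := opn_strip sz.
have e0 : 0 < nrm (PhiS A A z) by rewrite nrm_gt0.
have /cvgnP/(_ _ e0)[d d0 Hd] := cz.
exists (Num.min r d); first by rewrite lt_min r0.
move=> w bw; split; first by apply: H; apply: box_le bw; rewrite ge_min lexx.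
have /Hd : box z d w by apply: box_le bw; rewrite ge_min lexx orbT.
by apply: contraTneq => ->; rewrite sub0r nrmN ltxx.
Qed.

Lemma hol_okS A : hol (okS A) (PhiS A A).
Proof. by have [h _] := hol_PhiS (R := R) A A; apply: hol_sub h => z []. Qed.

Lemma okS_neq0 A z : okS A z -> PhiS A A z != 0. Proof. by case. Qed.

Lemma hol_aq A l : hol (okS A) (aq A l).
Proof. exact: (hol_pdlog (map inl l) (@opn_okS A) (@hol_okS A) (@okS_neq0 A)). Qed.

Lemma inl_inj : injective (@inl T T). Proof. by move=> ? ? []. Qed.
Lemma inr_inj : injective (@inr T T). Proof. by move=> ? ? []. Qed.

Lemma setU1D1 A a b : b \in A -> a != b -> (b |: A :\ b :\ a = A :\ a)%SET.
Proof.
move=> bA ab; apply/setP => i; rewrite !inE.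
by have [->|] := eqVneq i b; rewrite ?bA ?andbT // eq_sym ab.
Qed.

(** On the locus where the two values of [c] agree, its Euler factors cancel. The locus is not open,
    but the variables of [l] do not include [c] and never leave it, so the derivatives agree as
    well. *)
Lemma aq_drop A l c z : c \in A -> c \notin l -> strip A A z -> z (inl c) = z (inr c) ->
  aq A l z = aq (A :\ c)%SET l z.
Proof.
move=> cA cl sz zc; rewrite /aq -[in RHS](map_id (map inl l)).
apply: (@pdlog_transport R _ _ [set y | strip A A y /\ y (inl c) = y (inr c)] (map inl l)
         id id _ _ (map inl l) z) => //; last first.
  move=> y [sy yc]; have [h1 h2] := strip_half sy.
  exact: (Phi_cancel cA cA yc h1 h2).
move=> y [sy yc] k kl; split=> //; have := near_upd k (opn_strip sy).
have [j jl ->] := mapP kl; apply: filterS => w sw; split=> //.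
have jc : j != c by apply: contraNneq cl => <-.
by rewrite !upd_ne // (inj_eq inl_inj) eq_sym.
Qed.

Lemma aq_off A l z z' : {subset l <= A} ->
  (forall i, i \in A -> z (inl i) = z' (inl i) /\ z (inr i) = z' (inr i)) ->
  aq A l z = aq A l z'.
Proof.
move=> lA zz.
pose K k := match k with inl i => i \in A | inr i => i \in A end.
pose e y : T + T -> C := fun k => if K k then y k else z' k.
have ez : e z = z'.
  by apply/funext => -[i|i]; rewrite /e /=; case: ifP => // iA; case: (zz i iA).
rewrite /aq -[in RHS](map_id (map inl l)) -ez.
apply: (@pdlog_transport R _ _ setT (map inl l) id e) => // [y _ k kl|y _].
  have Kk : K k by case/mapP: kl => j jl ->; apply: lA.
  split; [by apply: filterE|move=> w|by rewrite /e Kk].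
  by apply/funext => m; rewrite /e /upd; case: (eqVneq m k) => [->|]; rewrite ?Kk.
by apply: eq_Phi => i iA /=; rewrite /e /= iA.
Qed.


(** Both [a] and [b] are in D and opposite in this situation: the S-value of each is the B-value of
    the other, and the cancellation is crosswise. *)
Lemma aq_drop2 A l a b z : a \in A -> b \in A -> a != b -> a \notin l -> b \notin l ->
  strip A A z -> z (inl a) = z (inr b) -> z (inl b) = z (inr a) ->
  aq A l z = aq (A :\ a :\ b)%SET l z.
Proof.
move=> aA bA ab al bl sz za zb; rewrite /aq -[in RHS](map_id (map inl l)).
apply: (@pdlog_transport R _ _ [set y | strip A A y /\ (y (inl a) = y (inr b) /\ y (inl b) = y (inr a))]
         (map inl l) id id _ _ (map inl l) z) => //; last first.
  move=> y [sy [ya yb]]; have [h1 h2] := strip_half sy.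
  have b1 : b \in (A :\ a)%SET by rewrite !inE eq_sym ab.
  have a1 : a \in (A :\ b)%SET by rewrite !inE ab.
  rewrite /PhiS (Phi_cancel aA bA ya h1 h2) (Phi_cancel b1 a1 yb).
  - by rewrite finset.setDDl finset.setUC -finset.setDDl.
  - by move=> i /finset.setD1P[_]; exact: h1.
  - by move=> i /finset.setD1P[_]; exact: h2.
move=> y [sy [ya yb]] k kl; split=> //; have := near_upd k (opn_strip sy).
have [j jl ->] := mapP kl; apply: filterS => w sw; split=> //.
have ja : j != a by apply: contraNneq al => <-.
have jb : j != b by apply: contraNneq bl => <-.
by rewrite !upd_ne // ?(inj_eq inl_inj) // eq_sym.
Qed.

(** For [a] in D, [b] outside D and opposite values, the S-value of [a] cancels the B-value of [b].
    The surviving B-value of [a] takes the name [b], which is the configuration on A \ a with x_b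
    negated and [b] in D. *)
Lemma aq_swapB A l a b z : a \in A -> b \in A -> a != b -> a \notin l ->
  strip A A z -> z (inl a) = z (inr b) ->
  aq A l z = aq (A :\ a)%SET l (upd z (inr b) (z (inr a))).
Proof.
move=> aA bA ab al sz za; rewrite /aq -[in RHS](map_id (map inl l)).
apply: (@pdlog_transport R _ _ [set y | strip A A y /\ y (inl a) = y (inr b)]
         (map inl l) id (fun y => upd y (inr b) (y (inr a))) _ _ (map inl l) z) => //; last first.
  move=> y [sy ya]; have [h1 h2] := strip_half sy.
  have a1 : a \in (A :\ b)%SET by rewrite !inE ab.
  rewrite /PhiS (Phi_cancel aA bA ya h1 h2).
  have bn : b \notin (A :\ b)%SET by rewrite !inE eqxx.
  rewrite (@Phi_relabelB _ _ _ _ _ a b _ (upd y (inr b) (y (inr a)) \o inr) a1 bn).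
  - by rewrite setU1D1.
  - by rewrite /= upd_same.
  - by move=> i /finset.setD1P[_ /finset.setD1P[ib _]] /=; rewrite upd_ne.
move=> y [sy ya] k kl; have [j jl kj] := mapP kl; split.
- have := near_upd k (opn_strip sy); apply: filterS => w sw; split=> //.
  rewrite kj !upd_ne //; apply: contraNneq al => E; by rewrite kj in kl; case: E => ->.
- by move=> w; rewrite kj [upd y _ _ (inr a)]upd_ne // updC.
- by rewrite kj upd_ne.
Qed.

(** The constant [k] fills the vacated coordinate of [a]: moving that S-value must change the
    renamed coordinate [b] and nothing else, as [carries] demands. *)
Lemma PhiS_swapS A a b y k : a \in A -> b \in A -> a != b -> strip A A y -> y (inl b) = y (inr a) ->
  PhiS A A y = PhiS (A :\ a)%SET (A :\ a)%SET (upd (upd y (inl b) (y (inl a))) (inl a) k).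
Proof.
move=> aA bA ab sy yb; have [h1 h2] := strip_half sy.
have a1 : a \in (A :\ b)%SET by rewrite !inE ab.
have bn : b \notin (A :\ b)%SET by rewrite !inE eqxx.
rewrite /PhiS (Phi_cancel bA aA yb h1 h2).
rewrite (@Phi_relabelS _ _ _ a b _ (upd (upd y (inl b) (y (inl a))) (inl a) k \o inl) _ _ a1 bn).
- by rewrite setU1D1 //; exact: eq_Phi.
- by rewrite /= upd_ne ?upd_same // (inj_eq inl_inj) eq_sym.
- move=> i /finset.setD1P[ia /finset.setD1P[ib _]] /=.
  by rewrite !upd_ne // (inj_eq inl_inj).
Qed.

Lemma PhiS_swapB A a b y k : a \in A -> b \in A -> a != b -> strip A A y -> y (inl a) = y (inr b) ->
  PhiS A A y = PhiS (A :\ a)%SET (A :\ a)%SET (upd (upd y (inr b) (y (inr a))) (inr a) k).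
Proof.
move=> aA bA ab sy yb; have [h1 h2] := strip_half sy.
have a1 : a \in (A :\ b)%SET by rewrite !inE ab.
have bn : b \notin (A :\ b)%SET by rewrite !inE eqxx.
rewrite /PhiS (Phi_cancel aA bA yb h1 h2).
rewrite (@Phi_relabelB _ _ _ _ _ a b _ (upd (upd y (inr b) (y (inr a))) (inr a) k \o inr) a1 bn).
- by rewrite setU1D1.
- by rewrite /= upd_ne ?upd_same // (inj_eq inr_inj) eq_sym.
- move=> i /finset.setD1P[ia /finset.setD1P[ib _]] /=.
  by rewrite !upd_ne // (inj_eq inr_inj).
Qed.

Lemma plog_swapS A l a b z k : a \in A -> b \in A -> a != b -> a \notin l -> b \notin l ->
  strip A A z -> z (inl b) = z (inr a) -> 
  plog (ins2 (inl a) (map inl l)) (PhiS A A) z =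
  plog (ins2 (inl b) (map inl l)) (PhiS (A :\ a)%SET (A :\ a)%SET)
    (upd (upd z (inl b) (z (inl a))) (inl a) k).
Proof.
move=> aA bA ab al bl sz zb.
pose h (m : T + T) : T + T := if m == inl a then inl b else m.
have -> : ins2 (inl b) (map inl l) = map h (ins2 (inl a) (map inl l)) :> seq (T + T).
  have hl : map h (map inl l) = map inl l.
    rewrite -map_comp; apply/eq_in_map => j jl /=; rewrite /h; case: eqP => // -[ja].
    by rewrite -ja jl in al.
  by case: l hl {al bl} => [|j l] /=; rewrite /h eqxx // => -[-> ->].
have ms m : m \in ins2 (inl a) (map inl l) -> m = inl a \/ exists2 j, j \in l & m = inl j.
  move=> H; suff : m \in inl a :: map inl l.
    by rewrite inE => /orP[/eqP|/mapP[j]]; [left|right; exists j].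
  by case: l H {al bl} => [|j l] //=; rewrite !inE orbCA.
apply: (@plog_transport R _ _ [set y | strip A A y /\ y (inl b) = y (inr a)]
         (ins2 (inl a) (map inl l)) h (fun y => upd (upd y (inl b) (y (inl a))) (inl a) k)
         _ _ _ z) => //; last first.
  by move=> y [sy yb]; exact: PhiS_swapS.
have ab' : inl a != inl b :> T + T by rewrite (inj_eq inl_inj).
move=> y [sy yb] m /ms mm; split.
- have := near_upd m (opn_strip sy); apply: filterS => w sw; split=> //.
  case: mm => [->|[j jl ->]]; rewrite !upd_ne // ?(inj_eq inl_inj) 1?eq_sym //.
  by apply: contraNneq bl => <-.
- case: mm => [->|[j jl ->]] w; rewrite /h ?eqxx.
    apply/funext => n; rewrite /upd eqxx.
    have [->|na] := eqVneq n (inl a); first by rewrite (negbTE ab').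
    by case: eqP.
  have ja : j != a by apply: contraNneq al => <-.
  have jb : j != b by apply: contraNneq bl => <-.
  apply/funext => n; rewrite (inj_eq inl_inj) (negbTE ja) /upd.
  rewrite [inl a == inl j](inj_eq inl_inj) [a == j]eq_sym (negbTE ja).
  have [->|na] := eqVneq n (inl a); first by rewrite (inj_eq inl_inj) eq_sym (negbTE ja).
  have [->|nb] := eqVneq n (inl b); first by rewrite (inj_eq inl_inj) eq_sym (negbTE jb).
  by [].
- case: mm => [->|[j jl ->]]; rewrite /h ?eqxx; first by rewrite upd_ne ?upd_same // eq_sym.
  have ja : j != a by apply: contraNneq al => <-.
  have jb : j != b by apply: contraNneq bl => <-.
  by rewrite (inj_eq inl_inj) (negbTE ja) !upd_ne // (inj_eq inl_inj).
Qed.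

Lemma plog_swapB A l a b z k : a \in A -> b \in A -> a != b -> a \notin l ->
  strip A A z -> z (inl a) = z (inr b) -> 
  plog (ins2 (inr a) (map inl l)) (PhiS A A) z =
  plog (ins2 (inr b) (map inl l)) (PhiS (A :\ a)%SET (A :\ a)%SET)
    (upd (upd z (inr b) (z (inr a))) (inr a) k).
Proof.
move=> aA bA ab al sz zb.
pose h (m : T + T) : T + T := if m == inr a then inr b else m.
have -> : ins2 (inr b) (map inl l) = map h (ins2 (inr a) (map inl l)) :> seq (T + T).
  have hl : map h (map inl l) = map inl l by rewrite -map_comp; apply/eq_in_map.
  by case: l hl {al} => [|j l] /=; rewrite /h eqxx // => -[->].
have ms m : m \in ins2 (inr a) (map inl l) -> m = inr a \/ exists2 j, j \in l & m = inl j.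
  move=> H; suff : m \in inr a :: map inl l.
    by rewrite inE => /orP[/eqP|/mapP[j]]; [left|right; exists j].
  by case: l H {al} => [|j l] //=; rewrite !inE orbCA.
apply: (@plog_transport R _ _ [set y | strip A A y /\ y (inl a) = y (inr b)]
         (ins2 (inr a) (map inl l)) h (fun y => upd (upd y (inr b) (y (inr a))) (inr a) k)
         _ _ _ z) => //; last first.
  by move=> y [sy yb]; exact: PhiS_swapB.
have ab' : inr a != inr b :> T + T by rewrite (inj_eq inr_inj).
move=> y [sy yb] m /ms mm; split.
- have := near_upd m (opn_strip sy); apply: filterS => w sw; split=> //.
  case: mm => [->|[j jl ->]]; rewrite !upd_ne // ?(inj_eq inl_inj) ?(inj_eq inr_inj) 1?eq_sym //.
  by apply: contraNneq al => <-.
- case: mm => [->|[j jl ->]] w; rewrite /h ?eqxx.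
    apply/funext => n; rewrite /upd eqxx.
    have [->|na] := eqVneq n (inr a); first by rewrite (negbTE ab').
    by case: eqP.
  apply/funext => n; rewrite /upd /=.
  have [->|na] := eqVneq n (inr a); first by [].
  by have [->|nb] := eqVneq n (inr b).
- case: mm => [->|[j jl ->]]; rewrite /h ?eqxx; first by rewrite upd_ne ?upd_same // eq_sym.
  by rewrite !upd_ne.
Qed.


Lemma cder_upd2 (I : finType) (U : set (I -> C)) F (z0 z1 : I -> C) (k1 k2 : I) (f g : C -> C) w0
    (f' g' p q : C) : opn U -> hol U F -> k1 != k2 -> cder f w0 f' -> cder g w0 g' ->
  upd (upd z0 k1 (f w0)) k2 (g w0) = z1 -> U z1 -> pderiv k1 F z1 = p -> pderiv k2 F z1 = q ->
  cder (fun w => F (upd (upd z0 k1 (f w)) k2 (g w))) w0 (p * f' + q * g').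
Proof.
move=> oU hF k12 cf cg z1E Uz <- <-; rewrite -z1E in Uz *.
pose li k : C := if k == k1 then f' else if k == k2 then g' else 0.
have key k : cder (fun w => upd (upd z0 k1 (f w)) k2 (g w) k) w0 (li k).
  rewrite /upd /li; have [->|n1] := eqVneq k k1; first by rewrite (negbTE k12).
  by have [_|n2] := eqVneq k k2 => //; exact: cder_cst.
pose dF k : C := pderiv k F (upd (upd z0 k1 (f w0)) k2 (g w0)).
have H : cder (fun w => F (upd (upd z0 k1 (f w)) k2 (g w))) w0 (\sum_i dF i * li i).
  exact: (@cder_chain R I U F (fun w => upd (upd z0 k1 (f w)) k2 (g w)) w0 li oU hF Uz key).
have E : \sum_i dF i * li i = dF k1 * f' + dF k2 * g'.
  rewrite (bigD1 k1) //= (bigD1 k2) /= 1?eq_sym // big1 ?addr0.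
    by rewrite /li eqxx eq_sym (negbTE k12) eqxx.
  by move=> k /andP[n1 n2]; rewrite /li (negbTE n1) (negbTE n2) mulr0.
by rewrite E in H.
Qed.

(* On the diagonal the two values of b cancel, so the function is constant along it. *)
Lemma aq_diag A l b y : b \in A -> b \notin l -> {subset l <= A} -> okS A y -> y (inl b) = y (inr b) ->
  pderiv (inl b) (aq A l) y + pderiv (inr b) (aq A l) y = 0.
Proof.
move=> bA bl lA oky yb.
pose g w := upd (upd y (inl b) w) (inr b) w.
have gy : g (y (inl b)) = y by rewrite /g upd_id yb upd_id.
have h1 : cder (fun w => aq A l (g w)) (y (inl b))
    (pderiv (inl b) (aq A l) y * 1 + pderiv (inr b) (aq A l) y * 1).
  exact: (cder_upd2 (opn_okS (A := A)) (hol_aq A l) (isT : inl b != inr b :> T + T)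
    (cder_id (y (inl b))) (cder_id (y (inl b))) gy oky erefl erefl).
move: h1; move: (pderiv (inl b) _ y) (pderiv (inr b) _ y) => p q; rewrite !mulr1 => h1.
apply: (cder_uniq h1); apply: cder_ext (cder_cst (aq (A :\ b)%SET l y) _).
have [r r0 Hr] := opn_strip oky.1; apply/nbC_P; exists r => // w hw.
have sg : strip A A (g w).
  apply: Hr => k; rewrite /g /upd.
  have [->|_] := eqVneq k (inr b); first by rewrite -yb.
  by have [->|_] := eqVneq k (inl b) => //; rewrite subrr nrm0.
have gb : g w (inl b) = g w (inr b) by rewrite /g upd_ne // !upd_same.
apply: esym; rewrite -/(g w) (aq_drop bA bl sg gb); apply: aq_off.
  move=> i il; rewrite !inE lA // andbT; by apply: contraNneq bl => <-.
move=> i /finset.setD1P[ib _]; split; rewrite /g !upd_ne // ?(inj_eq inl_inj) ?(inj_eq inr_inj) //.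
Qed.

Lemma aq_ins A l b z : okS A z -> 
  plog (ins2 (inl b) (map inl l)) (PhiS A A) z = aq A (b :: l) z.
Proof.
move=> okz; apply: (plog_perm (@opn_okS A) (@hol_okS A) (@okS_neq0 A) okz).
by case: l => [|j l] //=; rewrite -[_ :: _]/([:: inl j] ++ [:: inl b] ++ map inl l) perm_catCA.
Qed.

Lemma okS_swapS A a b y k : a \in A -> b \in A -> a != b -> okS A y -> y (inl b) = y (inr a) ->
  okS (A :\ a)%SET (upd (upd y (inl b) (y (inl a))) (inl a) k).
Proof.
move=> aA bA ab [sy ny] yb; split; last by rewrite -PhiS_swapS.
case: sy => h1 h2; split=> i /finset.setD1P[ia iA]; rewrite upd_ne ?(inj_eq inl_inj) //.
  have [->|ib] := eqVneq i b; first by rewrite upd_same; exact: h1.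
  by rewrite upd_ne ?(inj_eq inl_inj) //; exact: h1.
by rewrite upd_ne //; exact: h2.
Qed.

Lemma okS_swapB A a b y k : a \in A -> b \in A -> a != b -> okS A y -> y (inl a) = y (inr b) ->
  okS (A :\ a)%SET (upd (upd y (inr b) (y (inr a))) (inr a) k).
Proof.
move=> aA bA ab [sy ny] yb; split; last by rewrite -PhiS_swapB.
case: sy => h1 h2; split=> i /finset.setD1P[ia iA]; rewrite upd_ne ?(inj_eq inr_inj) //.
  by rewrite upd_ne //; exact: h1.
have [->|ib] := eqVneq i b; first by rewrite upd_same; exact: h2.
by rewrite upd_ne ?(inj_eq inr_inj) //; exact: h2.
Qed.

(* Moving w moves the S-value - w and the B-value w of a. Each of these two variables alone
   leaves a cancelling pair among the others, and takes over the role of b in A :\ a. *)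
Lemma aq_cder A l a b z : a \in A -> b \in A -> a != b -> a \notin l -> b \notin l ->
  {subset l <= A} -> z (inl b) = - z (inr b) ->
  okS A (upd (upd z (inl a) (z (inr b))) (inr a) (- z (inr b))) ->
  cder (fun w => aq A l (upd (upd z (inl a) (- w)) (inr a) w)) (- z (inr b))
    (- ((if l is [::] then PhiS A A (upd (upd z (inl a) (z (inr b))) (inr a) (- z (inr b))) else 1) *
      (aq (A :\ a)%SET (b :: l) (upd z (inl b) (z (inr b))) +
       aq (A :\ a)%SET (b :: l) (upd z (inr b) (- z (inr b)))))).
Proof.
move=> aA bA ab al bl lA zb; set be := z (inr b); set z1 := upd _ _ _ => ok1.
have z1E : upd (upd z (inl a) (- - be)) (inr a) (- be) = z1 by rewrite opprK.
set m : C := if l is [::] then _ else _.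
have mE k : pderiv k (aq A l) z1 = m * plog (ins2 k (map inl l)) (PhiS A A) z1.
  apply: etrans (pderiv_pdlog k (map inl l) (okS_neq0 ok1)) _.
  by rewrite /m; case: (l).
have ab' : inl b != inl a :> T + T by rewrite (inj_eq inl_inj) eq_sym.
have ab'' : inr b != inr a :> T + T by rewrite (inj_eq inr_inj) eq_sym.
have zlb : z1 (inl b) = - be by rewrite /z1 !upd_ne.
have zrb : z1 (inr b) = be by rewrite /z1 !upd_ne.
have zla : z1 (inl a) = be by rewrite /z1 upd_ne // upd_same.
have zra : z1 (inr a) = - be by rewrite /z1 upd_same.
have e1 : z1 (inl b) = z1 (inr a) by rewrite zlb zra.
have e2 : z1 (inl a) = z1 (inr b) by rewrite zla zrb.
have lA' : {subset b :: l <= (A :\ a)%SET}.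
  move=> i; rewrite !inE => /orP[/eqP->|il]; first by rewrite bA eq_sym ab.
  by rewrite lA // andbT; apply: contraNneq al => <-.
have bA' : b \in (A :\ a)%SET by apply: lA'; exact: mem_head.
have lA'' : {subset l <= (A :\ a)%SET} by move=> i il; apply: lA'; rewrite inE il orbT.
have ok2 := okS_swapS 0 aA bA ab ok1 e1.
have ok3 := okS_swapB 0 aA bA ab ok1 e2.
have m1 := etrans (mE (inl a)) (congr1 ( *%R m) (plog_swapS 0 aA bA ab al bl ok1.1 e1)).
have m2 := etrans (mE (inr a)) (congr1 ( *%R m) (plog_swapB 0 aA bA ab al ok1.1 e2)).
set y2 := upd (upd z1 _ _) _ _ in ok2 m1; set y3 := upd (upd z1 _ _) _ _ in ok3 m2.
have y3b : y3 (inl b) = y3 (inr b).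
  by rewrite /y3 [LHS]upd_ne // [LHS]upd_ne // zlb [RHS]upd_ne // upd_same zra.
(* The B-derivative left by moving [inr a] is not one of the derivatives occurring in [aq].
   Constancy along the diagonal turns it into minus an S-derivative. *)
have dg := aq_diag bA' bl lA'' ok3 y3b.
have pE k : pderiv k (aq (A :\ a)%SET l) y3 =
    (if l is [::] then PhiS (A :\ a)%SET (A :\ a)%SET y3 else 1) *
      plog (ins2 k (map inl l)) (PhiS (A :\ a)%SET (A :\ a)%SET) y3.
  apply: etrans (pderiv_pdlog k (map inl l) (okS_neq0 ok3)) _.
  by case: (l).
have {pE}dg := etrans (esym (congr2 +%R (pE (inl b)) (pE (inr b)))) dg; rewrite -mulrDr in dg.
have n3 : (if l is [::] then PhiS (A :\ a)%SET (A :\ a)%SET y3 else 1) != 0.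
  by case: (l) => [|? ?]; [exact: (okS_neq0 ok3)|exact: oner_neq0].
have {}dg : plog (ins2 (inr b) (map inl l)) (PhiS (A :\ a)%SET (A :\ a)%SET) y3 =
   - plog (ins2 (inl b) (map inl l)) (PhiS (A :\ a)%SET (A :\ a)%SET) y3.
  move/eqP: dg; rewrite mulf_eq0 (negbTE n3) /= => /eqP h.
  by apply/eqP; rewrite -addr_eq0 addrC h.
rewrite {}dg (aq_ins _ _ ok3) in m2; rewrite (aq_ins _ _ ok2) in m1.
have E2 : aq (A :\ a)%SET (b :: l) y2 = aq (A :\ a)%SET (b :: l) (upd z (inl b) be).
  apply: aq_off => // i /finset.setD1P[ia iA]; rewrite /y2 zla.
  rewrite !(upd_ne _ _ (i := inl a)) ?(inj_eq inl_inj) //; split.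
    have [->|ib] := eqVneq i b; first by rewrite !upd_same.
    by rewrite /z1 !upd_ne ?(inj_eq inl_inj).
  by rewrite /z1 !upd_ne ?(inj_eq inr_inj).
have E3 : aq (A :\ a)%SET (b :: l) y3 = aq (A :\ a)%SET (b :: l) (upd z (inr b) (- be)).
  apply: aq_off => // i /finset.setD1P[ia iA]; rewrite /y3 zra.
  rewrite !(upd_ne _ _ (i := inr a)) ?(inj_eq inr_inj) //; split.
    by rewrite /z1 !upd_ne ?(inj_eq inl_inj).
  have [->|ib] := eqVneq i b; first by rewrite !upd_same.
  by rewrite /z1 !upd_ne ?(inj_eq inr_inj).
rewrite {}E2 in m1; rewrite {}E3 in m2.
have := cder_upd2 (opn_okS (A := A)) (hol_aq A l) (isT : inl a != inr a :> T + T)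
  (cderN (cder_id (- be))) (cder_id (- be)) z1E ok1 m1 m2.
by rewrite mulrN1 mulr1 mulrN -opprD -mulrDr.
Qed.


(* A_part A x D W if W is nonempty (A_part_Aw), A_DL A x A x D if W is empty (A_DL_Aw) *)
Definition Aw A x D W : C := aq A (enum W) (pt (swap D x) x).

Definition sx A x := forall i, i \in A -> `|complex.Re (x i)| < 4^-1.

Lemma A_part_Aw A x D W : W != finset.set0 -> W \subset ~: D -> A_part A x D W = Aw A x D W.
Proof.
move=> W0 WD; have wi : enum W != [::] by rewrite -size_eq0 -cardE cards_eq0.
rewrite /Aw /aq.
have -> : pdlog (map inl (enum W)) (PhiS A A) = plog (map inl (enum W)) (PhiS A A).
  by case: (enum W) wi.
have -> : A_part A x D W = plog (enum W) (fun y : T -> C => PhiS A A (pt (swap D y) x)) x.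
  rewrite -[LHS]/(plog (enum W) (fun y : T -> C => A_DL A y A x D) x).
  by have -> : (fun y : T -> C => A_DL A y A x D) = (fun y : T -> C => PhiS A A (pt (swap D y) x))
    by apply/funext => y; exact: A_DL_Phi.
apply: (@plog_transport R _ _ setT (enum W) inl (fun y : T -> C => pt (swap D y) x)
  (fun y : T -> C => PhiS A A (pt (swap D y) x)) (PhiS A A) (enum W) x) => //.
  move=> y _ i; rewrite mem_enum => iW; have iD : i \notin D by have := fintype.subsetP WD i iW; rewrite inE.
  split; [exact: filterE| |by rewrite /pt /swap (negbTE iD)].
  move=> w; apply/funext => -[j|j]; rewrite /pt /swap /upd /=; last by [].
  have [->|ji] := eqVneq j i; first by rewrite (negbTE iD) eqxx.
  by rewrite (inj_eq inl_inj) (negbTE ji).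
Qed.

Lemma A_DL_Aw A x D : A_DL A x A x D = Aw A x D finset.set0.
Proof. by rewrite A_DL_Phi /Aw enum_set0. Qed.

Lemma ReN_norm (u : C) : `|complex.Re (- u)| = `|complex.Re u|.
Proof. by rewrite ReN normrN. Qed.

Lemma strip_sx A x D : sx A x -> strip A A (pt (swap D x) x).
Proof. by move=> s; split=> i iA /=; rewrite /swap; try case: ifP => _; rewrite ?ReN_norm s. Qed.

Lemma okS_Aw A x D : sx A x -> Aw A x D finset.set0 != 0 -> okS A (pt (swap D x) x).
Proof. by move=> s; rewrite /Aw enum_set0; split => //; exact: strip_sx. Qed.

Lemma an_Aw A x D W a w0 : sx A (upd x a w0) -> Aw A (upd x a w0) D finset.set0 != 0 ->
  an (fun w => Aw A (upd x a w) D W) w0.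
Proof.
move=> s nz; have ok := okS_Aw s nz.
apply: (an_compN (L := fun w => pt (swap D (upd x a w)) (upd x a w)) (@opn_okS A) (hol_aq A (enum W)) ok).
have anu i : an (fun w => upd x a w i) w0.
  by rewrite /upd; case: eqP => _; [exact: an_id|exact: an_cst].
move=> [i|i]; last exact: anu.
by rewrite /= /swap; case: (i \in D); [apply: anN|]; exact: anu.
Qed.

Lemma Aw_off A x x' D D' W : W \subset A -> {in A, x =1 x'} -> {in A, D =i D'} ->
  Aw A x D W = Aw A x' D' W.
Proof.
move=> WA xx DD; apply: aq_off => [i|i iA]; first by rewrite mem_enum => /(fintype.subsetP WA).
by rewrite /pt /swap /= DD // xx.
Qed.

Lemma Aw_drop A x D W c : c \in A -> c \notin D -> c \notin W -> sx A x ->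
  Aw A x D W = Aw (A :\ c)%SET x D W.
Proof.
move=> cA cD cW s; apply: aq_drop => //; first by rewrite mem_enum.
  exact: strip_sx.
by rewrite /= /swap (negbTE cD).
Qed.

(** An index outside D has equal S- and B-values and drops out. Hence A_DL(D,D,D) is A_DL(A,B,D) at
    B = A, and the single family [Aw] covers both the prefactor and the blocks. *)
Lemma Aw_D A x D : D \subset A -> sx A x -> Aw A x D finset.set0 = Aw D x D finset.set0.
Proof.
move=> DA; move En : #|A :\: D|%SET => n; elim: n A DA En => [|n IH] A DA En s.
  move/eqP: En; rewrite cards_eq0 finset.setD_eq0 => AD.
  by have -> : A = D by apply/eqP; rewrite finset.eqEsubset AD.
have [c] : exists c, c \in (A :\: D)%SET by apply/set0Pn; rewrite -cards_eq0 En.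
have c0 : c \notin finset.set0 by rewrite inE.
rewrite inE => /andP[cD cA]; rewrite (Aw_drop cA cD c0 s); apply: IH.
- by rewrite subsetD1 DA.
- move: En; rewrite (cardsD1 c) !inE cD cA /= => -[<-].
  by rewrite add0n; apply: eq_card => i; rewrite !inE andbCA.
- by move=> i /finset.setD1P[_]; exact: s.
Qed.

Lemma Aw_drop2 A x D W a b : a \in A -> b \in A -> a != b -> a \in D -> b \in D -> 
  a \notin W -> b \notin W -> W \subset A -> sx A x -> x a = - x b ->
  Aw A x D W = Aw (A :\ a :\ b)%SET x (D :\ a :\ b)%SET W.
Proof.
move=> aA bA ab aD bD aW bW WA s xab; rewrite /Aw.
rewrite (aq_drop2 (a := a) (b := b)) //; rewrite ?mem_enum //; first last.
- by rewrite /= /swap bD xab.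
- by rewrite /= /swap aD xab opprK.
- exact: strip_sx.
apply: aq_off => [i|i]; last first.
  by rewrite !inE => /andP[ib /andP[ia _]]; rewrite /= /swap !inE ib ia.
rewrite mem_enum => iW; rewrite !inE (fintype.subsetP WA) // andbT.
by apply/andP; split; apply: contraTneq iW => ->.
Qed.

Lemma Aw_relabel A x D W a b : a \in A -> b \in A -> a != b -> a \in D -> b \notin D -> 
  a \notin W -> W \subset A -> sx A x -> x a = - x b ->
  Aw A x D W = Aw (A :\ a)%SET (upd x b (- x b)) (b |: D :\ a)%SET W.
Proof.
move=> aA bA ab aD bD aW WA s xab; rewrite /Aw.
rewrite (aq_swapB (a := a) (b := b)) //; rewrite ?mem_enum //; first last.
- by rewrite /= /swap aD xab opprK.
- exact: strip_sx.
apply: aq_off => [i|i]; first rewrite mem_enum => iW.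
  by rewrite !inE (fintype.subsetP WA) // andbT; apply: contraTneq iW => ->.
rewrite !inE => /andP[ia iA]; split.
  rewrite upd_ne //= /swap !inE ia /=; have [->|ib] := eqVneq i b.
    by rewrite (negbTE bD) upd_same opprK.
  by rewrite upd_ne.
rewrite /=; have [->|ib] := eqVneq i b; first by rewrite !upd_same.
by rewrite !upd_ne // (inj_eq inr_inj).
Qed.

Lemma Aw_zero A x D W a : a \in A -> a \in D -> a \notin W -> W \subset A -> sx A x -> x a = 0 ->
  Aw A x D W = Aw (A :\ a)%SET x (D :\ a)%SET W.
Proof.
move=> aA aD aW WA s x0; rewrite /Aw.
rewrite (aq_drop (c := a)) //; rewrite ?mem_enum //; first last.
- by rewrite /= /swap aD x0 oppr0.
- exact: strip_sx.
apply: aq_off => [i|i]; last first.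
  by rewrite !inE => /andP[ia _]; rewrite /= /swap !inE ia.
by rewrite mem_enum => iW; rewrite !inE (fintype.subsetP WA) // andbT; apply: contraTneq iW => ->.
Qed.

Lemma Aw_U1 A x D W b : b \notin W -> sx A x -> Aw A x D finset.set0 != 0 ->
  aq A (b :: enum W) (pt (swap D x) x) = Aw A x D (b |: W)%SET.
Proof.
move=> bW s nz; have ok := okS_Aw s nz.
have p : perm_eq (b :: enum W) (enum (b |: W)%SET).
  apply: uniq_perm; rewrite ?cons_uniq ?enum_uniq ?mem_enum ?bW //.
  by move=> i; rewrite inE !mem_enum !inE.
have -> : Aw A x D (b |: W)%SET = plog (map inl (enum (b |: W)%SET)) (PhiS A A) (pt (swap D x) x).
  by rewrite /Aw /aq; have := perm_size p; case: (enum (b |: W)%SET).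
exact: (plog_perm (@opn_okS A) (@hol_okS A) (@okS_neq0 A) ok (perm_map inl p)).
Qed.

Lemma Aw_cder A x D W a b : a \in A -> b \in A -> a != b -> a \in D -> b \in D ->
  a \notin W -> b \notin W -> W \subset A -> sx (A :\ a)%SET x ->
  Aw A (upd x a (- x b)) D finset.set0 != 0 ->
  cder (fun w => Aw A (upd x a w) D W) (- x b)
    (- ((if W == finset.set0 then Aw A (upd x a (- x b)) D finset.set0 else 1) *
        (Aw (A :\ a)%SET x (D :\ a :\ b)%SET (b |: W)%SET +
         Aw (A :\ a)%SET (upd x b (- x b)) (D :\ a :\ b)%SET (b |: W)%SET))).
Proof.
move=> aA bA ab aD bD aW bW WA s nz.
have ba : b != a by rewrite eq_sym.
have bA' : b \in (A :\ a)%SET by rewrite !inE ba.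
have s1 : sx A (upd x a (- x b)).
  move=> i iA; rewrite /upd; case: eqP => [_|/eqP ia]; last by rewrite s // !inE ia.
  by rewrite ReN_norm s.
have s2 : sx (A :\ a)%SET (upd x b (- x b)).
  move=> i iA; rewrite /upd; case: eqP => [_|_]; last by rewrite s.
  by rewrite ReN_norm s.
pose z := pt (swap D x) x.
have zE w : pt (swap D (upd x a w)) (upd x a w) = upd (upd z (inl a) (- w)) (inr a) w.
  apply/funext => -[i|i].
    rewrite [RHS]upd_ne // /upd (inj_eq inl_inj) /= /swap /upd; case: (eqVneq i a) => [->|_] //.
    by rewrite aD.
  rewrite /= /upd (inj_eq inr_inj); by case: eqP.
have zb : z (inl b) = - z (inr b) by rewrite /= /swap bD.
have W0 : (enum W == [::]) = (W == finset.set0) by rewrite -size_eq0 -cardE cards_eq0.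
have lA : {subset enum W <= A} by move=> i; rewrite mem_enum => /(fintype.subsetP WA).
have okz : okS A (upd (upd z (inl a) (z (inr b))) (inr a) (- z (inr b))).
  by have := okS_Aw s1 nz; rewrite zE /= opprK.
have am : a \notin enum W by rewrite mem_enum.
have bm : b \notin enum W by rewrite mem_enum.
have H := aq_cder aA bA ab am bm lA zb okz.
have -> : (fun w => Aw A (upd x a w) D W) =
    (fun w => aq A (enum W) (upd (upd z (inl a) (- w)) (inr a) w)).
  by apply/funext => w; rewrite /Aw zE.
have lA' : {subset b :: enum W <= (A :\ a)%SET}.
  move=> i; rewrite inE mem_enum => /orP[/eqP-> //|iW].
  by rewrite !inE (fintype.subsetP WA) // andbT; apply: contraTneq iW => ->.
have E2 : aq (A :\ a)%SET (b :: enum W) (upd z (inl b) (z (inr b))) =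
    aq (A :\ a)%SET (b :: enum W) (pt (swap (D :\ a :\ b)%SET x) x).
  apply: aq_off => // i; rewrite !inE => /andP[ia _].
  split; last by rewrite upd_ne.
  have [->|ib] := eqVneq i b; first by rewrite upd_same /= /swap !inE eqxx.
  by rewrite upd_ne ?(inj_eq inl_inj) //= /swap !inE ib ia.
have E3 : aq (A :\ a)%SET (b :: enum W) (upd z (inr b) (- z (inr b))) =
    aq (A :\ a)%SET (b :: enum W) (pt (swap (D :\ a :\ b)%SET (upd x b (- x b))) (upd x b (- x b))).
  apply: aq_off => // i; rewrite !inE => /andP[ia _].
  have [->|ib] := eqVneq i b; first by rewrite upd_same upd_ne //= /swap !inE eqxx bD upd_same.
  by rewrite !upd_ne ?(inj_eq inr_inj) //= /swap !inE ib ia !upd_ne.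
(* Dropping [a] and [b] crosswise at the collision, or [b] alone at [x] and at the negated point,
   leads to the same Euler product on [A :\ a :\ b]; its non-vanishing is therefore shared. *)
have n2 : Aw (A :\ a)%SET x (D :\ a :\ b)%SET finset.set0 != 0.
  rewrite (Aw_drop2 aA bA ab aD bD) ?inE ?finset.sub0set ?upd_same ?upd_ne // in nz.
  rewrite (Aw_drop bA') ?inE ?eqxx //.
  rewrite (Aw_off (x := upd x a (- x b)) (x' := x) (D' := (D :\ a :\ b)%SET)) ?finset.sub0set // in nz.
  by move=> i; rewrite !inE => /andP[_ /andP[ia _]]; rewrite upd_ne.
have n3 : Aw (A :\ a)%SET (upd x b (- x b)) (D :\ a :\ b)%SET finset.set0 != 0.
  rewrite (Aw_drop2 aA bA ab aD bD) ?inE ?finset.sub0set ?upd_same ?upd_ne // in nz.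
  rewrite (Aw_drop bA') ?inE ?eqxx //.
  rewrite (Aw_off (x := upd x a (- x b)) (x' := upd x b (- x b)) (D' := (D :\ a :\ b)%SET)) ?finset.sub0set // in nz.
  by move=> i; rewrite !inE => /andP[ib /andP[ia _]]; rewrite !upd_ne.
rewrite E2 E3 (Aw_U1 bW s n2) (Aw_U1 bW s2 n3) in H.
move: H; rewrite -W0; rewrite /Aw enum_set0 zE /= opprK.
by case: (enum W).
Qed.

End ArithmeticPart.

(** * Sums over set partitions *)

Section Partitions.
Context {T : finType} {K : comPzRingType}.
Implicit Types (A B W : {set T}) (P : {set {set T}}) (c : T) (h : {set T} -> K).

(** P corresponds to the pair (W, P \ W). In the converse direction a partition of A \ W cannot
    contain W, because W is nonempty. *)
Lemma sum_partition_block (F : {set T} -> {set {set T}} -> K) A :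
  \sum_(P : {set {set T}} | finset.partition P A) \sum_(W in P) F W (P :\ W)%SET =
  \sum_(W : {set T} | (W != finset.set0) && (W \subset A))
    \sum_(P : {set {set T}} | finset.partition P (A :\: W)%SET) F W P.
Proof.
rewrite (exchange_big_dep (fun W : {set T} => (W != finset.set0) && (W \subset A))) /=; last first.
  by move=> P W pP WP; rewrite (partition_neq0 pP WP) (partitionS pP WP).
apply: eq_bigr => W /andP[W0 WA].
rewrite (reindex_onto (fun P => W |: P)%SET (fun P => P :\ W)%SET) /=; last first.
  by move=> P /andP[_ WP]; rewrite finset.setD1K.
apply: eq_big => [P|P /andP[_ /eqP->]]; last by [].
apply/idP/idP.
  move=> /andP[/andP[pP WP] /eqP E]; rewrite -E; exact: partitionD1.
move=> pP.
have WP : W \notin P.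
  apply: contraNN W0 => WP; have := partitionS pP WP => WA'.
  by rewrite -finset.subset0 -(finset.setDv W); apply/fintype.subsetP => i iW; have := fintype.subsetP WA' i iW; rewrite !inE iW.
rewrite setU11 andbT finset.setU1K // eqxx andbT.
have dW : fintype.disjoint (mem W) (mem (A :\: W)%SET).
  by rewrite -finset.setI_eq0; apply/eqP/setP => i; rewrite !inE; case: (i \in W).
have := partitionU1 pP W0 dW; congr (finset.partition _ _).
apply/setP => i; rewrite !inE; case iW: (i \in W) => //=.
by rewrite (fintype.subsetP WA).
Qed.

Definition Part A h := \sum_(P : {set {set T}} | finset.partition P A) \prod_(W in P) h W.

Lemma eq_Part A h h' : (forall W, W != finset.set0 -> W \subset A -> h W = h' W) ->
  Part A h = Part A h'.
Proof.
move=> hh; apply: eq_bigr => P pP; apply: eq_bigr => W WP.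
by apply: hh; [exact: (partition_neq0 pP)|exact: (partitionS pP)].
Qed.

Lemma Part_rec A h c : c \in A ->
  Part A h = \sum_(W : {set T} | (W \subset A) && (c \in W)) h W * Part (A :\: W)%SET h.
Proof.
(* The weight vanishes unless the marked block contains [c], so exactly one block of each partition
   counts. *)
move=> cA; pose F W P := if c \in W then h W * \prod_(V in P) h V else 0.
have -> : Part A h = \sum_(P : {set {set T}} | finset.partition P A) \sum_(W in P) F W (P :\ W)%SET.
  apply: eq_bigr => P pP; have tP : finset.trivIset P by case/and3P: pP.
  have cP : c \in finset.cover P by rewrite (cover_partition pP).
  have bP := pblock_mem cP.
  rewrite [RHS](bigD1 _ bP) /= [X in _ + X]big1 ?addr0.
    by rewrite /F mem_pblock cP (big_setD1 _ bP).
  move=> W /andP[WP nW]; rewrite /F; case: ifP => // cW.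
  by rewrite (def_pblock tP WP cW) eqxx in nW.
rewrite sum_partition_block big_mkcond [RHS]big_mkcond; apply: eq_bigr => W _.
case WA: (W \subset A); rewrite ?andbF //= andbT.
case cW: (c \in W).
  have -> : W != finset.set0 by apply/set0Pn; exists c.
  by rewrite mulr_sumr; apply: eq_bigr => P _; rewrite /F cW.
case: ifP => // _; rewrite big1 // => P _; by rewrite /F cW.
Qed.

(** The empty W stands for the singleton block of [c]; the nonempty ones reproduce the shape of the
    derivative in [cder_Part], with [h (c |: W)] in place of the derivative of the block W. *)
Lemma Part_recU A h c : c \notin A ->
  Part (c |: A)%SET h = \sum_(W : {set T} | W \subset A) h (c |: W)%SET * Part (A :\: W)%SET h.
Proof.
move=> cA; rewrite (Part_rec _ (c := c)) ?setU11 //.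
rewrite (reindex_onto (fun W => c |: W)%SET (fun W => W :\ c)%SET) /=; last first.
  by move=> W /andP[_ cW]; rewrite finset.setD1K.
apply: eq_big => [W|W /andP[/andP[WA _] /eqP E]].
  apply/idP/idP => [/andP[/andP[WA _] /eqP <-]|WA].
    by rewrite finset.subDset.
  have cW : c \notin W by apply: contraNN cA; exact: fintype.subsetP.
  by rewrite finset.setUS // setU11 finset.setU1K // eqxx.
congr (_ * Part _ _); apply/setP => i; rewrite !inE; have [->|] := eqVneq i c => //=.
by rewrite (negbTE cA) andbF.
Qed.

Lemma Part_deriv A h (h' : {set T} -> K) :
  \sum_(P : {set {set T}} | finset.partition P A)
     \sum_(W in P) h' W * \prod_(V in (P :\ W)%SET) h V =
  \sum_(W : {set T} | (W != finset.set0) && (W \subset A)) h' W * Part (A :\: W)%SET h.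
Proof.
rewrite (sum_partition_block (fun W P => h' W * \prod_(V in P) h V)).
by apply: eq_bigr => W _; rewrite mulr_sumr.
Qed.

End Partitions.

Section PartitionAnalysis.
Context {R : realType} {T : finType}.
Local Notation C := (cplx R).

Lemma cder_bigprod (J : finType) (P : {set J}) (f : J -> C -> C) (f' : J -> C) z :
  (forall i, i \in P -> cder (f i) z (f' i)) ->
  cder (fun w => \prod_(i in P) f i w) z (\sum_(i in P) f' i * \prod_(j in (P :\ i)%SET) f j z).
Proof.
move En : #|P| => n; elim: n P En => [|n IH] P En H.
  move/eqP: En; rewrite cards_eq0 => /eqP ->; rewrite big_set0.
  have -> : (fun w => \prod_(i in finset.set0) f i w) = fun=> 1 by apply/funext => w; rewrite big_set0.
  exact: cder_cst.
have [c cP] : exists c, c \in P by apply/set0Pn; rewrite -cards_eq0 En.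
have Ec : #|P :\ c| = n by move: En; rewrite (cardsD1 c) cP => -[].
have H1 i : i \in (P :\ c)%SET -> cder (f i) z (f' i) by move=> /finset.setD1P[_]; exact: H.
have -> : (fun w => \prod_(i in P) f i w) = (fun w => f c w * \prod_(i in (P :\ c)%SET) f i w).
  by apply/funext => w; rewrite (big_setD1 c).
have := cderM (H c cP) (IH _ Ec H1).
have -> // : f' c * \prod_(i in (P :\ c)%SET) f i z +
    f c z * (\sum_(i in (P :\ c)%SET) f' i * \prod_(j in (P :\ c :\ i)%SET) f j z) =
  \sum_(i in P) f' i * \prod_(j in (P :\ i)%SET) f j z.
rewrite [RHS](big_setD1 c) //=; congr (_ + _); rewrite mulr_sumr; apply: eq_bigr => i /finset.setD1P[ic iP].
rewrite [in RHS](big_setD1 c) /=; last by rewrite !inE eq_sym ic.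
rewrite mulrCA; congr (_ * (_ * _)); apply: eq_bigl => j; by rewrite !inE andbCA.
Qed.

Lemma cder_Part (A : {set T}) (h : C -> {set T} -> C) (h' : {set T} -> C) z :
  (forall W : {set T}, W != finset.set0 -> W \subset A -> cder (h ^~ W) z (h' W)) ->
  cder (fun w => Part A (h w)) z
    (\sum_(W : {set T} | (W != finset.set0) && (W \subset A)) h' W * Part (A :\: W)%SET (h z)).
Proof.
move=> H; rewrite -Part_deriv; apply: cder_sum => P pP; apply: cder_bigprod => W WP.
by apply: H; [exact: (partition_neq0 pP)|exact: (partitionS pP)].
Qed.

Lemma an_Part (A : {set T}) (h : C -> {set T} -> C) z :
  (forall W : {set T}, W != finset.set0 -> W \subset A -> an (h ^~ W) z) ->
  an (fun w => Part A (h w)) z.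
Proof.
move=> H; apply: an_sum => P pP; apply: an_prod => W WP.
by apply: H; [exact: (partition_neq0 pP)|exact: (partitionS pP)].
Qed.

End PartitionAnalysis.

(** * The summands of J* *)

Section ZetaPrefactor.
Context {R : realType}.
Local Notation C := (cplx R).
Implicit Types (u v w : C) (d : nat).

Lemma derive1_shift (f : C -> C) (c v : C) :
  derive1 f (c + v) = derive1 (fun u => f (c + u)) v.
Proof.
have E : (fun h : C => h^-1 *: (f (h + (c + v)) - f (c + v))) =
         (fun h : C => h^-1 *: (f (c + (h + v)) - f (c + v))).
  by apply/funext => h; rewrite addrCA.
by rewrite /derive1 E.
Qed.

Definition lz v : C := logder (@zeta R) (1 + v).
Definition lzr v : C := derive1 zeta_res v / zeta_res v.

Lemma lzE v : lz v = derive1 (fun u : C => zeta (1 + u)) v / zeta (1 + v).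
Proof. by rewrite /lz /logder derive1_shift. Qed.

Lemma an_lz v : -1 < complex.Re v -> v != 0 -> zeta (1 + v) != 0 -> an lz v.
Proof.
move=> v1 v0 z0; have az := an_zeta v1 v0.
have -> : lz = (fun w => derive1 (fun u : C => zeta (1 + u)) w * (zeta (1 + w))^-1).
  by apply/funext => w; exact: lzE.
by apply: anM; [exact: an_derive|exact: anV].
Qed.

Lemma an_lzr v : -1 < complex.Re v -> zeta_res v != 0 -> an lzr v.
Proof.
move=> v1 z0; have az := an_zeta_res v1.
by apply: anM; [exact: an_derive|exact: anV].
Qed.

Lemma near_Re_gt (v : C) (r : R) : r < complex.Re v -> \forall w \near nbC v, r < complex.Re w.
Proof.
move=> rv; apply/nbC_P; exists (complex.Re v - r); first by rewrite subr_gt0.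
move=> w hw; have := le_lt_trans (Re_le_nrm _) hw; rewrite ReB ltr_norml => /andP[h _].
by move: h; lra.
Qed.

Lemma near_neq (v c : C) : v != c -> \forall w \near nbC v, w != c.
Proof.
move=> vc; apply/nbC_P; exists (nrm (v - c)); first by rewrite nrm_gt0 subr_eq0.
by move=> w; apply: contraTneq => ->; rewrite nrmBC ltxx.
Qed.

Lemma lz_pole v : -1 < complex.Re v -> v != 0 -> zeta_res v != 0 -> lz v = lzr v - v^-1.
Proof.
move=> v1 v0 z0; rewrite lzE zeta1E //.
have h1 := an_cder (an_zeta_res v1).
have h2 := cderM h1 (cderV (f := fun w : C => w) v0 (cder_id v)).
have near : \forall w \near nbC v, zeta_res w * w^-1 = zeta (1 + w).
  by apply: filterS2 (near_Re_gt v1) (near_neq v0) => w w1 w0; rewrite zeta1E.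
rewrite (cder_derive1 (cder_ext near h2)) /lzr.
move: (derive1 _ v) (zeta_res v) z0 v0 => p q q0 v0.
by field; rewrite v0 q0.
Qed.

Lemma an_derive_lz v : -1 < complex.Re v -> v != 0 -> zeta (1 + v) != 0 -> an (derive1 lz) v.
Proof. by move=> v1 v0 z0; apply: an_derive; exact: an_lz. Qed.

Lemma derive_lz_pole v : -1 < complex.Re v -> v != 0 -> zeta_res v != 0 ->
  derive1 lz v = derive1 lzr v + v^-1 ^+ 2.
Proof.
move=> v1 v0 z0.
have h := cderB (an_cder (an_lzr v1 z0)) (cderV (f := fun w : C => w) v0 (cder_id v)).
have near : \forall w \near nbC v, lzr w - w^-1 = lz w.
  apply: filterS3 (near_Re_gt v1) (near_neq v0) (an_neq0 (an_zeta_res v1) z0) => w w1 w0 wz.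
  by rewrite lz_pole.
rewrite (cder_derive1 (cder_ext near h)); move: (derive1 _ v) => p; field; exact: v0.
Qed.

(** The contribution of one element of D to the power of d/pi and the Gamma quotient; [psi_gd]
    identifies it with [psi_DL] at 1/2 + u. *)
Definition gd d u : C :=
  rpow (d%:R / pi) (- u) * (cGamma (4^-1 - u / 2) / cGamma (4^-1 + u / 2)).

Lemma gdN d u : gd d (- u) = (gd d u)^-1.
Proof. by rewrite /gd invfM invf_div rpowN mulNr !opprK. Qed.

Lemma psi_gd d u : (0 < d)%N -> psi_DL d (2^-1 + u) = gd d u.
Proof.
move=> d0; rewrite /psi_DL /gd; congr (_ * _).
  have dp : 0 < d%:R / pi :> R by rewrite divr_gt0 ?pi_gt0 // ltr0n.
  by rewrite /rpow -invf_div lnV // of_realN mulrN mulNr addrC addKr.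
by congr (cGamma _ / cGamma _); field.
Qed.

Lemma Re_half u : complex.Re (u / 2) = complex.Re u / 2.
Proof.
have -> : (2^-1 : C) = of_real (2^-1) by rewrite of_realV of_real_nat.
by rewrite mulrC cReMr mulrC.
Qed.

Lemma Re_quarter : complex.Re (4^-1 : C) = 4^-1.
Proof. by have -> : (4^-1 : C) = of_real (4^-1) by rewrite of_realV of_real_nat. Qed.

Lemma gd_args u : `|complex.Re u| < 4^-1 ->
  0 < complex.Re (4^-1 - u / 2 : C) /\ 0 < complex.Re (4^-1 + u / 2 : C).
Proof.
by rewrite ltr_norml ReB ReD Re_half Re_quarter => /andP[h1 h2]; split; lra.
Qed.

Lemma an_gd d u : `|complex.Re u| < 4^-1 -> an (gd d) u.
Proof.
move=> /gd_args[h1 h2]; have hf : an (fun w : C => w / 2) u by apply: anM; [exact: an_id|exact: an_cst].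
apply: anM; first by apply: an_rpow; apply: anN; exact: an_id.
apply: anM.
  apply: (an_comp (psi := fun w : C => 4^-1 - w / 2)); last exact: an_cGamma.
  by apply: anB => //; exact: an_cst.
apply: anV; first exact: cGamma_neq0.
apply: (an_comp (psi := fun w : C => 4^-1 + w / 2)); last exact: an_cGamma.
by apply: anD => //; exact: an_cst.
Qed.

Lemma gd_neq0 d u : `|complex.Re u| < 4^-1 -> gd d u != 0.
Proof.
move=> /gd_args[h1 h2]; rewrite /gd mulf_neq0 ?rpow_neq0 // mulf_neq0 ?invr_eq0 //; exact: cGamma_neq0.
Qed.

Lemma logder_psi d u : (0 < d)%N -> logder (@psi_DL R d) (2^-1 + u) = derive1 (gd d) u / gd d u.
Proof.
move=> d0; rewrite /logder derive1_shift (psi_gd u d0).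
have -> // : (fun v : C => psi_DL d (2^-1 + v)) = gd d.
by apply/funext => v; rewrite psi_gd.
Qed.

(** Differentiating gd(u) gd(- u) = 1 shows that the logarithmic derivative is even. *)
Lemma logder_gdN d u : `|complex.Re u| < 4^-1 ->
  derive1 (gd d) (- u) / gd d (- u) = derive1 (gd d) u / gd d u.
Proof.
move=> hu; have hu' : `|complex.Re (- u)| < 4^-1 by rewrite ReN_norm.
have h1 := an_cder (an_gd d hu); have h2 := an_cder (an_gd d hu').
have h3 := cderM h1 (cder_comp (cderN (cder_id u)) h2).
have near : \forall w \near nbC u, 1 = gd d w * gd d (- w).
  have [dl dl0 Hd] := proj1 (nbC_P _ _) (an_neq0 (an_gd d hu) (gd_neq0 d hu)).
  by apply/nbC_P; exists dl => // w /Hd w0; rewrite gdN divff.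
have := cder_uniq h3 (cder_ext near (cder_cst 1 u)).
have := gd_neq0 d hu; rewrite (gdN d u) invrK.
move: (derive1 _ u) (derive1 _ (- u)) (gd d u) => p q g g0 E.
have -> : p / g = p / g - (p / g + g * (q * -1)) by rewrite E subr0.
by ring.
Qed.

(** The interaction, in the zeta quotient of a term, between an element of value [u] added to D and
    an element of value [v] already there. It is inverted by u -> - u. *)
Definition Rr u v : C :=
  zeta (1 + (- u - v)) * zeta (1 + (u + v)) / (zeta (1 + (- u + v)) * zeta (1 + (- v + u))).

End ZetaPrefactor.

(** * The term of the summand attached to a subset D *)

Section Summand.
Context {R : realType} {T : finType}.
Local Notation C := (cplx R).
Implicit Types (x : T -> C) (A D W : {set T}) (c i j : T) (d : nat).

Definition Pr d D x : C :=
  rpow (d%:R / pi) (- \sum_(i in D) x i) *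
  (\prod_(i in D) (cGamma (4^-1 - x i / 2) / cGamma (4^-1 + x i / 2))) *
  (sqrtZY (@zeta R) D (fun i => - x i) D x / Zdagger (@zeta R) D (fun i => - x i) D x) *
  (-1) ^+ #|D|.

(** [Zdagger] omits factors according to values, not indices. The hypothesis excludes accidental
    coincidences, so that only the diagonal factor of [c] is omitted. *)
Lemma ZdaggerU1 D x c : c \notin D -> (forall j, j \in D -> x c != x j) ->
  Zdagger (@zeta R) (c |: D)%SET (fun i => - x i) (c |: D)%SET x =
  (\prod_(j in D) zeta (1 - x c + x j)) * (\prod_(j in D) zeta (1 - x j + x c)) *
  Zdagger (@zeta R) D (fun i => - x i) D x.
Proof.
move=> cD cj; rewrite /Zdagger big_setU1 //= -mulrA -big_split /=.
congr (_ * _).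
  rewrite big_mkcondr big_setU1 //= addNr eqxx /= mul1r; apply: eq_bigr => j jD.
  by rewrite addrC subr_eq0 eq_sym cj.
apply: eq_bigr => i iD; rewrite big_mkcondr big_setU1 //= -big_mkcondr.
by rewrite addrC subr_eq0 cj.
Qed.

Lemma Pr_U1 d D x c : c \notin D -> (forall j, j \in D -> x c != x j) ->
  Pr d (c |: D)%SET x =
  Pr d D x * (- (gd d (x c) * zeta (1 - x c *+ 2)) * \prod_(j in D) Rr (x c) (x j)).
Proof.
move=> cD cj.
have E (a1 a2 a3 a4 a5 a6 a7 a8 a9 a10 a11 a12 a13 a14 : C) :
  a4 * a3 * (a1 * a2) * (a5 * a7 * (a8 * a13) * (a9 * a14) * (a11 * a12 * a6)) * (-1 * a10) =
  a3 * a2 * (a7 * a8 * a9 * a6) * a10 * (- (a4 * a1 * a5) * (a13 * a14 * (a11 * a12))) by ring.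
rewrite /Pr ZdaggerU1 // /sqrtZY YprodU // !ZpairsU // cardsU1 cD exprS.
rewrite !big_setU1 //= opprD rpowD /gd /Rr -mulNrn.
have -> : \prod_(j in D) (zeta (1 + (- x c - x j)) * zeta (1 + (x c + x j)) /
      (zeta (1 + (- x c + x j)) * zeta (1 + (- x j + x c)))) =
    (\prod_(j in D) zeta (1 - x c - x j)) * (\prod_(j in D) zeta (1 + x c + x j)) /
    ((\prod_(j in D) zeta (1 - x c + x j)) * (\prod_(j in D) zeta (1 - x j + x c))).
  rewrite -!big_split /= -prodfV -big_split /=; apply: eq_bigr => j _.
  by rewrite !addrA.
rewrite !invfM.
move: (\prod_(j in D) zeta (1 - x c - x j)) (\prod_(j in D) zeta (1 + x c + x j)).
move: (\prod_(j in D) zeta (1 - x c + x j))^-1 (\prod_(j in D) zeta (1 - x j + x c))^-1.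
move: (Zdagger _ _ _ _ _)^-1 (Yprod _ _ _) (Zpairs _ _ _) (Zpairs _ _ _) ((-1) ^+ #|D|).
move: (\prod_(i in D) _) (rpow _ (- \sum_(i in D) x i)) (rpow _ (- x c)) (zeta _).
move: (cGamma _ / cGamma _) => a1 a2 a3 a4 a5 a6 a7 a8 a9 a10 a11 a12 a13 a14.
exact: E.
Qed.

Lemma Pr_eq d D x x' : {in D, x =1 x'} -> Pr d D x = Pr d D x'.
Proof.
move=> xx; have xN : {in D, (fun i => - x i) =1 (fun i => - x' i)} by move=> i iD; rewrite xx.
rewrite /Pr /sqrtZY (eq_Yprod _ xN) (eq_Zpairs _ xN) (eq_Zpairs _ xx).
rewrite (eq_bigr _ xx); congr (_ * _ * (_ / _) * _).
  by apply: eq_bigr => i iD; rewrite xx.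
apply: eq_bigr => i iD; apply: eq_big => [j|j /andP[jD _]]; last by rewrite !xx.
by case jD: (j \in D); rewrite //= !xx.
Qed.

Definition Hw A x D W : C := H_part x D W + Aw A x D W.

Definition tm d A x D : C := Pr d D x * Aw A x D finset.set0 * Part (A :\: D)%SET (Hw A x D).

Lemma J_summandE d A x : sx A x -> J_summand d A x = \sum_(D : {set T} | D \subset A) tm d A x D.
Proof.
move=> s; apply: eq_bigr => D DA; rewrite /tm /Part A_DL_Aw (Aw_D DA s).
congr (_ * _); apply: eq_bigr => P pP; apply: eq_bigr => W WP; rewrite /H_hat /Hw A_part_Aw //.
  exact: (partition_neq0 pP).
have := partitionS pP WP; move/fintype.subsetP => h; apply/fintype.subsetP => i /h.
by rewrite !inE => /andP[].
Qed.

Lemma H_part1 x D c : H_part x D [set c]%SET =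
  \sum_(b in D) (lz (x c - x b) - lz (x c + x b)) + lz (x c *+ 2).
Proof.
rewrite /H_part enum_set1 /lz; congr (_ + _); apply: eq_bigr => b _.
by rewrite !addrA.
Qed.

Lemma H_part2 x D c c' : c != c' -> H_part x D [set c; c']%SET = derive1 lz (x c + x c').
Proof.
move=> cc; have : perm_eq (enum [set c; c']%SET) [:: c; c'].
  apply: uniq_perm; rewrite ?enum_uniq //= ?inE ?cc //.
  by move=> i; rewrite mem_enum !inE.
rewrite /H_part => p; have sz := perm_size p.
have E u : derive1 (logder (@zeta R)) (1 + u) = derive1 lz u by exact: derive1_shift.
case En : (enum _) p sz => [|g1 [|g2 [|? ?]]] p sz; [by case: sz|by case: sz| |by case: sz].
rewrite -addrA E; congr (derive1 _ _).
have := perm_mem p g1; have := perm_mem p g2; rewrite !inE !eqxx ?orbT => /esym h2 /esym h1.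
have : uniq [:: g1; g2] by rewrite -En enum_uniq.
rewrite /= inE andbT => g12.
case/orP: h1 g12 => /eqP ->; case/orP: h2 => /eqP ->; rewrite ?eqxx // => _.
by rewrite addrC.
Qed.

Lemma H_part_big x D W : (2 < #|W|)%N -> H_part x D W = 0.
Proof. by rewrite cardE /H_part; case: (enum W) => [|? [|? [|? ?]]]. Qed.

Lemma H_part_eq x x' D W : {in W, x =1 x'} -> {in D, x =1 x'} -> H_part x D W = H_part x' D W.
Proof.
move=> xW xD; have we i : i \in enum W -> x i = x' i by rewrite mem_enum; exact: xW.
rewrite /H_part; case: (enum W) we => [_|g1 [|g2 [|? ? _]]]; first exact: erefl; last exact: erefl.
  move=> we; have -> : x g1 = x' g1 by apply: we; rewrite inE.
  by congr (_ + _); apply: eq_bigr => b bD; rewrite xD.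
move=> we; have -> : x g1 = x' g1 by apply: we; rewrite !inE eqxx.
by have -> : x g2 = x' g2 by apply: we; rewrite !inE eqxx orbT.
Qed.

End Summand.

(** * Removable factors, regular arguments of zeta and logarithmic derivatives *)

Section ResidueTools.
Context {R : realType}.
Local Notation C := (cplx R).
Implicit Types (f g phi : C -> C) (z v w r l : C).

Lemma pole2_near f g z r : (\forall w \near nbC z, w != z -> f w = g w) ->
  pole2 g z r -> pole2 f z r.
Proof.
move=> /nbC_P[d d0 Hd]; apply: pole2_ext; exists d => // w hw wz.
by rewrite Hd.
Qed.

Lemma pole2_frac f g phi z : an g z -> an phi z ->
  (\forall w \near nbC z, w != z -> f w = g w + phi w / (w - z)) -> pole2 f z (phi z).
Proof.
move=> ag aphi Hf; apply: (pole2_near Hf).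
rewrite -[phi z]add0r; apply: pole2D; first exact: pole2_an.
by apply: pole2_simple => //; exists 1.
Qed.

Definition good v := [/\ -1 < complex.Re v, v != 0 & zeta (1 + v) != 0].

Lemma an_lz_comp f z : an f z -> good (f z) -> an (fun w => lz (f w)) z.
Proof. by move=> af [h1 h2 h3]; apply: (an_comp (phi := lz)) => //; exact: an_lz. Qed.

Lemma an_dlz_comp f z : an f z -> good (f z) -> an (fun w => derive1 lz (f w)) z.
Proof. by move=> af [h1 h2 h3]; apply: (an_comp (phi := derive1 lz)) => //; exact: an_derive_lz. Qed.

Lemma an_zeta_comp f z : an f z -> good (f z) -> an (fun w => zeta (1 + f w)) z.
Proof. by move=> af [h1 h2 h3]; apply: (an_comp (phi := fun v : C => zeta (1 + v))) => //; exact: an_zeta. Qed.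

(** The derivative is kept in the form value times logarithmic derivative, so that [l] is additive
    over the long products of zeta factors. *)
Definition lder f z l := f z != 0 /\ cder f z (f z * l).

Lemma lderM f g z l m : lder f z l -> lder g z m -> lder (fun w => f w * g w) z (l + m).
Proof.
move=> [f0 hf] [g0 hg]; split; first by rewrite mulf_neq0.
have := cderM hf hg.
have E (p q : C) : p * l * q + p * (q * m) = p * q * (l + m) by ring.
by rewrite E.
Qed.

Lemma lderV f z l : lder f z l -> lder (fun w => (f w)^-1) z (- l).
Proof.
move=> [f0 hf]; split; first by rewrite invr_eq0.
have := cderV f0 hf; move: (f z) f0 => p p0.
by have -> : - (p * l) / p ^+ 2 = p^-1 * - l by field.
Qed.

Lemma lder_prod (J : finType) (P : {set J}) (F : J -> C -> C) z (L : J -> C) :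
  (forall i, i \in P -> lder (F i) z (L i)) ->
  lder (fun w => \prod_(i in P) F i w) z (\sum_(i in P) L i).
Proof.
move=> H; split; first by apply/prodf_neq0 => i /H[].
have := cder_bigprod (fun i (iP : i \in P) => (H i iP).2).
have -> // : \sum_(i in P) F i z * L i * \prod_(j in (P :\ i)%SET) F j z =
  \prod_(i in P) F i z * \sum_(i in P) L i.
rewrite mulr_sumr; apply: eq_bigr => i iP.
by rewrite (big_setD1 i iP) /= mulrAC.
Qed.

Lemma lder_zeta f z m : good (f z) -> cder f z m -> lder (fun w => zeta (1 + f w)) z (lz (f z) * m).
Proof.
move=> [h1 h2 h3] hf; split=> //.
have := cder_comp hf (an_cder (an_zeta h1 h2)).
by rewrite mulrA lzE mulrCA divff // mulr1.
Qed.

Lemma lder_an f z : f z != 0 -> an f z -> lder f z (derive1 f z / f z).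
Proof. by move=> f0 /an_cder h; split=> //; rewrite mulrC divfK. Qed.

End ResidueTools.

(** * Poles in the variable of an index outside D *)

Section ResidueH.
Context {R : realType} {T : finType}.
Local Notation C := (cplx R).
Implicit Types (x : T -> C) (A D W : {set T}) (a b c i j : T) (d : nat).

Lemma an_upd x a i w0 : an (fun w => upd x a w i) w0.
Proof. by rewrite /upd; case: eqP => _; [exact: an_id|exact: an_cst]. Qed.

Lemma an_H x a w0 D W :
  (forall c, W = [set c]%SET -> good (upd x a w0 c *+ 2) /\
    forall b, b \in D -> good (upd x a w0 c - upd x a w0 b) /\ good (upd x a w0 c + upd x a w0 b)) ->
  (forall c c', c != c' -> W = [set c; c']%SET -> good (upd x a w0 c + upd x a w0 c')) ->
  an (fun w => H_part (upd x a w) D W) w0.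
Proof.
move=> H1 H2; have au i := an_upd x a i w0.
have [W2|W2] := ltnP 2 #|W|.
  have -> : (fun w => H_part (upd x a w) D W) = (fun=> 0) by apply/funext => w; exact: H_part_big.
  exact: an_cst.
have [/cards2P[c [c' [cc E]]]|n2] := boolP (#|W| == 2%N).
  rewrite E; have -> : (fun w => H_part (upd x a w) D [set c; c']%SET) =
      (fun w => derive1 lz (upd x a w c + upd x a w c')).
    by apply/funext => w; exact: H_part2.
  by apply: an_dlz_comp; [exact: anD|exact: H2].
have [/cards1P[c E]|n1] := boolP (#|W| == 1%N).
  rewrite E; have -> : (fun w => H_part (upd x a w) D [set c]%SET) =
      (fun w => \sum_(b in D) (lz (upd x a w c - upd x a w b) - lz (upd x a w c + upd x a w b)) +
         lz (upd x a w c *+ 2)) by apply/funext => w; exact: H_part1.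
  have [g1 g2] := H1 c E; apply: anD.
    by apply: an_sum => b /g2[h1 h2]; apply: anB; apply: an_lz_comp => //; [exact: anB|exact: anD].
  by apply: an_lz_comp => //; exact: anD.
have /eqP -> : W == finset.set0.
  by rewrite -cards_eq0; move: W2 n2 n1; case: #|W| => [|[|[|]]].
have -> : (fun w => H_part (upd x a w) D finset.set0) = (fun=> 0).
  by apply/funext => w; rewrite /H_part enum_set0.
exact: an_cst.
Qed.

Lemma Hw_eq A x D W A' x' D' : H_part x D W = H_part x' D' W -> Aw A x D W = Aw A' x' D' W ->
  Hw A x D W = Hw A' x' D' W.
Proof. by rewrite /Hw => -> ->. Qed.

Lemma near_sx A x a w0 : sx A (upd x a w0) -> \forall w \near nbC w0, sx A (upd x a w).
Proof.
move=> s; have : `|complex.Re w0| < 4^-1 \/ a \notin A.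
  by have [aA|] := boolP (a \in A); [left; have := s a aA; rewrite upd_same|right].
have key w : (a \in A -> `|complex.Re w| < 4^-1) -> sx A (upd x a w).
  move=> hw i iA; have [ia|ia] := eqVneq i a; first by rewrite ia upd_same hw // -ia.
  by have := s i iA; rewrite !upd_ne.
move=> [h|aA]; last by apply: filterE => w; apply: key; rewrite (negbTE aA).
apply/nbC_P; exists (4^-1 - `|complex.Re w0|); first by rewrite subr_gt0.
move=> w hw; apply: key => _; have := le_lt_trans (Re_le_nrm _) hw; rewrite ReB => hr.
have := ler_normD (complex.Re w - complex.Re w0) (complex.Re w0); rewrite subrK => h2.
by apply: le_lt_trans h2 _; move: hr; rewrite ltrBrDr.
Qed.

Lemma Aw_at A x a w D W : a \in A -> a \notin D -> a \notin W -> W \subset A -> sx A (upd x a w) ->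
  Aw A (upd x a w) D W = Aw (A :\ a)%SET x D W.
Proof.
move=> aA aD aW WA s; rewrite (Aw_drop aA aD aW s); apply: Aw_off => //.
  by rewrite subsetD1 WA.
by move=> i /finset.setD1P[ia _]; rewrite upd_ne.
Qed.

(* The terms with a \notin D depend on x a only through the block of a. *)
Lemma pole2_tm_notin d A x a w0 D (rho : {set T} -> C) : a \in A -> D \subset (A :\ a)%SET ->
  sx A (upd x a w0) -> Aw A (upd x a w0) D finset.set0 != 0 ->
  (forall W, W \subset (A :\: D)%SET -> a \in W ->
    pole2 (fun w => H_part (upd x a w) D W) w0 (rho W)) ->
  pole2 (fun w => tm d A (upd x a w) D) w0
    (Pr d D x * Aw (A :\ a)%SET x D finset.set0 *
     \sum_(W : {set T} | (W \subset (A :\: D)%SET) && (a \in W))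
        rho W * Part (A :\: D :\: W)%SET (Hw (A :\ a)%SET x D)).
Proof.
move=> aA DA s nz H; set y := upd x a w0 in s nz.
have aD : a \notin D by have := fintype.subsetP DA a; rewrite !inE eqxx; case: (a \in D) => // /(_ isT).
have xD (w : C) : {in D, upd x a w =1 x}.
  by move=> i iD; rewrite upd_ne //; apply: contraNneq aD => <-.
have sn := near_sx s.
have AwE w W : sx A (upd x a w) -> W \subset A -> a \notin W -> Aw A (upd x a w) D W = Aw (A :\ a)%SET x D W.
  by move=> sw WA aW; exact: Aw_at.
pose G w := Pr d D x * Aw (A :\ a)%SET x D finset.set0 *
   \sum_(W : {set T} | (W \subset (A :\: D)%SET) && (a \in W))
      Part (A :\: D :\: W)%SET (Hw (A :\ a)%SET x D) * (H_part (upd x a w) D W + Aw A (upd x a w) D W).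
apply: (@pole2_near _ _ G).
  apply: filterS sn => w sw _; rewrite /tm (Pr_eq d (xD w)) AwE ?inE ?finset.sub0set //.
  congr (_ * _); rewrite (Part_rec _ (c := a)); last by rewrite inE aD.
  apply: eq_bigr => W /andP[WAD aW]; rewrite mulrC; congr (_ * _); apply: eq_Part => V V0 VW.
  have aV : a \notin V by apply/negP => /(fintype.subsetP VW); rewrite !inE aW.
  have VA : V \subset A by apply: (fintype.subset_trans VW); rewrite !finset.subDset; apply/fintype.subsetP => i iA; rewrite !inE iA !orbT.
  apply: Hw_eq (AwE _ _ sw VA aV); apply: H_part_eq => i; last exact: xD.
  by move=> iV; rewrite upd_ne //; apply: contraNneq aV => <-.
rewrite /G; apply: pole2Z; apply: pole2_sum => W /andP[WA aW]; rewrite mulrC; apply: pole2Z.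
rewrite -[rho W]addr0; apply: pole2D; first exact: H.
by apply: pole2_an; exact: an_Aw.
Qed.



Lemma sub_notin (D A : {set T}) a : D \subset (A :\ a)%SET -> a \notin D.
Proof. by rewrite subsetD1 => /andP[]. Qed.

Lemma sum_set1 (K : nmodType) (F : {set T} -> K) A a : a \in A ->
  \sum_(W : {set T} | (W \subset A) && (a \in W)) (if W == [set a]%SET then F W else 0) = F [set a]%SET.
Proof.
move=> aA; rewrite (bigD1 [set a]%SET) /=; last by rewrite finset.sub1set aA finset.set11.
by rewrite eqxx big1 ?addr0 // => W /andP[_ /negbTE ->].
Qed.

(** Only the singleton block of [a] contributes a residue, and removing it leaves the partitions of
    (A \ a) \ D. *)
Lemma pole2_tm_single d A x a w0 D r : a \in A -> D \subset (A :\ a)%SET ->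
  sx A (upd x a w0) -> Aw A (upd x a w0) D finset.set0 != 0 ->
  (forall W, W \subset (A :\: D)%SET -> a \in W -> W != [set a]%SET ->
    pole2 (fun w => H_part (upd x a w) D W) w0 0) ->
  pole2 (fun w => H_part (upd x a w) D [set a]%SET) w0 r ->
  pole2 (fun w => tm d A (upd x a w) D) w0 (r * tm d (A :\ a)%SET x D).
Proof.
move=> aA DA s nz H1 H2; have aD := sub_notin DA.
have aAD : a \in (A :\: D)%SET by rewrite inE aD.
have := pole2_tm_notin d (rho := fun W => if W == [set a]%SET then r else 0) aA DA s nz _.
have -> : \sum_(W : {set T} | (W \subset (A :\: D)%SET) && (a \in W))
     (if W == [set a]%SET then r else 0) * Part (A :\: D :\: W)%SET (Hw (A :\ a)%SET x D) =
   r * Part ((A :\ a) :\: D)%SET (Hw (A :\ a)%SET x D).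
  under eq_bigr => W _ do rewrite -[if _ then _ else _]mulrb mulrnAl mulrb.
  rewrite (sum_set1 (fun W => r * Part (A :\: D :\: W)%SET (Hw (A :\ a)%SET x D)) aAD).
  congr (_ * Part _ _); by apply/setP => i; rewrite !inE andbCA.
rewrite mulrCA /tm; apply=> W WA aW; case: eqP => [-> //|/eqP Wa]; exact: H1.
Qed.

End ResidueH.

(** * Residues of the summands *)

Section Regular.
Context {R : realType} {T : finType}.
Local Notation C := (cplx R).
Implicit Types (x : T -> C) (A D W : {set T}) (a b c i j : T) (d : nat).

Lemma goodP (v : C) : zeta_regular v -> `|complex.Re v| < 1 -> good v /\ good (- v).
Proof.
move=> [v0 v1 v2]; rewrite ltr_norml => /andP[h1 h2].
by split; split; rewrite ?oppr_eq0 // ReN; lra.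
Qed.

Lemma regular_sx A x : regular_at A x -> sx A x. Proof. by case. Qed.

Lemma regular_Aw A x D : regular_at A x -> D \subset A -> Aw A x D finset.set0 != 0.
Proof.
move=> [h1 _ _ h4] DA; rewrite Aw_D //; have := h4 D DA; by rewrite A_DL_Aw.
Qed.

Lemma regular_double A x i : regular_at A x -> i \in A -> good (x i *+ 2) /\ good (- (x i *+ 2)).
Proof.
move=> [h1 h2 _ _] iA; apply: goodP; first exact: h2.
have := h1 i iA; rewrite !ltr_norml mulr2n ReD => /andP[p q]; apply/andP; split; lra.
Qed.

Lemma regular_pair A x i j : regular_at A x -> i \in A -> j \in A -> i != j ->
  [/\ good (x i + x j), good (- (x i + x j)), good (x i - x j) & good (- (x i - x j))].
Proof.
move=> [h1 _ h3 _] iA jA ij; have [p q] := h3 i j iA jA ij.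
have := h1 i iA; have := h1 j jA; rewrite !ltr_norml => /andP[a1 a2] /andP[a3 a4].
have [|g1 g2] := goodP p; first by rewrite ReD ltr_norml; apply/andP; split; lra.
have [|g3 g4] := goodP q; first by rewrite ReB ltr_norml; apply/andP; split; lra.
by [].
Qed.

(** The polar part of zeta'/zeta (1 + s) is - 1/s, so that of its derivative is exactly s^(-2), with
    a constant coefficient. *)
Lemma pole2_dlz (be : C) : pole2 (fun w => derive1 lz (w + be)) (- be) 0.
Proof.
have r0 : -1 < complex.Re (0 : C) by rewrite /= ltrN10.
have z0 : zeta_res (0 : C) != 0 by rewrite zeta_res0 oner_neq0.
have sh : an (fun w => w + be) (- be) by apply: anD; [exact: an_id|exact: an_cst].
have e0 : - be + be = 0 by rewrite addNr.
rewrite -[0]addr0; apply: (@pole2_near _ _ (fun w => derive1 lzr (w + be) + 1 / (w - - be) ^+ 2)).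
  have n1 : \forall w \near nbC (- be), zeta_res (w + be) != 0.
    apply: an_neq0; last by rewrite e0.
    by apply: (an_comp (phi := zeta_res)) => //; rewrite e0; exact: an_zeta_res.
  apply: filterS2 (near_Re_gt (v := - be) (r := -1 - complex.Re be) _) n1 => [w w1 wz wn|].
    have w0 : w + be != 0 by rewrite addr_eq0.
    rewrite derive_lz_pole //; last by rewrite ReD -ltrBlDr.
    by rewrite opprK div1r exprVn.
  by rewrite ReN; lra.
apply: pole2D.
  apply: pole2_an; apply: (an_comp (phi := derive1 lzr)) => //; rewrite e0.
  by apply: an_derive; exact: an_lzr.
have <- : derive1 (fun=> 1 : C) (- be) = 0 by apply: cder_derive1; exact: cder_cst.
by apply: pole2_double; [exact: an_cst|exists 1].
Qed.

Lemma pole2_lz (k be : C) : k != 0 -> pole2 (fun w => lz (k * (w + be))) (- be) (- k^-1).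
Proof.
move=> k0; have r0 : -1 < complex.Re (0 : C) by rewrite /= ltrN10.
have z0 : zeta_res (0 : C) != 0 by rewrite zeta_res0 oner_neq0.
have sh : an (fun w => k * (w + be)) (- be).
  by apply: anM; [exact: an_cst|apply: anD; [exact: an_id|exact: an_cst]].
have e0 : k * (- be + be) = 0 by rewrite addNr mulr0.
apply: (@pole2_frac _ _ (fun w => lzr (k * (w + be))) (fun=> - k^-1)).
- apply: (an_comp (phi := lzr)) => //; rewrite e0; exact: an_lzr.
- exact: an_cst.
have n1 : \forall w \near nbC (- be), zeta_res (k * (w + be)) != 0.
  apply: an_neq0; last by rewrite e0.
  by apply: (an_comp (phi := zeta_res)) => //; rewrite e0; exact: an_zeta_res.
have n2 : \forall w \near nbC (- be), -1 < complex.Re (k * (w + be)).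
  have := an_cvg sh => /(_ [set v | -1 < complex.Re v]); apply.
  by rewrite e0; exact: near_Re_gt.
apply: filterS2 n1 n2 => w wz w1 wn.
have w0 : w + be != 0 by rewrite addr_eq0.
rewrite lz_pole ?mulf_neq0 // opprK invfM mulNr; congr (_ - _); exact: mulrC.
Qed.

Lemma pole2_mul_lz (phi : C -> C) (be : C) : an phi (- be) ->
  pole2 (fun w => phi w * - lz (be + w)) (- be) (phi (- be)).
Proof.
move=> aphi; have r0 : -1 < complex.Re (0 : C) by rewrite /= ltrN10.
have z0 : zeta_res (0 : C) != 0 by rewrite zeta_res0 oner_neq0.
have sh : an (fun w => be + w) (- be) by apply: anD; [exact: an_cst|exact: an_id].
have e0 : be + - be = 0 by rewrite subrr.
apply: (@pole2_frac _ _ (fun w => phi w * - lzr (be + w)) phi) => //.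
  apply: anM => //; apply: anN; apply: (an_comp (phi := lzr)) => //; rewrite e0; exact: an_lzr.
have n1 : \forall w \near nbC (- be), zeta_res (be + w) != 0.
  apply: an_neq0; last by rewrite e0.
  by apply: (an_comp (phi := zeta_res)) => //; rewrite e0; exact: an_zeta_res.
have n2 : \forall w \near nbC (- be), -1 < complex.Re (be + w).
  have := an_cvg sh => /(_ [set v | -1 < complex.Re v]); apply.
  by rewrite e0; exact: near_Re_gt.
apply: filterS2 n1 n2 => w wz w1 wn.
have w0 : be + w != 0 by rewrite addrC addr_eq0.
by rewrite lz_pole // opprK opprB mulrDr addrC mulrN [w + be]addrC.
Qed.

Lemma an_Rr (v w0 : C) : good (- w0 - v) -> good (w0 + v) -> good (- w0 + v) -> good (- v + w0) ->
  an (fun w => Rr w v) w0.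
Proof.
move=> g1 g2 g3 g4; have a0 := an_id w0; have av := an_cst v w0.
apply: anM.
  by apply: anM; apply: an_zeta_comp => //; [apply: anB => //; exact: anN|exact: anD].
apply: anV; first by case: g3 g4 => _ _ h3 [_ _ h4]; rewrite mulf_neq0.
by apply: anM; apply: an_zeta_comp => //; apply: anD => //; [exact: anN|exact: anN].
Qed.

Lemma Pr_in d D x a w : a \in D -> (forall j, j \in (D :\ a)%SET -> w != x j) ->
  Pr d D (upd x a w) = Pr d (D :\ a)%SET x *
    (- (gd d w * zeta (1 - w *+ 2)) * \prod_(j in (D :\ a)%SET) Rr w (x j)).
Proof.
move=> aD H; have xj j : j \in (D :\ a)%SET -> upd x a w j = x j.
  by move=> /finset.setD1P[ja _]; rewrite upd_ne.
rewrite -{1}(finset.setD1K aD) Pr_U1; first last.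
- by move=> j jD; rewrite upd_same xj // H.
- by rewrite !inE eqxx.
rewrite upd_same (Pr_eq d xj); congr (_ * (_ * _)); apply: eq_bigr => j jD; by rewrite xj.
Qed.

Lemma H_part_cong x D x' D' W : {in W, x =1 x'} ->
  (forall c, W = [set c]%SET -> \sum_(b in D) (lz (x c - x b) - lz (x c + x b)) =
     \sum_(b in D') (lz (x' c - x' b) - lz (x' c + x' b))) ->
  H_part x D W = H_part x' D' W.
Proof.
move=> xx H; have [W2|W2] := ltnP 2 #|W|; first by rewrite !H_part_big.
have [/cards2P[c [c' [cc E]]]|n2] := boolP (#|W| == 2%N).
  by rewrite E in xx *; rewrite !(H_part2 _ _ cc) !xx ?inE ?eqxx ?orbT.
have [/cards1P[c E]|n1] := boolP (#|W| == 1%N).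
  by rewrite E in xx H *; rewrite !H_part1 (H c) // xx ?inE.
have /eqP -> : W == finset.set0.
  by rewrite -cards_eq0; move: W2 n2 n1; case: #|W| => [|[|[|]]].
by rewrite /H_part !enum_set0.
Qed.

(** * Residues at opposite values of two variables *)

Section Opposite.
Context (A : {set T}) (a b : T) (x : T -> C) (aA : a \in A) (bA : b \in A) (ba : b != a).
Context (rx : regular_at (A :\ a)%SET x) (rm : regular_at (A :\ a)%SET (upd x b (- x b))).

Let y := upd x a (- x b).

Lemma opp_b : b \in (A :\ a)%SET. Proof. by rewrite !inE ba. Qed.

Lemma opp_ya : y a = - x b. Proof. by rewrite /y upd_same. Qed.
Lemma opp_yi i : i != a -> y i = x i. Proof. by move=> ia; rewrite /y upd_ne. Qed.

Lemma opp_sx : sx A y.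
Proof.
move=> i iA; have [->|ia] := eqVneq i a; last by rewrite opp_yi // (regular_sx rx) // !inE ia.
by rewrite opp_ya ReN_norm (regular_sx rx) // opp_b.
Qed.

Lemma opp_double i : i \in A -> good (y i *+ 2) /\ good (- (y i *+ 2)).
Proof.
move=> iA; have [->|ia] := eqVneq i a.
  by rewrite opp_ya mulNrn opprK; have [] := regular_double rx opp_b.
by rewrite opp_yi //; apply: (regular_double rx); rewrite !inE ia.
Qed.

(** At the collision a difference with [a] becomes, up to sign, a sum with [b] at [x], and the
    difference of [a] and [b] becomes a double of x_b; regularity on A \ a covers all of these. *)
Lemma opp_sub i j : i \in A -> j \in A -> i != j -> good (y i - y j).
Proof.
have [bd1 bd2] := regular_double rx opp_b.
have key k : k \in A -> k != a -> good (x b + x k) /\ good (- (x b + x k)).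
  move=> kA ka; have [->|kb] := eqVneq k b; first by rewrite -mulr2n.
  by have [] := regular_pair rx opp_b (_ : k \in (A :\ a)%SET) (_ : b != k); rewrite ?inE ?ka // eq_sym.
move=> iA jA; have [->|ia] := eqVneq i a => [|ij].
  rewrite eq_sym => ja; rewrite opp_ya opp_yi // -opprD; by have [] := key j jA ja.
have [->|ja] := eqVneq j a.
  by rewrite opp_ya opp_yi // opprK addrC; have [] := key i iA ia.
rewrite !opp_yi //; by have [] := regular_pair rx (_ : i \in (A :\ a)%SET) (_ : j \in (A :\ a)%SET) ij; rewrite ?inE ?ia ?ja.
Qed.

Lemma opp_add2 i j : i \in A -> j \in A -> i != j -> [set i; j]%SET != [set a; b]%SET ->
  good (y i + y j) /\ good (- (y i + y j)).
Proof.
have key k : k \in A -> k != a -> k != b -> good (x b - x k) /\ good (- (x b - x k)).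
  by move=> kA ka kb; have [] := regular_pair rx opp_b (_ : k \in (A :\ a)%SET) (_ : b != k); rewrite ?inE ?ka // eq_sym.
move=> iA jA; have [->|ia] := eqVneq i a => [|ij].
  rewrite eq_sym => ja; have [->|jb _] := eqVneq j b; first by rewrite eqxx.
  rewrite opp_ya opp_yi // -[x j]opprK -opprD [- - (_ - _)]opprK.
  by have [h1 h2] := key j jA ja jb.
have [->|ja] := eqVneq j a.
  have [->|ib _] := eqVneq i b; first by rewrite finset.setUC eqxx.
  rewrite opp_ya opp_yi // addrC -[x i]opprK -opprD [- - (_ - _)]opprK.
  by have [h1 h2] := key i iA ia ib.
move=> _; rewrite !opp_yi //; by have [] := regular_pair rx (_ : i \in (A :\ a)%SET) (_ : j \in (A :\ a)%SET) ij; rewrite ?inE ?ia ?ja.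
Qed.

Lemma opp_add i j : i \in A -> j \in A -> i != j -> [set i; j]%SET != [set a; b]%SET -> good (y i + y j).
Proof. by move=> iA jA ij E; have [] := opp_add2 iA jA ij E. Qed.

(** Cancellation turns the Euler product of A at the collision into one on A \ a. If [a] is in D and
    [b] is not, the point is [x] with x_b negated, hence the second regularity hypothesis; otherwise
    it is [x] itself. *)
Lemma opp_Aw D : D \subset A -> Aw A y D finset.set0 != 0.
Proof.
move=> DA; have aE : a \notin finset.set0 by rewrite inE.
have bE : b \notin finset.set0 by rewrite inE.
have ab : a != b by rewrite eq_sym.
have yab : y a = - y b by rewrite opp_ya opp_yi.
have [aD|aD] := boolP (a \in D); last first.
  rewrite Aw_at ?finset.sub0set //; last exact: opp_sx.
  by apply: (regular_Aw rx); rewrite subsetD1 DA.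
have [bD|bD] := boolP (b \in D).
  rewrite (Aw_drop2 aA bA ab aD bD aE bE (finset.sub0set _) opp_sx yab).
  have DA' : (D :\ a :\ b)%SET \subset (A :\ a)%SET.
    by rewrite finset.subDset; apply: (fintype.subset_trans (finset.setSD _ DA)); exact: finset.subsetUr.
  have := regular_Aw rx DA'; rewrite (Aw_drop opp_b) ?inE ?eqxx //; last exact: regular_sx.
  rewrite (Aw_off (x' := y) (D' := (D :\ a :\ b)%SET)) ?finset.sub0set //.
  by move=> i /finset.setD1P[_ /finset.setD1P[ia _]]; rewrite opp_yi.
rewrite (Aw_relabel aA bA ab aD bD aE (finset.sub0set _) opp_sx yab).
have DA' : (b |: D :\ a)%SET \subset (A :\ a)%SET.
  by rewrite finset.subUset finset.sub1set opp_b finset.setSD.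
have := regular_Aw rm DA'.
rewrite (Aw_off (x' := upd y b (- y b)) (D' := (b |: D :\ a)%SET)) ?finset.sub0set //.
move=> i /finset.setD1P[ia _]; have [->|ib] := eqVneq i b; first by rewrite !upd_same opp_yi.
by rewrite upd_ne // [RHS]upd_ne // opp_yi.
Qed.

Lemma opp_notin d D : D \subset (A :\ a)%SET -> b \notin D -> 
  pole2 (fun w => tm d A (upd x a w) D) (- x b) 0.
Proof.
move=> DA bD; have aD := sub_notin DA.
have DAA : D \subset A by move: DA; rewrite subsetD1 => /andP[].
have := pole2_tm_notin d (rho := fun=> 0) aA DA opp_sx (opp_Aw DAA) _.
rewrite big1 ?mulr0; last by move=> W _; rewrite mul0r.
apply=> W WA aW.
have [->|Wab] := eqVneq W [set a; b]%SET.
  have -> : (fun w => H_part (upd x a w) D [set a; b]%SET) = (fun w => derive1 lz (w + x b)).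
    have ab : a != b by rewrite eq_sym.
    by apply/funext => w; rewrite (H_part2 _ _ ab) upd_same upd_ne.
  exact: pole2_dlz.
apply: pole2_an; apply: an_H => [c E|c c' cc E].
  move: aW; rewrite E inE => /eqP <-; split; first by have [] := opp_double aA.
  move=> i iD; have iA := fintype.subsetP DAA i iD.
  have ia : a != i by apply: contraNneq aD => ->.
  split; first exact: opp_sub.
  apply: opp_add => //; apply: contraNneq bD => /setP/(_ b).
  by rewrite !inE eqxx orbT (negbTE ba) /= => /eqP ->.
have cW : c \in W /\ c' \in W by rewrite E !inE !eqxx ?orbT.
have WAA : W \subset A by apply: (fintype.subset_trans WA); exact: finset.subsetDl.
by apply: opp_add; rewrite -?E //; apply: (fintype.subsetP WAA); case: cW.
Qed.

Lemma opp_in d D : D \subset (A :\ a)%SET -> b \in D -> 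
  pole2 (fun w => tm d A (upd x a w) D) (- x b) (tm d (A :\ a)%SET x D).
Proof.
move=> DA bD; have aD := sub_notin DA.
have DAA : D \subset A by move: DA; rewrite subsetD1 => /andP[].
rewrite -[tm _ _ _ _]mul1r; apply: pole2_tm_single => //; [exact: opp_sx|exact: opp_Aw| |].
  move=> W WA aW Wa; apply: pole2_an; apply: an_H => [c E|c c' cc E].
    by move: aW Wa; rewrite E inE => /eqP ->; rewrite eqxx.
  have cW : c \in W /\ c' \in W by rewrite E !inE !eqxx ?orbT.
  have WAA : W \subset A by apply: (fintype.subset_trans WA); exact: finset.subsetDl.
  apply: opp_add => //; rewrite -?E //; try by apply: (fintype.subsetP WAA); case: cW.
  apply: contraTneq WA => ->; apply/negP => /fintype.subsetP/(_ b).
  by rewrite !inE eqxx orbT bD => /(_ isT).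
(* The H-part of the block of [a] without its polar term [- lz (x_a + x_b)], which is present
   because [b] is in D. *)
pose g w := (\sum_(i in (D :\ b)%SET) (lz (upd x a w a - upd x a w i) - lz (upd x a w a + upd x a w i)) +
    lz (upd x a w a - upd x a w b)) + lz (upd x a w a *+ 2).
have ag : an g (- x b).
  have au i := an_upd x a i (- x b).
  apply: anD; last by apply: an_lz_comp; [exact: anD|have [] := opp_double aA].
  apply: anD; last by apply: an_lz_comp; [exact: anB|apply: opp_sub; rewrite // eq_sym].
  apply: an_sum => i /finset.setD1P[ib iD]; have iA := fintype.subsetP DAA i iD.
  have ia : a != i by apply: contraNneq aD => ->.
  apply: anB; apply: an_lz_comp; [exact: anB|exact: opp_sub|exact: anD|].
  apply: opp_add => //; apply: contraNneq ib => /setP/(_ b).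
  by rewrite !inE eqxx orbT (negbTE ba) /= => /eqP ->.
rewrite -[1](add0r); apply: (@pole2_near _ _ (fun w => g w + (- 1) * lz (1 * (w + x b)))).
  apply: filterE => w _; rewrite H_part1 (big_setD1 b) //= /g upd_same [upd x a w b]upd_ne //.
  rewrite mul1r mulN1r; move: (\sum_(_ in _) _) (lz _) (lz _) (lz _) => p q r s.
  by ring.
apply: pole2D; first exact: pole2_an.
have E : -1 * - 1^-1 = 1 :> C by rewrite invr1 mulrNN mulr1.
rewrite -[X in pole2 _ _ X]E; apply: pole2Z; apply: pole2_lz; exact: oner_neq0.
Qed.

Lemma opp_near (D : {set T}) : D \subset A ->
  \forall w \near nbC (- x b), forall j, j \in (D :\ a)%SET -> w != x j.
Proof.
move=> DA; suff : \forall w \near nbC (- x b), forall j, j \in enum (D :\ a)%SET -> w != x j.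
  by apply: filterS => w h j jD; apply: h; rewrite mem_enum.
have : {subset enum (D :\ a)%SET <= (A :\ a)%SET}.
  by move=> j; rewrite mem_enum !inE => /andP[-> /(fintype.subsetP DA)].
elim: (enum _) => [_|j s IH sA]; first by apply: filterE.
have jA := sA j (mem_head _ _); move: (jA); rewrite !inE => /andP[ja jA'].
have bj : - x b != x j.
  have aj : a != j by rewrite eq_sym.
  have [_ + _] := opp_sub aA jA' aj.
  by rewrite opp_ya opp_yi // subr_eq0.
apply: filterS2 (near_neq bj) (IH _) => [w wj ws i|i si]; last by apply: sA; rewrite inE si orbT.
by rewrite inE => /orP[/eqP->|/ws].
Qed.

Lemma opp_an_Hw D W : D \subset A -> a \in D -> W \subset (A :\: D)%SET -> W != [set b]%SET ->
  an (fun w => Hw A (upd x a w) D W) (- x b).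
Proof.
move=> DA aD WA Wb; have WAA : W \subset A by apply: (fintype.subset_trans WA); exact: finset.subsetDl.
have nW c : c \in W -> c != a /\ c \notin D.
  move=> cW; have := fintype.subsetP WA c cW; rewrite inE => /andP[cD _]; split=> //.
  by apply: contraNneq cD => ->.
apply: anD; last by apply: an_Aw; [exact: opp_sx|exact: opp_Aw].
apply: an_H => [c E|c c' cc E].
  have cW : c \in W by rewrite E inE.
  have [ca cD] := nW c cW; have cA := fintype.subsetP WAA c cW.
  have cb : c != b by apply: contraNneq Wb => <-; rewrite E.
  split; first by have [] := opp_double cA.
  move=> i iD; have iA := fintype.subsetP DA i iD.
  have ci : c != i by apply: contraNneq cD => ->.
  split; first exact: opp_sub.
  apply: opp_add => //; apply: contraNneq ca => /setP/(_ c).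
  by rewrite !inE eqxx (negbTE cb) orbF /= => /esym/eqP ->.
have [cW c'W] : c \in W /\ c' \in W by rewrite E !inE !eqxx ?orbT.
apply: opp_add; rewrite -?E //; try exact: (fintype.subsetP WAA).
apply: contraTneq aD => Eab; have aW : a \in W by rewrite Eab !inE eqxx.
by have [] := nW a aW; rewrite eqxx.
Qed.

Lemma opp_an_Pr d D : D \subset A -> a \in D -> b \notin D ->
  an (fun w => Pr d (D :\ a)%SET x * (- (gd d w * zeta (1 - w *+ 2)) * \prod_(j in (D :\ a)%SET) Rr w (x j)))
    (- x b).
Proof.
move=> DA aD bD; apply: anM; first exact: an_cst.
apply: anM.
  apply: anN; apply: anM; first by apply: an_gd; rewrite ReN_norm (regular_sx rx) // opp_b.
  apply: an_zeta_comp; first by apply: anN; apply: anD; exact: an_id.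
  by have [_] := opp_double aA; rewrite opp_ya.
apply: an_prod => j /finset.setD1P[ja jD]; have jA := fintype.subsetP DA j jD.
have aj : a != j by rewrite eq_sym.
have jb : j != b by apply: contraNneq bD => <-.
have [|g1 g2] := opp_add2 aA jA aj.
  apply: contraNneq jb => /setP/(_ j); by rewrite !inE eqxx orbT (negbTE ja) /= => /esym/eqP ->.
have g3 := opp_sub aA jA aj; have g4 := opp_sub jA aA ja.
move: g1 g2 g3 g4; rewrite opp_ya opp_yi // => g1 g2 g3 g4.
by apply: an_Rr; [rewrite -opprD|exact: g1|rewrite addrC|rewrite addrC].
Qed.

(** At w = - x_b the element [a] of D acts as [b] would with its value negated: the prefactor and
    the sums over D involve that value alone, and [Aw_relabel] gives the same for the Euler
    product. *)
Lemma opp_swap_value d D : D \subset A -> a \in D -> b \notin D ->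
  Pr d (D :\ a)%SET x * (- (gd d (- x b) * zeta (1 - (- x b) *+ 2)) *
      \prod_(j in (D :\ a)%SET) Rr (- x b) (x j)) *
    Aw A y D finset.set0 * Part (A :\: D :\: [set b])%SET (Hw A y D) =
  tm d (A :\ a)%SET (upd x b (- x b)) (b |: D :\ a)%SET.
Proof.
move=> DA aD bD; have ab : a != b by rewrite eq_sym.
have yab : y a = - y b by rewrite opp_ya opp_yi.
have bD' : b \notin (D :\ a)%SET by rewrite !inE (negbTE bD) andbF.
have xj j : j \in (D :\ a)%SET -> upd x b (- x b) j = x j.
  by move=> jD; rewrite upd_ne //; apply: contraNneq bD' => <-.
have AE W : a \notin W -> W \subset A ->
    Aw A y D W = Aw (A :\ a)%SET (upd x b (- x b)) (b |: D :\ a)%SET W.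
  move=> aW WA; rewrite (Aw_relabel aA bA ab aD bD aW WA opp_sx yab); apply: Aw_off => //.
    by rewrite subsetD1 WA.
  move=> i /finset.setD1P[ia _]; have [->|ib] := eqVneq i b; first by rewrite !upd_same opp_yi.
  by rewrite upd_ne // [RHS]upd_ne // opp_yi.
rewrite /tm Pr_U1 //; last first.
  move=> j jD; rewrite upd_same xj //; have := jD; rewrite !inE => /andP[ja jD0].
  have jA := fintype.subsetP DA j jD0; have [|_ + _] := opp_sub aA jA; first by rewrite eq_sym.
  by rewrite opp_ya opp_yi // subr_eq0.
rewrite upd_same (Pr_eq d xj) AE ?inE ?finset.sub0set //; congr (_ * (_ * _) * _ * _).
  by apply: eq_bigr => j jD; rewrite xj.
have -> : (A :\ a :\: (b |: D :\ a) = A :\: D :\: [set b])%SET.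
  apply/setP => i; rewrite !inE negb_or negb_and negbK.
  by have [->|ia] := eqVneq i a; rewrite ?aD ?andbF //=; rewrite -andbA.
apply: eq_Part => W W0 WA.
have aW : a \notin W by apply/negP => /(fintype.subsetP WA); rewrite !inE aD andbF.
have bW : b \notin W by apply/negP => /(fintype.subsetP WA); rewrite !inE eqxx.
have WAA : W \subset A by apply: (fintype.subset_trans WA); rewrite !finset.subDset; apply/fintype.subsetP => i iA; rewrite !inE iA !orbT.
apply: Hw_eq (AE W aW WAA); apply: H_part_cong => [i iW|c E].
  rewrite opp_yi; last by apply: contraNneq aW => <-.
  by rewrite upd_ne //; apply: contraNneq bW => <-.
have cW : c \in W by rewrite E inE.
have ca : c != a by apply: contraNneq aW => <-.
have cb : c != b by apply: contraNneq bW => <-.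
have yc : y c = x c by exact: opp_yi.
have xc : upd x b (- x b) c = x c by rewrite upd_ne.
rewrite (big_setD1 _ aD) (big_setU1 _ bD') /= yc xc opp_ya upd_same.
congr (_ + _); apply: eq_bigr => j jD; rewrite xj //; have /finset.setD1P[ja _] := jD.
by rewrite opp_yi.
Qed.

Lemma opp_swap d D : D \subset A -> a \in D -> b \notin D ->
  pole2 (fun w => tm d A (upd x a w) D) (- x b)
    (tm d (A :\ a)%SET (upd x b (- x b)) (b |: D :\ a)%SET).
Proof.
move=> DA aD bD; have bAD : b \in (A :\: D)%SET by rewrite inE bD.
pose p w := Pr d (D :\ a)%SET x * (- (gd d w * zeta (1 - w *+ 2)) * \prod_(j in (D :\ a)%SET) Rr w (x j)) *
  Aw A (upd x a w) D finset.set0.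
have ap : an p (- x b).
  by apply: anM; [exact: opp_an_Pr|apply: an_Aw; [exact: opp_sx|exact: opp_Aw]].
have aPart (W : {set T}) : b \in W -> an (fun w => Part (A :\: D :\: W)%SET (Hw A (upd x a w) D)) (- x b).
  move=> bW; apply: an_Part => V V0 VA; apply: opp_an_Hw => //.
    by apply: (fintype.subset_trans VA); exact: finset.subsetDl.
  by apply: contraTneq VA => ->; rewrite finset.sub1set !inE bW.
pose h w := \sum_(i in (D :\ a)%SET) (lz (upd x a w b - upd x a w i) - lz (upd x a w b + upd x a w i)) +
  lz (upd x a w b - w) + lz (upd x a w b *+ 2).
have ah : an h (- x b).
  have au i := an_upd x a i (- x b).
  apply: anD; last by apply: an_lz_comp; [exact: anD|have [] := opp_double bA].
  apply: anD; last first.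
    apply: an_lz_comp; first by apply: anB => //; exact: an_id.
    by have := opp_sub bA aA ba; rewrite opp_ya.
  apply: an_sum => i /finset.setD1P[ia iD]; have iA := fintype.subsetP DA i iD.
  have bi : b != i by apply: contraNneq bD => ->.
  apply: anB; apply: an_lz_comp; [exact: anB|exact: opp_sub|exact: anD|].
  apply: opp_add => //; apply: contraNneq ia => /setP/(_ i).
  by rewrite !inE eqxx orbT [i == b]eq_sym (negbTE bi) orbF => /esym.
pose phi w := p w * Part (A :\: D :\: [set b])%SET (Hw A (upd x a w) D).
(* Partitions are expanded along the block of [b]. Only the singleton has a polar term,
   [- lz (x b + w)], due to [a] in D; [h] is its H-part without that term, so [G] is analytic. *)
pose G w := p w * (\sum_(W : {set T} | (W \subset (A :\: D)%SET) && (b \in W) && (W != [set b]%SET))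
     Hw A (upd x a w) D W * Part (A :\: D :\: W)%SET (Hw A (upd x a w) D)) +
   phi w * (h w + Aw A (upd x a w) D [set b]%SET).
have aphi : an phi (- x b) by apply: anM => //; apply: aPart; rewrite inE.
have aG : an G (- x b).
  apply: anD; last first.
    apply: anM => //; apply: anD => //; apply: an_Aw; [exact: opp_sx|exact: opp_Aw].
  apply: anM => //; apply: an_sum => W /andP[/andP[WA bW] Wb].
  by apply: anM; [exact: opp_an_Hw|exact: aPart].
rewrite -(opp_swap_value d DA aD bD) -[X in pole2 _ _ X]add0r.
apply: (@pole2_near _ _ (fun w => G w + phi w * - lz (x b + w))).
  apply: filterS (opp_near DA) => w wj _.
  rewrite /tm (Pr_in d aD wj) -/(p w) (Part_rec _ bAD).
  rewrite (bigD1 [set b]%SET) /=; last by rewrite finset.sub1set bAD finset.set11.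
  rewrite /Hw H_part1 (big_setD1 a) //= upd_same -/(Hw A (upd x a w) D).
  have xb : upd x a w b = x b by rewrite upd_ne.
  rewrite -[X in _ - lz X]/(upd x a w b + w) xb /G /phi /h xb.
  move: (p w) (Part _ _) (Aw _ _ _ _) (\sum_(W | _) _) (\sum_(i in _) _) (lz _) (lz _) (lz _).
  by move=> *; ring.
by apply: pole2D; [exact: pole2_an|exact: (pole2_mul_lz aphi)].
Qed.

(** * Double poles, from terms with both opposite elements in D *)

Section Both.
Context (D : {set T}) (DA : D \subset A) (aD : a \in D) (bD : b \in D).

Let D2 := (D :\ a :\ b)%SET.
Let xm := upd x b (- x b).

Lemma both_ab : a != b. Proof. by rewrite eq_sym. Qed.

Lemma both_notin W : W \subset (A :\: D)%SET -> [/\ a \notin W, b \notin W & W \subset A].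
Proof.
move=> WA; split; last by apply: (fintype.subset_trans WA); exact: finset.subsetDl.
  by apply/negP => /(fintype.subsetP WA); rewrite !inE aD.
by apply/negP => /(fintype.subsetP WA); rewrite !inE bD.
Qed.

Lemma both_D2 j : j \in D2 -> [/\ j != a, j != b & j \in A].
Proof. by rewrite !inE => /andP[jb /andP[ja jD]]; split=> //; exact: (fintype.subsetP DA). Qed.

Lemma both_xm j : j != b -> xm j = x j. Proof. by move=> jb; rewrite /xm upd_ne. Qed.

Lemma both_Aw W : a \notin W -> b \notin W -> W \subset A ->
  [/\ Aw A y D W = Aw (A :\ a :\ b)%SET x D2 W, Aw (A :\ a)%SET x D2 W = Aw (A :\ a :\ b)%SET x D2 W &
      Aw (A :\ a)%SET xm D2 W = Aw (A :\ a :\ b)%SET x D2 W].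
Proof.
move=> aW bW WA; have yab : y a = - y b by rewrite opp_ya opp_yi.
have WA' : W \subset (A :\ a :\ b)%SET by rewrite !subsetD1 WA aW.
have bD2 : b \notin D2 by rewrite !inE eqxx.
split.
- rewrite (Aw_drop2 aA bA both_ab aD bD aW bW WA opp_sx yab); apply: Aw_off => //.
  by move=> i /finset.setD1P[_ /finset.setD1P[ia _]]; rewrite opp_yi.
- exact: (Aw_drop opp_b bD2 bW (regular_sx rx)).
- rewrite (Aw_drop opp_b bD2 bW (regular_sx rm)); apply: Aw_off => //.
  by move=> i /finset.setD1P[ib _]; exact: both_xm.
Qed.

(** In the H-part of a singleton disjoint from D, x_a = - x_b exchanges the two terms of [a] with
    those of [b] with opposite sign, so the pair disappears from the sum. *)
Lemma both_H W : a \notin W -> b \notin W ->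
  H_part y D W = H_part x D2 W /\ H_part xm D2 W = H_part x D2 W.
Proof.
move=> aW bW; split; last first.
  apply: H_part_eq => i; last by move=> /both_D2[_ ib _]; exact: both_xm.
  by move=> iW; apply: both_xm; apply: contraNneq bW => <-.
have yi i : i \in W -> y i = x i by move=> iW; apply: opp_yi; apply: contraNneq aW => <-.
apply: H_part_cong => // c E; have cW : c \in W by rewrite E inE.
have bDa : b \in (D :\ a)%SET by rewrite !inE ba.
rewrite (big_setD1 _ aD) (big_setD1 _ bDa) /= (yi c cW) opp_ya (opp_yi ba) opprK.
have -> : \sum_(i in (D :\ a :\ b)%SET) (lz (x c - y i) - lz (x c + y i)) =
    \sum_(i in D2) (lz (x c - x i) - lz (x c + x i)).
  by apply: eq_bigr => i /both_D2[ia _ _]; rewrite opp_yi.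
by move: (lz _) (lz _) (\sum_(_ in _) _) => p q r; ring.
Qed.

Lemma both_Hw W : W \subset (A :\: D)%SET ->
  [/\ Hw A y D W = Hw (A :\ a :\ b)%SET x D2 W, Hw (A :\ a)%SET x D2 W = Hw (A :\ a :\ b)%SET x D2 W &
      Hw (A :\ a)%SET xm D2 W = Hw (A :\ a :\ b)%SET x D2 W].
Proof.
move=> /both_notin[aW bW WA]; have [e1 e2 e3] := both_Aw aW bW WA; have [h1 h2] := both_H aW bW.
by split; [exact: (Hw_eq h1 e1)|exact: (Hw_eq erefl e2)|exact: (Hw_eq h2 e3)].
Qed.

(** For W = {c} the derivative of lz(x_c - w) - lz(x_c + w) at - x_b is minus the sum of lz' at x_c
    + x_b and at x_c - x_b, the H-parts of {b, c} at [x] and at [xm]. For larger W the H-part is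
    constant in w, and the enlarged block has at least three elements and hence H-part zero. *)
Lemma both_cder_H W : W != finset.set0 -> W \subset (A :\: D)%SET ->
  cder (fun w => H_part (upd x a w) D W) (- x b)
    (- (H_part x D2 (b |: W)%SET + H_part xm D2 (b |: W)%SET)).
Proof.
move=> W0 WA; have [aW bW WAA] := both_notin WA.
have xW w i : i \in W -> upd x a w i = x i by move=> iW; rewrite upd_ne //; apply: contraNneq aW => <-.
have [/cards1P[c E]|n1] := boolP (#|W| == 1%N); last first.
  rewrite !H_part_big; try by rewrite cardsU1 bW ltnS ltn_neqAle eq_sym n1 card_gt0 W0.
  rewrite addr0 oppr0.
  have -> : (fun w => H_part (upd x a w) D W) = (fun=> H_part x D W).
    apply/funext => w; apply: H_part_cong; first by move=> i; exact: xW.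
    by move=> c E; rewrite E cards1 eqxx in n1.
  exact: cder_cst.
have cW : c \in W by rewrite E inE.
have ca : c != a by apply: contraNneq aW => <-.
have bc : b != c by apply: contraNneq bW => ->.
have cA := fintype.subsetP WAA c cW.
have cA' : c \in (A :\ a)%SET by rewrite !inE ca.
have [g1 _ _ g2] := regular_pair rx opp_b cA' bc.
rewrite E !(H_part2 _ _ bc) (both_xm (j := c)) 1?eq_sym // /xm upd_same.
have -> : (fun w => H_part (upd x a w) D [set c]%SET) = (fun w => lz (x c - w) - lz (x c + w) +
    (\sum_(i in (D :\ a)%SET) (lz (x c - x i) - lz (x c + x i)) + lz (x c *+ 2))).
  apply/funext => w; rewrite H_part1 (big_setD1 _ aD) /= (xW w c cW) upd_same -addrA.
  rewrite (eq_bigr (fun i => lz (x c - x i) - lz (x c + x i))) // => i /finset.setD1P[ia _].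
  by rewrite upd_ne.
have clz (v : C) : good v -> cder lz v (derive1 lz v) by move=> [? ? ?]; apply: an_cder; exact: an_lz.
have h1 := cder_comp (cderB (cder_cst (x c) (- x b)) (cder_id (- x b))) (clz (x c - - x b) _).
have h2 := cder_comp (cderD (cder_cst (x c) (- x b)) (cder_id (- x b))) (clz (x c + - x b) _).
have gg1 : good (x c - - x b) by rewrite opprK addrC.
have gg2 : good (x c + - x b) by rewrite -opprB.
have := cderD (cderB (h1 gg1) (h2 gg2)) (cder_cst (\sum_(i in (D :\ a)%SET) (lz (x c - x i) - lz (x c + x i)) + lz (x c *+ 2)) (- x b)).
rewrite opprK [x c + x b]addrC [x c + - x b]addrC.
have Epq (p q : C) : p * (0 - 1) - q * (0 + 1) + 0 = - (p + q) by ring.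
by rewrite Epq.
Qed.

Lemma both_cder_Hw W : W != finset.set0 -> W \subset (A :\: D)%SET ->
  cder (fun w => Hw A (upd x a w) D W) (- x b)
    (- (Hw (A :\ a)%SET x D2 (b |: W)%SET + Hw (A :\ a)%SET xm D2 (b |: W)%SET)).
Proof.
move=> W0 WA; have [aW bW WAA] := both_notin WA.
have := cderD (both_cder_H W0 WA)
  (Aw_cder aA bA both_ab aD bD aW bW WAA (regular_sx rx) (opp_Aw DA)).
rewrite (negbTE W0) mul1r -/D2 -/xm /Hw.
move: (H_part _ _ _) (H_part _ _ _) (Aw _ _ _ _) (Aw _ _ _ _) => p q r s.
by have -> : - (q + p) - (s + r) = - (q + s + (p + r)) by ring.
Qed.

Lemma both_sub j : j \in D2 -> 
  [/\ good (x b + x j), good (- x b - x j), good (x b - x j) & good (- x b + x j)].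
Proof.
move=> /both_D2[ja jb jA]; have jA' : j \in (A :\ a)%SET by rewrite !inE ja.
have bj : b != j by rewrite eq_sym.
have [g1 g2 g3 g4] := regular_pair rx opp_b jA' bj.
by split; rewrite -?opprD // -[x j]opprK -opprD.
Qed.

(** What [a] adds to the prefactor of D \ a, up to sign, without the product zeta(1 - s) zeta(1 +
    s), s = w + x_b, that carries the double pole. *)
Let k d w := gd d w * zeta (1 + (- (w *+ 2))) *
  (zeta (1 + (- w + x b)) * zeta (1 + (- x b + w)))^-1 * \prod_(j in D2) Rr w (x j).

(** Changing the sign of their first argument inverts [gd] and [Rr], so the contributions of [a] and
    [b] cancel; the remaining zeta factors match, and the sign is the one that [Pr_U1] attaches to
    [b]. *)
Lemma both_k0 d : Pr d (D :\ a)%SET x * k d (- x b) = - Pr d D2 x.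
Proof.
have bDa : b \in (D :\ a)%SET by rewrite !inE ba.
rewrite -{1}(finset.setD1K bDa) Pr_U1; first last.
- by move=> j /both_sub[_ _ [_ + _] _]; rewrite subr_eq0.
- by rewrite !inE eqxx.
rewrite -/D2 /k gdN mulNrn opprK.
have rb : `|complex.Re (x b)| < 4^-1 by apply: (regular_sx rx); exact: opp_b.
have g0 := gd_neq0 d rb.
have [[_ _ z1] [_ _ z2]] := regular_double rx opp_b.
have E : (\prod_(j in D2) Rr (x b) (x j)) * (\prod_(j in D2) Rr (- x b) (x j)) = 1.
  rewrite -big_split /= big1 // => j /both_sub[[_ _ h1] [_ _ h2] [_ _ h3] [_ _ h4]].
  rewrite /Rr opprK [- x j + x b]addrC [- x j - x b]addrC.
  by field; rewrite h1 h2 h3 h4.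
have -> : - x b - x b = - (x b *+ 2) by rewrite mulr2n opprD.
rewrite opprK -mulr2n.
move: E g0 z1 z2; move: (\prod_(j in D2) _) (\prod_(j in D2) _) => p q.
move: (gd d (x b)) (zeta (1 + x b *+ 2)) (zeta (1 - x b *+ 2)) (Pr _ _ _) => g z z' P E g0 z0 z0'.
have -> : P * (- (g * z') * q) * (g^-1 * z / (z * z') * p) = - P * (q * p) by field; rewrite g0 z0 z0'.
by rewrite E mulr1.
Qed.

(** [gd] contributes psi'/psi, by evenness of its logarithmic derivative. The factors [Rr] give
    minus the sums over D2 in the H-parts of {b} at [x] and at [xm]; zeta(1 - 2w) and the two zeta
    factors of the denominator give minus lz at 2 x_b and at - 2 x_b. *)
Lemma both_lder_k d : (0 < d)%N ->
  lder (k d) (- x b) (logder (@psi_DL R d) (2^-1 + x b) - (H_part x D2 [set b]%SET + H_part xm D2 [set b]%SET)).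
Proof.
move=> d0; have rb : `|complex.Re (x b)| < 4^-1 by apply: (regular_sx rx); exact: opp_b.
have rb' : `|complex.Re (- x b)| < 4^-1 by rewrite ReN_norm.
have [g1 g2] := regular_double rx opp_b.
have id0 : cder (fun w : C => w) (- x b) 1 := cder_id (- x b); have cc (c : C) := cder_cst c (- x b).
have n2 : - (- x b *+ 2) = x b *+ 2 by rewrite mulNrn opprK.
have l1 := lder_an (gd_neq0 d rb') (an_gd d rb').
have e2 : good (- (- x b *+ 2)) by rewrite n2.
have c2 : cder (fun w : C => - (w *+ 2)) (- x b) (- (1 + 1)) by exact: (cderN (cderD id0 id0)).
have l2 := lder_zeta (f := fun w : C => - (w *+ 2)) e2 c2.
have e3 : good (- - x b + x b) by rewrite opprK -mulr2n.
have l3 := lder_zeta (f := fun w : C => - w + x b) e3 (cderD (cderN id0) (cc (x b))).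
have e4 : good (- x b + - x b) by rewrite -opprD -mulr2n.
have l4 := lder_zeta (f := fun w : C => - x b + w) e4 (cderD (cc (- x b)) id0).
have lR j : j \in D2 -> lder (Rr^~ (x j)) (- x b)
    ((lz (- - x b - x j) * (- 1 - 0) + lz (- x b + x j) * (1 + 0)) +
      - (lz (- - x b + x j) * (- 1 + 0) + lz (- x j + - x b) * (0 + 1))).
  move=> /both_sub[h1 h2 h3 h4].
  have p1 : good (- - x b - x j) by rewrite opprK.
  have p2 : good (- - x b + x j) by rewrite opprK.
  have p3 : good (- x j + - x b) by rewrite addrC.
  apply: lderM.
    apply: lderM; [exact: (lder_zeta (f := fun w : C => - w - x j) p1 (cderB (cderN id0) (cc (x j))))|exact: (lder_zeta (f := fun w : C => w + x j) h4 (cderD id0 (cc (x j))))].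
  apply: lderV; apply: lderM; [exact: (lder_zeta (f := fun w : C => - w + x j) p2 (cderD (cderN id0) (cc (x j))))|exact: (lder_zeta (f := fun w : C => - x j + w) p3 (cderD (cc (- x j)) id0))].
have := lderM (lderM (lderM l1 l2) (lderV (lderM l3 l4))) (lder_prod lR).
rewrite -/(k d); congr (lder _ _ _).
rewrite (logder_gdN d rb) -(logder_psi (x b) d0) n2 !H_part1 /xm upd_same.
have -> : \sum_(i in D2) (lz (- x b - upd x b (- x b) i) - lz (- x b + upd x b (- x b) i)) =
   \sum_(i in D2) (lz (- x b - x i) - lz (- x b + x i)).
  by apply: eq_bigr => i /both_D2[_ ib _]; rewrite upd_ne.
rewrite mulNrn opprK -opprD -mulr2n.
pose u i := lz (x b - x i) - lz (x b + x i); pose v i := lz (- x b - x i) - lz (- x b + x i).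
have -> : \sum_(i in D2) ((lz (x b - x i) * (- 1 - 0) + lz (- x b + x i) * (1 + 0)) +
      - (lz (x b + x i) * (- 1 + 0) + lz (- x i + - x b) * (0 + 1))) =
   - (\sum_(i in D2) u i + \sum_(i in D2) v i).
  rewrite -big_split -sumrN; apply: eq_bigr => i _; rewrite /= /u /v [- x i + - x b]addrC.
  by move: (lz _) (lz _) (lz _) (lz _) => *; ring.
rewrite -/u -/v.
by move: (\sum_(i in D2) _) (\sum_(i in D2) _) (lz _) (lz _) (logder _ _) => *; ring.
Qed.

Lemma both_an_k d : an (k d) (- x b).
Proof.
have rb : `|complex.Re (- x b)| < 4^-1 by rewrite ReN_norm; apply: (regular_sx rx); exact: opp_b.
have [g1 g2] := regular_double rx opp_b.
have ai : an (fun w : C => w) (- x b) := an_id _; have ac (c : C) := an_cst c (- x b).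
have e3 : good (- - x b + x b) by rewrite opprK -mulr2n.
have e4 : good (- x b + - x b) by rewrite -opprD -mulr2n.
have e2 : good (- (- x b *+ 2)) by rewrite mulNrn opprK.
apply: anM; first apply: anM; first apply: anM; first exact: an_gd.
- apply: (an_zeta_comp (f := fun w : C => - (w *+ 2))) => //.
  by apply: anN; exact: (anD ai ai).
- apply: anV; first by case: e3 e4 => _ _ h3 [_ _ h4]; rewrite mulf_neq0.
  apply: anM.
    by apply: (an_zeta_comp (f := fun w : C => - w + x b)) => //; apply: anD => //; exact: anN.
  by apply: (an_zeta_comp (f := fun w : C => - x b + w)) => //; exact: anD.
- apply: an_prod => j /both_sub[h1 h2 h3 h4].
  by apply: an_Rr; rewrite ?opprK //; rewrite addrC.
Qed.

Let Z (w : C) := zeta_res (- (w + x b)) * zeta_res (w + x b).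

Lemma both_Z : [/\ an Z (- x b), Z (- x b) = 1 & cder Z (- x b) 0].
Proof.
have r0 : -1 < complex.Re (0 : C) by rewrite /= ltrN10.
have e0 : - x b + x b = 0 by rewrite addNr.
have e0' : - (- x b + x b) = 0 by rewrite e0 oppr0.
have aw : an (fun w : C => w + x b) (- x b) by apply: anD; [exact: an_id|exact: an_cst].
have cw : cder (fun w : C => w + x b) (- x b) (1 + 0) := cderD (cder_id _) (cder_cst _ _).
have az : an zeta_res (0 : C) := an_zeta_res r0.
have az1 : an zeta_res (- x b + x b) by rewrite e0.
have az2 : an zeta_res (- (- x b + x b)) by rewrite e0'.
split; last 2 first.
- by rewrite /Z e0 oppr0 zeta_res0 mulr1.
- have := cderM (cder_comp (cderN cw) (an_cder az2)) (cder_comp cw (an_cder az1)).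
  rewrite e0' e0 zeta_res0; have E (p : C) : p * - (1 + 0) * 1 + 1 * (p * (1 + 0)) = 0 by ring.
  by rewrite E.
apply: anM; last exact: (an_comp aw az1).
exact: (an_comp (psi := fun w : C => - (w + x b)) (anN aw) az2).
Qed.

Lemma both_Pr d : Pr d D2 xm = Pr d D2 x.
Proof. by apply: Pr_eq => i /both_D2[_ ib _]; exact: both_xm. Qed.

(** Here [x'] is [x] or [xm]. Both terms expand in the same way along the block of [b], and
    everything apart from that block is expressed at the collision point, where the derivative of
    [phi] lives. *)
Lemma both_Part_tm d (x' : T -> C) : Pr d D2 x' = Pr d D2 x ->
  (forall W, a \notin W -> b \notin W -> W \subset A -> Aw (A :\ a)%SET x' D2 W = Aw (A :\ a :\ b)%SET x D2 W) ->
  (forall W, W \subset (A :\: D)%SET -> Hw (A :\ a)%SET x' D2 W = Hw (A :\ a :\ b)%SET x D2 W) ->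
  tm d (A :\ a)%SET x' D2 = Pr d D2 x * Aw A y D finset.set0 *
    (Hw (A :\ a)%SET x' D2 [set b]%SET * Part (A :\: D)%SET (Hw A y D) +
     \sum_(W : {set T} | (W != finset.set0) && (W \subset (A :\: D)%SET))
       Hw (A :\ a)%SET x' D2 (b |: W)%SET * Part (A :\: D :\: W)%SET (Hw A y D)).
Proof.
move=> EP EA EH; have a0 : a \notin finset.set0 by rewrite inE.
have b0 : b \notin finset.set0 by rewrite inE.
have [e1 _ _] := both_Aw a0 b0 (finset.sub0set A).
rewrite /tm EP e1 EA // ?finset.sub0set //; congr (_ * _).
have -> : (A :\ a :\: D2 = b |: (A :\: D))%SET.
  apply/setP => i; rewrite !inE; have [->|ib] := eqVneq i b; first by rewrite bA ba.
  by have [->|ia] := eqVneq i a; rewrite ?aD.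
have bAD : b \notin (A :\: D)%SET by rewrite inE bD.
have EQ W : W \subset (A :\: D)%SET -> Part (A :\: D :\: W)%SET (Hw (A :\ a)%SET x' D2) =
    Part (A :\: D :\: W)%SET (Hw A y D).
  move=> WA; apply: eq_Part => V V0 VW.
  have VA : V \subset (A :\: D)%SET by apply: (fintype.subset_trans VW); exact: finset.subsetDl.
  by have [h1 _ _] := both_Hw VA; rewrite h1 EH.
rewrite (Part_recU _ bAD) (bigD1 finset.set0) /=; last exact: finset.sub0set.
rewrite finset.setU0 EQ ?finset.sub0set // finset.setD0; congr (_ + _).
by apply: eq_big => [W|W /andP[WA _]]; [rewrite andbC|rewrite EQ].
Qed.

(* With s = w + x b the factor zeta (1 + s) zeta (1 - s) is s^-2 times an even function,
   so the residue is the derivative of the remaining factor phi / Z. *)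
Lemma opp_both d : (0 < d)%N ->
  pole2 (fun w => tm d A (upd x a w) D) (- x b)
    (tm d (A :\ a)%SET x D2 + tm d (A :\ a)%SET xm D2
     - logder (@psi_DL R d) (2^-1 + x b) * tm d (A :\ a :\ b)%SET x D2).
Proof.
move=> d0; have a0 : a \notin finset.set0 by rewrite inE.
have b0 : b \notin finset.set0 by rewrite inE.
have s0 := finset.sub0set A.
have [aZ Z0 cZ] := both_Z.
(* There is no minus sign here: that of [Pr_in] is absorbed by zeta(1 + s) zeta(1 - s) = - Z /
   s^2. *)
pose phi w := Pr d (D :\ a)%SET x *
  (k d w * Z w * Aw A (upd x a w) D finset.set0 * Part (A :\: D)%SET (Hw A (upd x a w) D)).
have aphi : an phi (- x b).
  apply: anM; first exact: an_cst.
  apply: anM; first apply: anM; first apply: anM; [exact: both_an_k|exact: aZ| |].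
    by apply: an_Aw; [exact: opp_sx|exact: opp_Aw].
  apply: an_Part => W W0 WA; apply: opp_an_Hw => //.
  by apply: contraTneq WA => ->; rewrite finset.sub1set inE bD.
have Hf : \forall w \near nbC (- x b), w != - x b -> tm d A (upd x a w) D = phi w / (w - - x b) ^+ 2.
  have n1 : \forall w \near nbC (- x b), -1 < complex.Re (w + x b).
    have aw : an (fun w : C => w + x b) (- x b) by apply: anD; [exact: an_id|exact: an_cst].
    have := an_cvg aw => /(_ [set v | -1 < complex.Re v]); apply.
    by rewrite addNr; apply: near_Re_gt; rewrite /= ltrN10.
  have n2 : \forall w \near nbC (- x b), -1 < complex.Re (- (w + x b)).
    have aw : an (fun w : C => - (w + x b)) (- x b).
      by apply: anN; apply: anD; [exact: an_id|exact: an_cst].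
    have := an_cvg aw => /(_ [set v | -1 < complex.Re v]); apply.
    by rewrite addNr oppr0; apply: near_Re_gt; rewrite /= ltrN10.
  apply: filterS3 (opp_near DA) n1 n2 => w wj w1 w2 wn.
  have bDa : b \in (D :\ a)%SET by rewrite !inE ba.
  have w0 : w + x b != 0 by rewrite addr_eq0.
  have w0' : - (w + x b) != 0 by rewrite oppr_eq0.
  rewrite /tm (Pr_in d aD wj) (big_setD1 _ bDa) /= -/D2 opprK /phi /k /Z.
  rewrite {1}/Rr -opprD (zeta1E w1 w0) (zeta1E w2 w0').
  move: (Aw _ _ _ _) (Part _ _) (Pr _ _ _) (gd _ _) (zeta (1 - w *+ 2)) (\prod_(_ in D2) _) => e1 e2 e3 e4 e5 e6.
  move: (zeta_res _) (zeta_res _) (_ * _)^-1 => e7 e8 e9.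
  by field; exact: w0.
have -> : tm d (A :\ a)%SET x D2 + tm d (A :\ a)%SET xm D2
     - logder (@psi_DL R d) (2^-1 + x b) * tm d (A :\ a :\ b)%SET x D2 = derive1 phi (- x b); last first.
  apply: (pole2_near Hf); apply: pole2_double => //.
  by exists 1.
apply/esym/cder_derive1.
have hk := (both_lder_k d0).2.
have hA := Aw_cder aA bA both_ab aD bD a0 b0 s0 (regular_sx rx) (opp_Aw DA).
have hP := cder_Part (h := fun w => Hw A (upd x a w) D) both_cder_Hw.
rewrite eqxx finset.setU0 -/D2 -/y -/xm in hA.
have hphi := cderZ (Pr d (D :\ a)%SET x) (cderM (cderM (cderM hk cZ) hA) hP).
have [e1 e2 e3] := both_Aw a0 b0 s0.
have EA W : a \notin W -> b \notin W -> W \subset A ->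
    Aw (A :\ a)%SET x D2 W = Aw (A :\ a :\ b)%SET x D2 W by move=> h1 h2 h3; have [] := both_Aw h1 h2 h3.
have EA' W : a \notin W -> b \notin W -> W \subset A ->
    Aw (A :\ a)%SET xm D2 W = Aw (A :\ a :\ b)%SET x D2 W by move=> h1 h2 h3; have [] := both_Aw h1 h2 h3.
have EH W : W \subset (A :\: D)%SET -> Hw (A :\ a)%SET x D2 W = Hw (A :\ a :\ b)%SET x D2 W.
  by move=> h; have [] := both_Hw h.
have EH' W : W \subset (A :\: D)%SET -> Hw (A :\ a)%SET xm D2 W = Hw (A :\ a :\ b)%SET x D2 W.
  by move=> h; have [] := both_Hw h.
rewrite (both_Part_tm erefl EA EH) (both_Part_tm (both_Pr d) EA' EH').
have -> : tm d (A :\ a :\ b)%SET x D2 = Pr d D2 x * Aw A y D finset.set0 * Part (A :\: D)%SET (Hw A y D).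
  rewrite /tm e1; have -> : (A :\ a :\ b :\: D2 = A :\: D)%SET.
    apply/setP => i; rewrite !inE; have [->|ib] := eqVneq i b; first by rewrite bD.
    by have [->|ia] := eqVneq i a; rewrite ?aD.
  by congr (_ * _); apply: eq_Part => V V0 VA; have [-> _ _] := both_Hw VA.
move: hphi; rewrite -/phi Z0 -/y.
have k0 := both_k0 d.
pose S (x' : T -> C) := \sum_(W : {set T} | (W != finset.set0) && (W \subset (A :\: D)%SET))
       Hw (A :\ a)%SET x' D2 (b |: W)%SET * Part (A :\: D :\: W)%SET (Hw A y D).
have -> : \sum_(W : {set T} | (W != finset.set0) && (W \subset (A :\: D)%SET))
     - (Hw (A :\ a)%SET x D2 (b |: W)%SET + Hw (A :\ a)%SET xm D2 (b |: W)%SET) *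
       Part (A :\: D :\: W)%SET (Hw A y D) = - (S x + S xm).
  rewrite /S -big_split -sumrN; apply: eq_bigr => W _ /=.
  by rewrite mulNr mulrDl.
rewrite -/(S x) -/(S xm) /Hw -/(Hw A y D).
set L := logder _ _; set P0 := Part _ _; set A0 := Aw A y D _; set k1 := k d _ in k0 *.
set Hx := H_part x _ _; set Hm := H_part xm _ _.
set Ax := Aw _ x _ _; set Am := Aw _ xm _ _; set Pa := Pr d (D :\ a)%SET x in k0 *.
move: (S x) (S xm) => Sx Sm.
have -> : Pr d D2 x = - (Pa * k1) by rewrite k0 opprK.
(* On the left is the product rule for [phi], on the right the two expansions along the block of
   [b]: the singleton contributes [Hx + Ax] or [Hm + Am], the larger blocks [Sx] or [Sm]. *)
have E : Pa * (((k1 * (L - (Hx + Hm)) * 1 + k1 * 0) * A0 + k1 * 1 * - (A0 * (Ax + Am))) * P0 +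
     k1 * 1 * A0 * - (Sx + Sm)) =
  - (Pa * k1) * A0 * ((Hx + Ax) * P0 + Sx) + - (Pa * k1) * A0 * ((Hm + Am) * P0 + Sm)
   - L * (- (Pa * k1) * A0 * P0) by ring.
by rewrite -E.
Qed.

End Both.

End Opposite.

End Regular.

(** * Residues at the value zero of one variable *)

Section Zero.
Context {R : realType} {T : finType}.
Local Notation C := (cplx R).
Implicit Types (D W : {set T}) (i j c : T) (d : nat).
Context (A : {set T}) (a : T) (x : T -> C) (aA : a \in A).
Context (rx : regular_at (A :\ a)%SET x) (hz : forall i, i \in (A :\ a)%SET -> zeta_regular (x i)).

Let y := upd x a 0.

Lemma zero_ya : y a = 0. Proof. by rewrite /y upd_same. Qed.
Lemma zero_yi i : i != a -> y i = x i. Proof. by move=> ia; rewrite /y upd_ne. Qed.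

Lemma zero_sx : sx A y.
Proof.
move=> i iA; have [->|ia] := eqVneq i a; last by rewrite zero_yi // (regular_sx rx) // !inE ia.
by rewrite zero_ya normr0 invr_gt0 ltr0n.
Qed.

Lemma zero_good i : i \in A -> i != a -> good (x i) /\ good (- x i).
Proof.
move=> iA ia; have iA' : i \in (A :\ a)%SET by rewrite !inE ia.
by apply: goodP; [exact: hz|have := regular_sx rx iA'; lra].
Qed.

Lemma zero_pair i j : i \in A -> j \in A -> i != j ->
  [/\ good (y i + y j), good (- (y i + y j)), good (y i - y j) & good (- (y i - y j))].
Proof.
move=> iA jA; have [->|ia] := eqVneq i a => [|ij].
  rewrite eq_sym => ja; rewrite zero_ya zero_yi // add0r sub0r opprK.
  by have [] := zero_good jA ja.
have [->|ja] := eqVneq j a.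
  by rewrite zero_ya zero_yi // addr0 subr0; have [] := zero_good iA ia.
by rewrite !zero_yi //; apply: (regular_pair rx); rewrite ?inE ?ia ?ja.
Qed.

Lemma zero_AwE D W : D \subset A -> a \in D -> a \notin W -> W \subset A ->
  Aw A y D W = Aw (A :\ a)%SET x (D :\ a)%SET W.
Proof.
move=> DA aD aW WA; rewrite (Aw_zero aA aD aW WA zero_sx zero_ya); apply: Aw_off => //.
  by rewrite subsetD1 WA.
by move=> i /finset.setD1P[ia _]; exact: zero_yi.
Qed.

Lemma zero_Aw D : D \subset A -> Aw A y D finset.set0 != 0.
Proof.
move=> DA; have aE : a \notin finset.set0 by rewrite inE.
have [aD|aD] := boolP (a \in D).
  rewrite (zero_AwE DA aD aE (finset.sub0set _)); apply: (regular_Aw rx).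
  exact: finset.setSD.
rewrite (Aw_at aA aD aE (finset.sub0set _) zero_sx).
by apply: (regular_Aw rx); rewrite subsetD1 DA.
Qed.

Lemma zero_notin d D : D \subset (A :\ a)%SET ->
  pole2 (fun w => tm d A (upd x a w) D) 0 (- 2^-1 * tm d (A :\ a)%SET x D).
Proof.
move=> DA; have aD := sub_notin DA.
have DAA : D \subset A by move: DA; rewrite subsetD1 => /andP[].
apply: pole2_tm_single => //; [exact: zero_sx|exact: zero_Aw| |].
  move=> W WA aW Wa; apply: pole2_an; apply: an_H => [c E|c c' cc E].
    by move: aW Wa; rewrite E inE => /eqP ->; rewrite eqxx.
  have [cW c'W] : c \in W /\ c' \in W by rewrite E !inE !eqxx ?orbT.
  have WAA : W \subset A by apply: (fintype.subset_trans WA); exact: finset.subsetDl.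
  by have [] := zero_pair (fintype.subsetP WAA c cW) (fintype.subsetP WAA c' c'W) cc.
pose g w := \sum_(i in D) (lz (upd x a w a - upd x a w i) - lz (upd x a w a + upd x a w i)).
have ag : an g 0.
  have au i := an_upd x a i 0.
  apply: an_sum => i iD; have iA := fintype.subsetP DAA i iD.
  have ia : a != i by apply: contraNneq aD => ->.
  have [g1 _ g2 _] := zero_pair aA iA ia.
  by apply: anB; apply: an_lz_comp => //; [exact: anB|exact: anD].
have n2 : (2 : C) != 0 by rewrite pnatr_eq0.
have hl := pole2_lz 0 n2; rewrite oppr0 in hl.
rewrite -[X in pole2 _ _ X]add0r.
apply: (@pole2_near _ _ (fun w => g w + lz (2 * (w + 0)))).
  by apply: filterE => w _; rewrite H_part1 upd_same addr0 mulr_natl /g upd_same.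
by apply: pole2D; [exact: pole2_an|exact: hl].
Qed.

Lemma gd0 d : gd d 0 = 1 :> C.
Proof.
rewrite /gd oppr0 rpow0 mul0r subr0 addr0 mul1r divff //; apply: cGamma_neq0.
by rewrite Re_quarter invr_gt0 ltr0n.
Qed.

Lemma zero_near D : D \subset A -> \forall w \near nbC 0, forall j, j \in (D :\ a)%SET -> w != x j.
Proof.
move=> DA; suff : \forall w \near nbC 0, forall j, j \in enum (D :\ a)%SET -> w != x j.
  by apply: filterS => w h j jD; apply: h; rewrite mem_enum.
have : {subset enum (D :\ a)%SET <= (A :\ a)%SET}.
  by move=> j; rewrite mem_enum !inE => /andP[-> /(fintype.subsetP DA)].
elim: (enum _) => [_|j s IH sA]; first by apply: filterE.
have jA := sA j (mem_head _ _); have [x0 _ _] := hz jA.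
rewrite eq_sym in x0.
apply: filterS2 (near_neq x0) (IH _) => [w wj ws i|i si]; last by apply: sA; rewrite inE si orbT.
by rewrite inE => /orP[/eqP->|/ws].
Qed.

Lemma zero_Hw D W : D \subset A -> a \in D -> W \subset (A :\: D)%SET ->
  Hw A y D W = Hw (A :\ a)%SET x (D :\ a)%SET W.
Proof.
move=> DA aD WA; have aW : a \notin W by apply/negP => /(fintype.subsetP WA); rewrite !inE aD.
have WAA : W \subset A by apply: (fintype.subset_trans WA); exact: finset.subsetDl.
have yi i : i \in W -> y i = x i by move=> iW; apply: zero_yi; apply: contraNneq aW => <-.
apply: Hw_eq (zero_AwE DA aD aW WAA); apply: H_part_cong => // c E.
have cW : c \in W by rewrite E inE.
rewrite (big_setD1 _ aD) /= zero_ya subr0 addr0 subrr add0r (yi c cW).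
by apply: eq_bigr => i /finset.setD1P[ia _]; rewrite zero_yi.
Qed.

Lemma zero_in d D : D \subset A -> a \in D ->
  pole2 (fun w => tm d A (upd x a w) D) 0 (2^-1 * tm d (A :\ a)%SET x (D :\ a)%SET).
Proof.
move=> DA aD; have r0 : -1 < complex.Re (0 : C) by rewrite /= ltrN10.
have aE : a \notin finset.set0 by rewrite inE.
(* The only pole is that of zeta(1 - 2w), equal to [zeta_res] at - 2w divided by - 2w. With the sign
   of [Pr_in] this leaves 1/2; at w = 0 the factors [gd] and [Rr] all equal 1. *)
pose phi w := Pr d (D :\ a)%SET x * (2^-1 * gd d w * zeta_res (- (w *+ 2)) * \prod_(j in (D :\ a)%SET) Rr w (x j)) *
  Aw A (upd x a w) D finset.set0 * Part (A :\: D)%SET (Hw A (upd x a w) D).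
have e0 : - ((0 : C) *+ 2) = 0 by rewrite mul0rn oppr0.
have am : an (fun w : C => - (w *+ 2)) 0 by apply: anN; exact: (anD (an_id 0) (an_id 0)).
have jj j : j \in (D :\ a)%SET -> [/\ j \in A, j != a, a != j & good (x j) /\ good (- x j)].
  move=> /finset.setD1P[ja jD]; have jA := fintype.subsetP DA j jD.
  by split; rewrite // 1?eq_sym //; exact: zero_good.
have aphi : an phi 0.
  apply: anM; first apply: anM; first (apply: anM; first exact: an_cst).
  - apply: anM; first apply: anM; first (apply: anM; first exact: an_cst).
    + by apply: an_gd; rewrite normr0 invr_gt0 ltr0n.
    + by apply: (an_comp (psi := fun w : C => - (w *+ 2)) am); rewrite e0; exact: an_zeta_res.
    + apply: an_prod => j /jj[_ _ _ [g1 g2]].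
      by apply: an_Rr; rewrite ?oppr0 ?sub0r ?add0r ?addr0.
  - by apply: an_Aw; [exact: zero_sx|exact: zero_Aw].
  - apply: an_Part => W W0 WA; have WAA : W \subset A by apply: (fintype.subset_trans WA); exact: finset.subsetDl.
    apply: anD; last by apply: an_Aw; [exact: zero_sx|exact: zero_Aw].
    apply: an_H => [c E|c c' cc E].
      have cW : c \in W by rewrite E inE.
      have := fintype.subsetP WA c cW; rewrite inE => /andP[cD cA].
      have ca : c != a by apply: contraNneq cD => ->.
      split; first by rewrite -/y zero_yi //; have [] := regular_double rx (_ : c \in (A :\ a)%SET); rewrite ?inE ?ca.
      move=> i iD; have ci : c != i by apply: contraNneq cD => ->.
      by have [] := zero_pair cA (fintype.subsetP DA i iD) ci.
    have [cW c'W] : c \in W /\ c' \in W by rewrite E !inE !eqxx ?orbT.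
    by have [] := zero_pair (fintype.subsetP WAA c cW) (fintype.subsetP WAA c' c'W) cc.
have -> : 2^-1 * tm d (A :\ a)%SET x (D :\ a)%SET = phi 0.
  rewrite /phi gd0 e0 zeta_res0 big1.
    rewrite !mulr1 (zero_AwE DA aD aE (finset.sub0set _)) /tm.
    have -> : (A :\ a :\: (D :\ a) = A :\: D)%SET.
      by apply/setP => i; rewrite !inE; have [->|] := eqVneq i a; rewrite ?aD.
    rewrite (eq_Part (h' := Hw (A :\ a)%SET x (D :\ a)%SET)); last first.
      by move=> W _ WA; exact: zero_Hw.
    by rewrite [Pr _ _ _ / 2]mulrC -!mulrA.
  move=> j /jj[_ _ _ [[_ _ g1] [_ _ g2]]].
  by rewrite /Rr oppr0 !add0r !addr0 [zeta (1 + x j) * _]mulrC divff // mulf_neq0.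
apply: (@pole2_near _ _ (fun w => phi w / (w - 0))); last by apply: pole2_simple => //; exists 1.
have n1 : \forall w \near nbC 0, -1 < complex.Re (- (w *+ 2) : C).
  have := an_cvg am => /(_ [set v | -1 < complex.Re v]); apply.
  by rewrite e0; exact: near_Re_gt.
apply: filterS2 (zero_near DA) n1 => w wj w1 w0.
have w20 : - (w *+ 2) != 0 by rewrite oppr_eq0 mulrn_eq0.
rewrite /tm (Pr_in d aD wj) (zeta1E w1 w20) /phi subr0 -[w *+ 2]mulr_natl.
move: (Aw _ _ _ _) (Part _ _) (Pr _ _ _) (gd _ _) (\prod_(_ in _) _) (zeta_res _) => e1 e2 e3 e4 e5 e6.
by field; exact: w0.
Qed.

End Zero.

(** * Summation of the residues over D and d *)

Section Assembly.
Context {R : realType} {T : finType}.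
Local Notation C := (cplx R).

Lemma sum_subsets (K : nmodType) (F : {set T} -> K) (A : {set T}) a : a \in A ->
  \sum_(D : {set T} | D \subset A) F D =
  \sum_(D : {set T} | D \subset (A :\ a)%SET) (F D + F (a |: D)%SET).
Proof.
move=> aA; rewrite (bigID (fun D : {set T} => a \in D)) /= addrC big_split /=; congr (_ + _).
  by apply: eq_bigl => D; rewrite subsetD1.
rewrite (reindex_onto (fun D => a |: D)%SET (fun D => D :\ a)%SET) /=; last first.
  by move=> D /andP[_ aD]; rewrite finset.setD1K.
apply: eq_bigl => D; rewrite setU11 andbT subsetD1 finset.subUset finset.sub1set aA /=.
case aD: (a \in D) => /=; last by rewrite finset.setU1K ?aD // eqxx.
rewrite andbF; apply/negbTE/negP => /andP[_ /eqP/setP/(_ a)].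
by rewrite !inE eqxx aD.
Qed.

(** Above each subset D of A \ {a, b} there are four subsets of A. Adding neither, [b], [a] or both
    contributes 0, [t1] at b with D, [t2] at b with D, and [t1 + t2 - L * t3] at D, which regroups
    into the three sums on the left. *)
Lemma sum_subsets2 (K : comPzRingType) (t1 t2 t3 : {set T} -> K) (L : K) (A : {set T}) a b :
  a \in A -> b \in A -> b != a ->
  \sum_(D : {set T} | D \subset (A :\ a)%SET) t1 D + \sum_(D : {set T} | D \subset (A :\ a)%SET) t2 D
    - L * \sum_(D : {set T} | D \subset (A :\ a :\ b)%SET) t3 D =
  \sum_(D : {set T} | D \subset A) if a \in D then
      if b \in D then t1 (D :\ a :\ b)%SET + t2 (D :\ a :\ b)%SET - L * t3 (D :\ a :\ b)%SET
      else t2 (b |: D :\ a)%SET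
    else if b \in D then t1 D else 0.
Proof.
move=> aA bA ba; have bA' : b \in (A :\ a)%SET by rewrite !inE ba.
rewrite !(sum_subsets _ bA') (sum_subsets _ aA) (sum_subsets _ bA') mulr_sumr -big_split -sumrB /=.
apply: eq_bigr => D; rewrite !subsetD1 => /andP[/andP[_ aD] bD].
have aD' : a \notin (b |: D)%SET by rewrite !inE negb_or eq_sym ba.
have bD' : b \notin (a |: D)%SET by rewrite !inE negb_or ba.
rewrite (negbTE aD) (negbTE bD) (negbTE aD') (negbTE bD') !setU11 finset.setU1r ?setU11 //.
rewrite !finset.setU1K //; move: (t1 _) (t1 _) (t2 _) (t2 _) (t3 _) => p1 p2 p3 p4 p5.
by ring.
Qed.

Lemma fundamental_discriminant_gt0 d : fundamental_discriminant d -> (0 < d)%N.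
Proof. by case: d. Qed.

Lemma Jstar0 (X : R) A (x : T -> C) : Jstar X A finset.set0 x =
  \sum_(1 <= d < (Num.truncn X).+1 | fundamental_discriminant d) J_summand d A x.
Proof. by apply: eq_bigr => d _; rewrite big_set0 mul1r. Qed.

(** Near [w0] the strip condition persists, so [Jstar] is a finite sum of the terms [tm]. Residues
    add in the form [pole2], in which the pole order is bounded once and for all. *)
Lemma residue_Jstar (X : R) (A : {set T}) a (x : T -> C) w0 (r : nat -> {set T} -> C) :
  sx A (upd x a w0) ->
  (forall (d : nat) (D : {set T}), (0 < d)%N -> D \subset A -> pole2 (fun w => tm d A (upd x a w) D) w0 (r d D)) ->
  is_residue (fun w => Jstar X A finset.set0 (upd x a w)) w0
    (\sum_(1 <= d < (Num.truncn X).+1 | fundamental_discriminant d)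
       \sum_(D : {set T} | D \subset A) r d D).
Proof.
move=> s H; apply: pole2_residue.
apply: (@pole2_near _ _ (fun w => \sum_(1 <= d < (Num.truncn X).+1 | fundamental_discriminant d)
   \sum_(D : {set T} | D \subset A) tm d A (upd x a w) D)).
  apply: filterS (near_sx s) => w sw _; rewrite Jstar0; apply: eq_bigr => d _.
  exact: J_summandE.
apply: pole2_sum => d /fundamental_discriminant_gt0 d0; apply: pole2_sum => D DA; exact: H.
Qed.

End Assembly.

Theorem theorem6p3 (R : realType) (X : R) (T : finType) (A : {set T})
    (a : T) (aA : a \in A) (x : T -> cplx R) :
  (forall b : T, b \in A -> b != a ->
     regular_at (A :\ a)%SET x ->
     regular_at (A :\ a)%SET (upd x b (- x b)) ->
     is_residue (fun w => Jstar X A finset.set0 (upd x a w)) (- x b)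
       (Jstar X (A :\ a)%SET finset.set0 x
        + Jstar X (A :\ a)%SET finset.set0 (upd x b (- x b))
        - Jstar X (A :\ a :\ b)%SET [set b]%SET x))
  /\
  (regular_at (A :\ a)%SET x ->
   (forall i, i \in (A :\ a)%SET -> zeta_regular (x i)) ->
   is_residue (fun w => Jstar X A finset.set0 (upd x a w)) 0 0).
Proof.
split=> [b bA ba rx rm|rx hz].
  have ab : a != b by rewrite eq_sym.
  have bA' : b \in (A :\ a)%SET by rewrite !inE ba.
  pose xm := upd x b (- x b).
  pose L (d : nat) := logder (@psi_DL R d) (2^-1 + x b).
  pose r d (D : {set T}) := if a \in D then
      if b \in D then tm d (A :\ a)%SET x (D :\ a :\ b)%SET + tm d (A :\ a)%SET xm (D :\ a :\ b)%SET
         - L d * tm d (A :\ a :\ b)%SET x (D :\ a :\ b)%SET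
      else tm d (A :\ a)%SET xm (b |: D :\ a)%SET
    else if b \in D then tm d (A :\ a)%SET x D else 0.
  have sx2 : sx (A :\ a :\ b)%SET x by move=> i /finset.setD1P[_]; exact: (regular_sx rx).
  have := residue_Jstar X (r := r) (opp_sx bA ba rx) _.
  have -> : Jstar X (A :\ a)%SET finset.set0 x + Jstar X (A :\ a)%SET finset.set0 xm
      - Jstar X (A :\ a :\ b)%SET [set b]%SET x =
    \sum_(1 <= d < (Num.truncn X).+1 | fundamental_discriminant d)
       \sum_(D : {set T} | D \subset A) r d D.
    rewrite !Jstar0 /Jstar -big_split -sumrB /=; apply: eq_bigr => d _.
    rewrite big_set1 (J_summandE d (regular_sx rx)) (J_summandE d (regular_sx rm)) (J_summandE d sx2).
    exact: (sum_subsets2 (tm d (A :\ a)%SET x) (tm d (A :\ a)%SET xm) (tm d (A :\ a :\ b)%SET x) (L d) aA bA ba).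
  apply=> d D d0 DA; rewrite /r; have [aD|aD] := boolP (a \in D); have [bD|bD] := boolP (b \in D).
  - exact: opp_both.
  - exact: opp_swap.
  - by apply: opp_in => //; rewrite subsetD1 DA.
  - by apply: opp_notin => //; rewrite subsetD1 DA.
pose r d (D : {set T}) : cplx R := if a \in D then 2^-1 * tm d (A :\ a)%SET x (D :\ a)%SET
  else - 2^-1 * tm d (A :\ a)%SET x D.
have := residue_Jstar X (r := r) (zero_sx rx) _.
rewrite big1 => [|d _].
  apply=> d D d0 DA; rewrite /r; have [aD|aD] := boolP (a \in D); first exact: zero_in.
  by apply: zero_notin => //; rewrite subsetD1 DA.
rewrite (sum_subsets _ aA) big1 // => D; rewrite subsetD1 => /andP[_ aD].
by rewrite /r (negbTE aD) setU11 finset.setU1K // mulNr addNr.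
Qed.
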